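(* Let $v\in\mathcal{N}(\mathbb{C}\setminus\mathbb{R})$ and assume that $v$ satisfies the symmetry condition $$v_{|\mathbb{C}^-}=\frac{1}{SR(v_{|\mathbb{C}^+})}.$$ Then there are functions $h_1,h_2$ in $\mathcal{S}_0$ such that $v=\frac{h_1}{h_2}$ and $\mathcal{B}(h_1)\cap\mathcal{B}(h_2)=\{0\}$. Moreover, the space $$\mathcal{B}(v):=\frac{1}{h_2}\cdot\left(\mathcal{B}(h_1)\oplus-\mathcal{B}(h_2)\right)$$ is a reproducing kernel Krein space with domain $$U_0(v):=\{\zeta\in\mathbb{C}: h_1\text{ and }h_2\text{ are analytic at }\zeta\text{ and }h_1(\zeta)h_2(\zeta)\neq0\}$$ and kernel $$s_v:U_0(v)\times U_0(v)\to\mathbb{C},\quad s_v(\zeta,w)=\frac{1-v(\zeta)\overline{v(w)}}{-\mathrm{i}(\zeta-\overline{w})}.$$ Finally, $D_w$ is well defined and bounded on $\mathcal{B}(v)$ for every $w\in U_0(v)$.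
   Context: $\mathbb{C}^+$ and $\mathbb{C}^-$ are the open upper and lower half-planes, and $\mathcal{H}^\infty(\mathbb{C}^{+})$ is the space of bounded analytic functions on $\mathbb{C}^+$ with the supremum norm. $\mathcal{N}(\mathbb{C}^+)$ is the set of meromorphic functions on $\mathbb{C}^+$ of the form $f_1/f_2$ with $f_1,f_2\in\mathcal{H}^\infty(\mathbb{C}^+)$, $f_2\not\equiv 0$; $\mathcal{N}(\mathbb{C}^-)$ is defined analogously. $\mathcal{N}(\mathbb{C}\setminus\mathbb{R})$ is the set of meromorphic functions $f$ on $\mathbb{C}\setminus\mathbb{R}$ with $f_{|\mathbb{C}^+}\in\mathcal{N}(\mathbb{C}^+)$ and $f_{|\mathbb{C}^-}\in\mathcal{N}(\mathbb{C}^-)$. For $g$ on $\mathbb{C}^+$, $SR(g)(z)=\overline{g(\overline{z})}$ on $\mathbb{C}^-$. For $f\in\mathcal{N}(\mathbb{C}\setminus\mathbb{R})$, $U_{ext}(f)$ is the union of the domain of analyticity of $f$ in $\mathbb{C}\setminus\mathbb{R}$ and all $\zeta\in\mathbb{R}$ for which there is an open interval $(a,b)\ni\zeta$ such that $f$ can be analytically extended through $(a,b)$ (there is an analytic function on an open neighbourhood of $(a,b)$ agreeing with $f$ off $\mathbb{R}$). ''Analytic at $\zeta$'' means $\zeta\in U_{ext}$. $\mathcal{S}_0$ is the set of $h\in\mathcal{N}(\mathbb{C}\setminus\mathbb{R})$ with $h_{|\mathbb{C}^+}\in\mathcal{H}^\infty(\mathbb{C}^+)\setminus\{0\}$, $\|h_{|\mathbb{C}^+}\|_{\mathcal{H}^\infty(\mathbb{C}^+)}\le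 1$ and $h_{|\mathbb{C}^-}=1/SR(h_{|\mathbb{C}^+})$. For $h\in\mathcal{S}_0$, $\mathcal{B}(h)$ is the reproducing kernel Hilbert space of analytic functions on $U_{ext}(h)$ with kernel $s_h(z,w)=\frac{1-h(z)\overline{h(w)}}{-\mathrm{i}(z-\overline{w})}$ (kernels $s_h$, $s_v$ are extended by continuity to $z=\overline{w}$). Elements of $\mathcal{B}(h)$ are regarded as meromorphic functions on $\mathbb{C}\setminus\mathbb{R}$ when forming intersections, and are restricted to $U_0(v)$ when forming $\mathcal{B}(v)$. A Krein space is a complex vector space $\mathcal{K}$ with a sesquilinear form that has a direct orthogonal decomposition $\mathcal{K}=\mathcal{K}_+[+]\mathcal{K}_-$ such that $\mathcal{K}_+$ and $-\mathcal{K}_-:=(\mathcal{K}_-,-[\cdot,\cdot])$ are Hilbert spaces; it carries the Hilbert space topology of $\mathcal{K}_+\oplus(-\mathcal{K}_-)$. A reproducing kernel Krein space on an open set $\Omega$ with kernel $H$ is a Krein space of analytic functions on $\Omega$ with $H(\cdot,w)\in\mathcal{K}$ and $g(w)=[g,H(\cdot,w)]_{\mathcal{K}}$ for all $w\in\Omega$, $g\in\mathcal{K}$. $\frac{1}{h_2}\cdot(\mathcal{B}(h_1)\oplus-\mathcal{B}(h_2))$ consists of the functions $\frac{1}{h_2}(g_1+g_2)$, $g_i\in\mathcal{B}(h_i)$, with inner product $\left[\frac{1}{h_2}(g_1+g_2),\frac{1}{h_2}(g_1'+g_2')\right]=[g_1,g_1']_{\mathcal{B}(h_1)}-[g_2,g_2']_{\mathcal{B}(h_2)}$.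 $D_w(g)(\zeta)=\frac{g(\zeta)-g(w)}{\zeta-w}$ for $\zeta\neq w$, $D_w(g)(w)=g'(w)$. *)

(* Defs.v *)
From HB Require Import structures.
From mathcomp Require Import all_boot all_order all_algebra.
From mathcomp Require Import all_classical all_reals all_analysis.
From mathcomp Require Import complex.

Set Implicit Arguments.
Unset Strict Implicit.
Unset Printing Implicit Defensive.

Import Order.TTheory GRing.Theory Num.Theory.
Import numFieldNormedType.Exports.

Local Open Scope classical_set_scope.
Local Open Scope ring_scope.

(* R[i] with its numClosedFieldType structure made explicit: on the bare type
   R[i] the topology and the normed module structure over itself are not
   inferred. *)
Definition Cplx (R : realType) : numClosedFieldType := R[i].

Section Functions.
Variable R : realType.
Local Notation C := (Cplx R).
Implicit Types (f g h v : C -> C) (z w : C) (D : set C).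

Definition reC (z : C) : R := complex.Re z.
Definition imC (z : C) : R := complex.Im z.

Definition upper : set C := [set z | 0 < imC z].
Definition lower : set C := [set z | imC z < 0].
Definition nonreal : set C := [set z | imC z != 0].

Definition analytic_at f z := \forall w \near z, derivable f w 1.

Definition analytic_on D f := forall z, D z -> analytic_at f z.

Definition pole_at f z :=
  (\forall w \near z^', analytic_at f w) /\
  complex.Re `|f w| @[w --> z^'] --> +oo.

(* Meromorphic functions are total functions with all removable singularities
   removed: every point of D is a point of analyticity or a pole. The value at
   a pole, and the values outside D, carry no information. *)
Definition meromorphic_on D f :=
  forall z, D z -> analytic_at f z \/ pole_at f z.

(* Equality of meromorphic functions on D: equality up to isolated points.
   It can also be used for pointwise expressions such as f1 / f2, that are not
   normalized at the zeros of f2. *)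
Definition eq_mero D f g := forall z, D z -> \forall w \near z^', f w = g w.

Definition Hinf D f :=
  analytic_on D f /\ exists M : R, forall z, D z -> complex.Re `|f z| <= M.

Definition Hinf_norm D f : R := sup [set complex.Re `|f z| | z in D].

Definition Nevanlinna_half D f :=
  meromorphic_on D f /\
  exists f1 f2, [/\ Hinf D f1, Hinf D f2, exists2 z, D z & f2 z != 0
    & eq_mero D f (fun z => f1 z / f2 z)].

Definition Nevanlinna f :=
  [/\ meromorphic_on nonreal f, Nevanlinna_half upper f
    & Nevanlinna_half lower f].

Definition SR g : C -> C := fun z => (g z^*)^*.

(* 1 / SR(v) is a meromorphic function only if v does not vanish identically
   on the upper half-plane; with the total inverse this must be said. *)
Definition reflection_symmetric v :=
  ~ eq_mero upper v (fun=> 0) /\ eq_mero lower v (fun z => (SR v z)^-1).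

Definition S0 h :=
  [/\ Nevanlinna h, Hinf upper h, exists2 z, upper z & h z != 0,
      Hinf_norm upper h <= 1 & reflection_symmetric h].

Definition Uext f : set C := [set z |
  (nonreal z /\ analytic_at f z) \/
  (imC z = 0 /\ exists a b : R,
     [/\ a < reC z, reC z < b
       & exists (O : set C) (g : C -> C),
         [/\ open O, forall x : R, a < x < b -> O (x%:C)%C,
             analytic_on O g & forall w, O w -> nonreal w -> g w = f w]])].

(* The extension of f to Uext f; the values of f itself on the real line are
   irrelevant. *)
Definition mero_ext f : C -> C := fun z =>
  if imC z == 0 then lim (f w @[w --> within nonreal (nbhs z)]) else f z.

(* The kernel s_f: on the diagonal z = w^* it is the continuous extension of
   z |-> s_f(z, w). *)
Definition kernel_quot f (w z : C) : C :=
  (1 - mero_ext f z * (mero_ext f w)^*) / (- 'i * (z - w^*)).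

Definition skernel f (z w : C) : C :=
  if z == w^* then lim (kernel_quot f w z' @[z' --> z^'])
  else kernel_quot f w z.

Definition U0 h1 h2 : set C :=
  [set z | [/\ Uext h1 z, Uext h2 z & mero_ext h1 z * mero_ext h2 z != 0]].

Definition Dw D w g : C -> C :=
  (fun z => if z == w then derive1 g w else (g z - g w) / (z - w)) \_ D.

End Functions.

Arguments upper {R}.
Arguments lower {R}.
Arguments nonreal {R}.

Section Spaces.
Variables (R : realType) (V : lmodType (Cplx R)).
Local Notation C := (Cplx R).

Record inner_space := InnerSpace {
  carrier :> V -> Prop;
  iprod : V -> V -> C }.
Implicit Types X : inner_space.

Definition sub_inner X (K : set V) := InnerSpace K (iprod X).
Definition opp_inner X := InnerSpace X (fun x y => - iprod X x y).

Definition is_inner X :=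
  [/\ X 0,
      forall (a : C) x y, X x -> X y -> X (a *: x + y),
      forall (a : C) x y z, X x -> X y -> X z ->
        iprod X (a *: x + y) z = a * iprod X x z + iprod X y z
    & forall x y, X x -> X y -> iprod X y x = (iprod X x y)^*].

Definition hnorm X x : R := Num.sqrt (reC (iprod X x x)).

Definition is_hilbert X :=
  [/\ is_inner X,
      forall x, X x -> x != 0 -> 0 < iprod X x x
    & forall u : nat -> V, (forall n, X (u n)) ->
        (forall e : R, 0 < e -> exists N, forall m n,
           (N <= m)%N -> (N <= n)%N -> hnorm X (u m - u n) < e) ->
        exists2 l, X l & hnorm X (u n - l) @[n --> \oo] --> 0].

Definition fundamental_decomposition X (Kp Km : set V) :=
  [/\ is_hilbert (sub_inner X Kp),
      is_hilbert (opp_inner (sub_inner X Km)),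
      forall x y, Kp x -> Km y -> iprod X x y = 0,
      Kp `&` Km = [set 0]
    & carrier X = [set x + y | x in Kp & y in Km]].

Definition is_krein X :=
  is_inner X /\ exists Kp Km, fundamental_decomposition X Kp Km.

(* Norm of x + y in the Hilbert space K+ (+) (-K-), x in K+ and y in K-. *)
Definition fnorm X x y : R := Num.sqrt (reC (iprod X x x) - reC (iprod X y y)).

(* T maps X into X and is bounded for the Hilbert norm of a fundamental
   decomposition; any two such norms on a Krein space are equivalent. *)
Definition bounded_op X (T : V -> V) :=
  (forall x, X x -> X (T x)) /\
  exists Kp Km, fundamental_decomposition X Kp Km /\
  exists M : R, forall xp xm yp ym, Kp xp -> Km xm -> Kp yp -> Km ym ->
    T (xp + xm) = yp + ym -> fnorm X yp ym <= M * fnorm X xp xm.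

End Spaces.

Section ReproducingKernel.
Variable R : realType.
Local Notation C := (Cplx R).

(* A function with domain D is represented by the total function C -> C that
   is 0 outside of D (f \_ D for the restriction of f), so that functions on D
   are equal when their representatives are. *)
Definition fspace := inner_space (C -> C).
Implicit Types (X B : fspace) (D : set C) (h : C -> C).

Definition reproducing D (H : C -> C -> C) X :=
  [/\ open D,
      forall g, X g -> analytic_on D g /\ g \_ D = g,
      forall w, D w -> X (H^~ w \_ D)
    & forall w g, D w -> X g -> g w = iprod X g (H^~ w \_ D)].

Definition is_rkhs D H X := is_hilbert X /\ reproducing D H X.
Definition is_rkks D H X := is_krein X /\ reproducing D H X.

(* X is the space B(h); the reproducing kernel determines the carrier of X and
   the values of iprod X on it. *)
Definition is_deBranges h X := is_rkhs (Uext h) (skernel h) X.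

Definition quot_fun h1 h2 (g1 g2 : C -> C) : C -> C :=
  (fun z => (g1 z + g2 z) / mero_ext h2 z) \_ (U0 h1 h2).

(* X is the space 1/h2 (B1 (+) -B2) of functions on U0 h1 h2; the clause on the
   iprod includes that it does not depend on the representation. *)
Definition is_quot_space h1 h2 B1 B2 X :=
  carrier X = [set quot_fun h1 h2 g1 g2 | g1 in carrier B1 & g2 in carrier B2] /\
  forall g1 g2 g1' g2', B1 g1 -> B2 g2 -> B1 g1' -> B2 g2' ->
    iprod X (quot_fun h1 h2 g1 g2) (quot_fun h1 h2 g1' g2') =
    iprod B1 g1 g1' - iprod B2 g2 g2'.

(* The intersection of B1 and B2, as spaces of meromorphic functions on the
   complement of the real line, is 0. *)
Definition trivial_mero_inter B1 B2 :=
  forall g1 g2, B1 g1 -> B2 g2 -> eq_mero nonreal g1 g2 ->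
    eq_mero nonreal g1 (fun=> 0).

End ReproducingKernel.

(* Main.v *)
(** For a Schur function h, positivity of the kernel of h (extended to the lower
    half-plane by 1/SR(h)) follows from the Schur algorithm, by induction on the number of
    points in the upper half-plane; B(h) is the completion of the span of the kernel
    functions. For nonreal a, the operator V_a = 1 + (a - conj a) D_a satisfies
    [V_a F, V_a G] = [F, G] + i (a - conj a) F(a) conj(G(a)), which bounds D_a by
    const/|Im a|; the maximum principle on a square around a real point removes this
    singularity, so D_w is bounded at real points too.

    The pair (h1, h2) is extremal: among all pairs of Schur functions with h1/h2 = v in the
    upper half-plane it maximizes |h2(z0)|. If B(h1) and B(h2) had a common nonzero element,
    the intersection would carry a Hilbert space inner product that dominates those of B(h1)
    and B(h2) and satisfies the identity above. The identity forces its reproducing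
    kernel to be (1 - c(z) conj(c(w))) / (-i (z - conj w)), and domination gives
    |h1|, |h2| <= |c| <= 1 and |c(z0)| < 1, so (h1/c, h2/c) would be a better pair.

    A trivial intersection makes the representation (g1 + g2)/h2 unique. The kernel identity
    s_v(z, w) = (s_h1(z, w) - s_h2(z, w)) / (h2(z) conj(h2(w))) and
    D_w ((g1 + g2)/h2) = (D_w g1 + D_w g2 - i (g1 + g2)(w) s_h2(., conj w)) / h2
    then give the Krein space. *)

Require Import Defs.
From HB Require Import structures.
From mathcomp Require Import all_boot all_order all_algebra.
From mathcomp Require Import all_classical all_reals all_analysis.
From mathcomp Require Import complex ring lra.

Set Implicit Arguments.
Unset Strict Implicit.
Unset Printing Implicit Defensive.

Import Order.TTheory GRing.Theory Num.Theory.
Import numFieldNormedType.Exports.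

Local Open Scope classical_set_scope.
Local Open Scope ring_scope.

(** * Complex numbers and complex derivatives *)

Section ComplexBase.
Variable R : realType.
Local Notation C := (Cplx R).
Implicit Types (z w : C) (f g : C -> C).

(** The complex analysis rests on Goursat's theorem for rectangles. The integral of 1/(w - z) is
    never evaluated: that it is nonzero suffices for the maximum principle and for the analyticity
    of difference quotients, which replace power series. Limits along one ultrafilter replace
    convergent subsequences, both for normal families and for weak limits.

    The obstacle is the set z = conj w, where the kernel formula reads 0/0; it contains (z, z) for
    every real z. Off this set, the kernel function at a lower point is a multiple of a difference
    quotient of h, so positivity is proved for a block kernel on two kinds of upper points. The
    remaining configurations follow by moving all points vertically by i/(n+1).

    The operator V_a is a Cayley transform, isometric on functions vanishing at a. On common
    elements of B(h1) and B(h2) its defect is the same in both inner products, so their difference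
    is invariant under V_a; this makes a single inner product dominating both possible. *)

Definition cmod (z : C) : R := complex.Re `|z|.
Definition toC (x : R) : C := real_complex R x.

Lemma reCD z w : reC (z + w) = reC z + reC w. Proof. by case: z w => a b []. Qed.
Lemma imCD z w : imC (z + w) = imC z + imC w. Proof. by case: z w => a b []. Qed.
Lemma reCN z : reC (- z) = - reC z. Proof. by case: z. Qed.
Lemma imCN z : imC (- z) = - imC z. Proof. by case: z. Qed.
Lemma reCB z w : reC (z - w) = reC z - reC w. Proof. by rewrite reCD reCN. Qed.
Lemma imCB z w : imC (z - w) = imC z - imC w. Proof. by rewrite imCD imCN. Qed.
Lemma reCM z w : reC (z * w) = reC z * reC w - imC z * imC w.
Proof. by case: z w => a b []. Qed.
Lemma imCM z w : imC (z * w) = reC z * imC w + imC z * reC w.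
Proof. by case: z w => a b []. Qed.
Lemma reCJ z : reC z^* = reC z. Proof. by case: z. Qed.
Lemma imCJ z : imC z^* = - imC z. Proof. by case: z. Qed.
Lemma reC_toC x : reC (toC x) = x. Proof. by []. Qed.
Lemma imC_toC x : imC (toC x) = 0. Proof. by []. Qed.
Lemma reC0 : reC (0:C) = 0. Proof. by []. Qed.
Lemma imC0 : imC (0:C) = 0. Proof. by []. Qed.
Lemma reCi : reC ('i:C) = 0. Proof. by []. Qed.
Lemma imCi : imC ('i:C) = 1. Proof. by []. Qed.

Definition pt (x y : R) : C := Complex x y.
Lemma reC_pt x y : reC (pt x y) = x. Proof. by []. Qed.
Lemma imC_pt x y : imC (pt x y) = y. Proof. by []. Qed.
Lemma pt_reim (z : C) : pt (reC z) (imC z) = z. Proof. by case: z. Qed.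
Lemma reCV z : reC z^-1 = reC z / (reC z ^+ 2 + imC z ^+ 2). Proof. by case: z. Qed.
Lemma imCV z : imC z^-1 = - imC z / (reC z ^+ 2 + imC z ^+ 2).
Proof. by case: z => a b; rewrite mulNr. Qed.

Lemma toCD x y : toC (x + y) = toC x + toC y. Proof. exact: rmorphD. Qed.
Lemma toCB x y : toC (x - y) = toC x - toC y. Proof. exact: rmorphB. Qed.
Lemma toCM x y : toC (x * y) = toC x * toC y. Proof. exact: rmorphM. Qed.
Lemma toCV x : toC (x^-1) = (toC x)^-1. Proof. exact: fmorphV. Qed.
Lemma toCX x n : toC (x ^+ n) = toC x ^+ n. Proof. exact: rmorphXn. Qed.
Lemma toC0 : toC 0 = 0. Proof. by []. Qed.
Lemma toC1 : toC 1 = 1. Proof. by []. Qed.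
Lemma toCJ x : (toC x)^* = toC x.
Proof. by apply/eqP; rewrite eq_complex /= oppr0 !eqxx. Qed.
Lemma toC_eq0 x : (toC x == 0) = (x == 0).
Proof. by rewrite eq_complex /= eqxx andbT. Qed.
Lemma le_toC x y : (toC x <= toC y) = (x <= y). Proof. exact: lecR. Qed.
Lemma lt_toC x y : (toC x < toC y) = (x < y). Proof. exact: ltcR. Qed.
Lemma toC_ge0 x : (0 <= toC x) = (0 <= x). Proof. exact: lecR. Qed.
Lemma toC_gt0 x : (0 < toC x) = (0 < x). Proof. exact: ltcR. Qed.

Lemma complexP z w : reC z = reC w -> imC z = imC w -> z = w.
Proof. by case: z w => a b [c d] /= -> ->. Qed.
Lemma complexRI z : z = toC (reC z) + 'i * toC (imC z). Proof. exact: complexE. Qed.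

Lemma cmodE z : `|z| = toC (cmod z).
Proof. by rewrite /cmod normc_def. Qed.
Lemma cmod_sqrt z : cmod z = Num.sqrt (reC z ^+ 2 + imC z ^+ 2).
Proof. by rewrite /cmod normc_def. Qed.
Lemma cmod_ge0 z : 0 <= cmod z. Proof. by rewrite -toC_ge0 -cmodE. Qed.
Hint Resolve cmod_ge0 : core.
Lemma cmod_sq z : cmod z ^+ 2 = reC z ^+ 2 + imC z ^+ 2.
Proof. by rewrite cmod_sqrt sqr_sqrtr // addr_ge0 ?sqr_ge0. Qed.
Lemma cmodM z w : cmod (z * w) = cmod z * cmod w.
Proof. by apply: (@complexI R); rewrite -[LHS]cmodE normrM !cmodE -toCM. Qed.
Lemma cmodV z : cmod z^-1 = (cmod z)^-1.
Proof. by apply: (@complexI R); rewrite -[LHS]cmodE normfV !cmodE -toCV. Qed.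
Lemma cmodf z w : cmod (z / w) = cmod z / cmod w. Proof. by rewrite cmodM cmodV. Qed.
Lemma cmodX z n : cmod (z ^+ n) = cmod z ^+ n.
Proof. by apply: (@complexI R); rewrite -[LHS]cmodE normrX !cmodE -toCX. Qed.
Lemma cmodD z w : cmod (z + w) <= cmod z + cmod w.
Proof. by rewrite -le_toC toCD -!cmodE ler_normD. Qed.
Lemma cmodB z w : cmod (z - w) <= cmod z + cmod w.
Proof. by rewrite -le_toC toCD -!cmodE ler_normB. Qed.
Lemma cmodN z : cmod (- z) = cmod z. Proof. by rewrite /cmod normrN. Qed.
Lemma cmodBC z w : cmod (z - w) = cmod (w - z). Proof. by rewrite /cmod distrC. Qed.
Lemma cmodJ z : cmod z^* = cmod z. Proof. by rewrite /cmod norm_conjC. Qed.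
Lemma cmod0 : cmod 0 = 0. Proof. by rewrite /cmod normr0. Qed.
Lemma cmod1 : cmod 1 = 1. Proof. by rewrite /cmod normr1. Qed.
Lemma cmodi : cmod 'i = 1.
Proof. by rewrite cmod_sqrt reCi imCi expr0n add0r expr1n sqrtr1. Qed.
Lemma cmod_toC x : cmod (toC x) = `|x|.
Proof. by rewrite cmod_sqrt reC_toC imC_toC expr0n addr0 sqrtr_sqr. Qed.
Lemma cmod_eq0 z : (cmod z == 0) = (z == 0).
Proof. by rewrite -toC_eq0 -cmodE normr_eq0. Qed.
Lemma cmod_gt0 z : (0 < cmod z) = (z != 0).
Proof. by rewrite lt_def cmod_ge0 andbT cmod_eq0. Qed.
Lemma cmod_conj z : z * z^* = toC (cmod z ^+ 2).
Proof. by rewrite -normCK cmodE -toCX. Qed.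
Lemma cmodBB z w u : cmod (z - u) <= cmod (z - w) + cmod (w - u).
Proof. by have := cmodD (z - w) (w - u); rewrite addrA subrK. Qed.
Lemma re_le_cmod z : `|reC z| <= cmod z.
Proof.
rewrite -(@ler_pXn2r _ 2) ?nnegrE ?normr_ge0 //.
by rewrite cmod_sq real_normK ?num_real // lerDl sqr_ge0.
Qed.
Lemma im_le_cmod z : `|imC z| <= cmod z.
Proof.
rewrite -(@ler_pXn2r _ 2) ?nnegrE ?normr_ge0 //.
by rewrite cmod_sq real_normK ?num_real // lerDr sqr_ge0.
Qed.
Lemma cmod_le_reim z : cmod z <= `|reC z| + `|imC z|.
Proof.
rewrite {1}[z]complexRI; apply: le_trans (cmodD _ _) _.
by rewrite cmodM cmodi mul1r !cmod_toC.
Qed.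
Lemma reC_le_cmod z : reC z <= cmod z.
Proof. exact: le_trans (ler_norm _) (re_le_cmod z). Qed.
Lemma lerB_cmod z w : cmod z - cmod w <= cmod (z - w).
Proof. by rewrite lerBlDr; have := cmodD (z - w) w; rewrite subrK. Qed.

Lemma ge0_toC z : 0 <= z -> z = toC (reC z).
Proof. by move=> z0; apply: complexP => //; rewrite imC_toC; exact: ger0_Im. Qed.
Lemma subCJ z : z - z^* = 2 * 'i * toC (imC z).
Proof.
have E2 : (2 : C) = toC 2 by rewrite -[2]/(1 + 1) toCD.
by rewrite E2; apply: complexP; rewrite ?reCB ?imCB !(reCM,imCM) ?reCJ ?imCJ !(reC_toC,imC_toC) reCi imCi; ring.
Qed.

Lemma nbhsCP (z : C) (P : set C) :
  nbhs z P <-> exists2 e : R, 0 < e & forall w, cmod (w - z) < e -> P w.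
Proof.
split.
  case/nbhs_normP => e /= e0 eP.
  have ee := ge0_toC (ltW e0); exists (reC e); first by rewrite -toC_gt0 -ee.
  by move=> w; rewrite -lt_toC -cmodE -ee distrC => /eP.
case=> e e0 eP; apply/nbhs_normP; exists (toC e) => /=; first by rewrite toC_gt0.
by move=> w /=; rewrite distrC cmodE lt_toC => /eP.
Qed.

Lemma nearCP (z : C) (P : C -> Prop) :
  (\forall w \near z, P w) <-> exists2 e : R, 0 < e & forall w, cmod (w - z) < e -> P w.
Proof. exact: nbhsCP. Qed.

Lemma dnbhsCP (z : C) (P : C -> Prop) :
  (\forall w \near z^', P w) <->
  exists2 e : R, 0 < e & forall w, w != z -> cmod (w - z) < e -> P w.
Proof.
rewrite near_withinE; split.
  by case/nbhsCP => e e0 h; exists e => // w wz wd; exact: h.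
by case=> e e0 h; apply/nbhsCP; exists e => // w wd wz; exact: h.
Qed.

Lemma cvgCP (T : Type) (F : set_system T) (FF : Filter F) (f : T -> C) (l : C) :
  f x @[x --> F] --> l <-> forall e : R, 0 < e -> \forall x \near F, cmod (f x - l) < e.
Proof.
split=> [fl e e0|h].
  have := @cvgr_dist_lt _ _ _ _ FF _ _ fl (toC e).
  rewrite toC_gt0 => /(_ e0); apply: filterS => x.
  by rewrite distrC cmodE lt_toC.
apply/cvgrPdist_lt => e e0; have ee := ge0_toC (ltW e0).
have /h : 0 < reC e by rewrite -toC_gt0 -ee.
by apply: filterS => x; rewrite -lt_toC -ee -cmodE distrC.
Qed.

Lemma cvgRP (T : Type) (F : set_system T) (FF : Filter F) (f : T -> R) (l : R) :
  f x @[x --> F] --> l <-> forall e : R, 0 < e -> \forall x \near F, `|f x - l| < e.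
Proof.
split=> [fl e e0|h].
  have := @cvgr_dist_lt _ _ _ _ FF _ _ fl e e0.
  by apply: filterS => x; rewrite distrC.
by apply/cvgrPdist_lt => e e0; have := h _ e0; apply: filterS => x; rewrite distrC.
Qed.

Lemma cvgC_reim (T : Type) (F : set_system T) (FF : Filter F) (f : T -> C) (l : C) :
  reC (f x) @[x --> F] --> reC l -> imC (f x) @[x --> F] --> imC l ->
  f x @[x --> F] --> l.
Proof.
move=> /cvgRP hr /cvgRP hi; apply/cvgCP => e e0.
have e2 : 0 < e / 2 by rewrite divr_gt0.
have := hr _ e2; have := hi _ e2; apply: filterS2 => x xi xr.
apply: le_lt_trans (cmod_le_reim _) _.
by rewrite reCB imCB [e]splitr ltrD.
Qed.

Lemma cvg_reC (T : Type) (F : set_system T) (FF : Filter F) (f : T -> C) (l : C) :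
  f x @[x --> F] --> l -> reC (f x) @[x --> F] --> reC l.
Proof.
move=> /cvgCP h; apply/cvgRP => e /h; apply: filterS => x.
by apply: le_lt_trans; rewrite -reCB re_le_cmod.
Qed.

Lemma cvg_imC (T : Type) (F : set_system T) (FF : Filter F) (f : T -> C) (l : C) :
  f x @[x --> F] --> l -> imC (f x) @[x --> F] --> imC l.
Proof.
move=> /cvgCP h; apply/cvgRP => e /h; apply: filterS => x.
by apply: le_lt_trans; rewrite -imCB im_le_cmod.
Qed.

Lemma cvg_conj (T : Type) (F : set_system T) (FF : Filter F) (f : T -> C) (l : C) :
  f x @[x --> F] --> l -> (f x)^* @[x --> F] --> l^*.
Proof.
move=> /cvgCP h; apply/cvgCP => e /h; apply: filterS => x.
by rewrite -rmorphB cmodJ.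
Qed.

Lemma cvg_toC (T : Type) (F : set_system T) (FF : Filter F) (f : T -> R) (l : R) :
  f x @[x --> F] --> l -> toC (f x) @[x --> F] --> toC l.
Proof.
move=> /cvgRP h; apply/cvgCP => e /h; apply: filterS => x.
by rewrite -toCB cmod_toC.
Qed.

Lemma cvgC_unique (T : Type) (F : set_system T) (FF : ProperFilter F) (f : T -> C) (l l' : C) :
  f x @[x --> F] --> l -> f x @[x --> F] --> l' -> l = l'.
Proof.
move=> h h'; rewrite -(cvg_lim (@norm_hausdorff _ C) h).
exact: (cvg_lim (@norm_hausdorff _ C) h').
Qed.

Lemma cvgC_near_eq (T : Type) (F : set_system T) (FF : Filter F) (f g : T -> C) (l : C) :
  (\forall x \near F, f x = g x) -> g x @[x --> F] --> l -> f x @[x --> F] --> l.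
Proof.
move=> fg /cvgCP h; apply/cvgCP => e /h; move: fg; apply: filterS2 => x.
by move=> ->.
Qed.

Lemma limC_eq (T : Type) (F : set_system T) (FF : ProperFilter F) (f : T -> C) (l : C) :
  f x @[x --> F] --> l -> lim (f x @[x --> F]) = l.
Proof. by move=> h; exact: (cvg_lim (@norm_hausdorff _ C) h). Qed.

(** The difference quotient in Carathéodory's form: for [f] differentiable at [w] it is continuous
    at [w], and the expansion [ddE] needs no case distinction. [Dw] is its restriction to a
    domain. *)
Definition dd f w (z : C) : C := if z == w then derive1 f w else (f z - f w) / (z - w).

Lemma continuous_eps f z : {for z, continuous f} <->
  forall e : R, 0 < e -> exists2 d : R, 0 < d & forall w, cmod (w - z) < d -> cmod (f w - f z) < e.
Proof.
split=> [/cvgCP h e /h /nbhsCP //|h].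
apply: (proj2 (@cvgCP C (nbhs z) _ f (f z))) => e /h ?; exact/nbhsCP.
Qed.

Lemma quot_cvg_derivable f w (d : C) :
  (f z - f w) / (z - w) @[z --> w^'] --> d <-> derivable f w 1 /\ derive1 f w = d.
Proof.
have E : (fun h : C => h^-1 *: ((f \o shift w) (h *: 1) - f w)) =
   (fun h => (f (h + w) - f w) / h).
  by apply/funext => h /=; rewrite /GRing.scale /= mulr1 mulrC.
have E' : (fun h : C => h^-1 *: (f (h + w) - f w)) = (fun h => (f (h + w) - f w) / h).
  by apply/funext => h; rewrite /GRing.scale /= mulrC.
have H : (f z - f w) / (z - w) @[z --> w^'] --> d <->
         (f (h + w) - f w) / h @[h --> 0^'] --> d.
  split=> /cvgCP h; apply/cvgCP => e /h /dnbhsCP[r r0 hr]; apply/dnbhsCP; exists r => // x x0 xr.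
    have := hr (x + w); rewrite addrK; apply; last by rewrite subr0 in xr.
    by rewrite -subr_eq0 addrK.
  have := hr (x - w); rewrite subrK; apply; last by rewrite subr0.
  by rewrite subr_eq0.
split=> [/H h|[h1 h2]]; last first.
  by apply/H; rewrite -h2 /derive1 E'; rewrite /derivable E in h1.
split; first by rewrite /derivable E; apply/cvg_ex; exists d.
by rewrite /derive1 E'; apply/cvg_lim.
Qed.

Lemma dd_cvg f w : derivable f w 1 -> (f z - f w) / (z - w) @[z --> w^'] --> derive1 f w.
Proof. by move=> h; apply/quot_cvg_derivable. Qed.

Lemma ddE f w z : f z = f w + dd f w z * (z - w).
Proof.
rewrite /dd; case: eqVneq => [->|zw]; first by rewrite subrr mulr0 addr0.
by rewrite divfK ?subr_eq0 // addrC subrK.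
Qed.

Lemma dd_continuous f w : derivable f w 1 -> {for w, continuous (dd f w)}.
Proof.
move=> /dd_cvg /cvgCP h; apply/continuous_eps => e e0; case/dnbhsCP: (h _ e0) => r r0 hr.
exists r => // z zr; rewrite {2}/dd eqxx /dd.
by case: eqVneq => [_|zw]; [rewrite subrr cmod0 | exact: hr].
Qed.

Lemma caratheodory f w (phi : C -> C) : {for w, continuous phi} ->
  (\forall z \near w, f z = f w + phi z * (z - w)) -> derivable f w 1 /\ derive1 f w = phi w.
Proof.
move=> /cvgCP h /nbhsCP[r r0 hr]; apply/quot_cvg_derivable/cvgCP => e e0.
case/nbhsCP: (h _ e0) => s s0 hs; apply/dnbhsCP; exists (Num.min r s).
  by rewrite lt_min r0.
move=> z zw; rewrite lt_min => /andP[zr zs].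
by rewrite (hr z zr) [f w + _]addrC addrK mulfK ?subr_eq0 // hs.
Qed.

Lemma derivable_cont f w : derivable f w 1 -> {for w, continuous f}.
Proof.
move=> fd; apply: (@differentiable_continuous C C C).
exact/derivable1_diffP.
Qed.

Lemma der_cst (k : C) w : derivable (fun _ : C => k : C) w 1.
Proof. exact: derivable_cst. Qed.
Lemma der_id w : derivable (fun z : C => z : C) w 1.
Proof. exact: derivable_id. Qed.
Lemma derD f g w : derivable f w 1 -> derivable g w 1 -> derivable (fun z => f z + g z) w 1.
Proof. exact: derivableD. Qed.
Lemma derB f g w : derivable f w 1 -> derivable g w 1 -> derivable (fun z => f z - g z) w 1.
Proof. exact: derivableB. Qed.
Lemma derM f g w : derivable f w 1 -> derivable g w 1 -> derivable (fun z => f z * g z) w 1.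
Proof. exact: derivableM. Qed.
Lemma derV f w : f w != 0 -> derivable f w 1 -> derivable (fun z => (f z)^-1) w 1.
Proof. exact: derivableV. Qed.
Lemma derX f n w : derivable f w 1 -> derivable (fun z => f z ^+ n) w 1.
Proof.
move=> df; elim: n => [|n IH]; first exact: der_cst.
rewrite (_ : (fun z => _) = (fun z => f z * f z ^+ n)); first exact: derM df IH.
by apply/funext => z; rewrite exprS.
Qed.
Lemma derDiv f g w : g w != 0 -> derivable f w 1 -> derivable g w 1 -> derivable (fun z => f z / g z) w 1.
Proof. by move=> g0 df dg; exact: (derM df (derV g0 dg)). Qed.

Lemma derivable_near_eq f g w : (\forall z \near w, f z = g z) -> derivable f w 1 ->
  derivable g w 1 /\ derive1 g w = derive1 f w.
Proof.
move=> fg fd; have fgw : f w = g w by case/nbhsCP: fg => e e0; apply; rewrite subrr cmod0.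
have -> : derive1 f w = dd f w w by rewrite /dd eqxx.
apply: caratheodory; first exact: dd_continuous.
by move: fg; apply: filterS => z <-; rewrite -fgw -ddE.
Qed.

Lemma analytic_near_eq f g z : (\forall w \near z, f w = g w) -> analytic_at f z -> analytic_at g z.
Proof.
move=> /nearCP[r r0 fg] /nearCP[s s0 fs]; apply/nearCP.
exists (Num.min r s); first by rewrite lt_min r0.
move=> w; rewrite lt_min => /andP[wr ws].
apply: (derivable_near_eq _ (fs _ ws)).1.
apply/nearCP; exists (r - cmod (w - z)); first by rewrite subr_gt0.
by move=> u; rewrite ltrBrDr => ur; apply: fg; apply: le_lt_trans (cmodBB _ w _) ur.
Qed.

Lemma analytic_at_der f z : analytic_at f z -> derivable f z 1.
Proof. by move=> /nearCP[r r0]; apply; rewrite subrr cmod0. Qed.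

Lemma analytic_at_near f z : analytic_at f z -> \forall w \near z, analytic_at f w.
Proof.
move=> /nearCP[r r0 fr]; apply/nearCP; exists r => // w wr.
apply/nearCP; exists (r - cmod (w - z)); first by rewrite subr_gt0.
by move=> u; rewrite ltrBrDr => ur; apply: fr; apply: le_lt_trans (cmodBB _ w _) ur.
Qed.

Lemma analytic_cont f z : analytic_at f z -> {for z, continuous f}.
Proof. by move/analytic_at_der/derivable_cont. Qed.

Lemma openCP (D : set C) : open D <->
  forall z, D z -> exists2 e : R, 0 < e & forall w, cmod (w - z) < e -> D w.
Proof.
rewrite openE; split=> h z Dz; first by apply/nbhsCP; exact: h.
by have := h _ Dz; move/nbhsCP.
Qed.

Lemma analytic_on_der (D : set C) f : open D ->
  analytic_on D f <-> forall z, D z -> derivable f z 1.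
Proof.
move=> /openCP oD; split=> [h z /h /analytic_at_der //|h z Dz].
have [e e0 he] := oD _ Dz; apply/nearCP; exists e => // w we; exact/h/he.
Qed.

Lemma open_upper : open (@upper R).
Proof.
apply/openCP => z z0; exists (imC z) => // w; rewrite /upper /=.
move=> /(le_lt_trans (im_le_cmod _)); rewrite imCB ltr_distl => /andP[+ _].
by rewrite subrr.
Qed.

Lemma open_lower : open (@lower R).
Proof.
apply/openCP => z; rewrite /lower /= => z0; exists (- imC z); first by rewrite oppr_gt0.
move=> w /(le_lt_trans (im_le_cmod _)); rewrite imCB ltr_distl => /andP[_].
by rewrite subrr.
Qed.

Lemma open_nonreal : open (@nonreal R).
Proof.
have -> : @nonreal R = upper `|` lower.
  rewrite /nonreal; apply/seteqP; split=> z /=.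
    by rewrite neq_lt => /orP[]; [right|left].
  by case=> h; rewrite neq_lt h ?orbT.
exact: openU open_upper open_lower.
Qed.

Lemma derivable_conj f w : derivable f w^* 1 -> derivable (fun z => (f z^*)^*) w 1.
Proof.
move=> fd; apply: (proj1 (@caratheodory (fun z => (f z^*)^*) w (fun z => (dd f w^* z^*)^*) _ _)).
  apply/continuous_eps => e e0.
  have /continuous_eps/(_ _ e0)[d d0 hd] := dd_continuous fd.
  exists d => // z zd; rewrite -rmorphB cmodJ; apply: hd.
  by rewrite -rmorphB cmodJ.
apply/nearCP; exists 1 => // z _ /=.
by rewrite (ddE f w^* z^*) rmorphD rmorphM rmorphB /= !conjCK.
Qed.

Lemma near_conj (P : C -> Prop) z : (\forall w \near z^*, P w) -> \forall w \near z, P w^*.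
Proof.
by move=> /nearCP[e e0 h]; apply/nearCP; exists e => // w we; apply: h; rewrite -rmorphB cmodJ.
Qed.

Lemma dnear_conj (P : C -> Prop) z : (\forall w \near z^*^', P w) -> \forall w \near z^', P w^*.
Proof.
move=> /dnbhsCP[e e0 h]; apply/dnbhsCP; exists e => // w wz we; apply: h.
  by rewrite (inj_eq (can_inj (@conjCK _))).
by rewrite -rmorphB cmodJ.
Qed.

Lemma analytic_conj f z : analytic_at f z^* -> analytic_at (fun z => (f z^*)^*) z.
Proof. by move=> /near_conj; apply: filterS => w; exact: derivable_conj. Qed.

Lemma dnbhs_proper (z : C) : ProperFilter z^'. Proof. exact: Proper_dnbhs_numFieldType. Qed.

Lemma dnearW (z : C) P : (\forall w \near z, P w) -> \forall w \near z^', P w.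
Proof. by move=> /nearCP[e e0 h]; apply/dnbhsCP; exists e => // w _; exact: h. Qed.

(** Identities between meromorphic functions are known on punctured neighbourhoods only; this
    carries them to the centre. *)
Lemma cont_eq_dnear f g z : {for z, continuous f} -> {for z, continuous g} ->
  (\forall w \near z^', f w = g w) -> f z = g z.
Proof.
move=> cf cg fg.
have hf : f w @[w --> z^'] --> f z by apply: cvg_trans cf; apply: cvg_app; exact: cvg_within.
have hg : g w @[w --> z^'] --> g z by apply: cvg_trans cg; apply: cvg_app; exact: cvg_within.
by apply: (cvgC_unique (F := z^')) hf _; apply: (cvgC_near_eq (F := z^')) hg.
Qed.

End ComplexBase.
#[export] Hint Resolve cmod_ge0 : core.
#[global] Opaque Cplx reC imC cmod toC pt derivable.
#[export] Hint Extern 0 (is_true (_ <= cmod _)%R) => exact: cmod_ge0 : core.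

(** * Integrals over the boundary of a rectangle *)

Section Integral.
Variable R : realType.
Local Notation C := (Cplx R).
Local Notation mu := (@lebesgue_measure R).
Implicit Types (g h : R -> C) (a b c d x y : R) (f : C -> C).

Definition cint g a b : C :=
  pt (\int[mu]_(x in `[a, b]) reC (g x)) (\int[mu]_(x in `[a, b]) imC (g x)).

(** The nearby point [y] may leave the interval, so continuity is two-sided at the endpoints too.
    This fits integrands that come from functions continuous at points of the plane. *)
Definition ccont g a b := forall x, a <= x <= b ->
  forall e : R, 0 < e -> exists2 d : R, 0 < d & forall y, `|y - x| < d -> cmod (g y - g x) < e.

Lemma ccontW g a b a' b' : a <= a' -> b' <= b -> ccont g a b -> ccont g a' b'.
Proof.
by move=> aa bb h x /andP[ax xb]; apply: h; rewrite (le_trans aa ax) (le_trans xb bb).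
Qed.

Lemma ccontD g h a b : ccont g a b -> ccont h a b -> ccont (fun x => g x + h x) a b.
Proof.
move=> cg ch x xab e e0; have e2 : 0 < e / 2 by rewrite divr_gt0.
have [d d0 hd] := cg x xab _ e2; have [d' d0' hd'] := ch x xab _ e2.
exists (Num.min d d'); first by rewrite lt_min d0.
move=> y; rewrite lt_min => /andP[/hd h1 /hd' h2].
rewrite opprD addrACA; apply: le_lt_trans (cmodD _ _) _.
by rewrite [e]splitr ltrD.
Qed.

Lemma ccontZ (k : C) g a b : ccont g a b -> ccont (fun x => k * g x) a b.
Proof.
move=> cg x xab e e0.
have k0 : 0 < cmod k + 1 by have := cmod_ge0 k; lra.
have [d d0 hd] := cg x xab _ (divr_gt0 e0 k0); exists d => // y /hd.
rewrite -mulrBr cmodM ltr_pdivlMr // => h; apply: le_lt_trans h.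
by have := cmod_ge0 (g y - g x); lra.
Qed.

Lemma ccontN g a b : ccont g a b -> ccont (fun x => - g x) a b.
Proof.
move=> cg x xab e /(cg x xab)[d d0 hd]; exists d => // y /hd.
by rewrite -opprD cmodN.
Qed.

Lemma ccontB g h a b : ccont g a b -> ccont h a b -> ccont (fun x => g x - h x) a b.
Proof. by move=> cg ch; apply: ccontD => //; exact: ccontN. Qed.

Lemma ccont_int (p : C -> R) g a b : (forall z w, `|p z - p w| <= cmod (z - w)) ->
  ccont g a b -> mu.-integrable `[a, b] (EFin \o (fun x => p (g x))).
Proof.
move=> hp cg; apply: continuous_compact_integrable; first exact: segment_compact.
apply: continuous_in_subspaceT => x; rewrite inE /= in_itv /= => xab.
apply/cvgRP => e /(cg x xab)[d d0 hd].
apply/nbhs_normP; exists d => //= y; rewrite /= distrC => /hd.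
by apply: le_lt_trans.
Qed.

Lemma re_lip (z w : C) : `|reC z - reC w| <= cmod (z - w).
Proof. by rewrite -reCB re_le_cmod. Qed.
Lemma im_lip (z w : C) : `|imC z - imC w| <= cmod (z - w).
Proof. by rewrite -imCB im_le_cmod. Qed.

Let mitv a b : measurable (`[a, b]%classic : set (measurableTypeR R)).
Proof. exact: measurable_itv. Qed.

Let Rint_cst a b r : a <= b -> \int[mu]_(x in `[a, b]) r = r * (b - a).
Proof.
move=> ab; rewrite Rintegral_cst //; congr (_ * _).
transitivity (fine (b%:E - a%:E)%E); last by [].
congr fine; apply: (etrans (lebesgue_measure_itv `[a, b])).
rewrite /= lte_fin; case: ltgtP ab => //= -> _.
by rewrite -EFinB subrr.
Qed.

Lemma eq_cint g h a b : (forall x, a <= x <= b -> g x = h x) -> cint g a b = cint h a b.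
Proof.
move=> gh; rewrite /cint; congr pt; apply: eq_Rintegral => x;
by rewrite inE /= in_itv /= => /gh ->.
Qed.

Lemma cintD g h a b : ccont g a b -> ccont h a b ->
  cint (fun x => g x + h x) a b = cint g a b + cint h a b.
Proof.
move=> cg ch; apply: complexP; rewrite ?reCD ?imCD /cint ?reC_pt ?imC_pt.
  rewrite -RintegralD //; try exact: (ccont_int re_lip).
  by apply: eq_Rintegral => x _; rewrite reCD.
rewrite -RintegralD //; try exact: (ccont_int im_lip).
by apply: eq_Rintegral => x _; rewrite imCD.
Qed.

Lemma cintZ k g a b : ccont g a b -> cint (fun x => k * g x) a b = k * cint g a b.
Proof.
move=> cg.
have ir := ccont_int re_lip cg; have ii := ccont_int im_lip cg.
have iZ (r : R) (p : R -> R) : mu.-integrable `[a, b] (EFin \o p) ->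
    mu.-integrable `[a, b] (EFin \o (fun x => r * p x)).
  move=> ip; have := integrableZl (mitv a b) r ip.
  by apply: eq_integrable => // x _; rewrite /= EFinM.
apply: complexP; rewrite ?reCM ?imCM /cint ?reC_pt ?imC_pt.
  rewrite -!RintegralZl // -RintegralB //; try exact: iZ.
  by apply: eq_Rintegral => x _; rewrite reCM.
rewrite -!RintegralZl // -RintegralD //; try exact: iZ.
by apply: eq_Rintegral => x _; rewrite imCM.
Qed.

Lemma cintB g h a b : ccont g a b -> ccont h a b ->
  cint (fun x => g x - h x) a b = cint g a b - cint h a b.
Proof.
move=> cg ch.
have -> : (fun x => g x - h x) = (fun x => g x + (-1) * h x) by apply/funext => x; rewrite mulN1r.
by rewrite cintD ?cintZ ?mulN1r //; exact: ccontZ.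
Qed.

Lemma cint_cst (k : C) a b : a <= b -> cint (fun=> k) a b = k * toC (b - a).
Proof.
move=> ab; apply: complexP; rewrite ?reCM ?imCM /cint ?reC_pt ?imC_pt !Rint_cst //; ring.
Qed.

Lemma cint_split g a b c : a <= c <= b -> ccont g a b ->
  cint g a b = cint g a c + cint g c b.
Proof.
move=> /andP[ac cb] cg.
have main (p : C -> R) : (forall z w, `|p z - p w| <= cmod (z - w)) ->
    \int[mu]_(x in `[a, b]) p (g x) = \int[mu]_(x in `[a, c]) p (g x) + \int[mu]_(x in `[c, b]) p (g x).
  move=> hp; have ig := ccont_int hp cg.
  have ig2 : mu.-integrable `[c, b] (EFin \o (fun x => p (g x))).
    exact: (ccont_int hp (ccontW ac (lexx b) cg)).
  rewrite -[X in _ + X]Rintegral_itv_obnd_cbnd; last first.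
    apply: integrableS ig2 => //; apply: subset_itv => //; by rewrite bnd_simp.
  by rewrite -(@Rintegral_itvB _ _ (BLeft a) (BRight b) c) // ?bnd_simp // addrC subrK.
by apply: complexP; rewrite ?reCD ?imCD /cint ?reC_pt ?imC_pt; apply: main; [exact: re_lip|exact: im_lip].
Qed.

(** The factor 2 comes from estimating real and imaginary part separately; only the finiteness of
    such constants matters later. *)
Lemma cint_bound g a b (M : R) : a <= b -> ccont g a b ->
  (forall x, a <= x <= b -> cmod (g x) <= M) -> cmod (cint g a b) <= 2 * M * (b - a).
Proof.
move=> ab cg gM.
have main (p : C -> R) : (forall z w, `|p z - p w| <= cmod (z - w)) -> p 0 = 0 ->
    `|\int[mu]_(x in `[a, b]) p (g x)| <= M * (b - a).
  move=> hp p0; have ig := ccont_int hp cg.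
  apply: le_trans (le_normr_Rintegral _ _) _ => //.
  rewrite -Rint_cst //.
  apply: le_Rintegral => //.
    by move/integrable_norm: ig; apply: eq_integrable => // x _.
    apply: (@continuous_compact_integrable R (fun=> M)); first exact: segment_compact.
    by apply: continuous_subspaceT => x; exact: cvg_cst.
  move=> x; rewrite /= in_itv /= => /gM; apply: le_trans.
  by have := hp (g x) 0; rewrite p0 !subr0.
apply: le_trans (cmod_le_reim _) _; rewrite /cint ?reC_pt ?imC_pt.
have -> : 2 * M * (b - a) = M * (b - a) + M * (b - a) by ring.
by apply: lerD; apply: main => //; [exact: re_lip|exact: im_lip].
Qed.

Lemma cint_same g a : ccont g a a -> cint g a a = 0.
Proof.
move=> cg; apply/eqP; rewrite -cmod_eq0 eq_le cmod_ge0 andbT.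
have /cint_bound : a <= a by [].
move=> /(_ g (cmod (g a)) cg); rewrite subrr mulr0; apply => x.
by move=> h; have -> : x = a by apply/eqP; rewrite eq_le andbC.
Qed.

Lemma im_cint_gt0 g a b (m : R) : a < b -> 0 < m -> ccont g a b ->
  (forall x, a <= x <= b -> m <= imC (g x)) -> 0 < imC (cint g a b).
Proof.
move=> ab m0 cg gm; rewrite /cint ?reC_pt ?imC_pt.
have : \int[mu]_(x in `[a, b]) m <= \int[mu]_(x in `[a, b]) imC (g x).
  apply: le_Rintegral => //.
  - apply: (@continuous_compact_integrable R (fun=> m)); first exact: segment_compact.
    by apply: continuous_subspaceT => x; exact: cvg_cst.
  - exact: (ccont_int im_lip).
apply: lt_le_trans; rewrite Rint_cst ?(ltW ab) //.
by rewrite mulr_gt0 // subr_gt0.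
Qed.

Lemma cmod_ptx x x' y : cmod (pt x y - pt x' y) = `|x - x'|.
Proof.
have -> : pt x y - pt x' y = toC (x - x') by
  apply: complexP; rewrite ?reCB ?imCB ?reC_pt ?imC_pt ?reC_toC ?imC_toC ?subrr.
exact: cmod_toC.
Qed.

Lemma cmod_pty x y y' : cmod (pt x y - pt x y') = `|y - y'|.
Proof.
by rewrite cmod_sqrt reCB imCB !reC_pt !imC_pt subrr expr0n /= add0r sqrtr_sqr.
Qed.

Definition rcont f a b c d := forall x y, a <= x <= b -> c <= y <= d ->
  {for pt x y, continuous f}.

Lemma ccont_h f a b y : (forall x, a <= x <= b -> {for pt x y, continuous f}) ->
  ccont (fun x => f (pt x y)) a b.
Proof.
move=> h x /h /continuous_eps cf e /cf[d d0 hd]; exists d => // x' xx'.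
by apply: hd; rewrite cmod_ptx.
Qed.

Lemma ccont_v f c d x : (forall y, c <= y <= d -> {for pt x y, continuous f}) ->
  ccont (fun y => f (pt x y)) c d.
Proof.
move=> h y /h /continuous_eps cf e /cf[r r0 hd]; exists r => // x' xx'.
by apply: hd; rewrite cmod_pty.
Qed.

(** The counterclockwise boundary integral, with opposite sides paired in one integrand: bottom
    minus top, and right minus left. *)
Definition rint f a b c d : C :=
  cint (fun x => f (pt x c) - f (pt x d)) a b
  + 'i * cint (fun y => f (pt b y) - f (pt a y)) c d.

Lemma rint_cc f a b c d : a <= b -> c <= d -> rcont f a b c d ->
  ccont (fun x => f (pt x c) - f (pt x d)) a b /\ ccont (fun y => f (pt b y) - f (pt a y)) c d.
Proof.
move=> ab cd cf; split; apply: ccontB.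
- by apply: ccont_h => x xab; apply: cf => //; rewrite lexx.
- by apply: ccont_h => x xab; apply: cf => //; rewrite cd lexx.
- by apply: ccont_v => y ycd; apply: cf => //; rewrite ab lexx.
- by apply: ccont_v => y ycd; apply: cf => //; rewrite ab lexx.
Qed.

Lemma rintB f1 f2 a b c d : a <= b -> c <= d -> rcont f1 a b c d -> rcont f2 a b c d ->
  rint (fun z => f1 z - f2 z) a b c d = rint f1 a b c d - rint f2 a b c d.
Proof.
move=> ab cd c1 c2; have [h1 v1] := rint_cc ab cd c1; have [h2 v2] := rint_cc ab cd c2.
rewrite /rint.
rewrite (_ : (fun x => f1 (pt x c) - _ - _) = (fun x => (f1 (pt x c) - f1 (pt x d)) - (f2 (pt x c) - f2 (pt x d)))); last first.
  by apply/funext => y; ring.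
rewrite (_ : (fun y => f1 (pt b y) - _ - _) = (fun y => (f1 (pt b y) - f1 (pt a y)) - (f2 (pt b y) - f2 (pt a y)))); last first.
  by apply/funext => y; ring.
by rewrite (cintB h1 h2) (cintB v1 v2); ring.
Qed.

Lemma rint_affine (k l : C) a b c d : a <= b -> c <= d ->
  rint (fun z => k + l * z) a b c d = 0.
Proof.
move=> ab cd; rewrite /rint.
have -> : (fun x => k + l * pt x c - (k + l * pt x d)) = (fun=> l * ('i * toC (c - d))).
  apply/funext => x; have -> : forall u v, k + l * u - (k + l * v) = l * (u - v) by move=> *; ring.
  by congr (_ * _); apply: complexP; rewrite ?(reCB,imCB,reCM,imCM) ?reCi ?imCi ?(reC_pt,imC_pt,reC_toC,imC_toC); ring.
have -> : (fun y => k + l * pt b y - (k + l * pt a y)) = (fun=> l * toC (b - a)).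
  apply/funext => y; have -> : forall u v, k + l * u - (k + l * v) = l * (u - v) by move=> *; ring.
  by congr (_ * _); apply: complexP; rewrite ?(reCB,imCB,reCM,imCM) ?reCi ?imCi ?(reC_pt,imC_pt,reC_toC,imC_toC); ring.
by rewrite !cint_cst // !toCB; ring.
Qed.

Lemma rint_splitx f a b c d e : a <= e <= b -> c <= d -> rcont f a b c d ->
  rint f a b c d = rint f a e c d + rint f e b c d.
Proof.
move=> aeb cd cf; have ab : a <= b by case/andP: aeb; exact: le_trans.
have [h1 v1] := rint_cc ab cd cf; case/andP: (aeb) => ae eb.
have cv x : a <= x <= b -> ccont (fun y => f (pt x y)) c d.
  by move=> xab; apply: ccont_v => y ycd; exact: cf.
have := cv a; have := cv b; have := cv e.
rewrite aeb ab !lexx => /(_ isT) ce /(_ isT) cb /(_ isT) ca.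
by rewrite /rint (cint_split aeb) // !(cintB _ _ : _ c d = _) //; ring.
Qed.

Lemma rint_splity f a b c d e : c <= e <= d -> a <= b -> rcont f a b c d ->
  rint f a b c d = rint f a b c e + rint f a b e d.
Proof.
move=> ced ab cf; have cd : c <= d by case/andP: ced; exact: le_trans.
have [h1 v1] := rint_cc ab cd cf; case/andP: (ced) => ce ed.
have ch y : c <= y <= d -> ccont (fun x => f (pt x y)) a b.
  by move=> ycd; apply: ccont_h => x xab; exact: cf.
have := ch c; have := ch d; have := ch e.
rewrite ced cd !lexx => /(_ isT) he /(_ isT) hd /(_ isT) hc.
by rewrite /rint (cint_split ced v1) !(cintB _ _ : _ a b = _) //; ring.
Qed.

Lemma rint_bound f a b c d (M : R) : a <= b -> c <= d -> rcont f a b c d ->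
  (forall x y, a <= x <= b -> c <= y <= d -> cmod (f (pt x y)) <= M) ->
  cmod (rint f a b c d) <= 4 * M * ((b - a) + (d - c)).
Proof.
move=> ab cd cf fM; have [h1 v1] := rint_cc ab cd cf.
apply: le_trans (cmodD _ _) _; rewrite cmodM cmodi mul1r.
have -> : 4 * M * ((b - a) + (d - c)) = 2 * (M + M) * (b - a) + 2 * (M + M) * (d - c) by ring.
apply: lerD; apply: cint_bound => // x xx; apply: le_trans (cmodB _ _) _;
  by apply: lerD; apply: fM; rewrite ?lexx ?ab ?cd.
Qed.

Lemma rint_degx f a c d : c <= d -> rcont f a a c d -> rint f a a c d = 0.
Proof.
move=> cd cf; have [h1 v1] := rint_cc (lexx a) cd cf.
rewrite /rint cint_same // add0r (_ : (fun y => _) = (fun=> 0)).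
  by rewrite cint_cst // mul0r mulr0.
by apply/funext => y; rewrite subrr.
Qed.

Lemma rint_degy f a b c : a <= b -> rcont f a b c c -> rint f a b c c = 0.
Proof.
move=> ab cf; have [h1 v1] := rint_cc ab (lexx c) cf.
rewrite /rint [X in _ * X]cint_same // mulr0 addr0 (_ : (fun y => _) = (fun=> 0)).
  by rewrite cint_cst // mul0r.
by apply/funext => y; rewrite subrr.
Qed.

End Integral.

Opaque cint rint.

(** * Goursat's theorem *)

Section Goursat.
Variable R : realType.
Local Notation C := (Cplx R).
Implicit Types (a b c d x y : R) (f : C -> C).

Lemma rcontW f a b c d a' b' c' d' : a <= a' -> b' <= b -> c <= c' -> d' <= d ->
  rcont f a b c d -> rcont f a' b' c' d'.
Proof.
move=> h1 h2 h3 h4 cf x y /andP[h5 h6] /andP[h7 h8]; apply: cf.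
  by rewrite (le_trans h1 h5) (le_trans h6 h2).
by rewrite (le_trans h3 h7) (le_trans h8 h4).
Qed.

Lemma cmodD4 (z1 z2 z3 z4 : C) : cmod (z1 + z2 + (z3 + z4)) <=
  cmod z1 + cmod z2 + (cmod z3 + cmod z4).
Proof. by apply: le_trans (cmodD _ _) _; apply: lerD; exact: cmodD. Qed.

Lemma quarter (t p1 p2 p3 p4 : R) : t <= p1 + p2 + (p3 + p4) ->
  [\/ t <= 4 * p1, t <= 4 * p2, t <= 4 * p3 | t <= 4 * p4].
Proof.
move=> h.
case: (leP t (4 * p1)) => h1; first by constructor.
case: (leP t (4 * p2)) => h2; first by constructor.
case: (leP t (4 * p3)) => h3; first by constructor.
by constructor; lra.
Qed.

Lemma rint_child f a b c d : a <= b -> c <= d -> rcont f a b c d ->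
  exists q : R * R * R * R, let '(a', b', c', d') := q in
  [/\ a <= a' /\ b' <= b, c <= c' /\ d' <= d,
      b' - a' = (b - a) / 2, d' - c' = (d - c) / 2 &
      cmod (rint f a b c d) <= 4 * cmod (rint f a' b' c' d')].
Proof.
move=> ab cd cf; pose m := (a + b) / 2; pose n := (c + d) / 2.
have am : a <= m by rewrite /m; lra.
have mb : m <= b by rewrite /m; lra.
have cn : c <= n by rewrite /n; lra.
have nd : n <= d by rewrite /n; lra.
have E : rint f a b c d = rint f a m c n + rint f a m n d + (rint f m b c n + rint f m b n d).
  rewrite (@rint_splitx _ f a b c d m) ?am //.
  by rewrite !(@rint_splity _ f _ _ c d n) ?cn //; apply: (rcontW _ _ _ _ cf).
have := cmodD4 (rint f a m c n) (rint f a m n d) (rint f m b c n) (rint f m b n d).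
rewrite -E => /quarter H.
have ma : m - a = (b - a) / 2 by rewrite /m; field.
have bm : b - m = (b - a) / 2 by rewrite /m; field.
have nc : n - c = (d - c) / 2 by rewrite /n; field.
have dn : d - n = (d - c) / 2 by rewrite /n; field.
case: H => H.
- by exists (a, m, c, n); split.
- by exists (a, m, n, d); split.
- by exists (m, b, c, n); split.
- by exists (m, b, n, d); split.
Qed.

Lemma affine_cont (k l : C) a b c d : rcont (fun z => k + l * z) a b c d.
Proof.
move=> x y _ _; apply: (@derivable_cont _ (fun z : C => k + l * z)).
apply: derD; [exact: der_cst|apply: derM; [exact: der_cst|exact: der_id]].
Qed.

(** Repeated quartering keeps 4^n times the integral over the n-th rectangle at least as large as
    the original one. At the common point [p] of the rectangles, [f] is affine up to a small
    multiple of the distance, and affine functions integrate to 0, so the n-th integral is an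
    arbitrarily small multiple of 4^-n. *)
Lemma goursat f a b c d : a <= b -> c <= d ->
  (forall x y, a <= x <= b -> c <= y <= d -> derivable f (pt x y) 1) ->
  rint f a b c d = 0.
Proof.
move=> ab cd fd.
have cf : rcont f a b c d by move=> x y xab ycd; apply: derivable_cont; exact: fd.
pose T := (R * R * R * R)%type.
pose valid (q : T) := let '(a', b', c', d') := q in
  [/\ a <= a', b' <= b, c <= c' & d' <= d] /\ a' <= b' /\ c' <= d'.
(* The relation is vacuous on invalid rectangles, because dependent choice asks for a total
   relation; validity along the sequence is recovered in [val]. *)
pose Rel (q q' : T) := valid q -> let '(a', b', c', d') := q in let '(a1, b1, c1, d1) := q' in
  valid q' /\ [/\ a' <= a1 /\ b1 <= b', c' <= c1 /\ d1 <= d',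
      b1 - a1 = (b' - a') / 2, d1 - c1 = (d' - c') / 2 &
      cmod (rint f a' b' c' d') <= 4 * cmod (rint f a1 b1 c1 d1)].
have [|q [q0 qS]] := @dependent_choice T Rel _ (a, b, c, d).
  move=> [[[a' b'] c'] d']; apply: cid; rewrite /Rel /valid.
  case: (pselect (valid (a', b', c', d'))) => [[[h1 h2 h3 h4] [h5 h6]]|nv]; last first.
    by exists (a', b', c', d') => h; exfalso; apply: nv.
  have [[[[a1 b1] c1] d1] [[e1 e2] [e3 e4] e5 e6 e7]] := rint_child h5 h6 (rcontW h1 h2 h3 h4 cf).
  exists (a1, b1, c1, d1) => _; split; last by split.
  by split; [split|split]; try lra.
have val n : valid (q n).
  elim: n => [|n IH]; first by rewrite q0; split.
  by move: (qS n IH); case: (q n) => [[[? ?] ?] ?]; case: (q n.+1) => [[[? ?] ?] ?] [].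
pose A n := (q n).1.1.1; pose B n := (q n).1.1.2; pose X n := (q n).1.2; pose Y n := (q n).2.
have H n : [/\ A n <= B n, X n <= Y n, a <= A n /\ B n <= b & c <= X n /\ Y n <= d].
  by move: (val n); rewrite /A /B /X /Y; case: (q n) => [[[? ?] ?] ?] /= [[] ? ? ? ? []].
have S n : [/\ A n <= A n.+1 /\ B n.+1 <= B n, X n <= X n.+1 /\ Y n.+1 <= Y n,
    B n.+1 - A n.+1 = (B n - A n) / 2, Y n.+1 - X n.+1 = (Y n - X n) / 2 &
    cmod (rint f (A n) (B n) (X n) (Y n)) <= 4 * cmod (rint f (A n.+1) (B n.+1) (X n.+1) (Y n.+1))].
  move: (qS n (val n)); rewrite /A /B /X /Y; case: (q n) => [[[? ?] ?] ?].
  by case: (q n.+1) => [[[? ?] ?] ?] /= [].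
have limpt (U V : nat -> R) : (forall n, U n <= V n) -> (forall n, U n <= U n.+1) ->
    (forall n, V n.+1 <= V n) -> exists p, forall n, U n <= p <= V n.
  move=> UV Um Vm.
  have Uh : {homo U : n m / (n <= m)%N >-> n <= m} by apply/nondecreasing_seqP.
  have Vh : {homo V : n m / (n <= m)%N >-> m <= n} by apply/nonincreasing_seqP.
  have UVnm n m : U n <= V m.
    have [nm|mn] := leqP n m; first exact: le_trans (Uh _ _ nm) (UV m).
    exact: le_trans (UV n) (Vh _ _ (ltnW mn)).
  have hs : has_sup (range U) by split; [exists (U 0%N), 0%N|exists (V 0%N) => _ [n _ <-]].
  exists (sup (range U)) => n; apply/andP; split.
    by apply: sup_upper_bound => //; exists n.
  by apply: ge_sup; [exists (U 0%N), 0%N|move=> _ [m _ <-]].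
have [x hx] : exists p, forall n, A n <= p <= B n.
  by apply: limpt => n; [case: (H n)|case: (S n) => -[]|case: (S n) => -[]].
have [y hy] : exists p, forall n, X n <= p <= Y n.
  by apply: limpt => n; [case: (H n)|case: (S n) => _ []|case: (S n) => _ []].
have xab : a <= x <= b by have := hx 0%N; rewrite /A /B q0.
have ycd : c <= y <= d by have := hy 0%N; rewrite /X /Y q0.
pose s := (b - a) + (d - c); have s0 : 0 <= s by rewrite /s; lra.
have size n : (B n - A n) + (Y n - X n) = s / 2 ^+ n.
  elim: n => [|n IH]; first by rewrite /A /B /X /Y q0 expr0 divr1.
  have [_ _ -> -> _] := S n; rewrite -mulrDl IH exprS invfM; ring.
have big n : cmod (rint f a b c d) <= 4 ^+ n * cmod (rint f (A n) (B n) (X n) (Y n)).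
  elim: n => [|n IH]; first by rewrite /A /B /X /Y q0 expr0 mul1r.
  apply: le_trans IH _; rewrite exprSr -mulrA ler_pM2l ?exprn_gt0 //.
  by case: (S n).
set p := pt x y; have fdp := fd _ _ xab ycd; set l := derive1 f p.
apply/eqP; rewrite -cmod_eq0 eq_le cmod_ge0 andbT; apply/ler_addgt0Pl => e e0; rewrite addr0.
(* The final estimate is 4 s^2 [e1]; the summand 1 covers the degenerate case s = 0. *)
pose e1 := e / (4 * s ^+ 2 + 1).
have s2 : 0 <= s ^+ 2 by rewrite sqr_ge0.
have e10 : 0 < e1 by rewrite divr_gt0 //; lra.
have /continuous_eps/(_ _ e10)[r r0 hr] := dd_continuous fdp.
have [n sn] : exists n : nat, s / 2 ^+ n < r.
  exists (Num.bound (s / r)); rewrite ltr_pdivrMr ?exprn_gt0 // mulrC -ltr_pdivrMr //.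
  apply: lt_le_trans (archi_boundP (divr_ge0 s0 (ltW r0))) _.
  by rewrite -natrX ler_nat ltnW // ltn_expl.
have [AB XY [aA Bb] [cX Yd]] := H n.
have cfn : rcont f (A n) (B n) (X n) (Y n) by exact: (rcontW _ _ _ _ cf).
pose k := f p - l * p.
have E1 : rint f (A n) (B n) (X n) (Y n) =
    rint (fun z => f z - (k + l * z)) (A n) (B n) (X n) (Y n).
  by rewrite (rintB AB XY cfn (@affine_cont k l _ _ _ _)) (rint_affine _ _ AB XY) subr0.
have fb u v : A n <= u <= B n -> X n <= v <= Y n ->
    cmod (f (pt u v) - (k + l * pt u v)) <= e1 * (s / 2 ^+ n).
  move=> huv1 huv2.
  have d1 : cmod (pt u v - p) <= s / 2 ^+ n.
    apply: le_trans (cmod_le_reim _) _; rewrite -size; apply: lerD.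
      rewrite reCB !reC_pt; have := hx n; move: huv1; rewrite ler_norml; lra.
    rewrite imCB !imC_pt; have := hy n; move: huv2; rewrite ler_norml; lra.
  have -> : f (pt u v) - (k + l * pt u v) = (dd f p (pt u v) - dd f p p) * (pt u v - p).
    by rewrite {1}(ddE f p (pt u v)) /k [dd f p p]/dd eqxx -/l; ring.
  rewrite cmodM; have d2 := ltW (hr _ (le_lt_trans d1 sn)).
  exact: (ler_pM (cmod_ge0 _) (cmod_ge0 _) d2 d1).
have cfb : rcont (fun z => f z - (k + l * z)) (A n) (B n) (X n) (Y n).
  move=> u v hu hv; apply: (@derivable_cont _ (fun z => f z - (k + l * z))).
  apply: derB.
    by case/andP: hu => ? ?; case/andP: hv => ? ?; apply: fd; apply/andP; split; lra.
  apply: derD; [exact: der_cst|apply: derM; [exact: der_cst|exact: der_id]].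
have := rint_bound AB XY cfb fb; rewrite -E1 size => hI.
apply: le_trans (big n) _.
apply: (@le_trans _ _ (4 ^+ n * (4 * (e1 * (s / 2 ^+ n)) * (s / 2 ^+ n)))).
  by rewrite ler_pM2l ?exprn_gt0.
have -> : 4 ^+ n * (4 * (e1 * (s / 2 ^+ n)) * (s / 2 ^+ n)) = 4 * s ^+ 2 * e1.
  have -> : (4 : R) = 2 * 2 by ring.
  rewrite exprMn; have : (2 ^+ n : R) != 0 by rewrite expf_neq0.
  move: (2 ^+ n) => t t0; field; exact: t0.
rewrite /e1 mulrA ler_pdivrMr; last lra.
by rewrite mulrC ler_wpM2l ?ltW //; lra.
Qed.

(* A point where [f] is merely continuous is enclosed in a small square. *)
Lemma goursat_except f a b c d (p : C) : a <= b -> c <= d ->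
  rcont f a b c d ->
  (forall x y, a <= x <= b -> c <= y <= d -> pt x y != p -> derivable f (pt x y) 1) ->
  rint f a b c d = 0.
Proof.
move=> ab cd cf fd.
have [pin|pout] := pselect ((a <= reC p <= b) /\ (c <= imC p <= d)); last first.
  apply: (goursat ab cd) => x y xab ycd; apply: (fd _ _ xab ycd); apply/eqP => E.
  by apply: pout; rewrite -E.
case: pin => pab pcd; set u := reC p in pab; set v := imC p in pcd.
have cfp : {for p, continuous f} by rewrite -(pt_reim p); exact: cf.
have /continuous_eps/(_ _ ltr01)[r r0 hr] := cfp.
pose M := cmod (f p) + 1; have M0 : 0 < M by rewrite /M; have := cmod_ge0 (f p); lra.
apply/eqP; rewrite -cmod_eq0 eq_le cmod_ge0 andbT; apply/ler_addgt0Pl => e e0; rewrite addr0.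
(* The square of half-side [t], cut off by the rectangle, has side lengths summing to at most 4t,
   which gives the bound 4M * 4t <= e. The bound r/3 keeps the square where [f] is within 1 of
   f(p). *)
pose t := Num.min (r / 3) (e / (16 * M)).
have t0 : 0 < t by rewrite lt_min !divr_gt0 // mulr_gt0.
have tr : t < r / 2 by rewrite gt_min; apply/orP; left; lra.
have te : t * (16 * M) <= e by rewrite -ler_pdivlMr ?mulr_gt0 // ge_min lexx orbT.
pose x1 := Num.max a (u - t); pose x2 := Num.min b (u + t).
pose y1 := Num.max c (v - t); pose y2 := Num.min d (v + t).
have ax1 : a <= x1 by rewrite le_max lexx.
have cy1 : c <= y1 by rewrite le_max lexx.
have x2b : x2 <= b by rewrite ge_min lexx.
have y2d : y2 <= d by rewrite ge_min lexx.
have x1u : x1 <= u by rewrite ge_max; lra.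
have ux2 : u <= x2 by rewrite le_min; lra.
have y1v : y1 <= v by rewrite ge_max; lra.
have vy2 : v <= y2 by rewrite le_min; lra.
have x1t : u - t <= x1 by rewrite le_max lexx orbT.
have x2t : x2 <= u + t by rewrite ge_min lexx orbT.
have y1t : v - t <= y1 by rewrite le_max lexx orbT.
have y2t : y2 <= v + t by rewrite ge_min lexx orbT.
(* A subrectangle that is degenerate or misses [p] integrates to 0. The four strips around the small
   square are of this kind; they are degenerate where the square is cut off by the boundary. *)
have Z a' b' c' d' : a <= a' -> a' <= b' -> b' <= b -> c <= c' -> c' <= d' -> d' <= d ->
    [\/ a' = b', b' < u, u < a' | [\/ c' = d', d' < v | v < c']] -> rint f a' b' c' d' = 0.
  move=> h1 h2 h3 h4 h5 h6 h7; have cf' := rcontW h1 h3 h4 h6 cf.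
  have G : (forall x y, a' <= x <= b' -> c' <= y <= d' -> pt x y != p) -> rint f a' b' c' d' = 0.
    move=> h; apply: (goursat h2 h5) => x y hx hy.
    have hx' : a <= x <= b by case/andP: hx => ? ?; apply/andP; split; lra.
    have hy' : c <= y <= d by case/andP: hy => ? ?; apply/andP; split; lra.
    exact: (fd _ _ hx' hy' (h _ _ hx hy)).
  case: h7 => [E|h|h|[E|h|h]].
  - by rewrite -E in cf' *; apply: rint_degx.
  - by apply: G => x y hx hy; apply/eqP => E; move: hx h; rewrite /u -E reC_pt; lra.
  - by apply: G => x y hx hy; apply/eqP => E; move: hx h; rewrite /u -E reC_pt; lra.
  - by rewrite -E in cf' *; apply: rint_degy.
  - by apply: G => x y hx hy; apply/eqP => E; move: hy h; rewrite /v -E imC_pt; lra.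
  - by apply: G => x y hx hy; apply/eqP => E; move: hy h; rewrite /v -E imC_pt; lra.
have D1 : a = x1 \/ x1 < u.
  by rewrite /x1; case: (leP a (u - t)) => h; [right; lra|left].
have D2 : x2 = b \/ u < x2.
  by rewrite /x2; case: (leP b (u + t)) => h; [left|right; lra].
have D3 : c = y1 \/ y1 < v.
  by rewrite /y1; case: (leP c (v - t)) => h; [right; lra|left].
have D4 : y2 = d \/ v < y2.
  by rewrite /y2; case: (leP d (v + t)) => h; [left|right; lra].
clearbody x1 x2 y1 y2.
have x12 := le_trans x1u ux2; have y12 := le_trans y1v vy2.
have x1b := le_trans x12 x2b; have y1d := le_trans y12 y2d.
have axb : a <= x1 <= b by rewrite ax1 x1b.
have x12b : x1 <= x2 <= b by rewrite x12 x2b.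
have cyd : c <= y1 <= d by rewrite cy1 y1d.
have y12d : y1 <= y2 <= d by rewrite y12 y2d.
have ax2 := le_trans ax1 x12; have cy2 := le_trans cy1 y12.
have cf1 := rcontW ax1 (lexx b) (lexx c) (lexx d) cf.
have cf2 := rcontW ax1 x2b (lexx c) (lexx d) cf.
have cf3 := rcontW ax1 x2b cy1 (lexx d) cf.
have cf4 := rcontW ax1 x2b cy1 y2d cf.
have Z1 : rint f a x1 c d = 0.
  apply: (Z _ _ _ _ (lexx a) ax1 x1b (lexx c) cd (lexx d)).
  by case: D1 => ?; [constructor 1|constructor 2].
have Z2 : rint f x2 b c d = 0.
  apply: (Z _ _ _ _ ax2 x2b (lexx b) (lexx c) cd (lexx d)).
  by case: D2 => ?; [constructor 1|constructor 3].
have Z3 : rint f x1 x2 c y1 = 0.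
  apply: (Z _ _ _ _ ax1 x12 x2b (lexx c) cy1 y1d).
  by constructor 4; case: D3 => ?; [constructor 1|constructor 2].
have Z4 : rint f x1 x2 y2 d = 0.
  apply: (Z _ _ _ _ ax1 x12 x2b cy2 y2d (lexx d)).
  by constructor 4; case: D4 => ?; [constructor 1|constructor 3].
rewrite (rint_splitx axb cd cf) Z1 add0r (rint_splitx x12b cd cf1) Z2 addr0.
rewrite (rint_splity cyd x12 cf2) Z3 add0r (rint_splity y12d x12 cf3) Z4 addr0.
have B : cmod (rint f x1 x2 y1 y2) <= 4 * M * ((x2 - x1) + (y2 - y1)).
  apply: (rint_bound x12 y12 cf4) => x y hx hy.
  have : cmod (f (pt x y) - f p) < 1.
    apply: hr; apply: le_lt_trans (cmod_le_reim _) _; rewrite reCB imCB reC_pt imC_pt -/u -/v.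
    have h1 : `|x - u| <= t by rewrite ler_norml; have := hx; lra.
    have h2 : `|y - v| <= t by rewrite ler_norml; have := hy; lra.
    lra.
  by have := lerB_cmod (f (pt x y)) (f p); rewrite /M; lra.
apply: le_trans B _; apply: le_trans te.
have : (x2 - x1) + (y2 - y1) <= 4 * t by lra.
have -> : t * (16 * M) = 4 * M * (4 * t) by ring.
by move=> h; rewrite ler_pM2l // mulr_gt0.
Qed.

End Goursat.

Opaque cint rint.

(** * Cauchy's formula and the maximum principle *)

Section Cauchy.
Variable R : realType.
Local Notation C := (Cplx R).
Implicit Types (a b c d x y : R) (f : C -> C) (z w p : C).

Definition bcont f a b c d :=
  [/\ forall x, a <= x <= b -> {for pt x c, continuous f},
      forall x, a <= x <= b -> {for pt x d, continuous f},
      forall y, c <= y <= d -> {for pt a y, continuous f} &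
      forall y, c <= y <= d -> {for pt b y, continuous f}].

Definition bdry a b c d : set C := [set z | a <= reC z <= b /\ c <= imC z <= d /\
  (reC z = a \/ reC z = b \/ imC z = c \/ imC z = d)].

Lemma bcontP f a b c d : a <= b -> c <= d ->
  (forall z, bdry a b c d z -> {for z, continuous f}) -> bcont f a b c d.
Proof.
move=> ab cd h; split=> t ht; apply: h; rewrite /bdry /= !(reC_pt, imC_pt) ?lexx ?ab ?cd ?ht; do 2 split => //.
- by right; right; left.
- by right; right; right.
- by left.
- by right; left.
Qed.

Lemma bcont_cc f a b c d : bcont f a b c d ->
  ccont (fun x => f (pt x c) - f (pt x d)) a b /\ ccont (fun y => f (pt b y) - f (pt a y)) c d.
Proof.
by case=> h1 h2 h3 h4; split; apply: ccontB; [exact: ccont_h|exact: ccont_h|exact: ccont_v|exact: ccont_v].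
Qed.

Lemma eq_brint f (g : C -> C) a b c d : a <= b -> c <= d ->
  (forall z, bdry a b c d z -> f z = g z) -> rint f a b c d = rint g a b c d.
Proof.
Transparent rint.
move=> ab cd h; rewrite /rint; congr (_ + _ * _); apply: eq_cint => t ht;
congr (_ - _); apply: h; rewrite /bdry /= !(reC_pt, imC_pt) ?lexx ?ab ?cd ?ht; do 2 split => //.
- by right; right; left.
- by right; right; right.
- by right; left.
- by left.
Opaque rint.
Qed.

Lemma brintB f (g : C -> C) a b c d : bcont f a b c d -> bcont g a b c d ->
  rint (fun z => f z - g z) a b c d = rint f a b c d - rint g a b c d.
Proof.
Transparent rint.
move=> /bcont_cc[h1 v1] /bcont_cc[h2 v2].
rewrite /rint.
rewrite (_ : (fun x => f (pt x c) - _ - _) = (fun x => (f (pt x c) - f (pt x d)) - (g (pt x c) - g (pt x d)))); last first.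
  by apply/funext => y; ring.
rewrite (_ : (fun y => f (pt b y) - _ - _) = (fun y => (f (pt b y) - f (pt a y)) - (g (pt b y) - g (pt a y)))); last first.
  by apply/funext => y; ring.
by rewrite (cintB h1 h2) (cintB v1 v2); ring.
Opaque rint.
Qed.

Lemma brintZ k f a b c d : bcont f a b c d ->
  rint (fun z => k * f z) a b c d = k * rint f a b c d.
Proof.
Transparent rint.
move=> /bcont_cc[h1 v1]; rewrite /rint.
rewrite (_ : (fun x => k * f (pt x c) - _) = (fun x => k * (f (pt x c) - f (pt x d)))); last first.
  by apply/funext => y; ring.
rewrite (_ : (fun y => k * f (pt b y) - _) = (fun y => k * (f (pt b y) - f (pt a y)))); last first.
  by apply/funext => y; ring.
by rewrite (cintZ k h1) (cintZ k v1); ring.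
Opaque rint.
Qed.

Lemma brint_bound f a b c d (M : R) : a <= b -> c <= d -> bcont f a b c d ->
  (forall z, bdry a b c d z -> cmod (f z) <= M) ->
  cmod (rint f a b c d) <= 4 * M * ((b - a) + (d - c)).
Proof.
Transparent rint.
move=> ab cd /bcont_cc[h1 v1] fM; rewrite /rint.
apply: le_trans (cmodD _ _) _; rewrite cmodM cmodi mul1r.
have -> : 4 * M * ((b - a) + (d - c)) = 2 * (M + M) * (b - a) + 2 * (M + M) * (d - c) by ring.
have H u v s t : bdry a b c d (pt u v) -> bdry a b c d (pt s t) ->
    cmod (f (pt u v) - f (pt s t)) <= M + M.
  by move=> /fM h1' /fM h2'; exact: le_trans (cmodB _ _) (lerD h1' h2').
apply: lerD; apply: cint_bound => // t ht; apply: H;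
rewrite /bdry /= !(reC_pt, imC_pt) ?lexx ?ab ?cd ?ht; do 2 split => //.
- by right; right; left.
- by right; right; right.
- by right; left.
- by left.
Opaque rint.
Qed.

Definition insq a b c d z := (a < reC z < b) && (c < imC z < d).

Lemma insq_bdry a b c d z w : insq a b c d z -> bdry a b c d w -> w - z != 0.
Proof.
case/andP => /andP[h1 h2] /andP[h3 h4] [_ [_ h]]; apply/eqP => /eqP; rewrite subr_eq0 => /eqP E.
by rewrite E in h; case: h => [|[|[|]]] h; move: h1 h2 h3 h4; rewrite h ltxx.
Qed.

(* The value of this integral is 2 pi i, but only [kap_neq0] is needed. *)
Definition kap a b c d z : C := rint (fun w => (w - z)^-1) a b c d.

Lemma im_inv (u v : R) : imC ((pt u v)^-1 : C) = - v / (u ^+ 2 + v ^+ 2).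
Proof. by rewrite imCV reC_pt imC_pt. Qed.

Lemma der_inv1 z w : w - z != 0 -> derivable (fun t : C => (t - z)^-1) w 1.
Proof.
move=> h; apply: (@derV _ (fun t : C => t - z) _ h).
by apply: derB; [exact: der_id|exact: der_cst].
Qed.

(** Both terms of [rint] have positive imaginary part: Im 1/(w - z) is positive on the bottom edge
    and negative on the top edge, and Re 1/(w - z) is positive on the right edge and negative on the
    left one. The squared diagonal [L] bounds |w - z|^2 and makes the positivity uniform. *)
Lemma kap_neq0 a b c d z : insq a b c d z -> kap a b c d z != 0.
Proof.
Transparent rint.
move=> zin; have /andP[/andP[ax xb] /andP[cy yd]] := zin.
have ab : a < b by exact: lt_trans ax xb.
have cd : c < d by exact: lt_trans cy yd.
set u := reC z in ax xb; set v := imC z in cy yd.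
have bc : bcont (fun w => (w - z)^-1) a b c d.
  apply: bcontP; [exact: ltW|exact: ltW|move=> w hw].
  by apply: derivable_cont; apply: der_inv1; exact: insq_bdry hw.
have [ch cv] := bcont_cc bc.
have sq s t : (0 : R) <= s ^+ 2 + t ^+ 2 by rewrite addr_ge0 // sqr_ge0.
pose L := (b - a) ^+ 2 + (d - c) ^+ 2.
have L0 : 0 < L by rewrite ltr_pwDl ?sqr_ge0 // exprn_gt0 // subr_gt0.
have low (s t r : R) : 0 < r -> r <= t -> `|s| <= b - a -> t <= d - c ->
    r / L <= t / (s ^+ 2 + t ^+ 2).
  move=> r0 rt sb td; have t0 : 0 < t := lt_le_trans r0 rt.
  have S0 : 0 < s ^+ 2 + t ^+ 2 by rewrite ltr_wpDl ?sqr_ge0 // exprn_gt0.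
  apply: ler_pM => //; [exact: ltW|by rewrite invr_ge0 ltW|].
  rewrite lef_pV2 ?posrE //; apply: lerD.
    by rewrite -(real_normK (num_real s)) lerXn2r // ?nnegrE ?normr_ge0 // subr_ge0 ltW.
  by rewrite lerXn2r // ?nnegrE ?ltW // subr_gt0.
have low' (s t r : R) : 0 < r -> r <= t -> `|s| <= d - c -> t <= b - a ->
    r / L <= t / (s ^+ 2 + t ^+ 2).
  move=> r0 rt sb td; have t0 : 0 < t := lt_le_trans r0 rt.
  have S0 : 0 < s ^+ 2 + t ^+ 2 by rewrite ltr_wpDl ?sqr_ge0 // exprn_gt0.
  apply: ler_pM => //; [exact: ltW|by rewrite invr_ge0 ltW|].
  rewrite lef_pV2 ?posrE //; have -> : s ^+ 2 + t ^+ 2 = t ^+ 2 + s ^+ 2 by rewrite addrC.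
  apply: lerD.
    by rewrite lerXn2r // ?nnegrE ?ltW // subr_gt0.
  by rewrite -(real_normK (num_real s)) lerXn2r // ?nnegrE ?normr_ge0 // subr_ge0 ltW.
have i1 : 0 < imC (cint (fun x => (pt x c - z)^-1 - (pt x d - z)^-1) a b).
  apply: (@im_cint_gt0 _ _ _ _ ((v - c) / L)) => //; first by rewrite divr_gt0 // subr_gt0.
  move=> x /andP[h1 h2].
  have E y : pt x y - z = pt (x - u) (y - v) by apply: complexP; rewrite ?reCB ?imCB !(reC_pt,imC_pt).
  rewrite !E imCB !im_inv !opprB.
  have A : (v - c) / L <= (v - c) / ((x - u) ^+ 2 + (c - v) ^+ 2).
    rewrite -(sqrrN (c - v)) opprB; apply: low; rewrite ?subr_gt0 ?lexx //; last lra.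
    by rewrite ler_norml; lra.
  have B : (v - d) / ((x - u) ^+ 2 + (d - v) ^+ 2) <= 0.
    by apply: mulr_le0_ge0; [rewrite subr_le0 ltW|rewrite invr_ge0].
  by apply: le_trans A _; rewrite lerDl oppr_ge0.
have i2 : 0 < imC ('i * cint (fun y => (pt b y - z)^-1 - (pt a y - z)^-1) c d).
  rewrite -cintZ //; apply: (@im_cint_gt0 _ _ _ _ ((b - u) / L)) => //.
  - by rewrite divr_gt0 // subr_gt0.
  - exact: ccontZ.
  move=> y /andP[h1 h2].
  have E x : pt x y - z = pt (x - u) (y - v) by apply: complexP; rewrite ?reCB ?imCB !(reC_pt,imC_pt).
  have I (k : C) : imC ('i * k) = reC k by rewrite imCM reCi imCi; ring.
  have rI (s t : R) : reC ((pt s t)^-1 : C) = s / (s ^+ 2 + t ^+ 2) by rewrite reCV reC_pt imC_pt.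
  rewrite !E I reCB !rI.
  have A : (b - u) / L <= (b - u) / ((b - u) ^+ 2 + (y - v) ^+ 2).
    have -> : (b - u) ^+ 2 + (y - v) ^+ 2 = (y - v) ^+ 2 + (b - u) ^+ 2 by rewrite addrC.
    apply: low'; rewrite ?subr_gt0 ?lexx //; last lra.
    by rewrite ler_norml; lra.
  have B : (a - u) / ((a - u) ^+ 2 + (y - v) ^+ 2) <= 0.
    by apply: mulr_le0_ge0; [rewrite subr_le0 ltW|rewrite invr_ge0].
  by apply: le_trans A _; rewrite lerDl oppr_ge0.
rewrite /kap /rint; apply/eqP => /(congr1 (@imC R)).
by rewrite imCD imC0 => E; have := addr_gt0 i1 i2; rewrite E ltxx.
Opaque rint.
Qed.

Definition cauchyT f a b c d z : C := rint (fun w => f w / (w - z)) a b c d.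

(** The difference quotient [dd f z] is differentiable off [z] and continuous at [z], so
    [goursat_except] makes its integral vanish; on the boundary it splits into the two sides of the
    formula. *)
Lemma cauchy_formula f a b c d z : insq a b c d z ->
  (forall x y, a <= x <= b -> c <= y <= d -> derivable f (pt x y) 1) ->
  f z * kap a b c d z = cauchyT f a b c d z.
Proof.
move=> zin fd; have /andP[/andP[ax xb] /andP[cy yd]] := zin.
have ab : a < b by exact: lt_trans ax xb.
have cd : c < d by exact: lt_trans cy yd.
have fz : derivable f z 1 by rewrite -(pt_reim z); apply: fd; rewrite !ltW.
have ddder w : w - z != 0 -> derivable f w 1 -> derivable (dd f z) w 1.
  move=> wz fw.
  have H : derivable (fun t => (f t - f z) / (t - z)) w 1.
    apply: derDiv; first exact: wz.
      by apply: derB; [exact: fw|exact: der_cst].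
    by apply: derB; [exact: der_id|exact: der_cst].
  apply: (derivable_near_eq _ H).1; apply/nearCP; exists (cmod (w - z)); first by rewrite cmod_gt0.
  move=> t tw; rewrite /dd; case: eqVneq => [tz|//]; move: tw.
  by rewrite tz cmodBC ltxx.
have G : rint (dd f z) a b c d = 0.
  apply: (@goursat_except _ _ _ _ _ _ z) => [| | x y hx hy|x y hx hy hne]; try exact: ltW.
    have [E|ne] := eqVneq (pt x y) z; first by rewrite E; exact: dd_continuous.
    by apply: derivable_cont; apply: ddder; [rewrite subr_eq0|exact: fd].
  by apply: ddder; [rewrite subr_eq0|exact: fd].
have bd w : bdry a b c d w -> derivable f w 1.
  by case=> h1 [h2 _]; rewrite -(pt_reim w); apply: fd.
have B1 : bcont (fun w => f w / (w - z)) a b c d.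
  apply: bcontP; [exact: ltW|exact: ltW|move=> w hw]; apply: derivable_cont.
  apply: derDiv; [exact: insq_bdry hw|exact: bd|].
  by apply: derB; [exact: der_id|exact: der_cst].
have B2 : bcont (fun w => (w - z)^-1) a b c d.
  apply: bcontP; [exact: ltW|exact: ltW|move=> w hw]; apply: derivable_cont.
  by apply: der_inv1; exact: insq_bdry hw.
have B3 : bcont (fun w => f z * (w - z)^-1) a b c d.
  apply: bcontP; [exact: ltW|exact: ltW|move=> w hw]; apply: derivable_cont.
  by apply: derM; [exact: der_cst|apply: der_inv1; exact: insq_bdry hw].
apply/esym/eqP; rewrite -subr_eq0 /kap -(brintZ _ B2) /cauchyT -(brintB B1 B3) -G.
apply/eqP/eq_brint; [exact: ltW|exact: ltW|move=> w hw].
have := insq_bdry zin hw; rewrite /dd subr_eq0 => /negPf ->.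
by rewrite mulrBl.
Qed.

Lemma cauchyT_cont f a b c d z : insq a b c d z ->
  (forall w, bdry a b c d w -> {for w, continuous f}) ->
  bcont (fun w => f w / (w - z)) a b c d.
Proof.
move=> zin fc; have /andP[/andP[ax xb] /andP[cy yd]] := zin.
have ab : a <= b by exact/ltW/(lt_trans ax xb).
have cd : c <= d by exact/ltW/(lt_trans cy yd).
apply: (bcontP ab cd) => w hw; have /derivable_cont h := der_inv1 (insq_bdry zin hw).
exact: (continuousM (fc _ hw) h).
Qed.

Lemma bdry_dist a b c d z : insq a b c d z -> exists2 r : R, 0 < r &
  (forall w, bdry a b c d w -> r <= cmod (w - z)) /\ (forall z', cmod (z' - z) < r -> insq a b c d z').
Proof.
case/andP => /andP[ax xb] /andP[cy yd].
pose r := Num.min (Num.min (reC z - a) (b - reC z)) (Num.min (imC z - c) (d - imC z)).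
exists r; first by rewrite !lt_min !subr_gt0 ax xb cy yd.
have [[r1 r2] [r3 r4]] : (r <= reC z - a /\ r <= b - reC z) /\ (r <= imC z - c /\ r <= d - imC z).
  by rewrite /r !ge_min !lexx !orbT.
split=> [w [_ [_ h]]|z' h].
  have := re_le_cmod (w - z); have := im_le_cmod (w - z); rewrite reCB imCB.
  move: (cmod (w - z)) => m; rewrite !ler_norml => /andP[h1 h2] /andP[h3 h4].
  by case: h => [|[|[|]]] E; lra.
have := re_le_cmod (z' - z); have := im_le_cmod (z' - z); rewrite reCB imCB.
move: (cmod (z' - z)) h => m hm; rewrite !ler_norml => /andP[h1 h2] /andP[h3 h4].
by rewrite /insq; apply/andP; split; apply/andP; split; lra.
Qed.

Lemma bdry_bounded f a b c d : a <= b -> c <= d ->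
  (forall w, bdry a b c d w -> {for w, continuous f}) ->
  exists2 M : R, 0 <= M & forall w, bdry a b c d w -> cmod (f w) <= M.
Proof.
move=> ab cd fc.
have seg (u v : R) (g : R -> C) : u <= v -> ccont g u v -> exists M : R, forall x, u <= x <= v -> cmod (g x) <= M.
  move=> uv cg.
  suff /(@EVT_max R (fun x => cmod (g x)) u v uv)[x xin hx] :
      {within `[u, v], continuous (fun x => cmod (g x))}.
    by exists (cmod (g x)) => t ht; apply: hx; rewrite in_itv.
  apply: continuous_in_subspaceT => t; rewrite inE /= in_itv /= => tuv.
  apply/cvgRP => e /(cg t tuv)[r r0 hr]; apply/nbhs_normP; exists r => //= s; rewrite /= distrC => /hr.
  apply: le_lt_trans; rewrite ler_norml; apply/andP; split.
    by rewrite lerNl opprB cmodBC lerB_cmod.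
  exact: lerB_cmod.
have [h1 h2 h3 h4] := bcontP ab cd fc.
have [M1 m1] := seg _ _ _ ab (ccont_h h1); have [M2 m2] := seg _ _ _ ab (ccont_h h2).
have [M3 m3] := seg _ _ _ cd (ccont_v h3); have [M4 m4] := seg _ _ _ cd (ccont_v h4).
pose M := Num.max 0 (Num.max (Num.max M1 M2) (Num.max M3 M4)).
exists M; first by rewrite le_max lexx.
move=> w [hx [hy h]]; rewrite -(pt_reim w) !le_max; case: h => [E|[E|[E|E]]]; rewrite E.
- by rewrite (m3 _ hy) !orbT.
- by rewrite (m4 _ hy) !orbT.
- by rewrite (m1 _ hx) !orbT.
- by rewrite (m2 _ hx) !orbT.
Qed.

(** The partial fractions of 1/(t - z) - 1/(t - w). The remainder is again a Cauchy transform, so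
    continuity and the derivative of [cauchyT] both follow from this one identity. *)
Lemma cauchyT_diff f a b c d z w : insq a b c d z -> insq a b c d w ->
  (forall w, bdry a b c d w -> {for w, continuous f}) ->
  cauchyT f a b c d z = cauchyT f a b c d w +
    cauchyT (fun t => f t / (t - w)) a b c d z * (z - w).
Proof.
move=> zin win fc; have /andP[/andP[ax xb] /andP[cy yd]] := zin.
have ab : a <= b by exact/ltW/(lt_trans ax xb).
have cd : c <= d by exact/ltW/(lt_trans cy yd).
have gc t : bdry a b c d t -> {for t, continuous (fun t => f t / (t - w))}.
  move=> ht; have /derivable_cont h := der_inv1 (insq_bdry win ht).
  exact: (continuousM (fc _ ht) h).
apply/eqP; rewrite -subr_eq0 opprD addrA subr_eq0 mulrC; apply/eqP.
rewrite /cauchyT -(brintB (cauchyT_cont zin fc) (cauchyT_cont win fc)).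
rewrite -(brintZ _ (cauchyT_cont zin gc)); apply: eq_brint => // t ht.
have := insq_bdry zin ht; have := insq_bdry win ht => h1 h2.
by field; rewrite h1 h2.
Qed.

Lemma cauchyT_continuous f a b c d z : insq a b c d z ->
  (forall w, bdry a b c d w -> {for w, continuous f}) ->
  {for z, continuous (cauchyT f a b c d)}.
Proof.
move=> zin fc; have /andP[/andP[ax xb] /andP[cy yd]] := zin.
have ab : a <= b by exact/ltW/(lt_trans ax xb).
have cd : c <= d by exact/ltW/(lt_trans cy yd).
have gc t : bdry a b c d t -> {for t, continuous (fun t => f t / (t - z))}.
  move=> ht; have /derivable_cont h := der_inv1 (insq_bdry zin ht).
  exact: (continuousM (fc _ ht) h).
have [r r0 [hr1 hr2]] := bdry_dist zin.
have [M M0 hM] := bdry_bounded ab cd gc.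
pose K := 4 * (M * (2 / r)) * ((b - a) + (d - c)) + 1.
have K0 : 0 < K.
  have : 0 <= 4 * (M * (2 / r)) * ((b - a) + (d - c)).
    by rewrite !mulr_ge0 ?invr_ge0 ?(ltW r0) // addr_ge0 // subr_ge0.
  by rewrite /K; lra.
apply/continuous_eps => e e0; exists (Num.min (r / 2) (e / K)).
  by rewrite lt_min !divr_gt0.
move=> w; rewrite lt_min => /andP[wr we].
have win : insq a b c d w by apply: hr2; lra.
rewrite (cauchyT_diff win zin fc) addrC addKr cmodM.
have B : cmod (cauchyT (fun t => f t / (t - z)) a b c d w) <= 4 * (M * (2 / r)) * ((b - a) + (d - c)).
  apply: (brint_bound ab cd (cauchyT_cont win gc)) => t ht.
  rewrite cmodf; apply: (ler_pM (cmod_ge0 _)); [by rewrite invr_ge0 cmod_ge0|exact: hM|].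
  have h1 := hr1 _ ht; have h2 := cmodBB t w z.
  have h3 : r / 2 <= cmod (t - w) by lra.
  have -> : 2 / r = (r / 2)^-1 by rewrite invfM invrK mulrC.
  by rewrite lef_pV2 // posrE; lra.
apply: (@le_lt_trans _ _ ((K - 1) * cmod (w - z))).
  by rewrite /K addrK; exact: (ler_wpM2r (cmod_ge0 _) B).
apply: (@le_lt_trans _ _ (K * cmod (w - z))).
  by rewrite ler_wpM2r ?cmod_ge0 // gerBl.
by rewrite mulrC -ltr_pdivlMr.
Qed.

Lemma cauchyT_der f a b c d z : insq a b c d z ->
  (forall w, bdry a b c d w -> {for w, continuous f}) ->
  derivable (cauchyT f a b c d) z 1 /\
  derive1 (cauchyT f a b c d) z = cauchyT (fun t => f t / (t - z)) a b c d z.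
Proof.
move=> zin fc.
have gc t : bdry a b c d t -> {for t, continuous (fun t => f t / (t - z))}.
  move=> ht; have /derivable_cont h := der_inv1 (insq_bdry zin ht).
  exact: (continuousM (fc _ ht) h).
apply: caratheodory; first exact: cauchyT_continuous.
have [r r0 [hr1 hr2]] := bdry_dist zin.
by apply/nearCP; exists r => // w /hr2 win; rewrite (cauchyT_diff win zin fc).
Qed.

Lemma square_in (D : set C) z : open D -> D z -> exists2 r : R, 0 < r &
  forall x y, reC z - r <= x <= reC z + r -> imC z - r <= y <= imC z + r -> D (pt x y).
Proof.
move=> /openCP oD /oD[e e0 he]; exists (e / 3); first by rewrite divr_gt0.
move=> x y hx hy; apply: he; apply: le_lt_trans (cmod_le_reim _) _; rewrite reCB imCB reC_pt imC_pt.
have h1 : `|x - reC z| <= e / 3 by rewrite ler_norml; move: hx => /andP[? ?]; apply/andP; split; lra.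
have h2 : `|y - imC z| <= e / 3 by rewrite ler_norml; move: hy => /andP[? ?]; apply/andP; split; lra.
lra.
Qed.

Lemma insq_center z (r : R) : 0 < r -> insq (reC z - r) (reC z + r) (imC z - r) (imC z + r) z.
Proof. by move=> r0; rewrite /insq !ltrBlDr !ltrDl r0. Qed.

(** Only the point [w] is at issue. As [kap] is not known to be constant, [f] is represented near
    [w] as a quotient N/K of Cauchy transforms of [f] and 1; expanding both by [cauchyT_diff] writes
    the difference quotient as (N1 - f(w) K1)/K, which is differentiable at [w] because K does not
    vanish. *)
Theorem analytic_dd (D : set C) f w : open D -> analytic_on D f -> D w -> analytic_on D (dd f w).
Proof.
move=> oD fD Dw; apply/analytic_on_der => // z Dz.
have /analytic_on_der fd := fD; have {}fd := fd oD.
have [zw|zw] := eqVneq z w; last first.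
  have H : derivable (fun t => (f t - f w) / (t - w)) z 1.
    apply: derDiv; first by rewrite subr_eq0.
      by apply: derB; [exact: fd|exact: der_cst].
    by apply: derB; [exact: der_id|exact: der_cst].
  apply: (derivable_near_eq _ H).1; apply/nearCP; exists (cmod (z - w)).
    by rewrite cmod_gt0 subr_eq0.
  move=> t tw; rewrite /dd; case: eqVneq => [tz|//]; move: tw.
  by rewrite tz cmodBC ltxx.
rewrite {z}zw in Dz *.
have [r r0 hr] := square_in oD Dw.
set a := reC w - r in hr; set b := reC w + r in hr; set c := imC w - r in hr; set d := imC w + r in hr.
have win : insq a b c d w := insq_center w r0.
have sd x y : a <= x <= b -> c <= y <= d -> derivable f (pt x y) 1.
  by move=> hx hy; apply: fd; exact: hr.
have fc t : bdry a b c d t -> {for t, continuous f}.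
  by case=> h1 [h2 _]; rewrite -(pt_reim t); apply: derivable_cont; exact: sd.
have oc t : bdry a b c d t -> {for t, continuous (fun _ : C => 1 : C)}.
  by move=> _; apply: derivable_cont; exact: der_cst.
pose N := cauchyT f a b c d; pose K := cauchyT (fun=> 1) a b c d.
pose N1 := cauchyT (fun t => f t / (t - w)) a b c d.
pose K1 := cauchyT (fun t => 1 / (t - w)) a b c d.
have gc (g : C -> C) : (forall t, bdry a b c d t -> {for t, continuous g}) ->
    forall t, bdry a b c d t -> {for t, continuous (fun t => g t / (t - w))}.
  move=> cg t ht; have /derivable_cont h := der_inv1 (insq_bdry win ht).
  exact: (continuousM (cg _ ht) h).
have KE z : K z = kap a b c d z.
  by rewrite /K /cauchyT /kap; congr (rint _ a b c d); apply/funext => t; rewrite mul1r.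
have H : derivable (fun z => (N1 z - f w * K1 z) / K z) w 1.
  apply: derDiv; first by rewrite KE kap_neq0.
    apply: derB; first exact: (cauchyT_der win (gc _ fc)).1.
    by apply: derM; [exact: der_cst|exact: (cauchyT_der win (gc _ oc)).1].
  exact: (cauchyT_der win oc).1.
have E z : insq a b c d z -> z != w -> dd f w z = (N1 z - f w * K1 z) / K z.
  move=> zin zw; have Kz : K z != 0 by rewrite KE kap_neq0.
  have Kw : K w != 0 by rewrite KE kap_neq0.
  have f1 : f z * K z = N z by rewrite KE /N cauchy_formula.
  have f2 : f w * K w = N w by rewrite KE /N cauchy_formula.
  have e1 : N z = N w + N1 z * (z - w) by exact: cauchyT_diff.
  have e2 : K z = K w + K1 z * (z - w) by exact: cauchyT_diff.
  have zw0 : z - w != 0 by rewrite subr_eq0.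
  rewrite /dd (negPf zw); apply/eqP; rewrite eqr_div //; apply/eqP.
  by rewrite [LHS]mulrBl f1 e1 -f2 e2; ring.
have [r' r0' [hr1 hr2]] := bdry_dist win.
have Ew : dd f w w = (N1 w - f w * K1 w) / K w.
  apply: (@cont_eq_dnear _ (dd f w) (fun z => (N1 z - f w * K1 z) / K z) w);
    [apply: dd_continuous; exact: fd|exact: derivable_cont H|].
  by apply/dnbhsCP; exists r' => // t tw /hr2 tin; exact: E.
apply: (derivable_near_eq _ H).1; apply/nearCP; exists r' => // t /hr2 tin.
by have [->|tw] := eqVneq t w; [rewrite Ew|rewrite E].
Qed.

(* Cauchy's formula for f ^+ n bounds |f(z)|^n by a constant times M^n. *)
Theorem max_principle f a b c d z (M : R) : insq a b c d z ->
  (forall x y, a <= x <= b -> c <= y <= d -> derivable f (pt x y) 1) ->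
  (forall w, bdry a b c d w -> cmod (f w) <= M) -> cmod (f z) <= M.
Proof.
move=> zin fd fM; have /andP[/andP[ax xb] /andP[cy yd]] := zin.
have ab : a <= b by exact/ltW/(lt_trans ax xb).
have cd : c <= d by exact/ltW/(lt_trans cy yd).
have M0 : 0 <= M.
  apply: le_trans (cmod_ge0 (f (pt a c))) (fM _ _).
  by rewrite /bdry /= !(reC_pt, imC_pt) !lexx ab cd; do 2 split => //; left.
have [r r0 [hr1 hr2]] := bdry_dist zin.
rewrite leNgt; apply/negP => Mf.
pose k := cmod (kap a b c d z); have k0 : 0 < k by rewrite cmod_gt0 kap_neq0.
pose L := 4 * r^-1 * ((b - a) + (d - c)).
have L0 : 0 <= L by rewrite !mulr_ge0 ?invr_ge0 ?(ltW r0) // addr_ge0 // subr_ge0.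
have B n : cmod (f z) ^+ n * k <= L * M ^+ n.
  have -> : L * M ^+ n = 4 * (M ^+ n / r) * ((b - a) + (d - c)) by rewrite /L; ring.
  have dn x y : a <= x <= b -> c <= y <= d -> derivable (fun t => f t ^+ n) (pt x y) 1.
    by move=> hx hy; apply: derX; exact: fd.
  rewrite -cmodX -cmodM (cauchy_formula zin dn).
  apply: (brint_bound ab cd).
    apply: (cauchyT_cont zin) => w [h1 [h2 _]].
    by rewrite -(pt_reim w); apply: derivable_cont; exact: dn.
  move=> w hw; rewrite cmodf cmodX; apply: ler_pM; rewrite ?exprn_ge0 ?invr_ge0 ?cmod_ge0 //.
    by rewrite lerXn2r ?nnegrE ?cmod_ge0 //; exact: fM.
  by rewrite lef_pV2 ?posrE //; [exact: hr1|exact: lt_le_trans r0 (hr1 _ hw)].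
have [M00|Mp] := eqVneq M 0.
  have := B 1%N; rewrite !expr1 M00 mulr0 leNgt => /negP; apply.
  by rewrite mulr_gt0 // -M00.
(* With q = |f(z)|/M > 1, Bernoulli's inequality makes q^n unbounded, against the bound L/k that
   does not depend on n. *)
have {}Mp : 0 < M by rewrite lt_def Mp.
pose q := cmod (f z) / M; have q1 : 1 < q by rewrite ltr_pdivlMr // mul1r.
have Bq n : q ^+ n * k <= L.
  by rewrite /q expr_div_n mulrAC ler_pdivrMr ?exprn_gt0.
pose s := q - 1; have s0 : 0 < s by rewrite subr_gt0.
have bern n : 1 + n%:R * s <= q ^+ n.
  elim: n => [|n IH]; first by rewrite mul0r addr0 expr0.
  rewrite exprS; apply: (@le_trans _ _ (q * (1 + n%:R * s))); last by rewrite ler_wpM2l //; lra.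
  have -> : q = 1 + s by rewrite /s; ring.
  have : 0 <= n%:R * s * s by rewrite !mulr_ge0 // ltW.
  by rewrite -natr1; lra.
have := archi_boundP (divr_ge0 L0 (ltW (mulr_gt0 s0 k0))).
set n := Num.bound _; rewrite ltr_pdivrMr ?mulr_gt0 // => Ln.
have := Bq n; rewrite leNgt => /negP; apply; apply: lt_le_trans Ln _.
rewrite mulrA; apply: ler_wpM2r; first exact: ltW.
by apply: le_trans (bern n); lra.
Qed.

End Cauchy.

(** * Normal families, removable singularities, the Schwarz lemma *)

Section Consequences.
Variable R : realType.
Local Notation C := (Cplx R).
Implicit Types (a b c d x y : R) (f g h : C -> C) (z w p : C).

Section Limits.
Variables (T : Type) (F : set_system T).
Context {FF : Filter F}.
Implicit Types (u v : T -> C) (k l : C).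
Lemma cvgCcst k : (fun _ : T => k) x @[x --> F] --> k.
Proof. exact: cvg_cst. Qed.
Lemma cvgCD u v k l : u x @[x --> F] --> k -> v x @[x --> F] --> l -> u x + v x @[x --> F] --> k + l.
Proof. exact: cvgD. Qed.
Lemma cvgCB u v k l : u x @[x --> F] --> k -> v x @[x --> F] --> l -> u x - v x @[x --> F] --> k - l.
Proof. exact: cvgB. Qed.
Lemma cvgCM u v k l : u x @[x --> F] --> k -> v x @[x --> F] --> l -> u x * v x @[x --> F] --> k * l.
Proof. exact: cvgM. Qed.
Lemma cvgCV u k : k != 0 -> u x @[x --> F] --> k -> (u x)^-1 @[x --> F] --> k^-1.
Proof. exact: cvgV. Qed.
Lemma cvgCdiv u v k l : l != 0 -> u x @[x --> F] --> k -> v x @[x --> F] --> l ->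
  u x / v x @[x --> F] --> k / l.
Proof. by move=> l0 h1 h2; exact: cvgCM h1 (cvgCV l0 h2). Qed.
Lemma cvgCJ u k : u x @[x --> F] --> k -> (u x)^* @[x --> F] --> k^*.
Proof. exact: cvg_conj. Qed.
End Limits.

Lemma cvg_cont f z (T : Type) (F : set_system T) (FF : Filter F) (u : T -> C) :
  {for z, continuous f} -> u x @[x --> F] --> z -> f (u x) @[x --> F] --> f z.
Proof.
move=> /continuous_eps cf /cvgCP hu; apply/cvgCP => e /cf[d d0 hd].
by move: (hu _ d0); apply: filterS => x; exact: hd.
Qed.

Lemma analytic_derI (D : set C) f : open D -> (forall z, D z -> derivable f z 1) -> analytic_on D f.
Proof. by move=> oD h; exact: (proj2 (analytic_on_der f oD) h). Qed.

Lemma analytic_derE (D : set C) f z : analytic_on D f -> D z -> derivable f z 1.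
Proof. by move=> h Dz; exact: analytic_at_der (h _ Dz). Qed.

Definition csq z (r : R) : set C := [set w | reC z - r <= reC w <= reC z + r /\
  imC z - r <= imC w <= imC z + r].

Lemma csq_ball z (r : R) w : cmod (w - z) <= r -> csq z r w.
Proof.
move=> h; have := le_trans (re_le_cmod _) h; have := le_trans (im_le_cmod _) h.
rewrite reCB imCB !ler_norml => /andP[h1 h2] /andP[h3 h4].
by split; apply/andP; split; lra.
Qed.

Lemma csq_in (D : set C) z : open D -> D z -> exists2 r : R, 0 < r & csq z r `<=` D.
Proof.
move=> oD Dz; have [r r0 hr] := square_in oD Dz; exists r => // w [h1 h2].
by rewrite -(pt_reim w); exact: hr.
Qed.

Lemma csq_sub z (r s : R) : r <= s -> csq z r `<=` csq z s.
Proof. by move=> rs w [/andP[? ?] /andP[? ?]]; split; apply/andP; split; lra. Qed.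

Lemma csq_bdry_dist z (r : R) w : 0 < r ->
  bdry (reC z - r) (reC z + r) (imC z - r) (imC z + r) w -> csq z r w /\ r <= cmod (w - z).
Proof.
move=> r0 [h1 [h2 h3]]; split; first by split.
have := re_le_cmod (w - z); have := im_le_cmod (w - z); rewrite reCB imCB.
move: (cmod (w - z)) => m; rewrite !ler_norml => /andP[? ?] /andP[? ?].
by case: h3 => [|[|[|]]] E; lra.
Qed.

Lemma csq_max (D : set C) f z (r M : R) w : open D -> analytic_on D f -> 0 < r ->
  csq z r `<=` D -> (forall t, csq z r t -> r <= cmod (t - z) -> cmod (f t) <= M) ->
  cmod (w - z) < r -> cmod (f w) <= M.
Proof.
move=> oD fD r0 rD fM wz.
apply: (@max_principle _ f (reC z - r) (reC z + r) (imC z - r) (imC z + r)).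
- have := le_lt_trans (re_le_cmod _) wz; have := le_lt_trans (im_le_cmod _) wz.
  rewrite reCB imCB !ltr_norml => /andP[h1 h2] /andP[h3 h4].
  by apply/andP; split; apply/andP; split; lra.
- move=> x y hx hy; move/(analytic_on_der _ oD): fD; apply; apply: rD.
  by split; rewrite ?reC_pt ?imC_pt.
- by move=> t /(csq_bdry_dist r0)[h1 h2]; exact: fM.
Qed.

(** On the boundary of the square |s - w| >= r/2, hence the quotient is at most 2M/(r/2) there; the
    maximum principle carries this bound to the points near [w], where the denominator is small. *)
Lemma dd_bound (D : set C) f z (r M : R) w t : open D -> analytic_on D f -> 0 < r ->
  csq z r `<=` D -> (forall t, csq z r t -> cmod (f t) <= M) ->
  cmod (w - z) < r / 2 -> cmod (t - z) < r -> cmod (dd f w t) <= 4 * M / r.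
Proof.
move=> oD fD r0 rD fM wz tz.
have wsq : csq z r w by apply: csq_ball; lra.
have fD' := analytic_dd oD fD (rD _ wsq).
apply: (csq_max oD fD' r0 rD) => // s ssq sr.
have d : r / 2 <= cmod (s - w) by have := cmodBB s w z; lra.
have d0 : 0 < r / 2 by lra.
rewrite /dd; case: eqVneq => [E|sw]; first by move: d; rewrite E subrr cmod0; lra.
rewrite cmodf ler_pdivrMr; last exact: lt_le_trans d0 d.
have M0 : 0 <= M by exact: le_trans (cmod_ge0 _) (fM _ wsq).
have M1 : 0 <= 4 * M / r by rewrite !mulr_ge0 ?invr_ge0 ?(ltW r0).
apply: (@le_trans _ _ (4 * M / r * (r / 2))); last by rewrite ler_wpM2l.
have -> : 4 * M / r * (r / 2) = M + M by field; rewrite gt_eqF.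
by apply: le_trans (cmodB _ _) _; apply: lerD; exact: fM.
Qed.

(** The limit is the supremum of those t for which almost every [x n], in the sense of [U], is at
    least t. Convergence along one ultrafilter holds for all bounded families at once, so no
    diagonal subsequence is needed. *)
Lemma ultra_cvgR (T : Type) (U : set_system T) (UU : UltraFilter U) (x : T -> R) (M : R) :
  (forall n, `|x n| <= M) -> exists l : R, x n @[n --> U] --> l.
Proof.
move=> xM; have UF : ProperFilter U by exact: ultra_proper.
pose S := [set t : R | U [set n | t <= x n]].
have S0 : S (- M).
  rewrite /S /=; have -> : [set n | - M <= x n] = setT; last exact: filterT.
  by apply/seteqP; split => // n _ /=; have := xM n; rewrite ler_norml => /andP[].
have Sub : ubound S M.
  move=> t /= /filter_ex[n /= tn]; apply: le_trans tn _.
  by have := xM n; rewrite ler_norml => /andP[].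
have hs : has_sup S by split; [exists (- M)|exists M].
exists (sup S); apply/cvgRP => e e0.
have [t St tl] := sup_adherent e0 hs.
have h2 : U [set n | x n < sup S + e].
  have [h|h] := in_ultra_setVsetC [set n | sup S + e <= x n] UU.
    have := sup_upper_bound hs h; rewrite gerDl; lra.
  by apply: filterS h => n /= /negP; rewrite -ltNge.
have {}St : U [set n | t <= x n] := St.
near=> n; rewrite ltr_norml.
have n1 : t <= x n by near: n.
have n2 : x n < sup S + e by near: n.
by apply/andP; split; lra.
Unshelve. all: by end_near. Qed.

Lemma ultra_cvgC (T : Type) (U : set_system T) (UU : UltraFilter U) (x : T -> C) (M : R) :
  (forall n, cmod (x n) <= M) -> exists l : C, x n @[n --> U] --> l.
Proof.
move=> xM; have UF : ProperFilter U by exact: ultra_proper.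
have [l1 h1] := @ultra_cvgR T U UU (fun n => reC (x n)) M (fun n => le_trans (re_le_cmod _) (xM n)).
have [l2 h2] := @ultra_cvgR T U UU (fun n => imC (x n)) M (fun n => le_trans (im_le_cmod _) (xM n)).
by exists (pt l1 l2); apply: cvgC_reim; rewrite ?reC_pt ?imC_pt.
Qed.

Lemma cvg_cmod_le (T : Type) (F : set_system T) (FF : ProperFilter F) (f : T -> C) (l : C) (M : R) :
  f x @[x --> F] --> l -> (\forall x \near F, cmod (f x) <= M) -> cmod l <= M.
Proof.
move=> /cvgCP h hM; apply/ler_addgt0Pl => e e0.
have [x [/= h1 h2]] := filter_ex (filterI (h _ e0) hM).
by have := lerB_cmod l (f x); rewrite cmodBC; lra.
Qed.

(* A quadratic error term shows that the limit is differentiable. *)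
Theorem ultra_analytic (T : Type) (U : set_system T) (UU : UltraFilter U) (D : set C)
    (f : T -> C -> C) (F : C -> C) : open D -> (forall n, analytic_on D (f n)) ->
  (forall z, D z -> exists e M : R, 0 < e /\ forall n w, D w -> cmod (w - z) < e -> cmod (f n w) <= M) ->
  (forall z, D z -> f n z @[n --> U] --> F z) -> analytic_on D F.
Proof.
move=> oD fD fb fF; have UF : ProperFilter U by exact: ultra_proper.
apply: (analytic_derI oD) => z Dz.
have [e [M [e0 hM]]] := fb _ Dz; have [r1 r10 r1D] := csq_in oD Dz.
pose r := Num.min r1 (e / 3).
have r0 : 0 < r by rewrite lt_min r10 divr_gt0.
have rD : csq z r `<=` D by apply: subset_trans r1D; apply: csq_sub; rewrite ge_min lexx.
have re : r <= e / 3 by rewrite ge_min lexx orbT.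
have fM n t : csq z r t -> cmod (f n t) <= M.
  move=> ht; apply: hM; first exact: rD.
  case: ht => /andP[h1 h2] /andP[h3 h4].
  apply: le_lt_trans (cmod_le_reim _) _; rewrite reCB imCB.
  have k1 : `|reC t - reC z| <= e / 3 by rewrite ler_norml; apply/andP; split; lra.
  have k2 : `|imC t - imC z| <= e / 3 by rewrite ler_norml; apply/andP; split; lra.
  lra.
have M0 : 0 <= M.
  have [t0 _] := filter_ex (@filterT _ U _).
  by apply: le_trans (cmod_ge0 (f t0 z)) (fM _ _ _); apply: csq_ball; rewrite subrr cmod0 ltW.
(* [h n] is the second difference quotient at [z], so that f_n(w) = f_n(z) + g_n(z)(w - z) +
   h_n(w)(w - z)^2. Applying [dd_bound] twice bounds [h n] uniformly in [n]. *)
pose g n : C -> C := dd (f n) z; pose h n : C -> C := dd (g n) z.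
have z0r : cmod (z - z) < r / 2 by rewrite subrr cmod0; lra.
have gM n t : cmod (t - z) < r -> cmod (g n t) <= 4 * M / r.
  exact: (dd_bound oD (fD n) r0 rD (fM n) z0r).
(* The closed square of half-side r/3 lies in the disc of radius r, where the first application of
   [dd_bound] controls [g n]. *)
pose s := r / 3; have s0 : 0 < s by rewrite divr_gt0.
have sD : csq z s `<=` D by apply: subset_trans rD; apply: csq_sub; rewrite /s; lra.
have gM' n t : csq z s t -> cmod (g n t) <= 4 * M / r.
  move=> [/andP[h1 h2] /andP[h3 h4]]; apply: gM.
  apply: le_lt_trans (cmod_le_reim _) _; rewrite reCB imCB.
  have k1 : `|reC t - reC z| <= s by rewrite ler_norml; apply/andP; split; lra.
  have k2 : `|imC t - imC z| <= s by rewrite ler_norml; apply/andP; split; lra.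
  by move: k1 k2; rewrite /s; lra.
have gD n : analytic_on D (g n) by exact: analytic_dd.
have z0s : cmod (z - z) < s / 2 by rewrite subrr cmod0; lra.
have hB n t : cmod (t - z) < s -> cmod (h n t) <= 4 * (4 * M / r) / s.
  exact: (dd_bound oD (gD n) s0 sD (gM' n) z0s).
set K := 4 * (4 * M / r) / s in hB.
have gz n : cmod (g n z) <= 4 * M / r by apply: gM; rewrite subrr cmod0.
have [L hL] := ultra_cvgC UU gz.
have est w : cmod (w - z) < s -> cmod (F w - F z - L * (w - z)) <= K * cmod (w - z) ^+ 2.
  move=> ws; have Dw : D w by apply: sD; apply: csq_ball; exact: ltW.
  have E n : f n w - f n z - g n z * (w - z) = h n w * (w - z) ^+ 2.
    by rewrite (ddE (f n) z w) -/(g n) (ddE (g n) z w) -/(h n); ring.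
  apply: (@cvg_cmod_le _ U UF (fun n => f n w - f n z - g n z * (w - z))).
    exact: (cvgCB (cvgCB (fF _ Dw) (fF _ Dz)) (cvgCM hL (@cvgCcst _ _ _ _))).
  near=> n; rewrite E cmodM cmodX; apply: ler_wpM2r; first by rewrite exprn_ge0 ?cmod_ge0.
  exact: hB.
apply: (proj1 (proj1 (@quot_cvg_derivable _ F z L) _)).
have K0 : 0 <= K by rewrite /K !mulr_ge0 ?invr_ge0 ?(ltW r0) ?(ltW s0) ?M0.
apply/cvgCP => e' e'0; apply/dnbhsCP.
have K1 : 0 < K + 1 by lra.
exists (Num.min s (e' / (K + 1))); first by rewrite lt_min s0 divr_gt0.
move=> w wz; rewrite lt_min => /andP[ws we].
have wz0 : w - z != 0 by rewrite subr_eq0.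
have c0 : 0 < cmod (w - z) by rewrite cmod_gt0.
have -> : (F w - F z) / (w - z) - L = (F w - F z - L * (w - z)) / (w - z) by field.
rewrite cmodf ltr_pdivrMr //; apply: le_lt_trans (est w ws) _.
rewrite expr2 mulrA ltr_pM2r //.
move: we; rewrite ltr_pdivlMr //; move: (cmod (w - z)) c0 => m m0; nra.
Unshelve. all: by end_near. Qed.

(** Riemann's argument: (z - p)^2 f(z), set to 0 at [p], is differentiable there with value and
    derivative 0. Two difference quotients at [p] then give back [f] with the singularity
    removed. *)
Theorem removable f p (e M : R) : 0 < e ->
  (forall z, z != p -> cmod (z - p) < e -> derivable f z 1) ->
  (forall z, z != p -> cmod (z - p) < e -> cmod (f z) <= M) ->
  exists g : C -> C, (forall z, cmod (z - p) < e -> derivable g z 1) /\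
    (forall z, z != p -> cmod (z - p) < e -> g z = f z).
Proof.
move=> e0 fd fM.
pose G z := if z == p then 0 else (z - p) ^+ 2 * f z.
pose D := [set z | cmod (z - p) < e].
have oD : open D.
  apply/openCP => z Dz; exists (e - cmod (z - p)); first by rewrite subr_gt0.
  by move=> w; rewrite ltrBrDr => h; apply: le_lt_trans (cmodBB _ z _) h.
have Dp : D p by rewrite /D /= subrr cmod0.
have M0 : 0 <= M.
  have := fM (toC (e / 2) + p); rewrite addrK cmod_toC -subr_eq0 addrK toC_eq0.
  rewrite gtr0_norm ?divr_gt0 // => h; apply: le_trans (cmod_ge0 _) (h _ _); last lra.
  by rewrite gt_eqF // divr_gt0.
have Gp : (G z - G p) / (z - p) @[z --> p^'] --> (0 : C).
  apply/cvgCP => t t0; apply/dnbhsCP; exists (Num.min e (t / (M + 1))).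
    by rewrite lt_min e0 divr_gt0 //; lra.
  move=> z zp; rewrite lt_min => /andP[ze zt]; have zp0 : z - p != 0 by rewrite subr_eq0.
  rewrite /G eqxx (negPf zp) !subr0.
  have -> : (z - p) ^+ 2 * f z / (z - p) = (z - p) * f z by field.
  move: zt; rewrite cmodM ltr_pdivlMr; last lra.
  apply: le_lt_trans; apply: ler_wpM2l; first exact: cmod_ge0.
  by have := fM _ zp ze; lra.
have [Gdp G0] := proj1 (@quot_cvg_derivable _ G p 0) Gp.
have near_ne z : z != p -> \forall t \near z, t != p.
  move=> zp; apply/nearCP; exists (cmod (z - p)); first by rewrite cmod_gt0 subr_eq0.
  by move=> t tz; apply/eqP => tp; move: tz; rewrite tp cmodBC ltxx.
have GD : analytic_on D G.
  apply: (analytic_derI oD) => z Dz; have [->//|zp] := eqVneq z p.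
  have H : derivable (fun t => (t - p) ^+ 2 * f t) z 1.
    apply: derM; last exact: fd.
    by apply: derX; apply: derB; [exact: der_id|exact: der_cst].
  apply: (derivable_near_eq _ H).1.
  by have := near_ne _ zp; apply: filterS => t tp; rewrite /G (negPf tp).
have D1 := analytic_dd oD GD Dp; have D2 := analytic_dd oD D1 Dp.
exists (dd (dd G p) p); split; first by move=> z; exact: (analytic_derE D2).
move=> z zp _; have zp0 : z - p != 0 by rewrite subr_eq0.
have E1 : dd G p p = 0 by rewrite /dd eqxx.
have E2 : dd G p z = (z - p) * f z.
  by rewrite /dd (negPf zp) /G eqxx (negPf zp) subr0; field.
by rewrite {1}/dd (negPf zp) E1 E2 subr0; field.
Qed.

Definition schur h := analytic_on upper h /\ forall z, upper z -> cmod (h z) <= 1.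

Lemma schur_der h z : schur h -> upper z -> derivable h z 1.
Proof. by move=> [h1 _] uz; apply: analytic_at_der; exact: h1. Qed.

Definition blaschke w z : C := (z - w) / (z - w^*).

Lemma upper_conj_neq z w : upper z -> upper w -> z - w^* != 0.
Proof.
rewrite /upper /= => z0 w0; apply/eqP => /(congr1 (@imC R)).
by rewrite imCB imCJ imC0 opprK => E; have := addr_gt0 z0 w0; rewrite E ltxx.
Qed.

Lemma blaschke_sq w z : upper z -> upper w ->
  1 - cmod (blaschke w z) ^+ 2 = 4 * imC z * imC w / cmod (z - w^*) ^+ 2.
Proof.
move=> uz uw; have n0 : cmod (z - w^*) != 0 by rewrite cmod_eq0 upper_conj_neq.
rewrite /blaschke cmodf; have := cmod_sq (z - w^*); have := cmod_sq (z - w).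
rewrite !reCB !imCB reCJ imCJ opprK => e1 e2.
apply: (mulIf (x := cmod (z - w^*) ^+ 2)); first by rewrite expf_neq0.
rewrite divfK ?expf_neq0 // exprMn exprVn mulrBl divfK ?expf_neq0 // e1 e2; ring.
Qed.

Lemma blaschke_le1 w z : upper z -> upper w -> cmod (blaschke w z) < 1.
Proof.
move=> uz uw; have := blaschke_sq uz uw.
have p0 : 0 < 4 * imC z * imC w / cmod (z - w^*) ^+ 2.
  by rewrite divr_gt0 ?exprn_gt0 ?cmod_gt0 ?upper_conj_neq // !mulr_gt0.
move=> E; rewrite ltNge; apply/negP => h; have : 1 <= cmod (blaschke w z) ^+ 2 by rewrite exprn_ege1.
lra.
Qed.

Lemma blaschke_neq0 w z : upper z -> upper w -> z != w -> blaschke w z != 0.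
Proof. by move=> uz uw zw; rewrite /blaschke mulf_neq0 ?invr_eq0 ?subr_eq0 // -subr_eq0 upper_conj_neq. Qed.

(** The quotient of [g] by the Blaschke factor is (z - conj w) times the difference quotient of [g]
    at [w], hence analytic. As |blaschke| tends to 1 only at the real line and at infinity, the
    maximum principle is applied on a large rectangle slightly above the real line, on whose
    boundary |blaschke|^2 >= 1 - eta; then eta is arbitrary. *)
Theorem schwarz g w : schur g -> upper w -> g w = 0 ->
  exists2 g', schur g' & forall z, upper z -> g z = blaschke w z * g' z.
Proof.
move=> sg uw gw; have [ga g1] := sg.
pose g' z := (z - w^*) * dd g w z.
have oU := @open_upper R.
have ddu := analytic_dd oU ga uw.
have g'd z : upper z -> derivable g' z 1.
  move=> uz; apply: derM; first by apply: derB; [exact: der_id|exact: der_cst].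
  by apply: analytic_at_der; exact: ddu.
have gE z : upper z -> g z = blaschke w z * g' z.
  move=> uz; have := upper_conj_neq uz uw; rewrite (ddE g w z) gw /blaschke /g' => n0.
  by field.
exists g'; last exact: gE.
split; first exact: (analytic_derI oU).
move=> z0 uz0.
suff H (eta : R) : 0 < eta -> eta < 1 -> cmod (g' z0) ^+ 2 * (1 - eta) <= 1.
  rewrite leNgt; apply/negP => h.
  have h2 : 1 < cmod (g' z0) ^+ 2 by rewrite exprn_egt1.
  (* With this [eta], m (1 - eta) = (m + 1)/2, which exceeds 1 when m does. *)
  set m := cmod (g' z0) ^+ 2 in h2 H; pose eta := (m - 1) / (2 * m).
  have m0 : 0 < m by lra.
  have eta0 : 0 < eta by apply: divr_gt0; lra.
  have eta1 : eta < 1 by rewrite ltr_pdivrMr ?mulr_gt0 //; lra.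
  have E : m * (1 - eta) = (m + 1) / 2 by rewrite /eta; field; rewrite gt_eqF.
  by have := H _ eta0 eta1; rewrite E; lra.
move=> eta0 eta1; set v := imC w; have v0 : 0 < v by [].
have iz0 : 0 < imC z0 by [].
(* By [blaschke_sq], 1 - |blaschke|^2 = 4 Im z Im w / |z - conj w|^2. On the bottom edge this is at
   most 4 del / v <= eta; on the other edges |z - conj w| >= L = 4v/eta suffices. The bound Im z0 /
   2 puts [z0] above the bottom edge. *)
pose del := Num.min (imC z0 / 2) (eta * v / 4).
have del0 : 0 < del by rewrite lt_min !divr_gt0 // mulr_gt0.
have del1 : del <= imC z0 / 2 by rewrite ge_min lexx.
have del2 : del <= eta * v / 4 by rewrite ge_min lexx orbT.
pose L := 4 * v / eta; have L0 : 0 < L by rewrite divr_gt0 // mulr_gt0.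
pose L' := `|reC z0| + imC z0 + `|reC w| + L + 1.
have n1 := normr_ge0 (reC z0); have n2 := normr_ge0 (reC w).
have n3 := ler_norm (reC z0); have n4 : - `|reC z0| <= reC z0 by rewrite lerNl -normrN ler_norm.
have n5 := ler_norm (reC w); have n6 : - `|reC w| <= reC w by rewrite lerNl -normrN ler_norm.
have L'E : L' = `|reC z0| + imC z0 + `|reC w| + L + 1 by [].
clearbody L'.
have zin : insq (- L') L' del L' z0.
  by apply/andP; split; apply/andP; split; lra.
have bup z : bdry (- L') L' del L' z -> upper z.
  by move=> [_ [/andP[h _] _]]; rewrite /upper /=; exact: lt_le_trans h.
have key z : bdry (- L') L' del L' z -> 1 - eta <= cmod (blaschke w z) ^+ 2.
  move=> hz; have uz := bup _ hz; suff : 1 - cmod (blaschke w z) ^+ 2 <= eta by lra.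
  have m0 : 0 < cmod (z - w^*) by rewrite cmod_gt0 upper_conj_neq.
  rewrite (blaschke_sq uz uw) ler_pdivrMr ?exprn_gt0 // -/v.
  have im1 := im_le_cmod (z - w^*); have re1 := re_le_cmod (z - w^*).
  move: im1 re1; rewrite imCB imCJ opprK -/v reCB reCJ.
  set m := cmod (z - w^*) in m0 *; rewrite !ler_norml => /andP[_ im1] /andP[re1 re2].
  have uz' : 0 < imC z by [].
  case: hz => [/andP[x1 x2] [/andP[y1 y2] hz]].
  have big : L <= m -> 4 * imC z * v <= eta * m ^+ 2.
    move=> Lm; have : 4 * v <= eta * m by move: Lm; rewrite /L ler_pdivrMr // [m * _]mulrC.
    move=> k1; apply: (@le_trans _ _ (eta * m * imC z)); last first.
      by rewrite expr2 mulrA ler_pM2l ?mulr_gt0 //; lra.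
    have -> : 4 * imC z * v = 4 * v * imC z by ring.
    by rewrite ler_pM2r.
  case: hz => [E|[E|[E|E]]]; first by apply: big; lra.
  - by apply: big; lra.
  - have vm : v <= m by lra.
    have : v ^+ 2 <= m ^+ 2 by rewrite lerXn2r // ?nnegrE ltW.
    rewrite E => vm2; apply: (@le_trans _ _ (eta * v ^+ 2)); last by rewrite ler_pM2l.
    have -> : eta * v ^+ 2 = 4 * (eta * v / 4) * v by field.
    by rewrite ler_pM2r // ler_pM2l.
  - by apply: big; lra.
have q0 : 0 < 1 - eta by lra.
pose M := Num.sqrt ((1 - eta)^-1).
have M2 : M ^+ 2 = (1 - eta)^-1 by rewrite sqr_sqrtr // invr_ge0 ltW.
have : cmod (g' z0) <= M.
  apply: (max_principle zin).
    move=> x y hx /andP[hy _]; apply: g'd; rewrite /upper /= imC_pt; exact: lt_le_trans hy.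
  move=> z hz; have uz := bup _ hz; have k := key _ hz.
  have : cmod (g z) <= 1 by exact: g1.
  rewrite gE // cmodM => k1; rewrite -(@ler_pXn2r _ 2) ?nnegrE ?sqrtr_ge0 ?cmod_ge0 // M2.
  rewrite -[(1 - eta)^-1]mul1r ler_pdivlMr //.
  apply: (@le_trans _ _ (cmod (g' z) ^+ 2 * cmod (blaschke w z) ^+ 2)).
    by rewrite ler_wpM2l ?exprn_ge0 ?cmod_ge0.
  by rewrite -exprMn mulrC exprn_ile1 ?mulr_ge0 ?cmod_ge0.
move=> k; have : cmod (g' z0) ^+ 2 <= M ^+ 2 by rewrite lerXn2r ?nnegrE ?sqrtr_ge0 ?cmod_ge0.
by rewrite M2 -[(1 - eta)^-1]mul1r ler_pdivlMr.
Qed.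

Lemma pow_to0 (q e : R) : 0 <= q -> q < 1 -> 0 < e -> exists n, q ^+ n < e.
Proof.
move=> q0 q1 e0.
have h : q ^+ n @[n --> \oo] --> 0.
  by apply: cvg_expr; rewrite ger0_norm.
move/cvgRP: h => /(_ _ e0) [N _ hN]; exists N.
by have := hN N (leqnn N); rewrite subr0 ger0_norm ?exprn_ge0.
Qed.

(** If every quotient vanished at [w], [schwarz] could be repeated without end, and |h(z0)| <=
    |blaschke w z0|^n for all n would force h(z0) = 0. This gives the finite order of a zero without
    power series. *)
Theorem schur_factor h w : schur h -> upper w -> (exists2 z, upper z & h z != 0) ->
  exists n g, [/\ schur g, g w != 0 & forall z, upper z -> h z = blaschke w z ^+ n * g z].
Proof.
move=> sh uw [z0 uz0 hz0]; apply: contrapT => no.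
have ind n : exists2 g, schur g & forall z, upper z -> h z = blaschke w z ^+ n * g z.
  elim: n => [|n [g sg hg]]; first by exists h => // z _; rewrite expr0 mul1r.
  have [gw|gw] := eqVneq (g w) 0; last by exfalso; apply: no; exists n, g.
  have [g' sg' hg'] := schwarz sg uw gw; exists g' => // z uz.
  by rewrite hg // hg' // exprSr mulrA.
have c0 : 0 < cmod (h z0) by rewrite cmod_gt0.
have [n hn] := pow_to0 (cmod_ge0 _) (blaschke_le1 uz0 uw) c0.
have [g [_ g1] hg] := ind n; move: hn; rewrite hg // cmodM cmodX ltNge => /negP; apply.
by rewrite ler_piMr ?exprn_ge0 ?cmod_ge0 // g1.
Qed.

Lemma near_neq0 f z : {for z, continuous f} -> f z != 0 -> \forall w \near z, f w != 0.
Proof.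
move=> /continuous_eps cf fz; have f0 : 0 < cmod (f z) by rewrite cmod_gt0.
have [r r0 hr] := cf _ f0.
apply/nearCP; exists r => // w /hr h; apply/eqP => E; move: h.
by rewrite E sub0r cmodN ltxx.
Qed.

Lemma schur_isolated h w : schur h -> upper w -> (exists2 z, upper z & h z != 0) ->
  \forall z \near w^', h z != 0.
Proof.
move=> sh uw hz; have [n [g [sg gw hg]]] := schur_factor sh uw hz.
have gn := near_neq0 (derivable_cont (schur_der sg uw)) gw.
have un : \forall z \near w, upper z by apply: open_nbhs_nbhs; split => //; exact: open_upper.
have nw : \forall z \near w^', z != w by apply/dnbhsCP; exists 1.
move: (dnearW gn) (dnearW un) nw; apply: filterS3 => z gz uz zw.
by rewrite hg // mulf_neq0 // expf_neq0 // blaschke_neq0.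
Qed.

End Consequences.

(** * Positivity of the Pick kernel *)

Section Forms.
Variable R : realType.
Local Notation C := (Cplx R).

Lemma cjD (x y : C) : (x + y)^* = x^* + y^*. Proof. exact: rmorphD. Qed.
Lemma cjB (x y : C) : (x - y)^* = x^* - y^*. Proof. exact: rmorphB. Qed.
Lemma cjM (x y : C) : (x * y)^* = x^* * y^*. Proof. exact: rmorphM. Qed.
Lemma cjN (x : C) : (- x)^* = - x^*. Proof. exact: rmorphN. Qed.
Lemma cjV (x : C) : (x^-1)^* = (x^*)^-1. Proof. exact: fmorphV. Qed.
Lemma cj1 : (1 : C)^* = 1. Proof. exact: rmorph1. Qed.
Lemma cj0 : (0 : C)^* = 0. Proof. exact: rmorph0. Qed.
Lemma cji : ('i : C)^* = - 'i. Proof. exact: conjCi. Qed.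
Lemma cj2 : (2 : C)^* = 2. Proof. exact: conjC_nat. Qed.
Lemma cjX (x : C) n : (x ^+ n)^* = x^* ^+ n. Proof. exact: rmorphXn. Qed.
Definition cjE := (cjD, cjB, cjM, cjN, cjV, cj1, cj0, cji, cj2, cjX, @conjCK C, @toCJ R).

(** The square norm that a reproducing kernel space assigns to the sum of the p.1 K(., p.2). *)
Definition qform (T : Type) (K : T -> T -> C) (s : seq (C * T)) : C :=
  \sum_(p <- s) \sum_(q <- s) p.1 * (q.1)^* * K q.2 p.2.

Definition psd (T : eqType) (D : set T) (K : T -> T -> C) :=
  forall s : seq (C * T), (forall p, p \in s -> D p.2) -> 0 <= qform K s.

Lemma sum_sq_ge0 (I : Type) (s : seq I) (A : I -> C) :
  0 <= \sum_(p <- s) \sum_(q <- s) A p * (A q)^*.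
Proof.
rewrite (eq_bigr (fun p => A p * (\sum_(q <- s) A q)^*)).
  by rewrite -mulr_suml mul_conjC_ge0.
by move=> p _; rewrite rmorph_sum mulr_sumr.
Qed.

Lemma cvg_sum_seq (I T : Type) (F : set_system T) (FF : Filter F) (s : seq I) (u : I -> T -> C) (l : I -> C) :
  (forall i, u i x @[x --> F] --> l i) -> (\sum_(i <- s) u i x) @[x --> F] --> \sum_(i <- s) l i.
Proof.
move=> h; elim: s => [|i s IH].
  rewrite big_nil (_ : (fun x => _) = (fun=> 0)); first exact: cvgCcst.
  by apply/funext => x; rewrite big_nil.
rewrite big_cons (_ : (fun x => _) = (fun x => u i x + \sum_(i <- s) u i x)); first exact: cvgCD (h i) IH.
by apply/funext => x; rewrite big_cons.
Qed.

Lemma ge0CP (z : C) : (0 <= z) = (imC z == 0) && (0 <= reC z).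
Proof. Transparent Cplx reC imC. by rewrite lecE. Opaque Cplx reC imC. Qed.

Lemma cvg_ge0C (T : Type) (F : set_system T) (FF : ProperFilter F) (f : T -> C) (l : C) :
  f x @[x --> F] --> l -> (\forall x \near F, 0 <= f x) -> 0 <= l.
Proof.
move=> fl f0; 
have hr : forall e : R, 0 < e -> \forall x \near F, `|reC (f x) - reC l| < e by apply/cvgRP; exact: cvg_reC.
have hi : forall e : R, 0 < e -> \forall x \near F, `|imC (f x) - imC l| < e by apply/cvgRP; exact: cvg_imC.
rewrite ge0CP; apply/andP; split.
  rewrite -normr_eq0 eq_le normr_ge0 andbT; apply/ler_addgt0Pl => e e0; rewrite addr0.
  have [x [/= h1]] := filter_ex (filterI (hi _ e0) f0).
  by rewrite ge0CP => /andP[/eqP h2 _]; move: h1; rewrite h2 sub0r normrN => /ltW.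
rewrite leNgt; apply/negP => l0; have e0 : 0 < - reC l by rewrite oppr_gt0.
have [x [/= h1]] := filter_ex (filterI (hr _ e0) f0).
rewrite ge0CP => /andP[_ h2]; move: h1; rewrite ltr_norml => /andP[_]; lra.
Qed.

Lemma qform_cvg (T I : Type) (F : set_system I) (FF : Filter F) (K : I -> T -> T -> C) (K0 : T -> T -> C)
   (s : seq (C * T)) : (forall x y, K i x y @[i --> F] --> K0 x y) ->
   qform (K i) s @[i --> F] --> qform K0 s.
Proof.
move=> h; rewrite /qform.
apply: (@cvg_sum_seq (C * T) I F FF s (fun p i => \sum_(q <- s) p.1 * (q.1)^* * K i q.2 p.2)) => p.
apply: (@cvg_sum_seq (C * T) I F FF s (fun q i => p.1 * (q.1)^* * K i q.2 p.2)) => q.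
by apply: cvgCM => //; exact: cvgCcst.
Qed.

Implicit Types (h g : C -> C) (z w u v : C).

Definition pk h z w : C := (1 - h z * (h w)^*) / (- 'i * (z - w^*)).

(* points (true, z) stand for the kernel function at z in the upper half-plane,
   points (false, u) for the difference quotient D_u h *)
Definition gk h (x y : bool * C) : C :=
  match x, y with
  | (true, z), (true, w) => pk h z w
  | (true, z), (false, u) => (h z - h u) / (z - u)
  | (false, u), (true, z) => ((h z - h u) / (z - u))^*
  | (false, u), (false, v) => pk h v u
  end.

Lemma i_neq0 : 'i != 0 :> C. Proof. exact: neq0Ci. Qed.

Lemma pk_conj h z w : (pk h z w)^* = pk h w z.
Proof.
rewrite /pk !cjE opprK [(h z)^* * _]mulrC.
by have -> : 'i * (z^* - w) = - 'i * (w - z^*) by ring.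
Qed.

Lemma imC_expr w : 2 * toC (imC w) = - 'i * (w - w^*).
Proof.
rewrite subCJ; have := sqrCi C => h2.
have -> : - 'i * (2 * 'i * toC (imC w)) = - ('i ^+ 2) * (2 * toC (imC w)) by ring.
by rewrite h2 opprK mul1r.
Qed.

(** The Pick kernel of a single Blaschke factor has rank one; this is the positive term split off in
    each step of the Schur algorithm. *)
Lemma step_blaschke w z z' : upper w -> upper z -> upper z' ->
  (1 - blaschke w z * (blaschke w z')^*) / (- 'i * (z - z'^*)) =
  2 * toC (imC w) / ((z - w^*) * (z' - w^*)^*).
Proof.
move=> uw uz uz'; have n1 := upper_conj_neq uz uw; have n2 := upper_conj_neq uz' uw.
have n3 := upper_conj_neq uz uz'.
have n2' : z'^* - w != 0 by rewrite -[w]conjCK -rmorphB conjC_eq0.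
rewrite imC_expr /blaschke !cjE.
have := i_neq0; move: n1 n2' n3; move: (z'^*) (w^*) => a b n1 n2' n3 i0.
have -> : 1 - (z - w) / (z - b) * ((a - b) / (a - w)) = (z - a) * (b - w) / ((z - b) * (a - w)).
  by field; rewrite n1 n2'.
rewrite [(- 'i * (z - a))^-1]invfM invrN invCi opprK.
by field; rewrite n1 n2' n3.
Qed.

(** * One step of the Schur algorithm on the block kernel *)

Section Step.
Variables (g ht : C -> C) (w : C).
Hypotheses (uw : upper w) (gw1 : cmod (g w) < 1)
  (g1 : forall z, upper z -> cmod (g z) < 1)
  (gE : forall z, upper z -> g z - g w = blaschke w z * (1 - (g w)^* * g z) * ht z).
Let k := g w.
Let al z := 1 - k^* * g z.
Let N : C := (1 - k * k^*)^-1.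

Let kk : 1 - k * k^* != 0.
Proof.
rewrite cmod_conj -toC1 -toCB toC_eq0 gt_eqF // subr_gt0.
by rewrite exprn_ilt1 ?cmod_ge0.
Qed.

Definition step_r (x : bool * C) : C :=
  if x.1 then al x.2 / (x.2 - w^*) else ('i * ht x.2 * al x.2 / (x.2 - w^*))^*.
Definition step_t (x : bool * C) : C :=
  if x.1 then al x.2 * blaschke w x.2 else (al x.2)^*.

Let pkE z z' : upper z -> upper z' ->
  pk g z z' = N * (2 * toC (imC w) * (al z / (z - w^*)) * (al z' / (z' - w^*))^*) +
    N * ((al z * blaschke w z) * (al z' * blaschke w z')^* * pk ht z z').
Proof.
move=> uz uz'.
have E := step_blaschke uw uz uz'.
have e1 : al z * blaschke w z * ht z = g z - k by rewrite (gE uz) /al -/k; ring.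
have e2 : (al z' * blaschke w z')^* * (ht z')^* = (g z' - k)^*.
  by rewrite -rmorphM (gE uz') /al -/k; congr (_ ^*); ring.
set D := - 'i * (z - z'^*) in E *.
have -> : 2 * toC (imC w) * (al z / (z - w^*)) * (al z' / (z' - w^*))^* =
    al z * (al z')^* * (2 * toC (imC w) / ((z - w^*) * (z' - w^*)^*)).
  rewrite cjM cjV invfM; ring.
rewrite -E /pk -/D.
have -> : al z * blaschke w z * (al z' * blaschke w z')^* * ((1 - ht z * (ht z')^*) / D) =
  (al z * (al z')^* * (blaschke w z * (blaschke w z')^*) -
    (al z * blaschke w z * ht z) * ((al z' * blaschke w z')^* * (ht z')^*)) / D.
  rewrite cjM; ring.
rewrite e1 e2 /N /al.
have -> : (1 - k^* * g z')^* = 1 - k * (g z')^* by rewrite !cjE.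
have -> : (g z' - k)^* = (g z')^* - k^* by rewrite cjB.
have := kk; move: (k^*) ((g z')^*) ((blaschke w z')^*) (D^-1) => ks gs bs Di k1.
by field.
Qed.

Let mixE z u : upper z -> upper u -> z != u ->
  (g z - g u) / (z - u) =
  N * (2 * toC (imC w) * (al z / (z - w^*)) * ('i * ht u * al u / (u - w^*))) +
  N * ((al z * blaschke w z) * al u * ((ht z - ht u) / (z - u))).
Proof.
move=> uz uu zu; have zu0 : z - u != 0 by rewrite subr_eq0.
have n1 := upper_conj_neq uz uw; have n2 := upper_conj_neq uu uw.
have e1 : al z * blaschke w z * ht z = g z - k by rewrite (gE uz) /al -/k; ring.
have e2 : al u * blaschke w u * ht u = g u - k by rewrite (gE uu) /al -/k; ring.
have i2 : 2 * toC (imC w) * 'i = w - w^*.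
  by rewrite imC_expr; have := sqrCi C => h2;
     rewrite (_ : - 'i * (w - w^*) * 'i = - 'i ^+ 2 * (w - w^*)); [rewrite h2 opprK mul1r|ring].
have -> : 2 * toC (imC w) * (al z / (z - w^*)) * ('i * ht u * al u / (u - w^*)) =
  2 * toC (imC w) * 'i * ((al z / (z - w^*)) * (ht u * al u / (u - w^*))) by ring.
rewrite i2.
have E : (w - w^*) * ((al z / (z - w^*)) * (ht u * al u / (u - w^*))) =
   (al z * al u * ht u * (blaschke w z - blaschke w u)) / (z - u).
  by rewrite /blaschke; field; rewrite n1 n2 zu0.
rewrite E.
have -> : al z * al u * ht u * (blaschke w z - blaschke w u) / (z - u) =
  (al z * al u * ht u * blaschke w z - al z * (al u * blaschke w u * ht u)) / (z - u) by ring.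
have -> : al z * blaschke w z * al u * ((ht z - ht u) / (z - u)) =
   ((al z * blaschke w z * ht z) * al u - al z * al u * ht u * blaschke w z) / (z - u) by ring.
rewrite e1 e2 -mulrDr -mulrDl /N /al.
have := kk; move: (k^*) => ks k1.
by field; rewrite k1 zu0.
Qed.

(** By [gE] the Möbius transform of [g] that sends g(w) to 0 is [blaschke w] times [ht]. Hence the
    kernel of [g] is a positive rank one kernel, built from [step_r], plus the kernel of [ht]
    multiplied by [step_t], and the same multipliers serve the entries with difference quotients.
    Mixed entries need distinct points, since the total quotient is 0, not the derivative, at equal
    points. *)
Lemma gk_step x y : upper x.2 -> upper y.2 ->
  (x.1 != y.1 -> x.2 != y.2) ->
  gk g x y = N * (2 * toC (imC w)) * (step_r x * (step_r y)^*) + N * (step_t x * (step_t y)^* * gk ht x y).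
Proof.
case: x y => [[] z] [[] u] /= uz uu zu; rewrite /step_r /step_t /=.
- by rewrite (pkE uz uu); ring.
- have {}zu := zu isT; rewrite (mixE uz uu zu) !conjCK; ring.
- have {}zu : u != z by rewrite eq_sym zu.
  have NJ : N^* = N by rewrite /N !cjE [k^* * _]mulrC.
  rewrite (mixE uu uz zu) cjD cjM [X in _ + X]cjM NJ !(cjM (2 * _ * _)) !(cjM (2 * _)) !(cjM 2) toCJ cj2.
  by rewrite !(cjM (_ * _ * _)) !(cjM (_ * _)); ring.
- rewrite (pkE uu uz) !conjCK.
  have E := step_blaschke uw uu uz; have i2 := sqrCi C.
  set D := - 'i * (u - z^*) in E *.
  set X := 2 * toC (imC w) / _ in E.
  have e1 : 2 * toC (imC w) * (al u / (u - w^*)) * (al z / (z - w^*))^* = X * (al u * (al z)^*).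
    by rewrite /X cjM cjV invfM; ring.
  have e2 : 2 * toC (imC w) * (('i * ht z * al z / (z - w^*))^* * ('i * ht u * al u / (u - w^*))) =
      X * (ht u * (ht z)^*) * (al u * (al z)^*).
    transitivity (- 'i ^+ 2 * (X * (ht u * (ht z)^*) * (al u * (al z)^*))); last by rewrite i2 opprK mul1r.
    by rewrite /X !cjM cji cjV invfM; ring.
  rewrite e1 -[N * (2 * _) * _]mulrA e2 /pk -/D cjM.
  apply/eqP; rewrite -subr_eq0; apply/eqP.
  transitivity (N * (al u * (al z)^*) * (1 - ht u * (ht z)^*) *
    (X - (1 - blaschke w u * (blaschke w z)^*) / D)); first by ring.
  by rewrite E subrr mulr0.
Qed.

Lemma step_N_ge0 : 0 <= N * (2 * toC (imC w)).
Proof.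
have h1 : 0 < 1 - cmod k ^+ 2 by rewrite subr_gt0 exprn_ilt1 ?cmod_ge0.
rewrite /N cmod_conj -toC1 -toCB -toCV; have -> : (2 : C) = toC 2 by rewrite -[2]/(1 + 1) toCD toC1.
by rewrite -!toCM toC_ge0 !mulr_ge0 ?invr_ge0 // ltW.
Qed.

Lemma step_N_ge0' : 0 <= N.
Proof.
have h1 : 0 < 1 - cmod k ^+ 2 by rewrite subr_gt0 exprn_ilt1 ?cmod_ge0.
by rewrite /N cmod_conj -toC1 -toCB -toCV toC_ge0 invr_ge0 ltW.
Qed.

Lemma step_t0 : step_t (true, w) = 0.
Proof. by rewrite /step_t /= /blaschke subrr mul0r mulr0. Qed.

(** [step_t] vanishes at [(true, w)], so this point drops out of the form for [ht]; this is how the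
    induction loses a point. *)
Lemma qform_step (s : seq (C * (bool * C))) :
  (forall p, p \in s -> upper p.2.2) ->
  (forall p q, p \in s -> q \in s -> p.2.1 != q.2.1 -> p.2.2 != q.2.2) ->
  0 <= qform (gk ht) [seq (p.1 * (step_t p.2)^*, p.2) | p <- s & p.2 != (true, w)] ->
  0 <= qform (gk g) s.
Proof.
move=> su sd; set s' := [seq _ | _ <- _ & _] => h.
have E : qform (gk g) s =
    N * (2 * toC (imC w)) * (\sum_(p <- s) \sum_(q <- s) (p.1 * (step_r p.2)^*) * (q.1 * (step_r q.2)^*)^*) +
    N * qform (gk ht) [seq (p.1 * (step_t p.2)^*, p.2) | p <- s].
  rewrite /qform big_map !mulr_sumr -big_split /=; apply: eq_big_seq => p ps.
  rewrite big_map !mulr_sumr -big_split /=; apply: eq_big_seq => q qs.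
  rewrite (gk_step (su _ qs) (su _ ps)); last by move=> ne; apply: sd.
  by rewrite !cjE; ring.
have E' : qform (gk ht) [seq (p.1 * (step_t p.2)^*, p.2) | p <- s] = qform (gk ht) s'.
  have Z (F : C * (bool * C) -> C) : (forall x, F (0, x) = 0) ->
      \sum_(p <- [seq (p.1 * (step_t p.2)^*, p.2) | p <- s]) F p = \sum_(p <- s') F p.
    move=> F0; rewrite !big_map big_filter [in RHS]big_mkcond /=; apply: eq_bigr => p _.
    by case: eqP => // ->; rewrite step_t0 cj0 mulr0 F0.
  rewrite /qform Z; last by move=> x /=; rewrite big1 // => q _; rewrite !mul0r.
  apply: eq_bigr => p _; rewrite (Z (fun q => p.1 * q.1^* * gk ht q.2 p.2)) //.
  by move=> x /=; rewrite cj0 mulr0 mul0r.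
rewrite E E'; apply: addr_ge0; apply: mulr_ge0 => //; [exact: step_N_ge0|exact: sum_sq_ge0|exact: step_N_ge0'].
Qed.

End Step.

Lemma schur_scale h (rho : R) : 0 <= rho -> rho <= 1 -> schur h -> schur (fun z => toC rho * h z).
Proof.
move=> r0 r1 sh; have [ha h1] := sh; split.
  apply: (analytic_derI (@open_upper R)) => z uz.
  by apply: derM; [exact: der_cst|exact: schur_der].
move=> z uz; rewrite cmodM cmod_toC ger0_norm //.
by apply: mulr_ile1; rewrite ?cmod_ge0 // h1.
Qed.

Lemma mobius_le (k x : C) : cmod k <= 1 -> cmod x <= 1 -> cmod (x - k) <= cmod (1 - k^* * x).
Proof.
move=> k1 x1; rewrite -(@ler_pXn2r _ 2) ?nnegrE ?cmod_ge0 // -le_toC -!cmod_conj.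
rewrite !cjE -subr_ge0.
have -> : (1 - k^* * x) * (1 - k * x^*) - (x - k) * (x^* - k^*) = (1 - x * x^*) * (1 - k * k^*) by ring.
by rewrite !cmod_conj -toC1 -!toCB -toCM toC_ge0 mulr_ge0 // subr_ge0 exprn_ile1 ?cmod_ge0.
Qed.

(** The factor rho < 1 keeps all values strictly inside the disc, so that the Möbius denominator
    cannot vanish, even when [h] is a unimodular constant. *)
Lemma schur_step h w (rho : R) : 0 <= rho -> rho < 1 -> schur h -> upper w ->
  exists2 ht, schur ht & forall z, upper z ->
   toC rho * h z - toC rho * h w = blaschke w z * (1 - (toC rho * h w)^* * (toC rho * h z)) * ht z.
Proof.
move=> r0 r1 sh uw; set k := toC rho * h w.
have [ga g1'] := schur_scale r0 (ltW r1) sh.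
have g1 z : upper z -> cmod (toC rho * h z) < 1.
  move=> uz; rewrite cmodM cmod_toC ger0_norm //.
  by have := (proj2 sh) z uz; have := cmod_ge0 (h z); move: (cmod (h z)) => m; nra.
have al0 z : upper z -> 1 - k^* * (toC rho * h z) != 0.
  move=> uz; apply/eqP => /eqP; rewrite subr_eq0 => /eqP/(congr1 (@cmod R)).
  rewrite cmod1 cmodM cmodJ => E; have := g1 _ uz; have := g1 _ uw; rewrite -/k.
  have := cmod_ge0 k; have := cmod_ge0 (toC rho * h z); move: E.
  by move: (cmod k) (cmod (toC rho * h z)) => a b; nra.
pose f z := (toC rho * h z - k) / (1 - k^* * (toC rho * h z)).
have sf : schur f.
  split.
    apply: (analytic_derI (@open_upper R)) => z uz.
    have d := analytic_derE ga uz.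
    apply: derDiv; [exact: al0|by apply: derB; [exact: d|exact: der_cst]|].
    by apply: derB; [exact: der_cst|apply: derM; [exact: der_cst|exact: d]].
  move=> z uz; rewrite /f cmodf ler_pdivrMr ?cmod_gt0 ?al0 // mul1r.
  exact: mobius_le (ltW (g1 _ uw)) (ltW (g1 _ uz)).
have fw : f w = 0 by rewrite /f subrr mul0r.
have [ht sht hE] := schwarz sf uw fw; exists ht => // z uz.
have := hE _ uz; rewrite /f => E.
have -> : toC rho * h z - k = (toC rho * h z - k) / (1 - k^* * (toC rho * h z)) * (1 - k^* * (toC rho * h z)).
  by rewrite divfK // al0.
by rewrite E; ring.
Qed.

Definition gvalid (s : seq (C * (bool * C))) :=
  (forall p, p \in s -> upper p.2.2) /\
  (forall p q, p \in s -> q \in s -> p.2.1 != q.2.1 -> p.2.2 != q.2.2).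

Lemma gk_scale_cvg h x y : gk (fun z => toC (1 - n.+2%:R^-1) * h z) x y @[n --> \oo] --> gk h x y.
Proof.
have c1 : toC (1 - n.+2%:R^-1 : R) @[n --> \oo] --> (1 : C).
  rewrite -toC1; apply: cvg_toC; rewrite -[X in _ --> X]subr0; apply: cvgB; first exact: cvg_cst.
  apply: (@cvg_comp _ _ _ succn (fun n => n.+1%:R^-1) _ \oo _ _ (@cvg_harmonic R)).
  by move=> A [N _ hN]; exists N => // n /= Nn; apply: hN => /=; exact: leq_trans Nn _.
have ch z : toC (1 - n.+2%:R^-1) * h z @[n --> \oo] --> h z.
  by rewrite -[X in _ --> X]mul1r; apply: cvgCM c1 _; exact: cvgCcst.
have cpk z u : pk (fun z => toC (1 - n.+2%:R^-1) * h z) z u @[n --> \oo] --> pk h z u.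
  apply: cvgCM; last exact: cvgCcst.
  apply: cvgCB; first exact: cvgCcst.
  exact: cvgCM (ch z) (cvgCJ (ch u)).
have cd z u : (toC (1 - n.+2%:R^-1) * h z - toC (1 - n.+2%:R^-1) * h u) / (z - u) @[n --> \oo] -->
     (h z - h u) / (z - u).
  by apply: cvgCM; [exact: cvgCB (ch z) (ch u)|exact: cvgCcst].
case: x y => [[] z] [[] u] /=; [exact: cpk|exact: cd|exact: cvgCJ (cd u z)|exact: cpk].
Qed.

Lemma count_lt (T : Type) (a b : pred T) (s : seq T) : (forall x, a x -> b x) ->
  has (fun x => b x && ~~ a x) s -> (count a s < count b s)%N.
Proof.
move=> ab; elim: s => //= x s IH /orP[/andP[-> /negPf ->]|/IH h].
  by rewrite add0n add1n ltnS; exact: sub_count.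
rewrite -addnS; apply: leq_add => //.
by case: (boolP (a x)) => // /ab ->.
Qed.

(** The induction is run twice. With [b] true all points are of the first kind and the base is the
    empty list; with [b] false the base consists of difference quotients only. Each step treats the
    scaled functions (1 - 1/(m+2)) h and lets m tend to infinity. *)
Lemma schur_ind (b : bool) :
  (forall h s, schur h -> gvalid s -> (b -> all (fun p => p.2.1) s) -> all (fun p => ~~ p.2.1) s ->
     0 <= qform (gk h) s) ->
  forall n h s, schur h -> gvalid s -> (b -> all (fun p => p.2.1) s) ->
    (count (fun p => p.2.1) s <= n)%N -> 0 <= qform (gk h) s.
Proof.
move=> base; elim=> [|n IH] h s sh sv bs.
  by rewrite leqn0 eqn0Ngt -has_count -all_predC => hs; exact: base.
case: (boolP (has (fun p : C * (bool * C) => p.2.1) s)); last first.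
  by rewrite -all_predC => hs _; exact: base.
case/hasP => -[c [b0 w]] /= ws b0t cn; rewrite b0t in ws.
have [su sd] := sv; have uw := su _ ws.
have step m : 0 <= qform (gk (fun z => toC (1 - m.+2%:R^-1) * h z)) s.
  have m0 : 0 < (m.+2%:R : R)^-1 by rewrite invr_gt0.
  have m1 : (m.+2%:R : R)^-1 <= 1 by rewrite invf_le1 // ler1n.
  have r0 : 0 <= 1 - (m.+2%:R : R)^-1 by rewrite subr_ge0.
  have r1 : 1 - (m.+2%:R : R)^-1 < 1 by rewrite gtrBl.
  have [ht sht hE] := schur_step r0 r1 sh uw.
  have gw1 : cmod (toC (1 - (m.+2%:R)^-1) * h w) < 1.
    rewrite cmodM cmod_toC ger0_norm //.
    have := (proj2 sh) w uw; have := cmod_ge0 (h w); move: (cmod (h w)) (1 - _) r0 r1 => k r; nra.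
  apply: (@qform_step (fun z => toC (1 - (m.+2%:R)^-1) * h z) ht w uw gw1 hE s su sd).
  apply: IH => //.
  - split=> [p|p q].
      by case/mapP => q; rewrite mem_filter => /andP[_ qs] ->; exact: (su _ qs).
    case/mapP => p'; rewrite mem_filter => /andP[_ ps] -> /mapP[q']; rewrite mem_filter => /andP[_ qs] ->.
    exact: (sd _ _ ps qs).
  - move=> hb; apply/allP => p /mapP[q]; rewrite mem_filter => /andP[_ qs] -> /=.
    by have /allP := bs hb; apply.
  - rewrite count_map count_filter -ltnS; apply: leq_trans cn.
    apply: count_lt => [p /andP[] //|]; apply/hasP; exists (c, (true, w)) => //=.
    by rewrite eqxx.
apply: (@cvg_ge0C nat \oo _ (fun m => qform (gk (fun z => toC (1 - m.+2%:R^-1) * h z)) s)).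
  by apply: qform_cvg => x y; exact: gk_scale_cvg.
by near=> m; exact: step.
Unshelve. all: by end_near. Qed.

Lemma pick_upper h s : schur h -> gvalid s -> all (fun p => p.2.1) s -> 0 <= qform (gk h) s.
Proof.
move=> sh sv sa; apply: (@schur_ind true _ (count (fun p => p.2.1) s)) => //.
move=> h' s' _ _ /(_ isT) a1 a2.
have -> : s' = [::] by case: s' a1 a2 => // p s' /= /andP[-> _] /andP[].
by rewrite /qform big_nil.
Qed.

(** When only difference quotients remain, their entries form the transposed Pick kernel;
    conjugating the coefficients reduces this base case to [pick_upper]. *)
Theorem pick h s : schur h -> gvalid s -> 0 <= qform (gk h) s.
Proof.
move=> sh sv; apply: (@schur_ind false _ (count (fun p => p.2.1) s)) => //.
clear; move=> h s sh sv _ a2; have [su sd] := sv.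
pose s' := [seq (p.1^*, (true, p.2.2)) | p <- s].
have -> : qform (gk h) s = qform (gk h) s'.
  rewrite /qform big_map exchange_big /=; apply: eq_big_seq => q qs.
  rewrite big_map; apply: eq_big_seq => p ps /=.
  move/allP: a2 => a2; have := a2 _ qs; have := a2 _ ps.
  case: p q {ps qs} => [c [b z]] [d [b' u]] /= /negPf -> /negPf ->.
  by rewrite conjCK [d^* * _]mulrC.
apply: pick_upper => //; last by apply/allP => p /mapP[q _ ->].
split=> [p /mapP[q qs ->]|p q /mapP[p' _ ->] /mapP[q' _ ->]] //=; exact: (su _ qs).
Qed.

End Forms.

(** * The extension of a Schur function *)

Section Extension.
Variable R : realType.
Local Notation C := (Cplx R).
Implicit Types (f g h : C -> C) (z w u v : C).

Lemma open_near (D : set C) z : open D -> D z -> \forall w \near z, D w.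
Proof. by move=> oD Dz; apply: open_nbhs_nbhs. Qed.

Lemma nonreal_cases z : nonreal z -> upper z \/ lower z.
Proof. by rewrite /nonreal /= neq_lt => /orP[]; [right|left]. Qed.

Lemma upperJ z : upper z -> lower z^*.
Proof. by rewrite /upper /lower /= imCJ oppr_lt0. Qed.
Lemma lowerJ z : lower z -> upper z^*.
Proof. by rewrite /upper /lower /= imCJ oppr_gt0. Qed.
Lemma upper_nonreal z : upper z -> nonreal z.
Proof. by move=> h; rewrite /nonreal /= gt_eqF. Qed.
Lemma lower_nonreal z : lower z -> nonreal z.
Proof. by move=> h; rewrite /nonreal /= lt_eqF. Qed.

Lemma real_conj z : imC z = 0 -> z^* = z.
Proof. by move=> h; apply: complexP; rewrite ?reCJ ?imCJ ?h ?oppr0. Qed.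

Lemma mero_ext_nonreal f z : nonreal z -> mero_ext f z = f z.
Proof. by rewrite /nonreal /mero_ext /= => /negPf ->. Qed.

Lemma within_nonreal_proper z : ProperFilter (within (@nonreal R) (nbhs z)).
Proof.
apply: Build_ProperFilter_ex => P; rewrite /within /= => /nbhsCP[e e0 hP].
have [zr|zr] := eqVneq (imC z) 0; last first.
  by exists z; apply: hP; rewrite ?subrr ?cmod0.
exists (z + 'i * toC (e / 2)); apply: hP.
  rewrite addrAC subrr add0r cmodM cmodi mul1r cmod_toC gtr0_norm ?divr_gt0 //; lra.
rewrite /nonreal /= imCD zr add0r imCM imCi reCi reC_toC mul0r add0r mul1r gt_eqF //.
by rewrite divr_gt0.
Qed.

Lemma lim_nonreal f g z : {for z, continuous g} -> (\forall w \near z, nonreal w -> f w = g w) ->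
  lim (f w @[w --> within (@nonreal R) (nbhs z)]) = g z.
Proof.
move=> /continuous_eps cg /nearCP[r r0 fg].
have PF := within_nonreal_proper z.
apply: limC_eq; apply/cvgCP => e /cg[d d0 hd].
apply/nbhsCP; exists (Num.min r d); first by rewrite lt_min r0.
move=> w; rewrite lt_min => /andP[wr wd] nw; rewrite fg //; exact: hd.
Qed.

(** Merges the two clauses of [Uext]: near real and nonreal points alike, [mero_ext f] is given by
    one differentiable function. *)
Lemma Uext_local f z : Uext f z -> exists2 e : R, 0 < e & exists g, forall w, cmod (w - z) < e ->
  [/\ Uext f w, mero_ext f w = g w & derivable g w 1].
Proof.
case=> [[nz fz]|[rz [a [b [az zb ex]]]]]; last case: ex => O [g [oO abO gO fg]].
  have /nearCP[r r0 hr] := analytic_at_near fz.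
  have /nearCP[s s0 hs] := open_near (@open_nonreal R) nz.
  exists (Num.min r s); first by rewrite lt_min r0.
  exists f => w; rewrite lt_min => /andP[wr ws].
  split; [by left; split; [exact: hs|exact: hr]|exact: mero_ext_nonreal (hs _ ws)|].
  by apply: analytic_at_der; exact: hr.
have Oz : O z.
  have -> : z = (reC z)%:C%C by apply: complexP; [rewrite -[RHS]/(reC (toC (reC z))) reC_toC|rewrite -[RHS]/(imC (toC (reC z))) imC_toC].
  by apply: abO; rewrite az.
have /openCP/(_ _ Oz)[r r0 hr] := oO.
pose e := Num.min r (Num.min (reC z - a) (b - reC z)).
exists e; first by rewrite !lt_min r0 !subr_gt0 az.
exists g => w; rewrite !lt_min => /andP[wr /andP[wa wb]].
have Ow := hr _ wr; have gw := gO _ Ow.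
have := re_le_cmod (w - z); rewrite reCB ler_norml => /andP[k1 k2].
split; last exact: analytic_at_der.
  have [rw|nw] := eqVneq (imC w) 0.
    right; split => //; exists a, b; split; [lra|lra|].
    by exists O, g.
  left; split; first exact: nw.
  apply: (analytic_near_eq _ gw); have n1 := open_near (@open_nonreal R) nw.
  by move: n1 (open_near oO Ow); apply: filterS2 => t nt Ot; exact: fg.
have [rw|nw] := eqVneq (imC w) 0; last by rewrite mero_ext_nonreal // fg.
rewrite /mero_ext rw eqxx; apply: lim_nonreal; first exact: analytic_cont.
by move: (open_near oO Ow); apply: filterS => t Ot nt; rewrite fg.
Qed.

Lemma open_Uext f : open (Uext f).
Proof.
apply/openCP => z /Uext_local[e e0 [g hg]]; exists e => // w /hg[]//.
Qed.

Lemma mero_ext_an f : analytic_on (Uext f) (mero_ext f).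
Proof.
apply: (analytic_derI (@open_Uext f)) => z /Uext_local[e e0 [g hg]].
have [|_ _ gd] := hg z; first by rewrite subrr cmod0.
apply: (derivable_near_eq _ gd).1; apply/nearCP; exists e => // w /hg[] //.
Qed.

(** The extension by 1/SR(h). At a pole the total inverse returns 0, and [rext_nan] shows that such
    a point is not taken for a point of analyticity. Real values carry no information, since
    [mero_ext] takes limits from nonreal points there. *)
Definition rext h z : C := if 0 < imC z then h z else ((h z^*)^*)^-1.

Lemma rext_up h z : upper z -> rext h z = h z.
Proof. by rewrite /upper /= /rext => ->. Qed.
Lemma rext_low h z : lower z -> rext h z = ((h z^*)^*)^-1.
Proof. by move=> lz; rewrite /rext ltNge (ltW (lz : imC z < 0)). Qed.

(** * The kernel of a nonzero Schur function on its extended domain *)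

Section Schur.
Variable h : C -> C.
Hypotheses (sh : schur h) (hnz : exists2 z, upper z & h z != 0).
Let H := rext h.
Let M := mero_ext H.
Let E := Uext H.

Lemma rext_an_up z : upper z -> analytic_at H z.
Proof.
move=> uz; apply: (analytic_near_eq _ (proj1 sh z uz)).
by have := open_near (@open_upper R) uz; apply: filterS => w uw; rewrite /H rext_up.
Qed.

Lemma rext_an_low z : lower z -> h z^* != 0 -> analytic_at H z.
Proof.
move=> lz hz; pose g w : C := ((h w^*)^*)^-1.
have uz := lowerJ lz.
have g_an : analytic_at g z.
  have n1 := near_conj (near_neq0 (derivable_cont (schur_der sh uz)) hz).
  have n2 := open_near (@open_lower R) lz.
  move: n1 n2; apply: filterS2 => w hw lw; apply: (@derV _ (fun w => (h w^*)^*)).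
    by rewrite conjC_eq0.
  by apply: derivable_conj; apply: schur_der => //; exact: lowerJ.
apply: (analytic_near_eq _ g_an).
by have := open_near (@open_lower R) lz; apply: filterS => w uw; rewrite /H rext_low.
Qed.

(** The product of the extension with the reflected function is 1 near [z] except at [z], since
    zeros are isolated; continuity at [z] would give 0 = 1. *)
Lemma rext_nan z : lower z -> h z^* = 0 -> ~ analytic_at H z.
Proof.
move=> lz hz Hz; have uz := lowerJ lz.
have ch := derivable_cont (derivable_conj (schur_der sh uz)).
have cH := analytic_cont Hz.
have n1 := dnear_conj (schur_isolated sh uz hnz).
have n2 := dnearW (open_near (@open_lower R) lz).
have := @cont_eq_dnear _ (fun w => H w * (h w^*)^*) (fun=> 1) z (continuousM cH ch).
rewrite /= hz conjC0 mulr0 => /(_ (derivable_cont (@der_cst R 1 z))) k.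
have : 0 = 1 :> C.
  apply: k; move: n1 n2; apply: filterS2 => w hw lw.
  by rewrite /H rext_low // mulVf // conjC_eq0.
by move/eqP; rewrite eq_sym oner_eq0.
Qed.

Lemma E_up z : upper z -> E z.
Proof. by move=> uz; left; split; [exact: upper_nonreal|exact: rext_an_up]. Qed.

Lemma E_low z : lower z -> E z <-> h z^* != 0.
Proof.
move=> lz; split=> [|hz]; last by left; split; [exact: lower_nonreal|exact: rext_an_low].
case=> [[_ Hz]|[rz _]]; last by move: lz; rewrite /lower /= rz ltxx.
by apply/eqP => hz; exact: (rext_nan lz hz).
Qed.

Lemma M_up z : upper z -> M z = h z.
Proof. by move=> uz; rewrite /M mero_ext_nonreal ?/H ?rext_up //; exact: upper_nonreal. Qed.

Lemma M_low z : lower z -> M z = ((h z^*)^*)^-1.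
Proof. by move=> uz; rewrite /M mero_ext_nonreal ?/H ?rext_low //; exact: lower_nonreal. Qed.

Lemma M_der z : E z -> derivable M z 1.
Proof. exact: analytic_derE (@mero_ext_an H). Qed.

Lemma M_cont z : E z -> {for z, continuous M}.
Proof. by move/M_der/derivable_cont. Qed.

Lemma MMJ_nonreal z : nonreal z -> E z -> E z^* -> M z * (M z^*)^* = 1.
Proof.
move=> /nonreal_cases[uz|lz] Ez Ez'.
  have hz : h z != 0 by have /E_low := upperJ uz; rewrite conjCK => k; exact/k.
  by rewrite M_up // M_low ?conjCK ?cjV ?conjCK ?mulfV //; exact: upperJ.
have hz : h z^* != 0 by exact/(E_low lz).
by rewrite M_low // (M_up (lowerJ lz)) mulVf // conjC_eq0.
Qed.

(** Adding it to all points moves real points off the real line and, because (z + shift) - conj (w +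
    shift) = z - conj w + 2 shift, also separates the pairs with z = conj w. *)
Definition shift (n : nat) : C := 'i * toC (n.+1%:R^-1).

Lemma imC_shift n : imC (shift n) = n.+1%:R^-1.
Proof. by rewrite /shift imCM imCi reCi reC_toC mul0r add0r mul1r. Qed.
Lemma shiftJ n : (shift n)^* = - shift n.
Proof. by rewrite /shift !cjE mulNr. Qed.
Lemma shift_neq0 n : shift n != 0.
Proof. by rewrite mulf_neq0 ?i_neq0 // toC_eq0 invr_eq0 pnatr_eq0. Qed.

Lemma shift_cvg : shift n @[n --> \oo] --> (0 : C).
Proof.
rewrite -[X in _ --> X](mulr0 'i) -toC0; apply: cvgCM; first exact: cvgCcst.
by apply: cvg_toC; exact: cvg_harmonic.
Qed.

Lemma shiftD z : z + shift n @[n --> \oo] --> z.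
Proof. by rewrite -[X in _ --> X]addr0; apply: cvgCD; [exact: cvgCcst|exact: shift_cvg]. Qed.
Lemma shiftB z : z - shift n @[n --> \oo] --> z.
Proof. by rewrite -[X in _ --> X]subr0; apply: cvgCB; [exact: cvgCcst|exact: shift_cvg]. Qed.

Lemma cvg_near (P : C -> Prop) z (u : nat -> C) : u n @[n --> \oo] --> z -> (\forall w \near z, P w) ->
  \forall n \near \oo, P (u n).
Proof. by move=> uz Pz; exact: (uz P Pz). Qed.

Lemma near_E z : E z -> \forall w \near z, E w.
Proof. exact: open_near (@open_Uext H). Qed.

Lemma shift_nonreal z : \forall n \near \oo, nonreal (z + shift n).
Proof.
have [rz|nz] := eqVneq (imC z) 0.
  by near=> n; rewrite /nonreal /= imCD rz add0r imC_shift invr_eq0 pnatr_eq0.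
exact: (cvg_near (@shiftD z) (open_near (@open_nonreal R) nz)).
Unshelve. all: by end_near. Qed.

Lemma MMJ z : E z -> E z^* -> M z * (M z^*)^* = 1.
Proof.
have [rz|nz] := eqVneq (imC z) 0; last exact: MMJ_nonreal.
move=> Ez Ez'.
apply: (@cvgC_unique R nat \oo _ (fun n => M (z + shift n) * (M (z + shift n)^*)^*)).
  apply: cvgCM; first exact: cvg_cont _ (M_cont Ez) (@shiftD z).
  by apply: cvgCJ; apply: cvg_cont _ (M_cont Ez') _; apply: cvgCJ; exact: shiftD.
apply: (@cvgC_near_eq R nat \oo _ _ (fun=> 1)); last exact: cvgCcst.
have n1 := @shift_nonreal z; have n2 := cvg_near (@shiftD z) (near_E Ez).
have n3 : \forall n \near \oo, E (z + shift n)^*.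
  by apply: (@cvg_near _ z^* (fun n => (z + shift n)^*) _ (near_E Ez')); apply: cvgCJ; exact: shiftD.
by move: n1 n2 n3; apply: filterS3 => n; exact: MMJ_nonreal.
Qed.

(** A nonreal point of the domain has its reflection outside the domain only if it is an upper zero
    of [h], where the reflected point is a pole. *)
Lemma E_conj z : E z -> M z != 0 -> E z^*.
Proof.
move=> Ez; have [rz|nz] := eqVneq (imC z) 0; first by rewrite real_conj.
case: (nonreal_cases nz) => [uz|lz] Mz; last exact: E_up (lowerJ lz).
by apply/(E_low (upperJ uz)); rewrite conjCK -M_up.
Qed.

Lemma M_neq0 z : E z -> E z^* -> M z != 0.
Proof.
move=> Ez Ez'; apply/eqP => M0; have := MMJ Ez Ez'; rewrite M0 mul0r.
by move/eqP; rewrite eq_sym oner_eq0.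
Qed.

Lemma MJE z : E z -> E z^* -> (M z^*)^* = (M z)^-1.
Proof.
by move=> Ez Ez'; apply: (mulfI (M_neq0 Ez Ez')); rewrite MMJ // mulfV // M_neq0.
Qed.

Let K := skernel H.

Lemma skern_off z w : z != w^* -> K z w = pk M z w.
Proof. by move=> /negPf zw; rewrite /K /skernel zw. Qed.

(** Replacing the 1 of the numerator by M(conj w) conj(M(w)), which equals it by [MMJ], exhibits a
    difference quotient at conj w; this form still makes sense on z = conj w. *)
Lemma pk_dd z w : E w -> E w^* -> z != w^* -> pk M z w = - 'i * (M w)^* * dd M w^* z.
Proof.
move=> Ew Ew' zw; have zw0 : z - w^* != 0 by rewrite subr_eq0.
have E1 : M w^* * (M w)^* = 1 by have := MMJ Ew' ; rewrite conjCK; apply.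
rewrite /pk /dd (negPf zw) -E1 -mulrBl invfM invrN invCi opprK; ring.
Qed.

Lemma skern_on z w : E z -> E w -> z = w^* -> K z w = - 'i * (M w)^* * dd M w^* z.
Proof.
move=> Ez Ew zw; have Ew' : E w^* by rewrite -zw.
rewrite zw /K /skernel eqxx.
have PF : ProperFilter (w^*)^' by exact: dnbhs_proper.
apply: limC_eq.
have c1 : dd M w^* t @[t --> (w^*)^'] --> dd M w^* w^*.
  apply: cvg_trans (dd_continuous (M_der Ew')).
  by apply: cvg_app; exact: cvg_within.
have c2 : - 'i * (M w)^* * dd M w^* t @[t --> (w^*)^'] --> - 'i * (M w)^* * dd M w^* w^*.
  by apply: cvgCM c1; exact: cvgCcst.
apply: (@cvgC_near_eq R C (w^*)^' _ _ _ _ _ c2).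
apply/dnbhsCP; exists 1; first exact: ltr01.
by move=> t tz _; rewrite -(pk_dd Ew Ew').
Qed.

Lemma skern_dd z w : E z -> E w -> E w^* -> K z w = - 'i * (M w)^* * dd M w^* z.
Proof.
move=> Ez Ew Ew'; have [zw|zw] := eqVneq z w^*; first exact: skern_on.
by rewrite skern_off // pk_dd.
Qed.

(** The form of the kernel formula without denominators. It includes z = conj w, where both sides
    vanish, and is what later computations with kernel values use. *)
Lemma skern_rel z w : E z -> E w -> (z - w^*) * K z w = 'i * (1 - M z * (M w)^*).
Proof.
move=> Ez Ew; have [zw|zw] := eqVneq z w^*.
  rewrite zw subrr mul0r; have := Ez; rewrite zw => Ew'.
  by have := MMJ Ew' ; rewrite conjCK => -> //; rewrite subrr mulr0.
have zw0 : z - w^* != 0 by rewrite subr_eq0.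
rewrite skern_off // /pk invfM invrN invCi opprK.
by field.
Qed.

(** On z = conj w, the shifted points satisfy w + shift = conj (z - shift). Then [MJE] turns the
    kernel into a multiple of the mean of the difference quotients of M at z + shift and z - shift,
    and both tend to the derivative. *)
Lemma skern_shift z w : E z -> E w -> pk M (z + shift n) (w + shift n) @[n --> \oo] --> K z w.
Proof.
move=> Ez Ew.
have cz : M (z + shift n) @[n --> \oo] --> M z by exact: cvg_cont _ (M_cont Ez) (@shiftD z).
have cw : M (w + shift n) @[n --> \oo] --> M w by exact: cvg_cont _ (M_cont Ew) (@shiftD w).
have [zw|zw] := eqVneq z w^*; last first.
  have zw0 : z - w^* != 0 by rewrite subr_eq0.
  have n0 : - 'i * (z - w^*) != 0 by rewrite mulf_neq0 // oppr_eq0 i_neq0.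
  have a1 : 1 - M (z + shift n) * (M (w + shift n))^* @[n --> \oo] --> 1 - M z * (M w)^*.
    by apply: cvgCB; [exact: cvgCcst|apply: cvgCM cz _; exact: cvgCJ].
  have a2 : - 'i * (z + shift n - (w + shift n)^*) @[n --> \oo] --> - 'i * (z - w^*).
    apply: cvgCM; first exact: cvgCcst.
    by apply: cvgCB (@shiftD z) _; apply: cvgCJ; exact: shiftD.
  by rewrite (skern_off zw); exact: (cvgCdiv n0 a1 a2).
rewrite (skern_on Ez Ew zw) -zw.
have Ew' : E w^* by rewrite -zw.
have dz := M_der Ez.
have d1 : dd M z (z + shift n) @[n --> \oo] --> dd M z z.
  exact: cvg_cont _ (dd_continuous dz) (@shiftD z).
have d2 : dd M z (z - shift n) @[n --> \oo] --> dd M z z.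
  exact: cvg_cont _ (dd_continuous dz) (@shiftB z).
have L : - 'i * (M (w + shift n))^* * ((dd M z (z + shift n) + dd M z (z - shift n)) / 2)
     @[n --> \oo] --> - 'i * (M w)^* * ((dd M z z + dd M z z) / 2).
  apply: cvgCM; first by apply: cvgCM; [exact: cvgCcst|exact: cvgCJ].
  by apply: cvgCM; [exact: cvgCD|exact: cvgCcst].
have -> : dd M z z = (dd M z z + dd M z z) / 2 by field.
apply: cvgC_near_eq L.
have n1 := cvg_near (@shiftB z) (near_E Ez).
have n2 := cvg_near (@shiftD w) (near_E Ew).
have n2' : \forall n \near \oo, E (z - shift n)^*.
  by move: n2; apply: filterS => n; rewrite zw cjB conjCK shiftJ opprK.
move: n1 n2'; apply: filterS2 => n e1 e2.
have J : (w + shift n) = (z - shift n)^* by rewrite zw cjB conjCK shiftJ opprK.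
have s0 := shift_neq0 n; have i0 := @i_neq0 R.
rewrite J MJE // /pk conjCK -J.
have M0 : M (z - shift n) != 0 by exact: M_neq0.
have -> : (M (w + shift n))^* = (M (z - shift n))^-1 by rewrite J MJE.
have A1 : M (z + shift n) = M z + dd M z (z + shift n) * shift n.
  by rewrite {1}(ddE M z (z + shift n)) addrAC subrr add0r.
have A2 : M (z - shift n) = M z - dd M z (z - shift n) * shift n.
  by rewrite {1}(ddE M z (z - shift n)) addrAC subrr add0r mulrN.
have -> : z + shift n - (z - shift n) = 2 * shift n by ring.
have -> : 1 - M (z + shift n) / M (z - shift n) =
   - (dd M z (z + shift n) + dd M z (z - shift n)) * shift n / M (z - shift n).
  rewrite -[X in X - _](mulfV M0) -mulrBl; congr (_ / _).
  by rewrite A1 {1}A2; ring.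
by rewrite invfM invrN invCi opprK; field; rewrite M0.
Qed.

Lemma skern_conj z w : E z -> E w -> (K z w)^* = K w z.
Proof.
move=> Ez Ew; apply: (@cvgC_unique R nat \oo _ (fun n => pk M (w + shift n) (z + shift n))).
  have -> : (fun n => pk M (w + shift n) (z + shift n)) = (fun n => (pk M (z + shift n) (w + shift n))^*).
    by apply/funext => n; rewrite pk_conj.
  by apply: cvgCJ; exact: skern_shift.
exact: skern_shift.
Qed.

Lemma near_seq (I : eqType) (s : seq I) (P : I -> nat -> Prop) :
  (forall p, p \in s -> \forall n \near \oo, P p n) -> \forall n \near \oo, forall p, p \in s -> P p n.
Proof.
elim: s => [|x s IH] hs; first by near=> n.
have h1 : \forall n \near \oo, P x n by apply: hs; rewrite inE eqxx.
have h2 : \forall n \near \oo, forall p, p \in s -> P p n.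
  by apply: IH => p ps; apply: hs; rewrite inE ps orbT.
move: h1 h2; apply: filterS2 => n h1 h2 p; rewrite inE => /orP[/eqP ->//|]; exact: h2.
Unshelve. all: by end_near. Qed.

(** The kernel function at a lower point p is the difference quotient of [h] at conj p divided by i
    h(conj p); [tr] moves that factor into the coefficient and reduces the claim to [pick]. The
    hypothesis on pairs excludes coinciding points in the mixed entries. *)
Lemma psd_generic (s : seq (C * C)) : (forall p, p \in s -> nonreal p.2 /\ E p.2) ->
  (forall p q, p \in s -> q \in s -> p.2 != (q.2)^*) -> 0 <= qform (pk M) s.
Proof.
move=> sE sg.
pose tr (p : C * C) : C * (bool * C) := if 0 < imC p.2 then (p.1, (true, p.2))
  else (p.1 / ('i * h (p.2)^*), (false, (p.2)^*)).
have lowE p : p \in s -> ~~ (0 < imC p.2) -> lower p.2 /\ h (p.2)^* != 0.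
  move=> ps up; have [np Ep] := sE _ ps.
  have lp : lower p.2 by case: (nonreal_cases np) => // k; rewrite k in up.
  by split => //; exact/(E_low lp).
have -> : qform (pk M) s = qform (gk h) [seq tr p | p <- s].
  rewrite /qform big_map; apply: eq_big_seq => p ps; rewrite big_map; apply: eq_big_seq => q qs.
  have pq := sg _ _ ps qs; have qp := sg _ _ qs ps.
  have i0 := @i_neq0 R.
  rewrite /tr; case: ifPn => up; case: ifPn => uq /=.
  - by rewrite /pk !M_up.
  - have [lq hq] := lowE _ qs uq; rewrite /pk (M_low lq) (M_up up).
    have hqJ : (h (q.2)^*)^* != 0 by rewrite conjC_eq0.
    have n0 : q.2 - (p.2)^* != 0 by rewrite subr_eq0.
    rewrite !cjE.
    have -> : (- 'i * (q.2 - (p.2)^*))^-1 = 'i / (q.2 - (p.2)^*) by rewrite invfM invrN invCi opprK.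
    have -> : (- 'i * (h (q.2)^*)^*)^-1 = 'i / (h (q.2)^*)^* by rewrite invfM invrN invCi opprK.
    have n1 : (p.2)^* - q.2 != 0 by rewrite -opprB oppr_eq0.
    by field; rewrite n0 n1 hqJ.
  - have [lp hp] := lowE _ ps up; rewrite /pk (M_low lp) (M_up uq).
    have n0 : q.2 - (p.2)^* != 0 by rewrite subr_eq0.
    rewrite !cjE.
    have -> : (- 'i * (q.2 - (p.2)^*))^-1 = 'i / (q.2 - (p.2)^*) by rewrite invfM invrN invCi opprK.
    have -> : ('i * h (p.2)^*)^-1 = - 'i / h (p.2)^* by rewrite invfM invCi.
    by field; rewrite n0 hp.
  - have [lp hp] := lowE _ ps up; have [lq hq] := lowE _ qs uq; rewrite /pk (M_low lp) (M_low lq).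
    have hqJ : (h (q.2)^*)^* != 0 by rewrite conjC_eq0.
    have n0 : q.2 - (p.2)^* != 0 by rewrite subr_eq0.
    have n1 : (p.2)^* - q.2 != 0 by rewrite -opprB oppr_eq0.
    rewrite !cjE.
    have -> : (- 'i * (q.2 - (p.2)^*))^-1 = 'i / (q.2 - (p.2)^*) by rewrite invfM invrN invCi opprK.
    have -> : (- 'i * ((p.2)^* - q.2))^-1 = 'i / ((p.2)^* - q.2) by rewrite invfM invrN invCi opprK.
    have -> : ('i * h (p.2)^*)^-1 = - 'i / h (p.2)^* by rewrite invfM invCi.
    have -> : (- 'i * (h (q.2)^*)^*)^-1 = 'i / (h (q.2)^*)^* by rewrite invfM invrN invCi opprK.
    have i2 := sqrCi C.
    transitivity (- 'i ^+ 2 * (p.1 * (q.1)^* * ((1 - (((h (q.2)^*)^*)^-1 * (h (p.2)^*)^-1)) * ('i / (q.2 - (p.2)^*))))).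
      by rewrite i2 opprK mul1r.
    by field; rewrite n0 n1 hqJ hp.
apply: pick => //; split=> [p' /mapP[p ps ->]|p' q' /mapP[p ps ->] /mapP[q qs ->]].
  rewrite /tr; case: ifPn => up //=; exact: lowerJ (lowE _ ps up).1.
have pq := sg _ _ ps qs; have qp := sg _ _ qs ps.
rewrite /tr; case: ifPn => up; case: ifPn => uq //= _.
by rewrite eq_sym.
Qed.

Lemma cvg_sum_in (I : eqType) (T : Type) (F : set_system T) (FF : Filter F) (s : seq I) (u : T -> I -> C) (l : I -> C) :
  (forall i, i \in s -> u x i @[x --> F] --> l i) -> (\sum_(i <- s) u x i) @[x --> F] --> \sum_(i <- s) l i.
Proof.
elim: s => [|i s IH] hs.
  rewrite big_nil (_ : (fun x => _) = (fun=> 0)); first exact: cvgCcst.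
  by apply/funext => x; rewrite big_nil.
rewrite big_cons (_ : (fun x => _) = (fun x => u x i + \sum_(i <- s) u x i)).
  by apply: cvgCD; [apply: hs; rewrite inE eqxx|apply: IH => j js; apply: hs; rewrite inE js orbT].
by apply/funext => x; rewrite big_cons.
Qed.

(** Shifting all points by the same vertical amount eventually makes every finite configuration
    generic, and the form passes to the limit by [skern_shift]. *)
Theorem skern_psd : psd E K.
Proof.
move=> s sE.
have n1 : \forall n \near \oo, forall p, p \in s -> nonreal (p.2 + shift n) /\ E (p.2 + shift n).
  apply: near_seq => p ps; move: (@shift_nonreal p.2) (cvg_near (@shiftD p.2) (near_E (sE _ ps))).
  by apply: filterS2.
have n2 : \forall n \near \oo, forall p, p \in s -> forall q, q \in s -> p.2 + shift n != (q.2 + shift n)^*.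
  apply: near_seq => p ps; apply: near_seq => q qs.
  have [E1|ne] := eqVneq p.2 (q.2)^*.
    near=> n; rewrite cjD shiftJ E1 -subr_eq0 opprD addrACA subrr add0r opprK.
    by rewrite -mulr2n mulrn_eq0 shift_neq0.
  have c : p.2 + shift n - (q.2 + shift n)^* @[n --> \oo] --> p.2 - (q.2)^*.
    by apply: cvgCB; [exact: shiftD|apply: cvgCJ; exact: shiftD].
  have n0 : p.2 - (q.2)^* != 0 by rewrite subr_eq0.
  have := cvg_near c (near_neq0 (f := fun x : C => x) (derivable_cont (@der_id R _)) n0).
  by apply: filterS => n; rewrite subr_eq0.
have key : forall n, (forall p, p \in s -> nonreal (p.2 + shift n) /\ E (p.2 + shift n)) ->
    (forall p, p \in s -> forall q, q \in s -> p.2 + shift n != (q.2 + shift n)^*) ->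
    0 <= \sum_(p <- s) \sum_(q <- s) p.1 * (q.1)^* * pk M (q.2 + shift n) (p.2 + shift n).
  move=> n h1 h2; have := @psd_generic [seq (p.1, p.2 + shift n) | p <- s].
  rewrite /qform big_map (eq_bigr (fun p => \sum_(q <- s) p.1 * (q.1)^* * pk M (q.2 + shift n) (p.2 + shift n))).
    apply=> [p /mapP[q qs ->]|p q /mapP[p' ps ->] /mapP[q' qs ->]] /=; [exact: h1|exact: h2].
  by move=> p _; rewrite big_map.
have c : \sum_(p <- s) \sum_(q <- s) p.1 * (q.1)^* * pk M (q.2 + shift n) (p.2 + shift n) @[n --> \oo] --> qform K s.
  apply: cvg_sum_in => p ps; apply: cvg_sum_in => q qs.
  by apply: cvgCM; [exact: cvgCcst|apply: skern_shift; exact: sE].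
apply: (@cvg_ge0C R nat \oo _ _ _ c); move: n1 n2; apply: filterS2 => n; exact: key.
Unshelve. all: by end_near. Qed.

End Schur.
End Extension.

(** * Pre-Hilbert spaces and their completion *)

Section InnerProducts.
Variables (R : realType) (V : lmodType (Cplx R)).
Local Notation C := (Cplx R).
Implicit Types (a : C) (x y z : V).

Definition pre_hilbert (X : inner_space V) :=
  is_inner X /\ forall x, X x -> 0 <= iprod X x x.

Section Pre.
Variable X : inner_space V.
Hypothesis pX : pre_hilbert X.
Local Notation "[ x , y ]" := (iprod X x y) (at level 0).

Lemma pre0 : X 0. Proof. by case: pX => -[]. Qed.
Lemma preL a x y : X x -> X y -> X (a *: x + y). Proof. by case: pX => -[_ h _ _] _; exact: h. Qed.
Lemma preD x y : X x -> X y -> X (x + y).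
Proof. by move=> hx hy; rewrite -[x]scale1r; exact: preL. Qed.
Lemma preZ a x : X x -> X (a *: x).
Proof. by move=> hx; rewrite -[_ *: _]addr0; apply: preL => //; exact: pre0. Qed.
Lemma preN x : X x -> X (- x).
Proof. by move=> hx; rewrite -scaleN1r; exact: preZ. Qed.
Lemma preB x y : X x -> X y -> X (x - y).
Proof. by move=> hx hy; apply: preD => //; exact: preN. Qed.

Lemma ipL a x y z : X x -> X y -> X z -> [a *: x + y, z] = a * [x, z] + [y, z].
Proof. by case: pX => -[_ _ h _] _; exact: h. Qed.
Lemma ipC x y : X x -> X y -> [y, x] = [x, y]^*.
Proof. by case: pX => -[_ _ _ h] _; exact: h. Qed.
Lemma ip_ge0 x : X x -> 0 <= [x, x]. Proof. by case: pX => _; exact. Qed.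

Lemma ipDl x y z : X x -> X y -> X z -> [x + y, z] = [x, z] + [y, z].
Proof. by move=> hx hy hz; rewrite -[x]scale1r ipL // mul1r scale1r. Qed.
Lemma ip0l z : X z -> [0, z] = 0.
Proof.
move=> hz; apply: (addrI [0, z]); rewrite -ipDl ?addr0 //; exact: pre0.
Qed.
Lemma ipZl a x z : X x -> X z -> [a *: x, z] = a * [x, z].
Proof. by move=> hx hz; rewrite -[_ *: _]addr0 ipL ?ip0l ?addr0 //; exact: pre0. Qed.
Lemma ipNl x z : X x -> X z -> [- x, z] = - [x, z].
Proof. by move=> hx hz; rewrite -scaleN1r ipZl // mulN1r. Qed.
Lemma ipBl x y z : X x -> X y -> X z -> [x - y, z] = [x, z] - [y, z].
Proof. by move=> hx hy hz; rewrite ipDl ?ipNl //; exact: preN. Qed.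
Lemma ipDr x y z : X x -> X y -> X z -> [z, x + y] = [z, x] + [z, y].
Proof.
by move=> hx hy hz; rewrite (ipC (preD hx hy) hz) ipDl // cjD -!ipC.
Qed.
Lemma ipZr a x z : X x -> X z -> [z, a *: x] = a^* * [z, x].
Proof. by move=> hx hz; rewrite (ipC (preZ a hx) hz) ipZl // cjM -ipC. Qed.
Lemma ipNr x z : X x -> X z -> [z, - x] = - [z, x].
Proof. by move=> hx hz; rewrite (ipC (preN hx) hz) ipNl // cjN -ipC. Qed.
Lemma ip0r z : X z -> [z, 0] = 0.
Proof. by move=> hz; rewrite (ipC pre0 hz) ip0l // cj0. Qed.
Lemma ipBr x y z : X x -> X y -> X z -> [z, x - y] = [z, x] - [z, y].
Proof. by move=> hx hy hz; rewrite ipDr ?ipNr //; exact: preN. Qed.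

Definition nsq x : R := reC [x, x].

Lemma nsqE x : X x -> [x, x] = toC (nsq x).
Proof. by move=> hx; apply: ge0_toC; exact: ip_ge0. Qed.
Lemma nsq_ge0 x : X x -> 0 <= nsq x.
Proof. by move=> hx; rewrite -toC_ge0 -nsqE // ip_ge0. Qed.
Lemma hnormE x : hnorm X x = Num.sqrt (nsq x). Proof. by []. Qed.
Lemma hnorm_ge0 x : 0 <= hnorm X x. Proof. exact: sqrtr_ge0. Qed.
Lemma hnorm_sq x : X x -> hnorm X x ^+ 2 = nsq x.
Proof. by move=> hx; rewrite sqr_sqrtr //; exact: nsq_ge0. Qed.

Lemma nsqZ a x : X x -> nsq (a *: x) = cmod a ^+ 2 * nsq x.
Proof.
move=> hx; rewrite /nsq ipZl ?ipZr //; try exact: preZ.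
by rewrite mulrA cmod_conj nsqE // -toCM reC_toC.
Qed.

Lemma hnormZ a x : X x -> hnorm X (a *: x) = cmod a * hnorm X x.
Proof.
move=> hx; apply: (@pexpIrn _ 2) => //; rewrite ?nnegrE ?hnorm_ge0 ?mulr_ge0 ?cmod_ge0 ?hnorm_ge0 //.
by rewrite exprMn !hnorm_sq ?nsqZ //; exact: preZ.
Qed.

Lemma hnormN x : X x -> hnorm X (- x) = hnorm X x.
Proof. by move=> hx; rewrite -scaleN1r hnormZ // cmodN cmod1 mul1r. Qed.

Lemma hnormBC x y : X x -> X y -> hnorm X (x - y) = hnorm X (y - x).
Proof. by move=> hx hy; rewrite -hnormN ?opprB //; exact: preB. Qed.

Lemma nsqD x y : X x -> X y -> nsq (x + y) = nsq x + nsq y + 2 * reC [x, y].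
Proof.
move=> hx hy; have hxy := preD hx hy.
rewrite /nsq ipDl // !ipDr // (ipC hx hy) !reCD reCJ; ring.
Qed.

Lemma nsqB x y : X x -> X y -> nsq (x - y) = nsq x + nsq y - 2 * reC [x, y].
Proof.
move=> hx hy; rewrite nsqD //; last exact: preN.
by rewrite ipNr // reCN /nsq ipNr ?ipNl ?opprK ?mulrN //; exact: preN.
Qed.

(** The square norm of x - s [x, y] y is nonnegative for every real s. The choice s = 1/|y|^2 gives
    the inequality; when |y| = 0, a large s forces [x, y] = 0. *)
Lemma CS_sq x y : X x -> X y -> cmod [x, y] ^+ 2 <= nsq x * nsq y.
Proof.
move=> hx hy; set b := [x, y]; set A := nsq x; set B := nsq y.
have A0 : 0 <= A by exact: nsq_ge0.
have B0 : 0 <= B by exact: nsq_ge0.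
have key (s : R) : 0 <= A + s ^+ 2 * cmod b ^+ 2 * B - 2 * s * cmod b ^+ 2.
  have h2 := preZ (toC s * b) hy.
  have := nsq_ge0 (preB hx h2); rewrite nsqB // nsqZ // ipZr // -/b cmodM exprMn cmod_toC (real_normK (num_real s)).
  have -> : (toC s * b)^* * b = toC s * (b * b^*) by rewrite cjM toCJ; ring.
  by rewrite cmod_conj -toCM reC_toC mulrA.
move: key; have : 0 <= cmod b ^+ 2 by exact: sqr_ge0.
move: (cmod b ^+ 2) => q q0 key.
have [B1|B1] := eqVneq B 0.
  rewrite B1 mulr0; have := key ((A + 1) / (2 * q)); rewrite B1 mulr0 addr0.
  have [->//|qn] := eqVneq q 0.
  have -> : 2 * ((A + 1) / (2 * q)) * q = A + 1 by field.
  lra.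
have := key B^-1.
have -> : A + B^-1 ^+ 2 * q * B - 2 * B^-1 * q = (A * B - q) / B by field.
by rewrite pmulr_lge0 ?subr_ge0 // invr_gt0 lt_def B1.
Qed.

Lemma CS x y : X x -> X y -> cmod [x, y] <= hnorm X x * hnorm X y.
Proof.
move=> hx hy; rewrite -(ler_pXn2r (ltn0Sn 1)) ?nnegrE ?cmod_ge0 ?mulr_ge0 ?hnorm_ge0 //.
by rewrite exprMn !hnorm_sq //; exact: CS_sq.
Qed.

Lemma hnormD x y : X x -> X y -> hnorm X (x + y) <= hnorm X x + hnorm X y.
Proof.
move=> hx hy; have h1 := hnorm_ge0 x; have h2 := hnorm_ge0 y.
rewrite -(ler_pXn2r (ltn0Sn 1)) ?nnegrE ?hnorm_ge0 ?addr_ge0 //.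
rewrite sqrrD !hnorm_sq ?nsqD //; last exact: preD.
have := le_trans (reC_le_cmod _) (CS hx hy).
move: (hnorm X x * _) => p; rewrite mulr2n; lra.
Qed.

Lemma hnormBB x y z : X x -> X y -> X z -> hnorm X (x - z) <= hnorm X (x - y) + hnorm X (y - z).
Proof.
move=> hx hy hz; have -> : x - z = (x - y) + (y - z) by rewrite addrA subrK.
by apply: hnormD; exact: preB.
Qed.

Lemma hnorm0 : hnorm X 0 = 0.
Proof. by rewrite /hnorm ip0l ?reC0 ?sqrtr0 //; exact: pre0. Qed.

Definition cau (u : nat -> V) := forall e : R, 0 < e -> exists N, forall m n,
  (N <= m)%N -> (N <= n)%N -> hnorm X (u m - u n) < e.

Lemma cau_bound u : (forall n, X (u n)) -> cau u -> exists M : R, forall n, hnorm X (u n) <= M.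
Proof.
move=> hu /(_ 1 ltr01)[N hN].
exists (\sum_(i < N.+1) hnorm X (u i) + 1) => n.
have le i : (i < N.+1)%N -> hnorm X (u i) <= \sum_(i < N.+1) hnorm X (u i).
  move=> iN; rewrite (bigD1 (Ordinal iN)) //= lerDl; apply: sumr_ge0 => j _; exact: hnorm_ge0.
have [nN|Nn] := ltnP n N.
  by apply: le_trans (le n _) _; [exact: ltnW|rewrite lerDl].
rewrite -[u n](subrK (u N)); apply: le_trans (hnormD _ _) _ => //; first exact: preB.
by rewrite addrC; apply: lerD; [exact: le|apply: ltW; exact: hN].
Qed.

Lemma ip_null u v (M : R) : (forall n, X (u n)) -> (forall n, X (v n)) ->
  (forall n, hnorm X (u n) <= M) -> hnorm X (v n) @[n --> \oo] --> 0 ->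
  [u n, v n] @[n --> \oo] --> (0 : C).
Proof.
move=> hu hv uM /cvgRP hv0; apply/cvgCP => e e0.
have M0 : 0 <= M by apply: le_trans (uM 0%N); exact: hnorm_ge0.
have M1 : 0 < M + 1 by lra.
have := hv0 _ (divr_gt0 e0 M1); apply: filterS => n.
rewrite !subr0 ger0_norm ?hnorm_ge0 // ltr_pdivlMr // => h.
apply: le_lt_trans (CS (hu n) (hv n)) _; apply: le_lt_trans h.
rewrite mulrC; apply: ler_pM; rewrite ?hnorm_ge0 //.
by apply: le_trans (uM n) _; rewrite lerDl.
Qed.

Lemma ip_cau u v : (forall n, X (u n)) -> (forall n, X (v n)) -> cau u -> cau v ->
  forall e : R, 0 < e -> exists N, forall m n, (N <= m)%N -> (N <= n)%N ->
    cmod ([u m, v m] - [u n, v n]) < e.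
Proof.
move=> hu hv cu cv e e0.
have [M uM] := cau_bound hu cu; have [L vL] := cau_bound hv cv.
have M0 : 0 <= M by apply: le_trans (uM 0%N); exact: hnorm_ge0.
have L0 : 0 <= L by apply: le_trans (vL 0%N); exact: hnorm_ge0.
have D0 : 0 < M + L + 1 by lra.
have [N1 h1] := cu _ (divr_gt0 e0 D0); have [N2 h2] := cv _ (divr_gt0 e0 D0).
exists (maxn N1 N2) => m n; rewrite !geq_max => /andP[m1 m2] /andP[n1 n2].
have -> : [u m, v m] - [u n, v n] = [u m - u n, v m] + [u n, v m - v n].
  rewrite ipBl // ipBr //; ring.
have := h1 _ _ m1 n1; have := h2 _ _ m2 n2; set d := e / _ => k2 k1.
have d0 : 0 <= d by rewrite divr_ge0 // ltW.
have l1 : cmod [u m - u n, v m] <= d * L.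
  by apply: le_trans (CS (preB (hu _) (hu _)) (hv _)) _; apply: ler_pM; rewrite ?hnorm_ge0 // ltW.
have l2 : cmod [u n, v m - v n] <= M * d.
  by apply: le_trans (CS (hu _) (preB (hv _) (hv _))) _; apply: ler_pM; rewrite ?hnorm_ge0 // ltW.
apply: le_lt_trans (cmodD _ _) _; apply: le_lt_trans (lerD l1 l2) _.
have -> : e = d * (M + L + 1) by rewrite /d divfK // gt_eqF.
have : 0 < d by rewrite divr_gt0.
move: l1 l2 => _ _; nra.
Qed.

End Pre.

Lemma hilbert_pre X : is_hilbert X -> pre_hilbert X.
Proof.
case=> iX pos _; split=> // x hx; have [->|x0] := eqVneq x 0; last by apply: ltW; exact: pos.
have [h0 _ hl _] := iX.
have : iprod X 0 0 = iprod X 0 0 + iprod X 0 0.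
  by rewrite -{1}(addr0 (0 : V)) -{1}(scale1r (0 : V)) hl // mul1r.
by move/(canLR (addrK _)); rewrite subrr => <-.
Qed.

Lemma hilbert_eq0 X x : is_hilbert X -> X x -> nsq X x = 0 -> x = 0.
Proof.
move=> hX hx n0; apply/eqP; apply/negPn/negP => x0; case: (hX) => _ /(_ x hx x0) + _.
by rewrite (nsqE (hilbert_pre hX) hx) n0 toC0 ltxx.
Qed.

End InnerProducts.

Section CauchyLimits.
Variable R : realType.
Local Notation C := (Cplx R).

Lemma cauchyR (u : nat -> R) : (forall e : R, 0 < e -> exists N, forall m n,
  (N <= m)%N -> (N <= n)%N -> `|u m - u n| < e) -> exists l : R, u n @[n --> \oo] --> l.
Proof.
move=> h; apply/cvg_ex; apply/cauchy_cvgP/cauchy_ballP => e e0.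
have [N hN] := h _ e0; exists (u @` [set n | (N <= n)%N], u @` [set n | (N <= n)%N]).
  by split; exists N => // n hn; exists n.
by move=> [x y] [/= [m hm <-] [n hn <-]]; exact: hN.
Qed.

Lemma cauchyC (u : nat -> C) : (forall e : R, 0 < e -> exists N, forall m n,
  (N <= m)%N -> (N <= n)%N -> cmod (u m - u n) < e) -> exists l : C, u n @[n --> \oo] --> l.
Proof.
move=> h.
have [x hx] : exists l : R, reC (u n) @[n --> \oo] --> l.
  apply: cauchyR => e /h[N hN]; exists N => m n hm hn; rewrite -reCB.
  exact: le_lt_trans (re_le_cmod _) (hN _ _ hm hn).
have [y hy] : exists l : R, imC (u n) @[n --> \oo] --> l.
  apply: cauchyR => e /h[N hN]; exists N => m n hm hn; rewrite -imCB.
  exact: le_lt_trans (im_le_cmod _) (hN _ _ hm hn).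
by exists (pt x y); apply: cvgC_reim; rewrite ?reC_pt ?imC_pt.
Qed.

Lemma nullP (u : nat -> R) : (forall n, 0 <= u n) -> u n @[n --> \oo] --> 0 <->
  forall e : R, 0 < e -> exists N, forall n, (N <= n)%N -> u n < e.
Proof.
move=> u0; split=> [/cvgRP h e /h[N _ hN]|h].
  by exists N => n nN; have := hN n nN; rewrite subr0 ger0_norm.
apply/cvgRP => e /h[N hN]; exists N => // n /= nN.
by rewrite subr0 ger0_norm //; exact: hN.
Qed.

Lemma inv_null (e : R) : 0 < e -> exists N, forall n, (N <= n)%N -> n.+1%:R^-1 < e.
Proof.
move=> e0; apply: (proj1 (@nullP (fun n => n.+1%:R^-1) _)) e0 => [n|].
  by rewrite invr_ge0.
exact: cvg_harmonic.
Qed.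

End CauchyLimits.

#[global] Opaque hnorm.

(** * Completion inside a space of functions *)

Section Completion.
Variable R : realType.
Local Notation C := (Cplx R).
Implicit Types (F G : C -> C) (u v : nat -> C -> C) (z w : C).
Variables (D : set C) (X : fspace R) (k : C -> C -> C).
Hypothesis pX : pre_hilbert X.
Hypothesis suppX : forall F, X F -> F \_ D = F.
Hypothesis kX : forall w, D w -> X (k w).
Hypothesis repX : forall F w, D w -> X F -> F w = iprod X F (k w).
(* Holds when X is the linear span of the kernel functions. *)
Hypothesis weakX : forall G u, X G -> (forall n, X (u n)) -> (forall z, D z -> u n z @[n --> \oo] --> (0 : C)) ->
  iprod X (u n) G @[n --> \oo] --> (0 : C).

(** Elements of the completion are the pointwise limits of Cauchy sequences, so that it consists of
    functions and not of equivalence classes. The hypothesis [weakX] makes the norm limit depend on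
    the pointwise limit alone. *)
Definition approximates u F :=
  [/\ forall n, X (u n), cau X u & forall z, u n z @[n --> \oo] --> F z].

Let seq_of F : nat -> C -> C :=
  if pselect (exists u, approximates u F) is left ex then sval (cid ex) else (fun=> F).

Lemma seq_ofP F u : approximates u F -> approximates (seq_of F) F.
Proof.
by move=> hu; rewrite /seq_of; case: pselect => [ex|[]]; [exact: (svalP (cid ex))|exists u].
Qed.

Definition completion : fspace R :=
  InnerSpace (fun F => exists u, approximates u F)
    (fun F G => lim (iprod X (seq_of F n) (seq_of G n) @[n --> \oo])).
Local Notation Y := completion.

Lemma suppX0 F z : X F -> ~ D z -> F z = 0.
Proof. by move=> /suppX <- Dz; rewrite patchE memNset. Qed.

Lemma eval_bound F z : D z -> X F -> cmod (F z) <= hnorm X F * hnorm X (k z).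
Proof. by move=> Dz XF; rewrite (repX Dz XF); exact: (CS pX XF (kX Dz)). Qed.

(* |u n|^2 = (u n, u n - u N) + (u n, u N), and the second term tends to 0. *)
Lemma approx0_null u : approximates u (fun=> 0) -> hnorm X (u n) @[n --> \oo] --> 0.
Proof.
case=> Xu cu u0; apply/cvgRP => e e0.
have [M uM] := cau_bound pX Xu cu.
have M0 : 0 <= M by apply: le_trans (uM 0%N); exact: hnorm_ge0.
have d0 : 0 < e ^+ 2 / 2 / (M + 1) by rewrite !divr_gt0 ?exprn_gt0 //; lra.
have [N hN] := cu _ d0.
have e2 : 0 < e ^+ 2 / 2 by rewrite divr_gt0 ?exprn_gt0.
have h1 : forall z, D z -> u n z @[n --> \oo] --> (0 : C) by move=> z _; exact: u0.
have /cvgCP/(_ _ e2) := weakX (Xu N) Xu h1.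
have h2 : \forall n \near \oo, (N <= n)%N by exact: nbhs_infty_ge.
move: h2; apply: filterS2 => n nN; rewrite !subr0 ger0_norm ?hnorm_ge0 // => hn.
rewrite -(ltr_pXn2r (ltn0Sn 1)) ?nnegrE ?hnorm_ge0 ?(ltW e0) // hnorm_sq //.
have -> : nsq X (u n) = reC (iprod X (u n) (u N)) + reC (iprod X (u n) (u n - u N)).
  by rewrite -reCD -ipDr ?subrKC //; exact: preB.
have l1 := le_lt_trans (reC_le_cmod _) hn.
have l2 : reC (iprod X (u n) (u n - u N)) <= M * (e ^+ 2 / 2 / (M + 1)).
  apply: le_trans (reC_le_cmod _) _; apply: le_trans (CS pX (Xu _) (preB pX (Xu _) (Xu _))) _.
  by apply: ler_pM; rewrite ?hnorm_ge0 // ltW // hN.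
have l3 : M * (e ^+ 2 / 2 / (M + 1)) <= e ^+ 2 / 2.
  rewrite mulrA ler_pdivrMr; last by lra.
  by rewrite mulrC ler_pM2l //; lra.
move: l1 l2 l3; move: (e ^+ 2) (reC _) (reC _) => q x y; lra.
Qed.

Lemma approxL a u v F G : approximates u F -> approximates v G ->
  approximates (fun n => a *: u n + v n) (a *: F + G).
Proof.
move=> [Xu cu uF] [Xv cv vG]; split=> [n|e e0|z].
- exact: preL.
- have d0 : 0 < e / 2 / (cmod a + 1) by rewrite !divr_gt0 // ltr_wpDl ?cmod_ge0.
  have e2 : 0 < e / 2 by rewrite divr_gt0.
  have [N1 h1] := cu _ d0; have [N2 h2] := cv _ e2.
  exists (maxn N1 N2) => m n; rewrite !geq_max => /andP[m1 m2] /andP[n1 n2].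
  have -> : a *: u m + v m - (a *: u n + v n) = a *: (u m - u n) + (v m - v n).
    by rewrite scalerBr opprD addrACA.
  have X1 := preB pX (Xu m) (Xu n); have X2 := preB pX (Xv m) (Xv n).
  apply: le_lt_trans (hnormD pX (preZ pX a X1) X2) _; rewrite hnormZ //.
  have k1 := h1 _ _ m1 n1; have k2 := h2 _ _ m2 n2.
  have k3 : cmod a * hnorm X (u m - u n) <= e / 2.
    apply: (@le_trans _ _ ((cmod a + 1) * (e / 2 / (cmod a + 1)))).
      by apply: ler_pM; rewrite ?cmod_ge0 ?hnorm_ge0 ?lerDl // ltW.
    by rewrite mulrC divfK // gt_eqF // ltr_wpDl ?cmod_ge0.
  have -> : e = e / 2 + e / 2 by field.
  exact: ler_ltD.
by apply: cvgCD (vG z); apply: cvgCM (uF z); exact: cvgCcst.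
Qed.

Lemma approxB u v F G : approximates u F -> approximates v G ->
  approximates (fun n => v n - u n) (G - F).
Proof.
move=> /(approxL (-1)) h /h; rewrite scaleN1r addrC.
by have -> : (fun n => -1 *: u n + v n) = (fun n => v n - u n)
  by apply/funext => n; rewrite scaleN1r addrC.
Qed.

Lemma approx_norm_null u v F : approximates u F -> approximates v F ->
  hnorm X (v n - u n) @[n --> \oo] --> 0.
Proof. by move=> hu hv; apply: approx0_null; have := approxB hu hv; rewrite subrr. Qed.

(** Independence of the sequences chosen by [seq_of]: two Cauchy sequences with the same pointwise
    limit differ by a norm null sequence, and the inner product of a null sequence with a bounded
    one tends to 0. *)
Lemma approx_ip u v F G : approximates u F -> approximates v G ->
  iprod X (u n) (v n) @[n --> \oo] --> iprod Y F G.
Proof.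
move=> hu hv.
have hF : approximates (seq_of F) F by exact: seq_ofP hu.
have hG : approximates (seq_of G) G by exact: seq_ofP hv.
have [Xu cu _] := hu; have [Xv cv _] := hv; have [XF cF _] := hF; have [XG cG _] := hG.
have [l hl] := cauchyC (ip_cau pX XF XG cF cG).
have -> : iprod Y F G = l by exact: limC_eq.
have [M1 b1] := cau_bound pX XF cF; have [M2 b2] := cau_bound pX Xv cv.
have n1 := ip_null pX XF (fun n => preB pX (Xv n) (XG n)) b1 (approx_norm_null hG hv).
have n2 := ip_null pX Xv (fun n => preB pX (Xu n) (XF n)) b2 (approx_norm_null hF hu).
have c1 : iprod X (seq_of F n) (seq_of G n) + (iprod X (seq_of F n) (v n - seq_of G n) +
    (iprod X (v n) (u n - seq_of F n))^*) @[n --> \oo] --> l + (0 + 0^*).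
  by apply: cvgCD hl _; apply: cvgCD n1 _; exact: cvgCJ.
move: c1; rewrite conjC0 !addr0 => c1; apply: cvgC_near_eq c1; near=> n.
rewrite -ipC //; last exact: preB.
rewrite ipBr // ipBl //; ring.
Unshelve. all: by end_near. Qed.

Lemma approx_cst F : X F -> approximates (fun=> F) F.
Proof.
move=> XF; split=> // [e e0|z]; last exact: cvgCcst.
by exists 0%N => m n _ _; rewrite subrr hnorm0.
Qed.

Lemma sub_completion F : X F -> Y F.
Proof. by move=> /approx_cst; exists (fun=> F). Qed.

Lemma completion_ip F G : X F -> X G -> iprod Y F G = iprod X F G.
Proof.
move=> /approx_cst hF /approx_cst hG; apply: cvgC_unique (approx_ip hF hG) _.
exact: cvgCcst.
Qed.

Lemma completion_pre : pre_hilbert Y.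
Proof.
split; first split.
- by exists (fun=> 0); apply: approx_cst; exact: pre0.
- by move=> a F G [u hu] [v hv]; exists (fun n => a *: u n + v n); exact: approxL.
- move=> a F G H [u hu] [v hv] [t ht]; apply: cvgC_unique (approx_ip (approxL a hu hv) ht) _.
  have [Xu _ _] := hu; have [Xv _ _] := hv; have [Xt _ _] := ht.
  have c1 : a * iprod X (u n) (t n) + iprod X (v n) (t n) @[n --> \oo] --> a * iprod Y F H + iprod Y G H.
    by apply: cvgCD (approx_ip hv ht); apply: cvgCM (approx_ip hu ht); exact: cvgCcst.
  by apply: cvgC_near_eq c1; near=> n; rewrite ipL.
- move=> F G [u hu] [v hv]; apply: cvgC_unique (approx_ip hv hu) _.
  have [Xu _ _] := hu; have [Xv _ _] := hv.
  have c1 : (iprod X (u n) (v n))^* @[n --> \oo] --> (iprod Y F G)^* by apply: cvgCJ; exact: approx_ip.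
  by apply: cvgC_near_eq c1; near=> n; exact: ipC.
- move=> F [u hu]; apply: (@cvg_ge0C R nat \oo _ _ _ (approx_ip hu hu)); near=> n.
  by have [Xu _ _] := hu; exact: ip_ge0.
Unshelve. all: by end_near. Qed.

Lemma completion_supp F : Y F -> F \_ D = F.
Proof.
case=> u [Xu _ uF]; apply/funext => z; rewrite patchE; case: ifPn => // /negP Dz.
have h0 : u n z @[n --> \oo] --> (0 : C); last exact: cvgC_unique h0 (uF z).
apply: (@cvgC_near_eq R nat \oo _ _ (fun=> 0)); last exact: cvgCcst.
by near=> n; apply: suppX0 => // Dz'; apply: Dz; rewrite inE.
Unshelve. all: by end_near. Qed.

Lemma completion_rep F w : D w -> Y F -> F w = iprod Y F (k w).
Proof.
move=> Dw [u hu]; have [Xu _ uF] := hu.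
apply: cvgC_unique (uF w) _.
have := approx_ip hu (approx_cst (kX Dw)); apply: cvgC_near_eq; near=> n; exact: repX.
Unshelve. all: by end_near. Qed.

Lemma approx_norm u F : approximates u F -> hnorm Y (F - u n) @[n --> \oo] --> 0.
Proof.
move=> hu; have [Xu cu uF] := hu; have pY := completion_pre.
have YF : Y F by exists u.
apply/cvgRP => e e0; have e2 : 0 < e / 2 by rewrite divr_gt0.
have [N hN] := cu _ e2; exists N => // n /= nN.
have YB := preB pY YF (sub_completion (Xu n)).
rewrite subr0 ger0_norm ?hnorm_ge0 //; apply: (@le_lt_trans _ _ (e / 2)); last by lra.
rewrite -(ler_pXn2r (ltn0Sn 1)) ?nnegrE ?hnorm_ge0 ?(ltW e2) // hnorm_sq //.
have c := approx_ip (approxB (approx_cst (Xu n)) hu) (approxB (approx_cst (Xu n)) hu).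
rewrite -subr_ge0 -toC_ge0 toCB.
have -> : toC (nsq Y (F - u n)) = iprod Y (F - u n) (F - u n) by rewrite nsqE.
have c2 : toC ((e / 2) ^+ 2) - iprod X (u m - u n) (u m - u n) @[m --> \oo] -->
    toC ((e / 2) ^+ 2) - iprod Y (F - u n) (F - u n).
  by apply: cvgCB c; exact: cvgCcst.
apply: (@cvg_ge0C R nat \oo _ _ _ c2).
exists N => // m /= mN; have XB := preB pX (Xu m) (Xu n).
rewrite nsqE // -toCB toC_ge0 subr_ge0 -hnorm_sq // lerXn2r ?nnegrE ?hnorm_ge0 ?(ltW e2) //.
by apply: ltW; exact: hN.
Qed.

Lemma completion_eval F z : D z -> Y F -> cmod (F z) <= hnorm Y F * hnorm X (k z).
Proof.
move=> Dz YF; rewrite (completion_rep Dz YF).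
have := CS completion_pre YF (sub_completion (kX Dz)).
by rewrite (hnormE Y (k z)) /nsq (completion_ip (kX Dz) (kX Dz)).
Qed.

(** Each member of a Cauchy sequence is replaced by an element of [X] within 1/(n+1). The new
    sequence is Cauchy in [X]; it converges pointwise because evaluations are bounded, and its
    pointwise limit is the limit sought. *)
Theorem completion_hilbert : is_hilbert Y.
Proof.
have pY := completion_pre; have [iY _] := pY; split=> // [F YF F0|f Yf cf].
  rewrite lt_def ip_ge0 // andbT; apply: contra F0 => /eqP n0.
  apply/eqP/funext => z; have [Dz|Dz] := pselect (D z).
    apply/eqP; rewrite -cmod_eq0 eq_le cmod_ge0 andbT.
    apply: le_trans (completion_eval Dz YF) _.
    by rewrite hnormE /nsq n0 reC0 sqrtr0 mul0r.
  by rewrite -(completion_supp YF) patchE memNset.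
have ex n : exists G, X G /\ hnorm Y (f n - G) < n.+1%:R^-1.
  have [u hu] := Yf n; have [Xu _ _] := hu.
  have i0 : 0 < n.+1%:R^-1 :> R by rewrite invr_gt0.
  have [N hN] := proj1 (nullP (fun m => hnorm_ge0 Y (f n - u m))) (approx_norm hu) _ i0.
  by exists (u N); split=> //; exact: hN.
have [g hg] := choice ex; have Xg n := (hg n).1.
have Yg n := sub_completion (Xg n).
have cg : cau X g.
  move=> e e0; have e3 : 0 < e / 3 by rewrite divr_gt0.
  have [N1 h1] := cf _ e3; have [N2 h2] := inv_null e3.
  exists (maxn N1 N2) => m n; rewrite !geq_max => /andP[m1 m2] /andP[n1 n2].
  have -> : hnorm X (g m - g n) = hnorm Y (g m - g n).
    by rewrite !hnormE /nsq completion_ip //; exact: preB.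
  have k1 := lt_trans (hg m).2 (h2 _ m2); have k2 := lt_trans (hg n).2 (h2 _ n2).
  have k3 := h1 _ _ m1 n1.
  have t1 := hnormBB pY (Yg m) (Yf m) (Yg n); have t2 := hnormBB pY (Yf m) (Yf n) (Yg n).
  rewrite (hnormBC pY (Yg m) (Yf m)) in t1.
  by move: t1 t2 k1 k2 k3; do !move: (hnorm Y _); move=> *; lra.
have pt z : exists l : C, g n z @[n --> \oo] --> l.
  have [Dz|Dz] := pselect (D z); last first.
    exists 0; apply: (@cvgC_near_eq R nat \oo _ _ (fun=> 0)); last exact: cvgCcst.
    by near=> n; apply: suppX0.
  apply: cauchyC => e e0; have B0 := hnorm_ge0 X (k z).
  have B1 : 0 < hnorm X (k z) + 1 by lra.
  have [N hN] := cg _ (divr_gt0 e0 B1); exists N => m n mN nN.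
  have := eval_bound Dz (preB pX (Xg m) (Xg n)); have := hN _ _ mN nN.
  rewrite ltr_pdivlMr // => l1 l2; apply: le_lt_trans l2 _; apply: le_lt_trans l1.
  by rewrite ler_wpM2l ?hnorm_ge0 // lerDl.
have [F hF] := choice pt.
have aF : approximates g F by [].
exists F; first by exists g.
have YF : Y F by exists g.
apply/nullP => [n|e e0]; first exact: hnorm_ge0.
have e2 : 0 < e / 2 by rewrite divr_gt0.
have [N1 h1] := proj1 (nullP (fun n => hnorm_ge0 Y (F - g n))) (approx_norm aF) _ e2.
have [N2 h2] := inv_null e2.
exists (maxn N1 N2) => n; rewrite !geq_max => /andP[m1 m2].
have k1 := h1 _ m1; have k2 := lt_trans (hg n).2 (h2 _ m2).
have := hnormBB pY (Yf n) (Yg n) YF; rewrite (hnormBC pY (Yg n) YF).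
by move: k1 k2; do !move: (hnorm Y _); move=> *; lra.
Unshelve. all: by end_near. Qed.

End Completion.

(** * The span of the kernel functions *)

Section Span.
Variable R : realType.
Local Notation C := (Cplx R).
Implicit Types (F G : C -> C) (z w : C) (s t : seq (C * C)).
Variables (D : set C) (K : C -> C -> C).
Hypothesis psdK : psd D K.
Hypothesis hermK : forall z w, D z -> D w -> (K z w)^* = K w z.

Definition supported s := forall p, p \in s -> D p.2.
Definition comb s : C -> C := (fun z => \sum_(p <- s) p.1 * K z p.2) \_ D.

Lemma combE s z : D z -> comb s z = \sum_(p <- s) p.1 * K z p.2.
Proof. by move=> Dz; rewrite /comb patchE mem_set. Qed.

Lemma comb_out s z : ~ D z -> comb s z = 0.
Proof. by move=> Dz; rewrite /comb patchE memNset. Qed.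

Lemma lin_app (a : C) F G z : (a *: F + G) z = a * F z + G z.
Proof. by []. Qed.

Let coeffs G : seq (C * C) :=
  if pselect (exists2 s, supported s & G = comb s) is left ex then sval (cid2 ex) else [::].

Lemma coeffsP G s : supported s -> G = comb s -> supported (coeffs G) /\ G = comb (coeffs G).
Proof.
move=> hs Gs; rewrite /coeffs; case: pselect => [ex|[]]; last by exists s.
by split; [exact: s2valP (cid2 ex)|exact: s2valP' (cid2 ex)].
Qed.

(** The form is computed from a chosen representation of the second argument by the reproducing
    property. By [comb_swap] it can also be computed from the first argument, so it does not depend
    on the choice. *)
Definition kspan : fspace R :=
  InnerSpace (fun F => exists2 s, supported s & F = comb s)
    (fun F G => \sum_(q <- coeffs G) (q.1)^* * F q.2).

Lemma comb_swap s t : supported s -> supported t ->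
  \sum_(q <- t) (q.1)^* * comb s q.2 = \sum_(p <- s) p.1 * (comb t p.2)^*.
Proof.
move=> hs ht.
rewrite (eq_big_seq (fun q => \sum_(p <- s) p.1 * ((q.1)^* * K q.2 p.2))); last first.
  by move=> q /ht Dq; rewrite combE // mulr_sumr; apply: eq_bigr => p _; ring.
rewrite exchange_big; apply: eq_big_seq => p ps /=.
rewrite -mulr_sumr; congr (_ * _); rewrite combE ?rmorph_sum; last exact: hs.
by apply: eq_big_seq => q /ht Dq; rewrite -(hermK (hs _ ps) Dq) -cjM.
Qed.

Lemma kspan_ipr s t : supported s -> supported t ->
  iprod kspan (comb s) (comb t) = \sum_(q <- t) (q.1)^* * comb s q.2.
Proof.
move=> hs ht; have [h1 h2] := coeffsP ht erefl.
by rewrite /= !comb_swap // -h2.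
Qed.

Lemma kspan_ipl s t : supported s -> supported t ->
  iprod kspan (comb s) (comb t) = \sum_(p <- s) p.1 * (comb t p.2)^*.
Proof. by move=> hs ht; rewrite kspan_ipr // comb_swap. Qed.

Lemma comb_lin (a : C) s t :
  comb ([seq (a * p.1, p.2) | p <- s] ++ t) = a *: comb s + comb t.
Proof.
apply/funext => z; have [Dz|Dz] := pselect (D z); last first.
  by rewrite lin_app !comb_out // mulr0 addr0.
rewrite lin_app !combE // big_cat big_map mulr_sumr; congr (_ + _).
by apply: eq_bigr => p _ /=; rewrite mulrA.
Qed.

Lemma supported_lin (a : C) s t : supported s -> supported t ->
  supported ([seq (a * p.1, p.2) | p <- s] ++ t).
Proof.
move=> hs ht p; rewrite mem_cat => /orP[/mapP[q qs ->]|]; [exact: hs _ qs|exact: ht].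
Qed.

Lemma kspan_pre : pre_hilbert kspan.
Proof.
split; first split.
- exists [::] => //; apply/funext => z; rewrite /comb patchE big_nil; by case: ifP.
- move=> a F G [s hs ->] [t ht ->]; exists ([seq (a * p.1, p.2) | p <- s] ++ t).
    exact: supported_lin.
  by rewrite comb_lin.
- move=> a _ _ _ [s hs ->] [t ht ->] [r hr ->].
  rewrite -comb_lin !kspan_ipr //; last exact: supported_lin.
  rewrite comb_lin mulr_sumr -big_split /=; apply: eq_bigr => q _.
  rewrite lin_app; ring.
- move=> _ _ [s hs ->] [t ht ->]; rewrite kspan_ipl // kspan_ipr // rmorph_sum.
  by apply: eq_bigr => p _; rewrite -[RHS]/(((p.1)^* * comb s p.2)^*) cjM conjCK.
- move=> _ [s hs ->]; rewrite kspan_ipr //; have := psdK hs; rewrite /qform exchange_big.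
  congr (0 <= _); apply: eq_big_seq => q qs /=.
  rewrite combE; last exact: hs.
  by rewrite mulr_sumr; apply: eq_bigr => p _; ring.
Qed.

Lemma kspan_supp F : kspan F -> F \_ D = F.
Proof. by case=> s _ ->; apply/funext => z; rewrite /comb !patchE; case: (z \in D). Qed.

Lemma kerE w : K^~ w \_ D = comb [:: (1, w)].
Proof. by apply/funext => z; rewrite /comb !patchE big_seq1 mul1r. Qed.

Lemma supported1 w : D w -> supported [:: (1, w)].
Proof. by move=> Dw p; rewrite inE => /eqP ->. Qed.

Lemma kspan_ker w : D w -> kspan (K^~ w \_ D).
Proof. by move=> Dw; exists [:: (1, w)]; [exact: supported1|exact: kerE]. Qed.

Lemma kspan_rep F w : D w -> kspan F -> F w = iprod kspan F (K^~ w \_ D).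
Proof.
move=> Dw [s hs ->]; rewrite kerE kspan_ipr //; last exact: supported1.
by rewrite big_seq1 conjC1 mul1r.
Qed.

Lemma kspan_weak G (u : nat -> C -> C) : kspan G -> (forall n, kspan (u n)) ->
  (forall z, D z -> u n z @[n --> \oo] --> (0 : C)) -> iprod kspan (u n) G @[n --> \oo] --> (0 : C).
Proof.
move=> [s hs ->] hu u0.
apply: (@cvgC_near_eq R nat \oo _ _ (fun n => \sum_(q <- s) (q.1)^* * u n q.2)).
  by near=> n; have [t ht ->] := hu n; rewrite kspan_ipr.
rewrite -[X in _ --> X](_ : \sum_(q <- s) (q.1)^* * 0 = 0); last first.
  by rewrite big1 // => q _; rewrite mulr0.
apply: cvg_sum_in => q qs; apply: cvgCM; first exact: cvgCcst.
by apply: u0; exact: hs.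
Unshelve. all: by end_near. Qed.

Definition rkhs : fspace R := completion kspan.

Lemma rkhs_hilbert : is_hilbert rkhs.
Proof. exact: completion_hilbert kspan_pre kspan_supp kspan_ker kspan_rep kspan_weak. Qed.

Lemma rkhs_supp F : rkhs F -> F \_ D = F.
Proof. exact: completion_supp kspan_supp F. Qed.

Lemma kspan_rkhs F : kspan F -> rkhs F.
Proof. exact: (sub_completion kspan_pre). Qed.

Lemma rkhs_rep F w : D w -> rkhs F -> F w = iprod rkhs F (K^~ w \_ D).
Proof. exact: completion_rep kspan_pre kspan_ker kspan_rep kspan_weak F w. Qed.

Lemma rkhs_dense F : rkhs F -> exists u, [/\ forall n, kspan (u n), cau kspan u,
  forall z, u n z @[n --> \oo] --> F z & hnorm rkhs (F - u n) @[n --> \oo] --> 0].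
Proof.
case=> u hu; have [h1 h2 h3] := hu; exists u; split=> //.
exact: approx_norm kspan_pre kspan_weak u F hu.
Qed.

End Span.

(** * The Riesz representation theorem *)

Section Riesz.
Variables (R : realType) (V : lmodType (Cplx R)).
Local Notation C := (Cplx R).
Implicit Types (a : C) (x y z : V).
Variable X : inner_space V.
Hypothesis hX : is_hilbert X.
Let pX := hilbert_pre hX.
Local Notation "[ x , y ]" := (iprod X x y) (at level 0).

Lemma ip_cont (u v : nat -> V) x y : (forall n, X (u n)) -> (forall n, X (v n)) -> X x -> X y ->
  hnorm X (u n - x) @[n --> \oo] --> 0 -> hnorm X (v n - y) @[n --> \oo] --> 0 ->
  [u n, v n] @[n --> \oo] --> [x, y].
Proof.
move=> Xu Xv Xx Xy ux vy.
have nv : exists N, forall n, (N <= n)%N -> hnorm X (v n) <= hnorm X y + 1.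
  have [N hN] := proj1 (nullP (fun n => hnorm_ge0 X (v n - y))) vy _ ltr01.
  exists N => n /hN h; rewrite -[v n](subrK y) addrC; apply: le_trans (hnormD pX Xy (preB pX (Xv n) Xy)) _.
  by rewrite lerD2l ltW.
have [N hN] := nv.
have c1 : [x, v n - y] @[n --> \oo] --> (0 : C).
  exact: (ip_null pX (fun=> Xx) (fun n => preB pX (Xv n) Xy) (fun=> lexx _) vy).
have c2 : [u n - x, v n] @[n --> \oo] --> (0 : C).
  apply/cvgCP => e e0.
  have M1 : 0 < hnorm X y + 1 by have := hnorm_ge0 X y; lra.
  have [N2 h2] := proj1 (nullP (fun n => hnorm_ge0 X (u n - x))) ux _ (divr_gt0 e0 M1).
  exists (maxn N N2) => // n /=; rewrite geq_max => /andP[n1 n2]; rewrite subr0.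
  apply: le_lt_trans (CS pX (preB pX (Xu n) Xx) (Xv n)) _.
  have := h2 _ n2; rewrite ltr_pdivlMr // => h3; apply: le_lt_trans h3.
  by rewrite ler_wpM2l ?hnorm_ge0 // hN.
have c3 : [x, y] + ([x, v n - y] + [u n - x, v n]) @[n --> \oo] --> [x, y] + (0 + 0).
  by apply: cvgCD (cvgCD c1 c2); exact: cvgCcst.
move: c3; rewrite !addr0; apply: cvgC_near_eq; near=> n.
rewrite ipBr // ipBl //; ring.
Unshelve. all: by end_near. Qed.

Lemma lin_bound_ge0 (phi : V -> C) (A : R) :
  (forall x, X x -> cmod (phi x) <= A * hnorm X x) -> forall x, X x ->
  - (A ^+ 2) <= nsq X x - 2 * reC (phi x).
Proof.
move=> hA x Xx; have := le_trans (reC_le_cmod _) (hA _ Xx).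
rewrite -(hnorm_sq pX Xx); move: (hnorm X x) (reC _) => n r h; have := sqr_ge0 (n - A).
rewrite sqrrB !mulr2n; move: (n ^+ 2) (A ^+ 2) => p q; rewrite mulrC in h; lra.
Qed.

(** The functional J(x) = |x|^2 - 2 Re phi(x) is minimized: by the parallelogram law a minimizing
    sequence is Cauchy. For its limit y, the variation in direction x is nonnegative and quadratic
    in t without constant term, so its linear coefficient vanishes: Re phi(x) = Re [x, y]. Taking ix
    for x gives the imaginary part. *)
Theorem riesz (phi : V -> C) (A : R) :
  (forall a x y, X x -> X y -> phi (a *: x + y) = a * phi x + phi y) ->
  (forall x, X x -> cmod (phi x) <= A * hnorm X x) ->
  exists2 y, X y & forall x, X x -> phi x = [x, y].
Proof.
move=> lin bnd.
pose J x := nsq X x - 2 * reC (phi x).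
pose S := [set J x | x in (X : set V)].
have S0 : S !=set0 by exists (J 0), 0 => //; exact: pre0 pX.
have Slb : has_lbound S by exists (- (A ^+ 2)) => _ [x Xx <-]; exact: lin_bound_ge0 bnd x Xx.
pose m := inf S.
have Jm x : X x -> m <= J x by move=> Xx; apply: ge_inf => //; exists x.
have phi0 : phi 0 = 0.
  have := lin 1 0 0 (pre0 pX) (pre0 pX); rewrite scale1r addr0 mul1r => h.
  by apply: (addrI (phi 0)); rewrite -h addr0.
have phiD x y : X x -> X y -> phi (x + y) = phi x + phi y.
  by move=> Xx Xy; rewrite -{1}[x]scale1r lin // mul1r.
have phiZ a x : X x -> phi (a *: x) = a * phi x.
  by move=> Xx; rewrite -[_ *: _]addr0 lin ?phi0 ?addr0 //; exact: pre0 pX.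
have ex n : exists x, X x /\ J x < m + n.+1%:R^-1.
  have i0 : 0 < n.+1%:R^-1 :> R by rewrite invr_gt0.
  by have [_ [x Xx <-] h] := inf_adherent i0 (conj S0 Slb); exists x.
have [u hu] := choice ex; have Xu n := (hu n).1.
have par x y : X x -> X y -> nsq X (x - y) <= 2 * (J x + J y - 2 * m).
  move=> Xx Xy; have Xxy := preD pX Xx Xy.
  have := Jm _ (preZ pX (toC 2^-1) Xxy); rewrite /J nsqZ // phiZ // phiD // nsqD // nsqB //.
  rewrite cmod_toC ger0_norm // reCM reC_toC imC_toC mul0r subr0 reCD.
  by move: (nsq X x) (nsq X y) (reC _) (reC _) (reC _) => p q r s t; rewrite expr2; lra.
have cu : cau X u.
  move=> e e0; have e4 : 0 < e ^+ 2 / 4 by rewrite divr_gt0 ?exprn_gt0.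
  have [N hN] := inv_null e4; exists N => i j iN jN.
  rewrite -(ltr_pXn2r (ltn0Sn 1)) ?nnegrE ?hnorm_ge0 ?(ltW e0) //.
  rewrite hnorm_sq //; last exact: preB.
  have := par _ _ (Xu i) (Xu j); have := (hu i).2; have := (hu j).2.
  have := hN _ iN; have := hN _ jN.
  by move: (nsq X _) (J (u i)) (J (u j)) (i.+1%:R^-1) (j.+1%:R^-1) (e ^+ 2) => p q r s t v; lra.
have [_ _ cmpl] := hX.
have [y Xy uy] := cmpl u Xu cu.
exists y => //.
have re x : X x -> reC (phi x) = reC [x, y].
  move=> Xx.
  have key (t : R) : 0 <= t ^+ 2 * nsq X x + 2 * t * (reC [x, y] - reC (phi x)).
    rewrite leNgt; apply/negP => neg.
    pose d := - (t ^+ 2 * nsq X x + 2 * t * (reC [x, y] - reC (phi x))).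
    have d0 : 0 < d by rewrite oppr_gt0.
    have d2 : 0 < d / 2 by rewrite divr_gt0.
    have [N1 h1] := inv_null d2.
    have cc : [x, u n] @[n --> \oo] --> [x, y].
      by apply: ip_cont => //; under eq_fun do rewrite subrr hnorm0 //; exact: cvg_cst.
    have d3 : 0 < d / 2 / (2 * `|t| + 1).
      by rewrite divr_gt0 // ltr_wpDl // mulr_ge0.
    have /cvgCP/(_ _ d3)[N2 _ h2] := cc.
    pose n := maxn N1 N2.
    have k1 := h1 n (leq_maxl _ _); have k2 := h2 n (leq_maxr _ _).
    have k3 := le_lt_trans (re_le_cmod _) k2; rewrite reCB in k3.
    have k4 : `|2 * t * (reC [x, u n] - reC [x, y])| <= d / 2.
      rewrite !normrM (ger0_norm (ler0n R 2)).
      apply: (@le_trans _ _ ((2 * `|t| + 1) * (d / 2 / (2 * `|t| + 1)))).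
        by apply: ler_pM => //; rewrite ?mulr_ge0 // ?lerDl // ltW.
      by rewrite mulrC divfK // gt_eqF // ltr_wpDl // mulr_ge0.
    have := Jm _ (preD pX (Xu n) (preZ pX (toC t) Xx)).
    rewrite /J nsqD //; last exact: preZ.
    rewrite nsqZ // phiD ?phiZ //; last exact: preZ.
    rewrite ipZr // toCJ (ipC pX Xx (Xu n)) cmod_toC real_normK ?num_real // !reCD.
    rewrite !reCM !reC_toC !imC_toC !mul0r !subr0 reCJ.
    have := (hu n).2; rewrite /J; move: k4; rewrite ler_norml => /andP[_ k4].
    move: d2; rewrite /d in k1 k4 *; move: k1 k4.
    move: (nsq X (u n)) (reC (phi (u n))) (n.+1%:R^-1) => p q r.
    move: (reC [x, u n]) (reC [x, y]) (reC (phi x)) (t ^+ 2 * nsq X x) => a1 a2 a3 a4.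
    lra.
  have [n0|n0] := eqVneq (nsq X x) 0.
    have := key 1; have := key (-1); rewrite n0; lra.
  have n1 : 0 < nsq X x by rewrite lt_def n0 nsq_ge0.
  move: key n1; set b := reC [x, y] - reC (phi x); move=> key n1.
  have := key (- b / nsq X x).
  have -> : (- b / nsq X x) ^+ 2 * nsq X x + 2 * (- b / nsq X x) * b = - (b ^+ 2 / nsq X x) by field.
  rewrite oppr_ge0 pmulr_lle0 ?invr_gt0 // => b2.
  have : b ^+ 2 == 0 by rewrite eq_le b2 sqr_ge0.
  by rewrite expf_eq0 /= subr_eq0 => /eqP.
move=> x Xx; apply: complexP; first exact: re.
have := re _ (preZ pX 'i Xx); rewrite phiZ // ipZl // !reCM reCi imCi !mul0r !mul1r !sub0r.
exact: oppr_inj.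
Qed.

End Riesz.

Lemma infty_ultra : exists U : set_system nat, UltraFilter U /\ \oo `<=` U.
Proof. by have [U [UU hU]] := @ultraFilterLemma nat \oo _; exists U. Qed.

Section ReproducingSpaces.
Variable R : realType.
Local Notation C := (Cplx R).
Implicit Types (F G : C -> C) (z w : C).

(* A bounded sequence of a reproducing kernel Hilbert space has a weak limit along an
   ultrafilter, and weak convergence implies pointwise convergence. *)
Lemma weak_limit (D : set C) (X : fspace R) (k : C -> C -> C) (u : nat -> C -> C) F (A : R) :
  is_hilbert X -> (forall G, X G -> G \_ D = G) -> (forall w, D w -> X (k w)) ->
  (forall G w, D w -> X G -> G w = iprod X G (k w)) ->
  (forall n, X (u n)) -> (forall n, hnorm X (u n) <= A) -> F \_ D = F ->
  (forall z, D z -> u n z @[n --> \oo] --> F z) -> X F.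
Proof.
move=> hX supp kX rep Xu uA FD uF; have pX := hilbert_pre hX.
have [U [UU hU]] := infty_ultra; have UF : ProperFilter U by exact: ultra_proper.
have lim x : exists l : C, X x -> iprod X x (u n) @[n --> U] --> l.
  have [Xx|nXx] := pselect (X x); last by exists 0.
  have [|l hl] := @ultra_cvgC R nat U UU (fun n => iprod X x (u n)) (hnorm X x * A).
    by move=> n; apply: le_trans (CS pX Xx (Xu n)) _; rewrite ler_wpM2l ?hnorm_ge0.
  by exists l.
have [phi hphi] := choice lim.
have lin a x y : X x -> X y -> phi (a *: x + y) = a * phi x + phi y.
  move=> Xx Xy; apply: cvgC_unique (hphi _ (preL pX a Xx Xy)) _.
  have c1 : a * iprod X x (u n) + iprod X y (u n) @[n --> U] --> a * phi x + phi y.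
    by apply: cvgCD (hphi _ Xy); apply: cvgCM (hphi _ Xx); exact: cvgCcst.
  by apply: cvgC_near_eq c1; apply: nearW => n; rewrite ipL.
have bnd x : X x -> cmod (phi x) <= A * hnorm X x.
  move=> Xx; apply: cvg_cmod_le (hphi _ Xx) _; apply: nearW => n.
  by apply: le_trans (CS pX Xx (Xu n)) _; rewrite mulrC ler_wpM2r ?hnorm_ge0.
have [y Xy hy] := riesz hX lin bnd.
suff -> : F = y by [].
apply/funext => z; have [Dz|Dz] := pselect (D z); last first.
  by rewrite -FD -(supp _ Xy) !patchE memNset.
have c1 : u n z @[n --> U] --> F z by apply: cvg_trans (uF _ Dz); exact: cvg_app.
apply: cvgC_unique c1 _; rewrite (rep _ _ Dz Xy) (ipC pX (kX _ Dz) Xy) -hy; last exact: kX.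
have c2 : (iprod X (k z) (u n))^* @[n --> U] --> (phi (k z))^* by apply: cvgCJ; apply: hphi; exact: kX.
apply: cvgC_near_eq c2; apply: nearW => n.
by rewrite (rep _ _ Dz (Xu n)) (ipC pX (kX _ Dz) (Xu n)).
Qed.

End ReproducingSpaces.

(** * The spaces B(h) *)

Section DeBranges.
Variable R : realType.
Local Notation C := (Cplx R).
Implicit Types (F G : C -> C) (z w u a : C).
Variable h : C -> C.
Hypotheses (sh : schur h) (hnz : exists2 z, upper z & h z != 0).
Local Notation M := (mero_ext (rext h)).
Local Notation E := (Uext (rext h)).
Local Notation K := (skernel (rext h)).

Lemma oE : open E. Proof. exact: (@open_Uext R (rext h)). Qed.
Lemma M_an : analytic_on E M. Proof. exact: (@mero_ext_an R (rext h)). Qed.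

Lemma pk_cvg (T : Type) (F : set_system T) (FF : Filter F) (b c : T -> C) z w :
  E z -> E w -> z != w^* -> b x @[x --> F] --> z -> c x @[x --> F] --> w ->
  pk M (b x) (c x) @[x --> F] --> pk M z w.
Proof.
move=> Ez Ew zw bz cw; rewrite /pk.
have cMz : M (b x) @[x --> F] --> M z by apply: cvg_cont bz; exact: M_cont.
have cMw : M (c x) @[x --> F] --> M w by apply: cvg_cont cw; exact: M_cont.
have n0 : - 'i * (z - w^*) != 0 by rewrite mulf_neq0 ?oppr_eq0 ?i_neq0 // subr_eq0.
apply: (cvgCdiv n0).
  by apply: cvgCB; [exact: cvgCcst|apply: cvgCM cMz _; exact: cvgCJ].
apply: cvgCM; first exact: cvgCcst.
by apply: cvgCB bz _; exact: cvgCJ.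
Qed.

Lemma ker_an w : E w -> analytic_on E (K^~ w).
Proof.
move=> Ew; apply: (analytic_derI oE) => z Ez.
have [Ew'|nEw'] := pselect (E w^*).
  have d : derivable (fun z => - 'i * (M w)^* * dd M w^* z) z 1.
    apply: (@derM _ (fun=> - 'i * (M w)^*)); first exact: der_cst.
    exact: analytic_derE (analytic_dd oE M_an Ew') Ez.
  apply: (derivable_near_eq _ d).1.
  by have := open_near oE Ez; apply: filterS => t Et; rewrite (skern_dd sh hnz Et Ew Ew').
have n0 t : E t -> t != w^* by move=> Et; apply/eqP => tw; apply: nEw'; rewrite -tw.
have d : derivable (fun z => pk M z w) z 1.
  apply: (@derDiv _ (fun z => 1 - M z * (M w)^*) (fun z => - 'i * (z - w^*))).
  - by rewrite mulf_neq0 ?oppr_eq0 ?i_neq0 // subr_eq0; exact: n0.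
  - apply: (@derB _ (fun=> 1)); first exact: der_cst.
    by apply: (@derM _ M (fun=> (M w)^*)); [exact: analytic_derE M_an Ez|exact: der_cst].
  - apply: (@derM _ (fun=> - 'i)); first exact: der_cst.
    by apply: (@derB _ (fun z => z)); [exact: der_id|exact: der_cst].
apply: (derivable_near_eq _ d).1.
by have := open_near oE Ez; apply: filterS => t Et; rewrite (skern_off _ (n0 _ Et)).
Qed.

(** Near a nonreal point the diagonal kernel has a nonvanishing denominator and is continuous. Near
    a real point it is written as a difference quotient with base point conj w, which [dd_bound]
    controls uniformly. *)
Lemma K_locally_bounded z : E z -> exists e B : R, 0 < e /\
  forall w, cmod (w - z) < e -> E w /\ reC (K w w) <= B.
Proof.
move=> Ez; have [rz|nz] := eqVneq (imC z) 0; last first.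
  have zz : z != z^*.
    apply: contra nz => /eqP zz; have := congr1 (@imC R) zz; rewrite imCJ => /eqP.
    by rewrite -addr_eq0 -mulr2n mulrn_eq0.
  have ci : (fun w : C => w) w @[w --> z] --> z by exact: cvg_id.
  have c : pk M w w @[w --> z] --> pk M z z by exact: (@pk_cvg C (nbhs z) _ (fun w => w) (fun w => w) z z Ez Ez zz ci ci).
  have /cvgCP/(_ _ ltr01)/nearCP[e e0 he] := c.
  have /nearCP[r r0 hr] := open_near oE Ez.
  have /nearCP[s s0 hs] := open_near (@open_nonreal R) nz.
  exists (Num.min e (Num.min r s)), (cmod (pk M z z) + 1); split; first by rewrite !lt_min e0 r0.
  move=> w; rewrite !lt_min => /andP[we /andP[wr ws]]; split; first exact: hr.
  have ww : w != w^*.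
    apply: contraNneq (hs _ ws) => ww; have /eqP := congr1 (@imC R) ww.
    by rewrite imCJ -addr_eq0 -mulr2n mulrn_eq0.
  rewrite (skern_off _ ww); apply: le_trans (reC_le_cmod _) _.
  by have := he _ we; have := lerB_cmod (pk M w w) (pk M z z); lra.
have [r r0 rE] := csq_in oE Ez.
have /cvgCP/(_ _ ltr01)/nearCP[s s0 hs] := M_cont Ez.
pose e := Num.min r s / 4.
have m0 : 0 < Num.min r s by rewrite lt_min r0.
have e0 : 0 < e by rewrite divr_gt0.
have er : e <= r / 4 by rewrite ler_pM2r // ge_min lexx.
have es : e <= s / 4 by rewrite ler_pM2r // ge_min lexx orbT.
pose B := cmod (M z) + 1.
have hB w : csq z e w -> cmod (M w) <= B.
  move=> [/andP[x1 x2] /andP[y1 y2]]; have l : cmod (w - z) < s.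
    apply: le_lt_trans (cmod_le_reim _) _; rewrite reCB imCB.
    have lx : `|reC w - reC z| <= e by rewrite ler_norml; apply/andP; split; lra.
    have ly : `|imC w - imC z| <= e by rewrite ler_norml; apply/andP; split; lra.
    lra.
  by have := hs _ l; have := lerB_cmod (M w) (M z); rewrite /B; lra.
have eE : csq z e `<=` E by apply: subset_trans rE; apply: csq_sub; lra.
exists (e / 2), (B * (4 * B / e)); split; first by rewrite divr_gt0.
move=> w we.
have we' : cmod (w^* - z) < e / 2 by rewrite -(real_conj rz) -cjB cmodJ.
have sw : csq z e w by apply: csq_ball; lra.
have sw' : csq z e w^* by apply: csq_ball; lra.
have Ew := eE _ sw; split=> //.
rewrite (skern_dd sh hnz Ew Ew (eE _ sw')); apply: le_trans (reC_le_cmod _) _.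
rewrite !cmodM cmodN cmodi mul1r cmodJ; apply: ler_pM; rewrite ?cmod_ge0 //; first exact: hB.
by apply: (dd_bound oE M_an e0 eE hB we'); lra.
Qed.

Local Notation k w := (K^~ w \_ E).

Lemma psdK : psd E K. Proof. exact: skern_psd. Qed.
Lemma hermK z w : E z -> E w -> (K z w)^* = K w z. Proof. exact: skern_conj. Qed.
Lemma dB_kerE z w : E z -> k w z = K z w.
Proof. by move=> Ez; rewrite patchE mem_set. Qed.

Let pX : pre_hilbert (kspan E K) := kspan_pre psdK hermK.

Lemma kspan_nsq_ker w : E w -> nsq (kspan E K) (k w) = reC (K w w).
Proof.
move=> Ew; have kw := kspan_ker K Ew.
by rewrite /nsq -(kspan_rep hermK Ew kw) dB_kerE.
Qed.

Lemma K_diag_ge0 w : E w -> 0 <= reC (K w w).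
Proof. by move=> Ew; rewrite -(kspan_nsq_ker Ew); exact: (nsq_ge0 pX (kspan_ker K Ew)). Qed.

Lemma kspan_an F : kspan E K F -> analytic_on E F.
Proof.
move=> [s hs ->]; apply: (analytic_derI oE) => z Ez.
have d : derivable (fun z => \sum_(p <- s) p.1 * K z p.2) z 1.
  elim: s hs => [|p s IH] hs.
    rewrite (_ : (fun z => _) = fun=> 0); first exact: der_cst.
    by apply/funext => t; rewrite big_nil.
  rewrite (_ : (fun z => _) = (fun z => p.1 * K z p.2 + \sum_(p <- s) p.1 * K z p.2)); last first.
    by apply/funext => t; rewrite big_cons.
  apply: (@derD _ (fun z => p.1 * K z p.2)); last by apply: IH => q qs; apply: hs; rewrite inE qs orbT.
  apply: (@derM _ (fun=> p.1)); first exact: der_cst.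
  by apply: analytic_derE Ez; apply: ker_an; apply: hs; rewrite inE eqxx.
apply: (derivable_near_eq _ d).1.
by have := open_near oE Ez; apply: filterS => t Et; rewrite combE.
Qed.

(** By Cauchy-Schwarz against the kernel functions and [K_locally_bounded], an approximating
    sequence is locally uniformly bounded, so [ultra_analytic] applies to its pointwise limit. *)
Lemma rkhs_an F : rkhs E K F -> analytic_on E F.
Proof.
move=> /(rkhs_dense psdK hermK)[u [Xu cu uF _]].
have [U [UU hU]] := infty_ultra; have UF : ProperFilter U by exact: ultra_proper.
apply: (@ultra_analytic R nat U UU E u F oE) => [n|z Ez|z Ez].
- exact: kspan_an.
- have [A hA] := cau_bound pX Xu cu.
  have [e [b [e0 hb]]] := K_locally_bounded Ez.
  have b0 : 0 <= b.
    have [|Ez' l] := hb z; first by rewrite subrr cmod0.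
    exact: le_trans (K_diag_ge0 Ez) l.
  exists e, (A * Num.sqrt b); split=> // n w Ew we; have [_ l] := hb w we.
  have kw := kspan_ker K Ew.
  rewrite (kspan_rep hermK Ew (Xu n)); apply: le_trans (CS pX (Xu n) kw) _.
  apply: ler_pM; rewrite ?hnorm_ge0 //.
  by rewrite hnormE kspan_nsq_ker //; exact: ler_wsqrtr.
- by apply: cvg_trans (uF z); exact: cvg_app.
Qed.

End DeBranges.

(* The properties are packed in an opaque existential so that B(h1) and B(h2) are never
   compared by unfolding the construction. *)
Lemma deBranges_ex (R : realType) (h : Cplx R -> Cplx R) : exists B : fspace R,
  (forall F, B F -> F \_ (Uext (rext h)) = F) /\
  (schur h -> (exists2 z, upper z & h z != 0) ->
   [/\ is_hilbert B,
       forall w, Uext (rext h) w -> B ((skernel (rext h))^~ w \_ (Uext (rext h))),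
       forall F w, Uext (rext h) w -> B F ->
         F w = iprod B F ((skernel (rext h))^~ w \_ (Uext (rext h))),
       forall F, B F -> analytic_on (Uext (rext h)) F
     & forall F (e : R), B F -> 0 < e -> exists2 s, supported (Uext (rext h)) s &
         hnorm B (F - comb (Uext (rext h)) (skernel (rext h)) s) < e]).
Proof.
exists (rkhs (Uext (rext h)) (skernel (rext h))); split=> [F|sh hnz]; first exact: rkhs_supp.
have p := psdK sh hnz; have q := hermK sh hnz; split.
- exact: rkhs_hilbert p q.
- by move=> w Ew; apply: (kspan_rkhs p q); exact: kspan_ker.
- by move=> F w Ew BF; exact: rkhs_rep p q F w Ew BF.
- by move=> F; exact: (rkhs_an sh hnz).
- move=> F e /(rkhs_dense p q)[u [Xu _ _ Fu]] e0.
  have [N hN] := proj1 (nullP (fun n => hnorm_ge0 (rkhs _ _) (F - u n))) Fu _ e0.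
  by have [s hs us] := Xu N; exists s => //; rewrite -us; exact: hN.
Qed.

Definition deBranges (R : realType) (h : Cplx R -> Cplx R) : fspace R := sval (cid (deBranges_ex h)).

Section DeBrangesTheory.
Variable R : realType.
Local Notation C := (Cplx R).
Implicit Types (F G : C -> C) (z w u a : C).
Variable h : C -> C.
Hypotheses (sh : schur h) (hnz : exists2 z, upper z & h z != 0).
Local Notation E := (Uext (rext h)).
Local Notation K := (skernel (rext h)).
Local Notation B := (deBranges h).
Local Notation k w := (K^~ w \_ E).

Lemma dB_supp F : B F -> F \_ E = F.
Proof. exact: (proj1 (svalP (cid (deBranges_ex h)))). Qed.

Let dBP := proj2 (svalP (cid (deBranges_ex h))) sh hnz.

Lemma dB_hilbert : is_hilbert B. Proof. by case: dBP. Qed.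
Let pB : pre_hilbert B := hilbert_pre dB_hilbert.
Lemma dB_ker w : E w -> B (k w). Proof. by case: dBP => _ + _ _ _; exact. Qed.
Lemma dB_rep F w : E w -> B F -> F w = iprod B F (k w).
Proof. by case: dBP => _ _ + _ _; exact. Qed.
Lemma dB_an F : B F -> analytic_on E F. Proof. by case: dBP => _ _ _ + _; exact. Qed.
Lemma dB_dense F (e : R) : B F -> 0 < e ->
  exists2 s, supported E s & hnorm B (F - comb E K s) < e.
Proof. by case: dBP => _ _ _ _; exact. Qed.

Lemma dB_ker_ip z w : E z -> E w -> iprod B (k w) (k z) = K z w.
Proof. by move=> Ez Ew; rewrite -(dB_rep Ez (dB_ker Ew)) dB_kerE. Qed.
Lemma dB_nsq_ker w : E w -> nsq B (k w) = reC (K w w).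
Proof. by move=> Ew; rewrite /nsq dB_ker_ip. Qed.

Lemma dB_eval F z : E z -> B F -> cmod (F z) ^+ 2 <= nsq B F * reC (K z z).
Proof.
move=> Ez BF; rewrite -(dB_nsq_ker Ez) (dB_rep Ez BF).
exact: (CS_sq pB BF (dB_ker Ez)).
Qed.

Lemma dB_cvg (u : nat -> C -> C) F z : E z -> (forall n, B (u n)) -> B F ->
  hnorm B (u n - F) @[n --> \oo] --> 0 -> u n z @[n --> \oo] --> F z.
Proof.
move=> Ez Bu BF uF; rewrite (dB_rep Ez BF).
apply: (@cvgC_near_eq R nat \oo _ _ (fun n => iprod B (u n) (k z))).
  by apply: nearW => n; rewrite (dB_rep Ez (Bu n)).
apply: (ip_cont dB_hilbert Bu (fun=> dB_ker Ez) BF (dB_ker Ez) uF).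
by rewrite subrr (hnorm0 pB); exact: cvg_cst.
Qed.

Theorem dB_deBranges : is_deBranges (rext h) B.
Proof.
split; first exact: dB_hilbert.
split; [exact: (@oE R h)|by move=> g Bg; split; [exact: dB_an|exact: dB_supp]|exact: dB_ker|by move=> w g Ew Bg; exact: dB_rep].
Qed.

End DeBrangesTheory.

Lemma ip_comb2 (R : realType) (V : lmodType (Cplx R)) (X : inner_space V) (x y x' y' : V) (c1 c2 c3 c4 : Cplx R) :
  pre_hilbert X -> X x -> X y -> X x' -> X y' ->
  iprod X (c1 *: x + c2 *: y) (c3 *: x' + c4 *: y') =
  c1 * c3^* * iprod X x x' + c1 * c4^* * iprod X x y' + c2 * c3^* * iprod X y x' + c2 * c4^* * iprod X y y'.
Proof.
move=> pX hx hy hx' hy'; have h1 := preZ pX c2 hy; have h2 := preZ pX c4 hy'.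
have h3 := preZ pX c3 hx'.
rewrite (ipL pX _ hx h1 (preD pX h3 h2)) (ipZl pX _ hy (preD pX h3 h2)).
rewrite (ipDr pX h3 h2 hx) (ipDr pX h3 h2 hy) !(ipZr pX) //; ring.
Qed.

(** * The difference quotient operators on B(h) *)

Section DifferenceQuotients.
Variable R : realType.
Local Notation C := (Cplx R).
Implicit Types (F G : C -> C) (z w u a : C).

Lemma eq_at_punctured F G a : derivable F a 1 -> derivable G a 1 ->
  (\forall z \near a^', F z = G z) -> F a = G a.
Proof. by move=> /derivable_cont cF /derivable_cont cG; exact: cont_eq_dnear. Qed.

Lemma dd_off F a z : z != a -> dd F a z = (F z - F a) / (z - a).
Proof. by move=> za; rewrite /dd (negPf za). Qed.

Lemma dnear_neq a : \forall z \near a^', z != a.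
Proof. by apply/dnbhsCP; exists 1; [exact: ltr01|move=> w wa _]. Qed.

Lemma dd_lin F G c a z : derivable F a 1 -> derivable G a 1 ->
  dd (c *: F + G) a z = c * dd F a z + dd G a z.
Proof.
move=> dF dG; have off t : t != a -> dd (c *: F + G) a t = c * dd F a t + dd G a t.
  move=> ta; rewrite !dd_off // !lin_app; field; by rewrite subr_eq0.
have [->|za] := eqVneq z a; last exact: off.
have dcFG : derivable (c *: F + G) a 1.
  have -> : c *: F + G = (fun z => c * F z + G z) by [].
  have h1 : derivable (fun z => c * F z) a 1 := @derM R (fun=> c) F a (@der_cst R c a) dF.
  exact: (@derD R (fun z => c * F z) G a h1 dG).
apply: (@cont_eq_dnear R (dd (c *: F + G) a) (fun z => c * dd F a z + dd G a z)).
- exact: dd_continuous.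
- apply: (@continuousD _ _ _ (fun z => c * dd F a z) (dd G a)); last exact: dd_continuous.
  apply: (@continuousM _ _ (fun=> c) (dd F a)); last exact: dd_continuous.
  exact: derivable_cont (@der_cst R c a).
- by move: (dnear_neq a); apply: filterS => t; exact: off.
Qed.

(** The scalar identity behind [Vop_ker_ip], with conjugates as independent variables: [b], [u],
    [x], [n] stand for the conjugates of a, u, M(u), M(a), and [y], [m] for M(w), M(a). The kernel
    values [p], [q], [r], [s] are eliminated by four instances of [skern_rel]. *)
Lemma V_algebra (I a b u w m n x y p q r s : C) : I ^+ 2 = -1 -> a - b != 0 -> a - u != 0 -> b - w != 0 ->
  m != 0 -> n != 0 ->
  (w - u) * p = I * (1 - y * x) -> (b - u) * q = I * (1 - n^-1 * x) ->
  (w - a) * r = I * (1 - y / m) -> (b - a) * s = I * (1 - n^-1 / m) ->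
  (b - u) / (a - u) * ((a - w) / (b - w)) * p + (b - u) / (a - u) * ((b - a) * y * n / (b - w)) * q
  + (a - b) * x * m / (a - u) * ((a - w) / (b - w)) * r
  + (a - b) * x * m / (a - u) * ((b - a) * y * n / (b - w)) * s
  = p + I * (a - b) * (I * (1 - m * x) / (a - u)) * (- I * (1 - y * n) / (b - w)) .
Proof.
move=> hI h1 h2 h3 h4 h5 e1 e2 e3 e4.
have -> : (b - u) / (a - u) * ((a - w) / (b - w)) * p + (b - u) / (a - u) * ((b - a) * y * n / (b - w)) * q
  + (a - b) * x * m / (a - u) * ((a - w) / (b - w)) * r
  + (a - b) * x * m / (a - u) * ((b - a) * y * n / (b - w)) * s =
  p + ((a - b) * ((w - u) * p) + (b - a) * y * n * ((b - u) * q) - (a - b) * x * m * ((w - a) * r)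
     + (a - b) * x * m * y * n * ((b - a) * s)) / ((a - u) * (b - w)) by field; rewrite h2 h3.
rewrite e1 e2 e3 e4; congr (p + _); apply/eqP; rewrite -subr_eq0.
have -> : ((a - b) * (I * (1 - y * x)) + (b - a) * y * n * (I * (1 - n^-1 * x)) -
   (a - b) * x * m * (I * (1 - y / m)) + (a - b) * x * m * y * n * (I * (1 - n^-1 / m))) /
   ((a - u) * (b - w)) = I * (a - b) * (1 - m * x) * (1 - y * n) / ((a - u) * (b - w)).
  by field; rewrite h2 h3 h4 h5.
have -> : I * (a - b) * (I * (1 - m * x) / (a - u)) * (- I * (1 - y * n) / (b - w)) =
   - I ^+ 2 * (I * (a - b) * (1 - m * x) * (1 - y * n) / ((a - u) * (b - w))) by field; rewrite h2 h3.
by rewrite hI opprK mul1r subrr.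
Qed.

End DifferenceQuotients.

(** * The operator V_a on combinations of kernel functions *)

Section Resolvent.
Variable R : realType.
Local Notation C := (Cplx R).
Implicit Types (F G : C -> C) (z w u : C) (s t : seq (C * C)).
Variable h : C -> C.
Hypotheses (sh : schur h) (hnz : exists2 z, upper z & h z != 0).
Local Notation M := (mero_ext (rext h)).
Local Notation E := (Uext (rext h)).
Local Notation K := (skernel (rext h)).
Local Notation B := (deBranges h).
Local Notation k w := (K^~ w \_ E).
Let hB : is_hilbert B := dB_hilbert sh hnz.
Let pB : pre_hilbert B := hilbert_pre hB.

Variable a : C.
Hypotheses (Ea : E a) (Ea' : E a^*) (na : a - a^* != 0).
Let Ma0 : M a != 0 := M_neq0 sh hnz Ea Ea'.

(** Off [a] this is ((z - conj a) F(z) - (a - conj a) F(a))/(z - a), so a function vanishing at [a]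
    is multiplied by the inverse of a Blaschke factor. *)
Definition Vop (F : C -> C) : C -> C := F + (a - a^*) *: (dd F a \_ E).

Lemma VopE F z : E z -> Vop F z = F z + (a - a^*) * dd F a z.
Proof. by move=> Ez; rewrite /Vop -[LHS]/(F z + (a - a^*) * ((dd F a \_ E) z)) patchE mem_set. Qed.

Lemma Vop_supp F : F \_ E = F -> Vop F \_ E = Vop F.
Proof.
move=> FE; apply/funext => z; rewrite patchE; case: ifPn => // zE.
rewrite /Vop -[RHS]/(F z + (a - a^*) * ((dd F a \_ E) z)) -FE !patchE (negPf zE).
by rewrite mulr0 addr0.
Qed.

Lemma dB_der F u : B F -> E u -> derivable F u 1.
Proof. by move=> BF Eu; exact: analytic_derE (dB_an sh hnz BF) Eu. Qed.

Lemma Vop_lin c F G : B F -> B G -> Vop (c *: F + G) = c *: Vop F + Vop G.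
Proof.
move=> BF BG; apply/funext => z; rewrite lin_app.
have [Ez|nEz] := pselect (E z); last first.
  rewrite -(Vop_supp (dB_supp (preL pB c BF BG))) -(Vop_supp (dB_supp BF)).
  by rewrite -(Vop_supp (dB_supp BG)) !patchE memNset // mulr0 addr0.
rewrite !VopE // dd_lin; try exact: dB_der.
rewrite lin_app; ring.
Qed.

Lemma dd_eq_on_E F G : B F -> B G -> (forall z, E z -> z != a -> dd F a z = G z) ->
  forall z, E z -> dd F a z = G z.
Proof.
move=> BF BG FG z Ez; have [->|za] := eqVneq z a; last exact: FG.
apply: (@cont_eq_dnear R (dd F a) G).
- by apply: dd_continuous; exact: dB_der.
- by apply: derivable_cont; exact: dB_der.
by move: (dnearW (open_near (@oE R h) Ea)) (dnear_neq a); apply: filterS2 => t Et ta; exact: FG.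
Qed.

(** Kernel functions are mapped to combinations of two kernel functions, which reduces the identity
    for V_a to scalar algebra. At u = conj a the denominators vanish. *)
Lemma Vop_ker u : E u -> u != a^* -> Vop (k u) =
  ((a^* - u^*) / (a - u^*)) *: k u + ((a - a^*) * (M u)^* * M a / (a - u^*)) *: k a^*.
Proof.
move=> Eu ua; have Bu := dB_ker sh hnz Eu; have Ba := dB_ker sh hnz Ea'.
have n1 : a - u^* != 0 by rewrite subr_eq0; apply: contra ua => /eqP ->; rewrite conjCK.
pose G := (- (a - u^*)^-1) *: k u + ((M u)^* * M a / (a - u^*)) *: k a^*.
have BG : B G by exact: (preL pB _ Bu (preZ pB _ Ba)).
have key : forall z, E z -> dd (k u) a z = G z.
  apply: (dd_eq_on_E Bu BG) => z Ez za; rewrite dd_off // /G lin_app.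
  rewrite -[((_ *: k a^*) z)]/(_ * k a^* z) !dB_kerE //.
  have n2 : z - a != 0 by rewrite subr_eq0.
  have r1 := skern_rel sh hnz Ez Eu; have r2 := skern_rel sh hnz Ea Eu.
  have r3 := skern_rel sh hnz Ez Ea'; rewrite conjCK MJE // in r3.
  apply/eqP; rewrite -subr_eq0.
  have -> : (K z u - K a u) / (z - a) - (- (a - u^*)^-1 * K z u + (M u)^* * M a / (a - u^*) * K z a^*)
    = ((z - u^*) * K z u - (a - u^*) * K a u - (M u)^* * M a * ((z - a) * K z a^*)) / ((z - a) * (a - u^*)).
    by field; rewrite n1 n2.
  rewrite r1 r2 r3.
  have -> : 'i * (1 - M z * (M u)^*) - 'i * (1 - M a * (M u)^*) - (M u)^* * M a * ('i * (1 - M z / M a)) = 0.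
    by field.
  by rewrite mul0r.
apply/funext => z; have [Ez|nEz] := pselect (E z); last first.
  rewrite -(Vop_supp (dB_supp Bu)) !lin_app -[((_ *: k a^*) z)]/(_ * k a^* z) !patchE memNset //.
  by rewrite !mulr0 addr0.
rewrite VopE // key // /G !lin_app -![((_ *: k a^*) z)]/(_ * k a^* z) !dB_kerE //.
by field.
Qed.

Lemma Vop_ker_ip u w : E u -> E w -> u != a^* -> w != a^* ->
  iprod B (Vop (k u)) (Vop (k w)) = iprod B (k u) (k w) + 'i * (a - a^*) * k u a * (k w a)^*.
Proof.
move=> Eu Ew ua wa; rewrite !Vop_ker //.
have Bu := dB_ker sh hnz Eu; have Bw := dB_ker sh hnz Ew; have Ba := dB_ker sh hnz Ea'.
have n1 : a - u^* != 0 by rewrite subr_eq0; apply: contra ua => /eqP ->; rewrite conjCK.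
have n2 : a^* - w != 0 by rewrite subr_eq0 eq_sym.
have n3 : a - w^* != 0 by rewrite subr_eq0; apply: contra wa => /eqP ->; rewrite conjCK.
have Maj : (M a)^* != 0 by rewrite conjC_eq0.
rewrite (ip_comb2 _ _ _ _ pB Bu Ba Bw Ba) !dB_ker_ip // !dB_kerE //.
have Maa : M a^* = ((M a)^*)^-1 by rewrite -cjV -(MJE sh hnz Ea Ea') conjCK.
have r1 := skern_rel sh hnz Ew Eu; have r2 := skern_rel sh hnz Ea' Eu.
have r3 := skern_rel sh hnz Ew Ea'; have r4 := skern_rel sh hnz Ea' Ea'.
rewrite conjCK MJE // in r3 r4; rewrite Maa in r2 r4.
have s1 : K a u = 'i * (1 - M a * (M u)^*) / (a - u^*).
  by apply: (mulfI n1); rewrite (skern_rel sh hnz Ea Eu); field.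
have s2 : (K a w)^* = - 'i * (1 - M w * (M a)^*) / (a^* - w).
  have -> : K a w = 'i * (1 - M a * (M w)^*) / (a - w^*).
    by apply: (mulfI n3); rewrite (skern_rel sh hnz Ea Ew); field.
  by rewrite !cjE; congr (_ / _); ring.
rewrite s1 s2 !cjE.
have := V_algebra (sqrCi C) na n1 n2 Ma0 Maj r1 r2 r3 r4 => <-.
ring.
Qed.

Lemma comb_cons p s : comb E K (p :: s) = p.1 *: k p.2 + comb E K s.
Proof.
apply/funext => z; rewrite lin_app; have [Ez|nEz] := pselect (E z).
  by rewrite !combE // big_cons dB_kerE.
by rewrite !comb_out // patchE memNset // mulr0 addr0.
Qed.

Lemma comb_nil : comb E K [::] = 0.
Proof. by apply/funext => z; rewrite /comb patchE big_nil; case: ifP. Qed.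

Lemma dB_comb s : supported E s -> B (comb E K s).
Proof.
elim: s => [|p s IH] hs; first by rewrite comb_nil; exact: (pre0 pB).
rewrite comb_cons; apply: (preL pB).
  by apply: (dB_ker sh hnz); apply: hs; rewrite inE eqxx.
by apply: IH => q qs; apply: hs; rewrite inE qs orbT.
Qed.

(** The formula [Vop_ker] fails at conj a. Combinations without this point are still dense by
    [avoids_dense], and the results pass to all of B(h) by closure. *)
Definition avoids s := forall p, p \in s -> E p.2 /\ p.2 != a^*.

Lemma avoids_supported s : avoids s -> supported E s.
Proof. by move=> hs p /hs[]. Qed.

Lemma avoids_cons p s : avoids (p :: s) -> [/\ E p.2, p.2 != a^* & avoids s].
Proof.
move=> hs; have [h1 h2] := hs p (mem_head _ _); split=> // q qs.
by apply: hs; rewrite inE qs orbT.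
Qed.

Lemma Vop0 : Vop 0 = 0.
Proof.
have := Vop_lin (-1) (pre0 pB) (pre0 pB); rewrite scaler0 addr0 => {1}->.
by rewrite scaleN1r addNr.
Qed.

Lemma dB_Vker u : E u -> u != a^* -> B (Vop (k u)).
Proof.
move=> Eu ua; rewrite Vop_ker //.
exact: (preL pB _ (dB_ker sh hnz Eu) (preZ pB _ (dB_ker sh hnz Ea'))).
Qed.

Lemma dB_Vcomb s : avoids s -> B (Vop (comb E K s)).
Proof.
elim: s => [|p s IH] hs; first by rewrite comb_nil Vop0; exact: (pre0 pB).
have [Ep pa hs'] := avoids_cons hs.
rewrite comb_cons Vop_lin; [|exact: dB_ker|exact: dB_comb (avoids_supported hs')].
exact: (preL pB _ (dB_Vker Ep pa) (IH hs')).
Qed.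

Lemma Vcomb_ip s t : avoids s -> avoids t ->
  iprod B (Vop (comb E K s)) (Vop (comb E K t)) =
  iprod B (comb E K s) (comb E K t) + 'i * (a - a^*) * comb E K s a * (comb E K t a)^*.
Proof.
move=> hs ht.
have step1 u : E u -> u != a^* -> iprod B (Vop (k u)) (Vop (comb E K t)) =
    iprod B (k u) (comb E K t) + 'i * (a - a^*) * k u a * (comb E K t a)^*.
  move=> Eu ua; have Bu := dB_ker sh hnz Eu; have BVu := dB_Vker Eu ua.
  elim: t ht => [|p t IH] ht.
    by rewrite comb_nil Vop0 (ip0r pB Bu) (ip0r pB BVu) conjC0 mulr0 addr0.
  have [Ep pa ht'] := avoids_cons ht; have Bp := dB_ker sh hnz Ep.
  have Bt := dB_comb (avoids_supported ht').
  rewrite comb_cons Vop_lin // (ipDr pB (preZ pB _ (dB_Vker Ep pa)) (dB_Vcomb ht') BVu).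
  rewrite (ipZr pB _ (dB_Vker Ep pa) BVu) (IH ht') (Vop_ker_ip Eu Ep ua pa).
  rewrite (ipDr pB (preZ pB _ Bp) Bt Bu) (ipZr pB _ Bp Bu) lin_app cjD cjM.
  by move: (iprod _ _ _) (iprod _ _ _) => x y; ring.
have BVt := dB_Vcomb ht; have Bt := dB_comb (avoids_supported ht).
elim: s hs => [|p s IH] hs.
  by rewrite comb_nil Vop0 (ip0l pB Bt) (ip0l pB BVt) mulr0 mul0r addr0.
have [Ep pa hs'] := avoids_cons hs; have Bp := dB_ker sh hnz Ep.
have Bs := dB_comb (avoids_supported hs').
rewrite comb_cons Vop_lin // (ipL pB _ (dB_Vker Ep pa) (dB_Vcomb hs') BVt).
rewrite (IH hs') (step1 _ Ep pa) (ipL pB _ Bp Bs Bt) lin_app.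
by move: (iprod _ _ _) (iprod _ _ _) => x y; ring.
Qed.

(** The square norm of the difference of two kernel functions is K(u,u) + K(w,w) - 2 Re K(w,u). It
    tends to 0 as w approaches u = conj a, since at a nonreal point the kernel is continuous near
    the diagonal. *)
Lemma ker_approx (e : R) : 0 < e -> exists w, [/\ E w, w != a^* & hnorm B (k a^* - k w) < e].
Proof.
move=> e0; pose u := a^*.
have nu : u != u^* by rewrite /u conjCK eq_sym -subr_eq0.
pose w n := u + shift R n.
have wu : w n @[n --> \oo] --> u := @shiftD R u.
have cu : (fun=> u) n @[n --> \oo] --> u by exact: cvgCcst.
have nE : \forall n \near \oo, E (w n) := cvg_near wu (near_E Ea').
have n1 : \forall n \near \oo, w n != u^*.
  have c0 : w n - u^* @[n --> \oo] --> u - u^* by apply: cvgCB wu _; exact: cvgCcst.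
  have z0 : u - u^* != 0 by rewrite subr_eq0.
  have := cvg_near c0 (near_neq0 (f := fun x : C => x) (derivable_cont (@der_id R _)) z0).
  by apply: filterS => n; rewrite subr_eq0.
have n2 : \forall n \near \oo, w n != (w n)^*.
  have c0 : w n - (w n)^* @[n --> \oo] --> u - u^* by apply: cvgCB wu (cvgCJ wu).
  have z0 : u - u^* != 0 by rewrite subr_eq0.
  have := cvg_near c0 (near_neq0 (f := fun x : C => x) (derivable_cont (@der_id R _)) z0).
  by apply: filterS => n; rewrite subr_eq0.
have c1 : pk M (w n) u @[n --> \oo] --> pk M u u by exact: (pk_cvg _ Ea' Ea' nu wu cu).
have c2 : pk M (w n) (w n) @[n --> \oo] --> pk M u u by exact: (pk_cvg _ Ea' Ea' nu wu wu).
have c3 : pk M u u + pk M (w n) (w n) - 2 * pk M (w n) u @[n --> \oo] --> (0 : C).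
  have -> : 0 = pk M u u + pk M u u - 2 * pk M u u :> C by ring.
  apply: cvgCB; first by apply: cvgCD c2; exact: cvgCcst.
  by apply: cvgCM c1; exact: cvgCcst.
have e2 : 0 < e ^+ 2 by exact: exprn_gt0.
have /cvgCP/(_ _ e2) n3 := c3.
have [n [[En n1n] [n2n n3n]]] := filter_ex (filterI (filterI nE n1) (filterI n2 n3)).
exists (w n); split=> //; first by rewrite -subr_eq0 /w addrAC subrr add0r shift_neq0.
have Bu := dB_ker sh hnz Ea'; have Bw := dB_ker sh hnz En.
rewrite -(ltr_pXn2r (ltn0Sn 1)) ?nnegrE ?hnorm_ge0 ?(ltW e0) //.
rewrite (hnorm_sq pB (preB pB Bu Bw)) (nsqB pB Bu Bw) !(dB_nsq_ker sh hnz) // (dB_ker_ip sh hnz En Ea').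
rewrite (skern_off _ nu) (skern_off _ n2n) (skern_off _ n1n).
apply: le_lt_trans n3n; apply: le_trans (reC_le_cmod _); rewrite subr0 reCB reCD.
have -> : reC (2 * pk M (w n) u) = 2 * reC (pk M (w n) u); last by [].
have -> : 2 * pk M (w n) u = pk M (w n) u + pk M (w n) u by ring.
by rewrite reCD; ring.
Qed.

Lemma avoids_dense s (e : R) : supported E s -> 0 < e ->
  exists2 t, avoids t & hnorm B (comb E K s - comb E K t) < e.
Proof.
elim: s e => [|p s IH] e hs e0.
  by exists [::] => //; rewrite subrr (hnorm0 pB).
have Ep : E p.2 by apply: hs; rewrite inE eqxx.
have hs' : supported E s by move=> q qs; apply: hs; rewrite inE qs orbT.
have e2 : 0 < e / 2 by rewrite divr_gt0.
have [t ht st] := IH _ hs' e2.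
have Bs := dB_comb hs'; have Bt := dB_comb (avoids_supported ht).
have [w [Ew wa kw]] : exists w, [/\ E w, w != a^* & cmod p.1 * hnorm B (k p.2 - k w) < e / 2].
  have [->|pa] := eqVneq p.2 a^*; last first.
    by exists p.2; split=> //; rewrite subrr (hnorm0 pB) mulr0.
  have c0 : 0 < cmod p.1 + 1 by rewrite ltr_wpDl ?cmod_ge0.
  have [w [Ew wa kw]] := ker_approx (divr_gt0 e2 c0).
  exists w; split=> //; apply: le_lt_trans (_ : (cmod p.1 + 1) * hnorm B (k a^* - k w) < _).
    by rewrite ler_wpM2r ?hnorm_ge0 // lerDl.
  by rewrite mulrC -ltr_pdivlMr.
exists ((p.1, w) :: t).
  by move=> q; rewrite inE => /orP[/eqP ->|/ht].
rewrite !comb_cons /=.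
have -> : p.1 *: k p.2 + comb E K s - (p.1 *: k w + comb E K t) =
    p.1 *: (k p.2 - k w) + (comb E K s - comb E K t) by rewrite scalerBr opprD addrACA.
have Bk := preB pB (dB_ker sh hnz Ep) (dB_ker sh hnz Ew).
apply: le_lt_trans (hnormD pB (preZ pB _ Bk) (preB pB Bs Bt)) _.
rewrite (hnormZ pB _ Bk); move: kw st; do !move: (hnorm _ _).
by move=> x y; move: (cmod p.1 * y) => q h1 h2; lra.
Qed.

End Resolvent.

Lemma hnorm_le (R : realType) (V W : lmodType (Cplx R)) (X : inner_space V) (Y : inner_space W)
    (x : V) (y : W) (c : R) :
  pre_hilbert X -> pre_hilbert Y -> X x -> Y y -> 0 <= c -> nsq X x <= c * nsq Y y ->
  hnorm X x <= Num.sqrt c * hnorm Y y.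
Proof.
move=> pX pY hx hy c0 xy.
rewrite -(ler_pXn2r (ltn0Sn 1)) ?nnegrE ?hnorm_ge0 ?mulr_ge0 ?sqrtr_ge0 ?hnorm_ge0 //.
by rewrite exprMn (sqr_sqrtr c0) (hnorm_sq pX hx) (hnorm_sq pY hy).
Qed.

(** * The operators V_a and D_a on the whole space, for nonreal a *)

Section Colligation.
Variable R : realType.
Local Notation C := (Cplx R).
Implicit Types (F G : C -> C) (z w u : C) (s t : seq (C * C)).
Variable h : C -> C.
Hypotheses (sh : schur h) (hnz : exists2 z, upper z & h z != 0).
Local Notation E := (Uext (rext h)).
Local Notation K := (skernel (rext h)).
Local Notation B := (deBranges h).
Let hB : is_hilbert B := dB_hilbert sh hnz.
Let pB : pre_hilbert B := hilbert_pre hB.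

Variable a : C.
Hypotheses (Ea : E a) (Ea' : E a^*) (na : a - a^* != 0).
Local Notation V := (Vop h a).
Local Notation cb := (comb E K).

Lemma nsq_V F : B F -> B (V F) ->
  iprod B (V F) (V F) = iprod B F F + 'i * (a - a^*) * F a * (F a)^* ->
  nsq B (V F) <= (1 + cmod (a - a^*) * reC (K a a)) * nsq B F.
Proof.
move=> BF BVF; rewrite /nsq => ->; rewrite reCD mulrDl mul1r lerD2l.
apply: le_trans (reC_le_cmod _) _.
rewrite !cmodM cmodi mul1r cmodJ -mulrA -[X in _ <= X]mulrA ler_wpM2l ?cmod_ge0 //.
rewrite mulrC; have := dB_eval sh hnz Ea BF; rewrite mulrC.
by rewrite expr2.
Qed.

Definition Vbound : R := Num.sqrt (1 + cmod (a - a^*) * reC (K a a)).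

Lemma Vbound_ge0 : 0 <= 1 + cmod (a - a^*) * reC (K a a).
Proof. by apply: addr_ge0 => //; apply: mulr_ge0; [exact: cmod_ge0|exact: K_diag_ge0]. Qed.

Lemma hnorm_V F : B F -> B (V F) ->
  iprod B (V F) (V F) = iprod B F F + 'i * (a - a^*) * F a * (F a)^* ->
  hnorm B (V F) <= Vbound * hnorm B F.
Proof.
by move=> BF BVF e; apply: (hnorm_le pB pB BVF BF Vbound_ge0); exact: nsq_V.
Qed.

Lemma hnorm_Vcomb s t : avoids h a s -> avoids h a t ->
  hnorm B (V (cb s) - V (cb t)) <= Vbound * hnorm B (cb s - cb t).
Proof.
move=> hs ht; pose r := [seq (-1 * p.1, p.2) | p <- t] ++ s.
have hr : avoids h a r.
  by move=> q; rewrite mem_cat => /orP[/mapP[p /ht pt ->]//|/hs].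
have Bs := dB_comb sh hnz (avoids_supported hs); have Bt := dB_comb sh hnz (avoids_supported ht).
have er : cb r = -1 *: cb t + cb s by exact: comb_lin.
have -> : cb s - cb t = cb r by rewrite er scaleN1r addrC.
have -> : V (cb s) - V (cb t) = V (cb r).
  by rewrite er (Vop_lin sh hnz Ea (-1) Bt Bs) scaleN1r addrC.
have Br := dB_comb sh hnz (avoids_supported hr).
exact: (hnorm_V Br (dB_Vcomb sh hnz Ea Ea' hr) (Vcomb_ip sh hnz Ea Ea' na hr hr)).
Qed.

(** By the norm bound the images of approximating combinations form a Cauchy sequence. Evaluation is
    continuous, so its limit agrees pointwise with V F: off [a] by the formula for V, at [a] by
    continuity. *)
Lemma Vop_approx F : B F -> exists s : nat -> seq (C * C), [/\ forall n, avoids h a (s n),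
  hnorm B (cb (s n) - F) @[n --> \oo] --> 0, B (V F) & hnorm B (V (cb (s n)) - V F) @[n --> \oo] --> 0].
Proof.
move=> BF.
have ex n : exists s, avoids h a s /\ hnorm B (F - cb s) < n.+1%:R^-1.
  have i0 : 0 < n.+1%:R^-1 / 2 :> R by rewrite divr_gt0 // invr_gt0.
  have [t ht Ft] := dB_dense sh hnz BF i0.
  have [s hs ts] := avoids_dense sh hnz Ea' na ht i0.
  exists s; split=> //.
  apply: le_lt_trans (hnormBB pB BF (dB_comb sh hnz ht) (dB_comb sh hnz (avoids_supported hs))) _.
  by move: Ft ts; move: (hnorm _ _) (hnorm _ _) (n.+1%:R^-1) => x y q; lra.
have [s hs] := choice ex; have av n := (hs n).1.
have Bs n := dB_comb sh hnz (avoids_supported (av n)).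
have BVs n := dB_Vcomb sh hnz Ea Ea' (av n).
have sF : hnorm B (cb (s n) - F) @[n --> \oo] --> 0.
  apply/nullP => [n|e /inv_null[N hN]]; first exact: hnorm_ge0.
  exists N => n /hN; apply: lt_trans; rewrite (hnormBC pB (Bs n) BF); exact: (hs n).2.
have cV : cau B (fun n => V (cb (s n))).
  move=> e e0; have L0 : 0 <= Vbound by exact: sqrtr_ge0.
  have d0 : 0 < e / 2 / (Vbound + 1) by rewrite !divr_gt0 // ltr_wpDl.
  have [N hN] := proj1 (nullP (fun n => hnorm_ge0 B (cb (s n) - F))) sF _ d0.
  exists N => m n /hN k1 /hN k2; apply: le_lt_trans (hnorm_Vcomb (av m) (av n)) _.
  have := hnormBB pB (Bs m) BF (Bs n); rewrite (hnormBC pB BF (Bs n)).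
  move: k1 k2; move: (hnorm _ _) (hnorm _ _) (hnorm _ _) => x y q k1 k2 k3.
  apply: (@le_lt_trans _ _ (Vbound * (e / 2 / (Vbound + 1) + e / 2 / (Vbound + 1)))).
    by apply: ler_wpM2l => //; lra.
  have -> : Vbound * (e / 2 / (Vbound + 1) + e / 2 / (Vbound + 1)) = e * (Vbound / (Vbound + 1)).
    by field; rewrite gt_eqF // ltr_wpDl.
  by rewrite gtr_pMr // ltr_pdivrMr ?ltr_wpDl // mul1r ltrDl.
have [_ _ cmpl] := hB; have [G BG VG] := cmpl _ BVs cV.
exists s.
suff -> : V F = G by [].
have pF z (Ez : E z) := dB_cvg sh hnz Ez Bs BF sF.
have pG z (Ez : E z) := dB_cvg sh hnz Ez BVs BG VG.
pose G' : C -> C := (a - a^*)^-1 *: (G - F).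
have BG' : B G' by exact: (preZ pB _ (preB pB BG BF)).
have key : forall z, E z -> dd F a z = G' z.
  apply: (dd_eq_on_E sh hnz Ea BF BG') => z Ez za.
  have n0 : z - a != 0 by rewrite subr_eq0.
  rewrite dd_off // /G' -[RHS]/((a - a^*)^-1 * (G z - F z)).
  apply: (mulfI na); rewrite [RHS]mulrA mulfV // mul1r; apply/eqP; rewrite -subr_eq0; apply/eqP.
  have c : (a - a^*) * ((cb (s n) z - cb (s n) a) / (z - a)) - (V (cb (s n)) z - cb (s n) z) @[n --> \oo]
      --> (a - a^*) * ((F z - F a) / (z - a)) - (G z - F z).
    apply: cvgCB; last by apply: cvgCB; [exact: pG|exact: pF].
    apply: cvgCM; first exact: cvgCcst.
    by apply: cvgCM; [apply: cvgCB; exact: pF|exact: cvgCcst].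
  apply: cvgC_unique c _; apply: (@cvgC_near_eq R nat \oo _ _ (fun=> 0)); last exact: cvgCcst.
  by apply: nearW => n; rewrite VopE // dd_off //; ring.
apply/funext => z; have [Ez|nEz] := pselect (E z); last first.
  by rewrite -(Vop_supp a (dB_supp BF)) -(dB_supp BG) !patchE memNset.
rewrite VopE // key // /G' -[(_ *: _) z]/((a - a^*)^-1 * (G z - F z)).
by rewrite mulrA mulfV // mul1r subrKC.
Qed.

Lemma dB_V F : B F -> B (V F).
Proof. by case/Vop_approx => s []. Qed.

Theorem V_ip F G : B F -> B G ->
  iprod B (V F) (V G) = iprod B F G + 'i * (a - a^*) * F a * (G a)^*.
Proof.
move=> BF BG; have [s [hs sF BVF VF]] := Vop_approx BF; have [t [ht tG BVG VG]] := Vop_approx BG.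
have Bs n := dB_comb sh hnz (avoids_supported (hs n)).
have Bt n := dB_comb sh hnz (avoids_supported (ht n)).
have BVs n := dB_Vcomb sh hnz Ea Ea' (hs n).
have BVt n := dB_Vcomb sh hnz Ea Ea' (ht n).
have c1 := ip_cont hB BVs BVt BVF BVG VF VG; have c2 := ip_cont hB Bs Bt BF BG sF tG.
apply: cvgC_unique c1 _.
have c3 : iprod B (cb (s n)) (cb (t n)) + 'i * (a - a^*) * cb (s n) a * (cb (t n) a)^* @[n --> \oo] -->
    iprod B F G + 'i * (a - a^*) * F a * (G a)^*.
  apply: cvgCD c2 _; apply: cvgCM; last by apply: cvgCJ; exact: (dB_cvg sh hnz Ea Bt BG tG).
  by apply: cvgCM; [exact: cvgCcst|exact: (dB_cvg sh hnz Ea Bs BF sF)].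
by apply: cvgC_near_eq c3; apply: nearW => n; exact: Vcomb_ip.
Qed.

Lemma Vop_bound F : B F -> hnorm B (V F) <= Vbound * hnorm B F.
Proof. by move=> BF; exact: (hnorm_V BF (dB_V BF) (V_ip BF BF)). Qed.

Lemma Dw_Vop F : Dw E a F = (a - a^*)^-1 *: (V F - F).
Proof.
rewrite /Vop [F + _]addrC addrK scalerA mulVf // scale1r; apply/funext => z.
by rewrite /Dw !patchE.
Qed.

Lemma dB_D F : B F -> B (Dw E a F).
Proof. by move=> BF; rewrite Dw_Vop; exact: (preZ pB _ (preB pB (dB_V BF) BF)). Qed.

Lemma D_bound F : B F -> hnorm B (Dw E a F) <= (Vbound + 1) / cmod (a - a^*) * hnorm B F.
Proof.
move=> BF; rewrite Dw_Vop (hnormZ pB _ (preB pB (dB_V BF) BF)) cmodV mulrC mulrAC ler_wpM2r ?invr_ge0 ?cmod_ge0 //.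
apply: le_trans (hnormD pB (dB_V BF) (preN pB BF)) _.
by rewrite (hnormN pB BF) mulrDl mul1r lerD2r; exact: Vop_bound.
Qed.

End Colligation.

(** Testing against y = x would give |x|^2 <= c |x|. For y close to x there is an error (c + |x|) e;
    if |x| > c, the chosen [e] makes it half of |x| (|x| - c), a contradiction. *)
Lemma hnorm_dense (R : realType) (V : lmodType (Cplx R)) (X : inner_space V) (x : V) (c : R) :
  pre_hilbert X -> X x -> 0 <= c ->
  (forall e : R, 0 < e -> exists y, [/\ X y, hnorm X (x - y) < e & cmod (iprod X x y) <= c * hnorm X y]) ->
  hnorm X x <= c.
Proof.
move=> pX hx c0 dens; rewrite leNgt; apply/negP => cN.
have N0 : 0 < hnorm X x by exact: le_lt_trans cN.
pose e := hnorm X x * (hnorm X x - c) / (2 * (c + hnorm X x)).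
have e0 : 0 < e by rewrite divr_gt0 ?mulr_gt0 ?subr_gt0 ?ltr_wpDl.
have [y [hy xy ip]] := dens e e0.
have l1 : hnorm X y <= hnorm X x + e.
  have := hnormBB pX hy hx (pre0 pX); rewrite !subr0 (hnormBC pX hy hx).
  by move: xy; move: (hnorm _ _) (hnorm _ _) (hnorm _ _) => *; lra.
have l2 : hnorm X x ^+ 2 <= cmod (iprod X x y) + hnorm X x * hnorm X (x - y).
  rewrite hnorm_sq //; have := CS pX hx (preB pX hx hy).
  have -> : nsq X x = reC (iprod X x y) + reC (iprod X x (x - y)).
    by rewrite ipBr // reCB /nsq addrC subrK.
  by have := reC_le_cmod (iprod X x y); have := reC_le_cmod (iprod X x (x - y)); lra.
have l3 : c * hnorm X y <= c * (hnorm X x + e) by rewrite ler_wpM2l.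
have l4 : hnorm X x * hnorm X (x - y) <= hnorm X x * e by rewrite ler_wpM2l ?ltW.
have l5 : hnorm X x ^+ 2 <= c * hnorm X x + (c + hnorm X x) * e.
  rewrite mulrDr in l3; rewrite mulrDl; lra.
have l6 : (c + hnorm X x) * e = hnorm X x * (hnorm X x - c) / 2.
  by rewrite /e; field; rewrite gt_eqF // ltr_wpDl.
move: l5; rewrite l6 expr2; move: cN N0; move: (hnorm X x) => N cN N0; nra.
Qed.

(** * Difference quotient operators at real points *)

Section RealPoints.
Variable R : realType.
Local Notation C := (Cplx R).
Implicit Types (F G : C -> C) (z w u a : C) (s t : seq (C * C)).

Lemma toC2 : toC (2 : R) = 2 :> C.
Proof. by have := toCD (1 : R) 1; rewrite toC1. Qed.

(** Exchanging base point and argument turns analyticity in the argument into analyticity in the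
    base point. *)
Lemma dd_sym F a z : dd F a z = dd F z a.
Proof.
rewrite /dd eq_sym; case: eqVneq => [->//|az].
have n0 : z - a != 0 by rewrite subr_eq0 eq_sym.
have n1 : a - z != 0 by rewrite subr_eq0.
by field; rewrite n0 n1.
Qed.

(** The factor vanishes at w - r and w + r, the two points where the boundary of the square crosses
    the real line; it therefore compensates a bound of order 1/|Im a|. *)
Lemma square_weight w a (r : R) : imC w = 0 -> 0 < r ->
  bdry (reC w - r) (reC w + r) (imC w - r) (imC w + r) a ->
  cmod ((a - w) ^+ 2 - toC (r ^+ 2)) <= 3 * r * `|imC a|.
Proof.
move=> rw r0 [/andP[x1 x2] [/andP[y1 y2] h3]].
pose x := reC (a - w); pose y := imC a.
have ax : a - w = toC x + 'i * toC y.
  by rewrite {1}(complexRI (a - w)) imCB rw subr0.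
have i2 := sqrCi C.
have -> : (a - w) ^+ 2 - toC (r ^+ 2) = toC (x ^+ 2 - y ^+ 2 - r ^+ 2) + 'i * toC (2 * x * y).
  rewrite ax !toCB !toCX !toCM.
  rewrite toC2.
  have -> : (toC x + 'i * toC y) ^+ 2 = toC x ^+ 2 + 2 * 'i * toC x * toC y + 'i ^+ 2 * toC y ^+ 2 by ring.
  by rewrite i2; ring.
rewrite rw sub0r add0r in y1 y2 h3 *.
have xr : `|x| <= r by rewrite ler_norml /x reCB; apply/andP; split; lra.
have yr : `|y| <= r by rewrite ler_norml /y; apply/andP; split; lra.
apply: le_trans (cmodD _ _) _; rewrite cmodM cmodi mul1r !cmod_toC !normrM (ger0_norm (ler0n R 2)).
have y0 := normr_ge0 y; have x0 := normr_ge0 x.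
have yy : y ^+ 2 = `|y| ^+ 2 by rewrite real_normK ?num_real.
have xx : x ^+ 2 = `|x| ^+ 2 by rewrite real_normK ?num_real.
have [xr'|yr'] : `|x| = r \/ `|y| = r.
  case: h3 => [h3|[h3|[h3|h3]]]; [left|left|right|right]; rewrite /x /y ?reCB h3.
  - by rewrite addrAC subrr add0r normrN gtr0_norm.
  - by rewrite addrAC subrr add0r gtr0_norm.
  - by rewrite normrN gtr0_norm.
  - by rewrite gtr0_norm.
- have -> : x ^+ 2 - y ^+ 2 - r ^+ 2 = - `|y| ^+ 2 by rewrite xx yy xr'; ring.
  rewrite normrN (ger0_norm (exprn_ge0 2 y0)) xr' -/y.
  by move: y0 yr; move: `|y| => t t0 tr; rewrite expr2; nra.
- have -> : x ^+ 2 - y ^+ 2 - r ^+ 2 = - (2 * r ^+ 2 - `|x| ^+ 2) by rewrite xx yy yr'; ring.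
  have l : 0 <= 2 * r ^+ 2 - `|x| ^+ 2.
    by move: x0 xr; move: `|x| => t t0 tr; rewrite !expr2; nra.
  rewrite normrN (ger0_norm l) -/y yr'.
  by have := sqr_ge0 (`|x| - r); rewrite !expr2; move: `|x| => t; lra.
Qed.

Variable h : C -> C.
Hypotheses (sh : schur h) (hnz : exists2 z, upper z & h z != 0).
Local Notation M := (mero_ext (rext h)).
Local Notation E := (Uext (rext h)).
Local Notation K := (skernel (rext h)).
Local Notation B := (deBranges h).
Local Notation k w := (K^~ w \_ E).
Let hB : is_hilbert B := dB_hilbert sh hnz.
Let pB : pre_hilbert B := hilbert_pre hB.

Lemma dB_ip_comb F s : B F -> supported E s ->
  iprod B F (comb E K s) = \sum_(p <- s) (p.1)^* * F p.2.
Proof.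
move=> BF; elim: s => [|p s IH] hs; first by rewrite comb_nil (ip0r pB BF) big_nil.
have Ep : E p.2 by apply: hs; rewrite inE eqxx.
have hs' : supported E s by move=> q qs; apply: hs; rewrite inE qs orbT.
have Bk := dB_ker sh hnz Ep.
rewrite comb_cons big_cons (ipDr pB (preZ pB _ Bk) (dB_comb sh hnz hs') BF) (ipZr pB _ Bk BF).
by rewrite (IH hs') -(dB_rep sh hnz Ep BF).
Qed.

(** The pairing of D_a F with [comb E K s], written out with [dd], so that it is defined and
    analytic in [a] also at real points, where D_a F is not yet known to lie in B(h). *)
Let pairing F s a : C := \sum_(p <- s) (p.1)^* * dd F a p.2.

Lemma pairing_an F s : B F -> supported E s -> analytic_on E (pairing F s).
Proof.
move=> BF; elim: s => [|p s IH] hs; apply: (analytic_derI (@oE R h)) => z Ez.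
  by rewrite (_ : pairing F [::] = fun=> 0); [exact: der_cst|apply/funext => a; rewrite /pairing big_nil].
have Ep : E p.2 by apply: hs; rewrite inE eqxx.
have hs' : supported E s by move=> q qs; apply: hs; rewrite inE qs orbT.
rewrite (_ : pairing F (p :: s) = fun a => (p.1)^* * dd F p.2 a + pairing F s a); last first.
  by apply/funext => a; rewrite /pairing big_cons dd_sym.
apply: (@derD R (fun a => (p.1)^* * dd F p.2 a) (pairing F s)).
  apply: (@derM R (fun=> (p.1)^*) (dd F p.2)); first exact: der_cst.
  exact: analytic_derE (analytic_dd (@oE R h) (dB_an sh hnz BF) Ep) Ez.
exact: analytic_derE (IH hs') Ez.
Qed.

Lemma pairing_ip F s a : B F -> supported E s -> B (Dw E a F) ->
  pairing F s a = iprod B (Dw E a F) (comb E K s).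
Proof.
move=> BF hs BD; rewrite dB_ip_comb //; apply: eq_big_seq => p ps; congr (_ * _).
by rewrite /Dw patchE mem_set //; exact: hs.
Qed.

Lemma real_square w : E w -> imC w = 0 -> exists r L : R, [/\ 0 < r, 0 <= L, csq w r `<=` E &
  forall a F, csq w r a -> imC a != 0 -> B F ->
   B (Dw E a F) /\ hnorm B (Dw E a F) <= L / `|imC a| * hnorm B F].
Proof.
move=> Ew rw.
have [e [b [e0 hb]]] := K_locally_bounded sh hnz Ew.
have [r1 r10 r1E] := csq_in (@oE R h) Ew.
pose r := Num.min r1 (e / 4).
have r0 : 0 < r by rewrite lt_min r10 divr_gt0.
have rr1 : r <= r1 by rewrite ge_min lexx.
have re : r <= e / 4 by rewrite ge_min lexx orbT.
have b0 : 0 <= b.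
  have [|Ew' l] := hb w; first by rewrite subrr cmod0.
  exact: le_trans (K_diag_ge0 sh hnz Ew') l.
have rE : csq w r `<=` E by apply: subset_trans r1E; exact: csq_sub.
(* On the square, |a - conj a| = 2 |Im a| <= 2r and K(a,a) <= b, so [L] dominates [Vbound h a + 1]
   for all nonreal [a] at once. *)
pose L : R := Num.sqrt (1 + 2 * r * b) + 1.
have L0 : 0 <= L by rewrite addr_ge0 ?sqrtr_ge0.
exists r, L; split; [exact: r0|exact: L0|exact: rE|move=> a F ar na BF].
have [/andP[x1 x2] /andP[y1 y2]] := ar; rewrite rw sub0r add0r in y1 y2.
have ar' : csq w r a^*.
  by split; rewrite ?reCJ ?imCJ ?rw ?sub0r ?add0r; apply/andP; split; lra.
have Ea := rE _ ar; have Ea' := rE _ ar'.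
have daa : cmod (a - a^*) = 2 * `|imC a|.
  rewrite subCJ !cmodM cmodi mulr1 cmod_toC; congr (_ * _).
  by rewrite -toC2 cmod_toC ger0_norm.
have na' : a - a^* != 0 by rewrite -cmod_eq0 daa mulf_neq0 ?normr_eq0 // pnatr_eq0.
split; first exact: dB_D.
apply: le_trans (D_bound sh hnz Ea Ea' na' BF) _.
rewrite daa; apply: ler_wpM2r; first exact: hnorm_ge0.
have i0 : 0 < `|imC a| by rewrite normr_gt0.
have [_ Kb] : E a /\ reC (K a a) <= b.
  apply: hb; apply: le_lt_trans (cmod_le_reim _) _; rewrite reCB imCB rw subr0.
  have lx : `|reC a - reC w| <= r by rewrite ler_norml; apply/andP; split; lra.
  have ly : `|imC a| <= r by rewrite ler_norml; apply/andP; split; lra.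
  lra.
have ly : `|imC a| <= r by rewrite ler_norml; apply/andP; split; lra.
have VL : Vbound h a + 1 <= L.
  rewrite /L lerD2r /Vbound; apply: ler_wsqrtr; rewrite lerD2l daa.
  apply: ler_pM => //; [exact: K_diag_ge0|by rewrite ler_pM2l].
rewrite invfM mulrA ler_wpM2r ?invr_ge0 // ler_pdivrMr //.
by apply: le_trans VL _; rewrite mulr2n mulrDr mulr1 lerDl.
Qed.

(* Pairing D_a F with a combination of kernel functions gives an analytic function of a,
   which is O(1/|Im a|). Multiplied by (a - w)^2 - r^2 it is bounded on the boundary of a
   square around w. *)
Theorem dB_D_real w : E w -> imC w = 0 -> exists A : R, forall F, B F ->
  B (Dw E w F) /\ hnorm B (Dw E w F) <= A * hnorm B F.
Proof.
move=> Ew rw; have [r [L [r0 L0 rE hD]]] := real_square Ew rw.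
(* On the boundary of the square the weight times the pairing is at most 3 r L |F| |comb|. On the
   vertical line through [w] the weight has modulus (Im a)^2 + r^2 >= r^2, and dividing by r^2 gives
   this constant. *)
pose A := 3 * L / r.
have A0 : 0 <= A by rewrite divr_ge0 ?mulr_ge0 // ltW.
have step F s a : B F -> supported E s -> reC a = reC w -> `|imC a| < r ->
    cmod (pairing F s a) <= A * hnorm B F * hnorm B (comb E K s).
  move=> BF hs ra ia; have Bs := dB_comb sh hnz hs.
  pose psi a := ((a - w) ^+ 2 - toC (r ^+ 2)) * pairing F s a.
  have psi_der (t : C) : E t -> derivable psi t 1.
    move=> Et; apply: (@derM R (fun a => (a - w) ^+ 2 - toC (r ^+ 2)) (pairing F s)).
      apply: (@derB R (fun a => (a - w) ^+ 2) (fun=> toC (r ^+ 2))); last exact: der_cst.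
      apply: (@derX R (fun a => a - w)).
      by apply: (@derB R (fun a => a) (fun=> w)); [exact: der_id|exact: der_cst].
    exact: analytic_derE (pairing_an BF hs) Et.
  have : cmod (psi a) <= 3 * r * L * hnorm B F * hnorm B (comb E K s).
    apply: (@max_principle R psi (reC w - r) (reC w + r) (imC w - r) (imC w + r)).
    - rewrite /insq ra; move: ia; rewrite ltr_norml rw => /andP[i1 i2].
      by apply/andP; split; apply/andP; split; lra.
    - by move=> x y hx hy; apply: psi_der; apply: rE; split; rewrite ?reC_pt ?imC_pt.
    - move=> t bt; have [tr _] := csq_bdry_dist r0 bt.
      have sw := square_weight rw r0 bt; rewrite /psi cmodM.
      have [it|it] := eqVneq (imC t) 0.
        move: sw; rewrite it normr0 mulr0 => sw.
        have -> : cmod ((t - w) ^+ 2 - toC (r ^+ 2)) = 0 by apply: le_anti; rewrite sw cmod_ge0.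
        by rewrite mul0r !mulr_ge0 ?hnorm_ge0 // ltW.
      have [BD Db] := hD t F tr it BF; rewrite (pairing_ip BF hs BD).
      have CSb := CS pB BD Bs.
      apply: (@le_trans _ _ (3 * r * `|imC t| * (L / `|imC t| * hnorm B F * hnorm B (comb E K s)))).
        apply: (ler_pM (cmod_ge0 _) (cmod_ge0 _) sw); apply: (le_trans CSb).
        exact: (ler_wpM2r (hnorm_ge0 _ _) Db).
      rewrite le_eqVlt; apply/orP; left; apply/eqP; move: (hnorm _ _) (hnorm _ _) => p q.
      by field; rewrite normr_eq0.
  have wr : r ^+ 2 <= cmod ((a - w) ^+ 2 - toC (r ^+ 2)).
    have -> : a - w = 'i * toC (imC a).
      by rewrite [LHS]complexRI reCB imCB ra rw subrr subr0 toC0 add0r.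
    rewrite exprMn sqrCi -toCX mulN1r -opprD cmodN -toCD cmod_toC ger0_norm.
      by rewrite lerDr sqr_ge0.
    by rewrite addr_ge0 ?sqr_ge0.
  rewrite /psi cmodM => hpsi; have r2 : 0 < r ^+ 2 by rewrite exprn_gt0.
  rewrite -(ler_pM2l r2); apply: le_trans (le_trans _ hpsi) _.
    by rewrite ler_wpM2r ?cmod_ge0.
  by rewrite le_eqVlt; apply/orP; left; apply/eqP; rewrite /A; move: (hnorm _ _) (hnorm _ _) => p q; field; rewrite gt_eqF.
exists A => F BF.
have bound a : E a -> reC a = reC w -> `|imC a| < r -> B (Dw E a F) ->
    hnorm B (Dw E a F) <= A * hnorm B F.
  move=> Ea ra ia BD; apply: (hnorm_dense pB BD); first by rewrite mulr_ge0 ?hnorm_ge0.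
  move=> e e0; have [s hs Ds] := dB_dense sh hnz BD e0.
  exists (comb E K s); split; [exact: (dB_comb sh hnz hs)|exact: Ds|].
  by rewrite -(pairing_ip BF hs BD); exact: step.
(* The estimate [bound] presupposes membership in B(h). For the real point [w], membership comes
   from a weak limit of D_a F along nonreal points above [w], whose norms are bounded uniformly. *)
have BDw : B (Dw E w F); last first.
  by split; [exact: BDw|apply: (bound _ Ew erefl _ BDw); rewrite rw normr0].
have [N hN] := inv_null r0.
pose a n := w + shift R (n + N).
have ra n : reC (a n) = reC w.
  by rewrite /a reCD /shift reCM reCi imCi imC_toC mul0r mulr0 subr0 addr0.
have ia n : imC (a n) = (n + N).+1%:R^-1 by rewrite /a imCD rw add0r imC_shift.
have iar n : `|imC (a n)| < r by rewrite ia ger0_norm ?invr_ge0 //; apply: hN; exact: leq_addl.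
have ar n : csq w r (a n).
  split; first by rewrite ra; apply/andP; split; lra.
  by move: (iar n); rewrite rw ltr_norml => /andP[i1 i2]; apply/andP; split; lra.
have nia n : imC (a n) != 0 by rewrite ia invr_eq0 pnatr_eq0.
have BDa n : B (Dw E (a n) F) by have [] := hD (a n) F (ar n) (nia n) BF.
apply: (@weak_limit R E B (fun w => k w) (fun n => Dw E (a n) F) _ (A * hnorm B F) hB).
- by move=> G; exact: dB_supp.
- by move=> t; exact: dB_ker.
- by move=> G t; exact: dB_rep.
- exact: BDa.
- by move=> n; exact: (bound _ (rE _ (ar n)) (ra n) (iar n) (BDa n)).
- by apply/funext => z; rewrite /Dw !patchE; case: (z \in E).
move=> z Ez.
have cw : a n @[n --> \oo] --> w.
  apply/cvgCP => e e0; have /cvgCP/(_ _ e0)[N2 _ h2] := @shiftD R w.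
  by exists N2 => // n /= nN; apply: h2; rewrite /= (leq_trans nN) // leq_addr.
rewrite /Dw; have EE G : (G \_ E) z = G z by rewrite patchE mem_set.
have c : dd F z (a n) @[n --> \oo] --> dd F z w.
  apply: cvg_cont cw; apply: derivable_cont.
  exact: analytic_derE (analytic_dd (@oE R h) (dB_an sh hnz BF) Ez) Ew.
rewrite EE -[X in _ --> X]/(dd F w z) dd_sym; apply: cvgC_near_eq c.
by apply: nearW => n; rewrite EE -[LHS]/(dd F (a n) z) dd_sym.
Qed.

Theorem dB_D_bounded w : E w -> M w != 0 -> exists A : R, forall F, B F ->
  B (Dw E w F) /\ hnorm B (Dw E w F) <= A * hnorm B F.
Proof.
move=> Ew Mw; have [rw|nw] := eqVneq (imC w) 0; first exact: dB_D_real.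
have Ew' := E_conj sh hnz Ew Mw.
have nw' : w - w^* != 0.
  by rewrite subCJ !mulf_neq0 ?i_neq0 ?toC_eq0 // pnatr_eq0.
exists ((Vbound h w + 1) / cmod (w - w^*)) => F BF.
by split; [exact: dB_D|exact: D_bound].
Qed.

End RealPoints.

(** * The intersection of two spaces B(h) *)

Section InvariantForm.
Variables (R : realType) (V : lmodType (Cplx R)).
Local Notation C := (Cplx R).
Variables (P : V -> Prop) (b1 b2 : V -> V -> C) (T : V -> V) (ev : V -> C) (kappa : R).
Let X1 := InnerSpace P b1.
Let X2 := InnerSpace P b2.
Let N := InnerSpace P (fun x y => b1 x y + b2 x y).
Hypotheses (p1 : pre_hilbert X1) (p2 : pre_hilbert X2) (hN : is_hilbert N).
Hypothesis PT : forall x, P x -> P (T x).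
Hypothesis linT : forall a x y, P x -> P y -> T (a *: x + y) = a *: T x + T y.
Hypothesis k0 : 0 < kappa.
Hypothesis b1T : forall x y, P x -> P y -> b1 (T x) (T y) = b1 x y - toC kappa * (ev x * (ev y)^*).
Hypothesis b2T : forall x y, P x -> P y -> b2 (T x) (T y) = b2 x y - toC kappa * (ev x * (ev y)^*).

Let Tn n x := iter n T x.

Lemma PTn n x : P x -> P (Tn n x).
Proof. by move=> Px; elim: n => //= n; exact: PT. Qed.

Lemma linTn n a x y : P x -> P y -> Tn n (a *: x + y) = a *: Tn n x + Tn n y.
Proof.
by move=> Px Py; elim: n => //= n IH; rewrite -!/(Tn n _) IH linT //; exact: PTn.
Qed.

Lemma nsqTn n x : P x -> nsq X2 (Tn n.+1 x) = nsq X2 (Tn n x) - kappa * cmod (ev (Tn n x)) ^+ 2.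
Proof.
move=> Px; rewrite /nsq /= -!/(Tn n x) b2T ?cmod_conj -?toCM ?reCB ?reC_toC //; exact: PTn.
Qed.

Lemma nsqTn_le n x : P x -> nsq X2 (Tn n x) <= nsq X2 x.
Proof.
move=> Px; elim: n => [//|n IH]; rewrite nsqTn //; apply: le_trans IH.
by rewrite lerBlDr lerDl mulr_ge0 ?exprn_ge0 ?cmod_ge0 // ltW.
Qed.

Lemma hnormTn_le n x : P x -> hnorm X2 (Tn n x) <= hnorm X2 x.
Proof.
move=> Px; rewrite !hnormE; apply: ler_wsqrtr; exact: nsqTn_le.
Qed.

(** The squared norms of T^n x in the second form decrease and are bounded below by 0; their
    successive differences, kappa |ev(T^n x)|^2, therefore tend to 0. *)
Lemma evTn_null x : P x -> cmod (ev (Tn n x)) @[n --> \oo] --> 0.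
Proof.
move=> Px; pose r n := nsq X2 (Tn n x).
have r_dec n : r n.+1 <= r n.
  by rewrite /r nsqTn // lerBlDr lerDl mulr_ge0 ?exprn_ge0 ?cmod_ge0 // ltW.
have r0 n : 0 <= r n by exact: (nsq_ge0 p2 (PTn n Px)).
have rc : cvgn r.
  apply: nonincreasing_is_cvgn; first by apply/nonincreasing_seqP.
  by exists 0 => _ [n _ <-].
have /cvg_ex[l /cvgRP rl] := rc.
apply/nullP => [n|d d0]; first exact: cmod_ge0.
have q0 : 0 < kappa * d ^+ 2 / 2 by rewrite !divr_gt0 ?mulr_gt0 ?exprn_gt0.
have [n0 _ h0] := rl _ q0; exists n0 => n nn.
have k1 : `|r n - l| < kappa * d ^+ 2 / 2 := h0 n nn.
have k2 : `|r n.+1 - l| < kappa * d ^+ 2 / 2 := h0 n.+1 (leqW nn).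
have rn : r n.+1 = r n - kappa * cmod (ev (Tn n x)) ^+ 2 by exact: nsqTn.
rewrite -(ltr_pXn2r (ltn0Sn 1)) ?nnegrE ?cmod_ge0 ?(ltW d0) //.
rewrite -(ltr_pM2l k0); move: k1 k2; rewrite /= rn !ltr_norml => /andP[_ k1] /andP[k2 _].
move: k1 k2; move: (r n) (kappa * cmod _ ^+ 2) (kappa * d ^+ 2) => x1 x2 x3; lra.
Qed.

(** One ultrafilter serves all pairs, so the limit form inherits linearity, symmetry and positivity
    from [b2] without a proof that the sequences converge. *)
Lemma alpha_ex : exists alpha : V -> V -> C, exists U : set_system nat, [/\ ProperFilter U, \oo `<=` U &
  forall x y, P x -> P y -> b2 (Tn n x) (Tn n y) @[n --> U] --> alpha x y].
Proof.
have [U [UU hU]] := infty_ultra; have UF : ProperFilter U by exact: ultra_proper.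
have lim (q : V * V) : exists l : C, P q.1 -> P q.2 -> b2 (Tn n q.1) (Tn n q.2) @[n --> U] --> l.
  have [[h1 h2]|nP] := pselect (P q.1 /\ P q.2); last by exists 0 => h1 h2; case: nP.
  have [|l hl] := @ultra_cvgC R nat U UU (fun n => b2 (Tn n q.1) (Tn n q.2)) (hnorm X2 q.1 * hnorm X2 q.2).
    move=> n; apply: le_trans (CS p2 (PTn n h1) (PTn n h2)) _.
    by apply: ler_pM; rewrite ?hnorm_ge0 //; exact: hnormTn_le.
  by exists l.
have [al hal] := choice lim.
by exists (fun x y => al (x, y)), U; split=> // x y Px Py; exact: (hal (x, y)).
Qed.

Definition invariant_form (b : V -> V -> C) :=
  [/\ is_hilbert (InnerSpace P b),
      forall x y, P x -> P y -> b (T x) (T y) = b x y - toC kappa * (ev x * (ev y)^*),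
      forall x, P x -> nsq X1 x <= reC (b x x)
    & forall x, P x -> nsq X2 x <= reC (b x x)].

(* The form is b1(x, y) + lim b2(T^n x, T^n y). As b1 - b2 is T-invariant, b1 and b2 can be
   exchanged, so that the form dominates both. *)
Theorem invariant_form_ex : exists b, invariant_form b.
Proof.
have [al [U [UF hU hal]]] := alpha_ex.
pose b x y := b1 x y + al x y; pose Y := InnerSpace P b.
have alL a x y z : P x -> P y -> P z -> al (a *: x + y) z = a * al x z + al y z.
  move=> Px Py Pz; apply: cvgC_unique (hal _ _ (preL p2 a Px Py) Pz) _.
  have c : a * b2 (Tn n x) (Tn n z) + b2 (Tn n y) (Tn n z) @[n --> U] --> a * al x z + al y z.
    by apply: cvgCD (hal _ _ Py Pz); apply: cvgCM (hal _ _ Px Pz); exact: cvgCcst.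
  apply: cvgC_near_eq c; apply: nearW => n.
  by rewrite linTn //; exact: (ipL p2 a (PTn n Px) (PTn n Py) (PTn n Pz)).
have alC x y : P x -> P y -> al y x = (al x y)^*.
  move=> Px Py; apply: cvgC_unique (hal _ _ Py Px) _.
  apply: cvgC_near_eq (cvgCJ (hal _ _ Px Py)); apply: nearW => n.
  exact: (ipC p2 (PTn n Px) (PTn n Py)).
have al0 x : P x -> 0 <= al x x.
  move=> Px; apply: (@cvg_ge0C R nat U _ _ _ (hal _ _ Px Px)); apply: nearW => n.
  exact: (ip_ge0 p2 (PTn n Px)).
have alle x : P x -> reC (al x x) <= nsq X2 x.
  move=> Px; rewrite -subr_ge0 -toC_ge0 toCB -(ge0_toC (al0 _ Px)).
  have c : toC (nsq X2 x) - b2 (Tn n x) (Tn n x) @[n --> U] --> toC (nsq X2 x) - al x x.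
    by apply: cvgCB (hal _ _ Px Px); exact: cvgCcst.
  apply: (@cvg_ge0C R nat U _ _ _ c); apply: nearW => n.
  have -> : b2 (Tn n x) (Tn n x) = toC (nsq X2 (Tn n x)) by exact: (nsqE p2 (PTn n Px)).
  by rewrite -toCB toC_ge0 subr_ge0 nsqTn_le.
have alT x y : P x -> P y -> al (T x) (T y) = al x y.
  move=> Px Py; apply: cvgC_unique (hal _ _ (PT Px) (PT Py)) _.
  have e0 : toC kappa * (ev (Tn n x) * (ev (Tn n y))^*) @[n --> U] --> (0 : C).
    have e1 z : P z -> ev (Tn n z) @[n --> U] --> (0 : C).
      move=> Pz; apply: cvg_trans (_ : ev (Tn n z) @[n --> \oo] --> (0 : C)); first exact: cvg_app.
      apply/cvgCP => d d0; have /cvgRP/(_ _ d0) := evTn_null Pz.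
      by apply: filterS => n; rewrite !subr0 ger0_norm ?cmod_ge0.
    rewrite -[X in _ --> X](mulr0 (toC kappa)); apply: cvgCM; first exact: cvgCcst.
    rewrite -[X in _ --> X](mul0r (0 : C)^*).
    by apply: cvgCM; [exact: e1|apply: cvgCJ; exact: e1].
  have c : b2 (Tn n x) (Tn n y) - toC kappa * (ev (Tn n x) * (ev (Tn n y))^*) @[n --> U] --> al x y - 0.
    by apply: cvgCB e0; exact: hal.
  rewrite subr0 in c.
  apply: cvgC_near_eq c; apply: nearW => n.
  by rewrite /Tn -!iterSr /= -!/(Tn n _) b2T //; exact: PTn.
have l1 x : P x -> nsq X1 x <= reC (b x x).
  by move=> Px; rewrite /b reCD lerDl -toC_ge0 -ge0_toC ?al0.
have l2 x : P x -> nsq X2 x <= reC (b x x).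
  move=> Px; have c : toC (nsq X1 (Tn n x)) @[n --> U] --> b1 x x - b2 x x + al x x.
    have c0 : b1 x x - b2 x x + b2 (Tn n x) (Tn n x) @[n --> U] --> b1 x x - b2 x x + al x x.
      by apply: cvgCD (hal _ _ Px Px); exact: cvgCcst.
    apply: cvgC_near_eq c0; apply: nearW => n.
    rewrite -(nsqE p1 (PTn n Px)) /=; elim: n => [|n IH] /=; first by rewrite subrK.
    rewrite -!/(Tn n x) b1T ?b2T //; try exact: PTn.
    by rewrite addrA -IH.
  have : 0 <= b1 x x - b2 x x + al x x.
    apply: (@cvg_ge0C R nat U _ _ _ c); apply: nearW => n; rewrite toC_ge0; exact: (nsq_ge0 p1 (PTn n Px)).
  by rewrite ge0CP => /andP[_]; rewrite reCD reCB /b reCD /nsq /=; lra.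
have iY : is_inner Y.
  split; first exact: pre0 p1.
  - exact: preL p1.
  - move=> a x y z Px Py Pz; rewrite /= /b alL //.
    have -> : b1 (a *: x + y) z = a * b1 x z + b1 y z := ipL p1 a Px Py Pz.
    ring.
  - move=> x y Px Py; rewrite /= /b alC // cjD; congr (_ + _); exact: (ipC p1 Px Py).
have pY : pre_hilbert Y.
  split=> // x Px; apply: addr_ge0; [exact: (ip_ge0 p1 Px)|exact: al0].
have pN := hilbert_pre hN.
(* The norms of [Y] and [N] are equivalent: the form is at most b1 + b2, and it dominates each of
   the two. Definiteness and completeness are taken over from [N]. *)
have YN x : P x -> nsq Y x <= nsq N x.
  by move=> Px; rewrite /nsq /= /b !reCD lerD2l; exact: alle.
have NY x : P x -> nsq N x <= 2 * nsq Y x.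
  by move=> Px; have := l1 _ Px; have := l2 _ Px; rewrite /nsq /= reCD; lra.
exists b; split=> //; last first.
  by move=> x y Px Py; rewrite /b b1T // alT //; ring.
split=> // [x Px x0|u Pu cu].
  rewrite lt_def (ip_ge0 pY Px) andbT; apply: contra x0 => /eqP b0; apply/eqP.
  apply: (hilbert_eq0 hN Px); apply: le_anti; rewrite (nsq_ge0 pN Px) andbT.
  by apply: le_trans (NY _ Px) _; rewrite /nsq b0 reC0 mulr0.
have [_ _ cmpl] := hN.
have [|l Pl ul] := cmpl u Pu.
  have s2 : 0 < Num.sqrt (2 : R) by rewrite sqrtr_gt0.
  move=> d d0; have [n0 h0] := cu _ (divr_gt0 d0 s2); exists n0 => m n mn nn.
  have Pd := preB pN (Pu m) (Pu n).
  have two : 0 <= (2 : R) by [].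
  apply: le_lt_trans (hnorm_le pN pY Pd Pd two (NY _ Pd)) _.
  by rewrite mulrC -ltr_pdivlMr //; exact: h0.
exists l => //; apply/nullP => [n|d d0]; first exact: hnorm_ge0.
have [n0 h0] := proj1 (nullP (fun n => hnorm_ge0 N (u n - l))) ul _ d0.
exists n0 => n nn; have Pd := preB pN (Pu n) Pl.
have nY : nsq Y (u n - l) <= 1 * nsq N (u n - l) by rewrite mul1r; exact: YN.
by have := hnorm_le pY pN Pd Pd ler01 nY; rewrite sqrtr1 mul1r => k; apply: le_lt_trans k (h0 _ nn).
Qed.

End InvariantForm.

Lemma sqrt_add (R : realType) (x y : R) : 0 <= x -> 0 <= y ->
  Num.sqrt (x + y) <= Num.sqrt x + Num.sqrt y.
Proof.
move=> x0 y0; have sx := sqrtr_ge0 x; have sy := sqrtr_ge0 y.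
rewrite -(ler_pXn2r (ltn0Sn 1)) ?nnegrE ?sqrtr_ge0 ?addr_ge0 //.
rewrite (sqr_sqrtr (addr_ge0 x0 y0)) sqrrD (sqr_sqrtr x0) (sqr_sqrtr y0).
by rewrite addrAC lerDl mulrn_wge0 // mulr_ge0.
Qed.

(** * The kernel of the space of common elements *)

Section CommonElements.
Variable R : realType.
Local Notation C := (Cplx R).
Implicit Types (z w u : C).
Variables h1 h2 : C -> C.
Hypotheses (s1 : schur h1) (s2 : schur h2).
Hypotheses (nz1 : exists2 z, upper z & h1 z != 0) (nz2 : exists2 z, upper z & h2 z != 0).
Local Notation E1 := (Uext (rext h1)).
Local Notation E2 := (Uext (rext h2)).
Local Notation K1 := (skernel (rext h1)).
Local Notation K2 := (skernel (rext h2)).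
Local Notation B1 := (deBranges h1).
Local Notation B2 := (deBranges h2).
Let hB1 : is_hilbert B1 := dB_hilbert s1 nz1.
Let hB2 : is_hilbert B2 := dB_hilbert s2 nz2.
Let pB1 : pre_hilbert B1 := hilbert_pre hB1.
Let pB2 : pre_hilbert B2 := hilbert_pre hB2.

Definition common_dom : set C :=
  [set z | [/\ nonreal z, E1 z, E1 z^*, E2 z & E2 z^*]].
Local Notation Om := common_dom.

Lemma Om_conj z : Om z -> Om z^*.
Proof.
case=> nz e1 e1' e2 e2'; split; rewrite ?conjCK //.
by move: nz; rewrite /nonreal /= imCJ oppr_eq0.
Qed.

Lemma near_Om z : Om z -> \forall w \near z, Om w.
Proof.
case=> nz e1 e1' e2 e2'.
have n0 := open_near (@open_nonreal R) nz.
have n1 := open_near (@oE R h1) e1; have n1' := near_conj (open_near (@oE R h1) e1').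
have n2 := open_near (@oE R h2) e2; have n2' := near_conj (open_near (@oE R h2) e2').
by near=> w; split; near: w.
Unshelve. all: by end_near. Qed.

Lemma upper_Om z : upper z -> h1 z != 0 -> h2 z != 0 -> Om z.
Proof.
move=> uz z1 z2; have lz := upperJ uz.
split; [exact: upper_nonreal|exact: E_up|apply/(E_low s1 nz1 lz)|exact: E_up|apply/(E_low s2 nz2 lz)];
  by rewrite conjCK.
Qed.

Lemma dnear_Om z : nonreal z -> \forall w \near z^', Om w.
Proof.
have up t : upper t -> \forall w \near t^', Om w.
  move=> ut; have n0 := dnearW (open_near (@open_upper R) ut).
  have n1 := schur_isolated s1 ut nz1; have n2 := schur_isolated s2 ut nz2.
  by move: n0 n1 n2; apply: filterS3 => w; exact: upper_Om.
move=> /nonreal_cases[|lz]; first exact: up.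
have := up _ (lowerJ lz); move=> /dnear_conj; apply: filterS => w /Om_conj.
by rewrite conjCK.
Qed.

Local Notation V := ((C -> C) * (C -> C))%type.
Implicit Types p q : V.

(** The two spaces consist of functions on different domains, so a common element is kept as a pair
    of functions that agree where both are analytic. *)
Definition common p := [/\ B1 p.1, B2 p.2 & forall z, Om z -> p.1 z = p.2 z].
Local Notation b1 := (fun p q => iprod B1 p.1 q.1).
Local Notation b2 := (fun p q => iprod B2 p.2 q.2).

Lemma common_lin (a : C) p q : common p -> common q -> common (a *: p + q).
Proof.
move=> [x1 x2 x3] [y1 y2 y3]; split=> /=; [exact: (preL pB1)|exact: (preL pB2)|].
by move=> z Oz; rewrite !lin_app x3 // y3.
Qed.

Lemma common0 : common 0.
Proof. by split; [exact: (pre0 pB1)|exact: (pre0 pB2)|]. Qed.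

Lemma pre1 : pre_hilbert (InnerSpace common b1).
Proof.
split; first split.
- exact: common0.
- exact: common_lin.
- by move=> a p q r [x1 _ _] [y1 _ _] [z1 _ _]; exact: (ipL pB1 a x1 y1 z1).
- by move=> p q [x1 _ _] [y1 _ _]; exact: (ipC pB1 x1 y1).
- by move=> p [x1 _ _]; exact: (ip_ge0 pB1 x1).
Qed.

Lemma pre2 : pre_hilbert (InnerSpace common b2).
Proof.
split; first split.
- exact: common0.
- exact: common_lin.
- by move=> a p q r [_ x1 _] [_ y1 _] [_ z1 _]; exact: (ipL pB2 a x1 y1 z1).
- by move=> p q [_ x1 _] [_ y1 _]; exact: (ipC pB2 x1 y1).
- by move=> p [_ x1 _]; exact: (ip_ge0 pB2 x1).
Qed.

Let N := InnerSpace common (fun p q => iprod B1 p.1 q.1 + iprod B2 p.2 q.2).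

Lemma preN12 : pre_hilbert N.
Proof.
split; first split.
- exact: common0.
- exact: common_lin.
- move=> a p q r [x1 x2 _] [y1 y2 _] [z1 z2 _] /=.
  by rewrite (ipL pB1 a x1 y1 z1) (ipL pB2 a x2 y2 z2) mulrDr addrACA.
- move=> p q [x1 x2 _] [y1 y2 _] /=.
  by rewrite (ipC pB1 x1 y1) (ipC pB2 x2 y2) cjD.
- move=> p [x1 x2 _]; apply: addr_ge0; [exact: (ip_ge0 pB1 x1)|exact: (ip_ge0 pB2 x2)].
Qed.

Lemma nsqN p : nsq N p = nsq B1 p.1 + nsq B2 p.2.
Proof. by rewrite /nsq /= reCD. Qed.

Lemma hnormN1 p : common p -> hnorm B1 p.1 <= hnorm N p.
Proof.
by move=> [_ x2 _]; rewrite !hnormE; apply: ler_wsqrtr; rewrite nsqN lerDl; exact: (nsq_ge0 pB2 x2).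
Qed.

Lemma hnormN2 p : common p -> hnorm B2 p.2 <= hnorm N p.
Proof.
by move=> [x1 _ _]; rewrite !hnormE; apply: ler_wsqrtr; rewrite nsqN lerDr; exact: (nsq_ge0 pB1 x1).
Qed.

Lemma hnormN_le p : common p -> hnorm N p <= hnorm B1 p.1 + hnorm B2 p.2.
Proof.
move=> [x1 x2 _]; rewrite !hnormE nsqN; exact: (sqrt_add (nsq_ge0 pB1 x1) (nsq_ge0 pB2 x2)).
Qed.

Lemma common_hilbert : is_hilbert N.
Proof.
have pN := preN12; split; first exact: (proj1 pN).
  move=> p cp p0; rewrite lt_def (ip_ge0 pN cp) andbT; apply: contra p0 => /eqP n0.
  have [x1 x2 _] := cp.
  have : nsq N p = 0 by rewrite /nsq n0 reC0.
  have g1 := nsq_ge0 pB1 x1; have g2 := nsq_ge0 pB2 x2; rewrite nsqN => e.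
  have e1 : p.1 = 0 by apply: (hilbert_eq0 hB1 x1); move: g1 g2 e; move: (nsq _ _) (nsq _ _) => *; lra.
  have e2 : p.2 = 0 by apply: (hilbert_eq0 hB2 x2); move: g1 g2 e; move: (nsq _ _) (nsq _ _) => *; lra.
  by apply/eqP; rewrite [p]surjective_pairing e1 e2.
move=> u cu cau_u.
have Bu1 n : B1 (u n).1 by have [] := cu n.
have Bu2 n : B2 (u n).2 by have [] := cu n.
have [_ _ cm1] := hB1; have [_ _ cm2] := hB2.
have [|l1 Bl1 ul1] := cm1 (fun n => (u n).1) Bu1.
  move=> e /cau_u[n0 hn]; exists n0 => m n mn nn; apply: le_lt_trans (hn _ _ mn nn).
  exact: (hnormN1 (preB pN (cu m) (cu n))).
have [|l2 Bl2 ul2] := cm2 (fun n => (u n).2) Bu2.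
  move=> e /cau_u[n0 hn]; exists n0 => m n mn nn; apply: le_lt_trans (hn _ _ mn nn).
  exact: (hnormN2 (preB pN (cu m) (cu n))).
have cl : common (l1, l2).
  split=> // z Oz /=; have [_ e1 _ e2 _] := Oz.
  apply: cvgC_unique (dB_cvg s1 nz1 e1 Bu1 Bl1 ul1) _.
  apply: cvgC_near_eq (dB_cvg s2 nz2 e2 Bu2 Bl2 ul2); apply: nearW => n.
  by have [_ _] := cu n; apply.
exists (l1, l2) => //; apply/nullP => [n|e e0]; first exact: hnorm_ge0.
have e2 : 0 < e / 2 by rewrite divr_gt0.
have [n1 k1] := proj1 (nullP (fun n => hnorm_ge0 B1 ((u n).1 - l1))) ul1 _ e2.
have [n2 k2] := proj1 (nullP (fun n => hnorm_ge0 B2 ((u n).2 - l2))) ul2 _ e2.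
exists (maxn n1 n2) => n; rewrite geq_max => /andP[nn1 nn2].
apply: le_lt_trans (hnormN_le (preB pN (cu n) cl)) _.
have := k1 _ nn1; have := k2 _ nn2; rewrite /=; move: (hnorm _ _) (hnorm _ _) => x y; lra.
Qed.

Lemma common_der1 p z : common p -> Om z -> derivable p.1 z 1.
Proof. by move=> [x1 _ _] [_ e1 _ _ _]; exact: (dB_der s1 nz1 x1 e1). Qed.
Lemma common_der2 p z : common p -> Om z -> derivable p.2 z 1.
Proof. by move=> [_ x2 _] [_ _ _ e2 _]; exact: (dB_der s2 nz2 x2 e2). Qed.

Lemma common_dd a z p : Om a -> common p -> Om z -> dd p.1 a z = dd p.2 a z.
Proof.
move=> Oa cp Oz; have [_ _ cpe] := cp.
have off t : Om t -> t != a -> dd p.1 a t = dd p.2 a t by move=> Ot ta; rewrite !dd_off // !cpe.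
have [->|za] := eqVneq z a; last exact: off.
apply: (@cont_eq_dnear R (dd p.1 a) (dd p.2 a)).
- by apply: dd_continuous; exact: common_der1.
- by apply: dd_continuous; exact: common_der2.
by move: (dnearW (near_Om Oa)) (dnear_neq a); apply: filterS2 => t; exact: off.
Qed.

Definition Tpair a p : V := (Vop h1 a p.1, Vop h2 a p.2).

Lemma Om_neq a : Om a -> a - a^* != 0.
Proof. by case=> na _ _ _ _; rewrite subCJ !mulf_neq0 ?i_neq0 ?toC_eq0 // pnatr_eq0. Qed.

Lemma common_T a p : Om a -> common p -> common (Tpair a p).
Proof.
move=> Oa cp; have [_ e1 e1' e2 e2'] := Oa; have [x1 x2 cpe] := cp; have na := Om_neq Oa.
split=> /=; [exact: (dB_V s1 nz1 e1 e1' na x1)|exact: (dB_V s2 nz2 e2 e2' na x2)|].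
move=> z Oz; have [_ f1 _ f2 _] := Oz.
by rewrite (VopE a p.1 f1) (VopE a p.2 f2) cpe // (common_dd Oa cp Oz).
Qed.

Lemma Tpair_lin a c p q : Om a -> common p -> common q ->
  Tpair a (c *: p + q) = c *: Tpair a p + Tpair a q.
Proof.
move=> [_ e1 _ e2 _] [x1 x2 _] [y1 y2 _]; rewrite /Tpair /=.
by rewrite (Vop_lin s1 nz1 e1 c x1 y1) (Vop_lin s2 nz2 e2 c x2 y2).
Qed.

(** Away from [a] and conj a this is an identity of rational expressions, and continuity fills in
    the rest. It lets every common element be written as an image under V_a, so that the invariance
    identity can be applied to inner products with only one V_a. *)
Lemma Tpair_inv a p : Om a -> common p -> Tpair a (Tpair a^* p) = p.
Proof.
move=> Oa cp; have Oa' := Om_conj Oa; have na := Om_neq Oa.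
have ct := common_T Oa (common_T Oa' cp).
have aux (h : C -> C) (sh : schur h) (nz : exists2 z, upper z & h z != 0) F :
    Uext (rext h) a -> Uext (rext h) a^* -> deBranges h F ->
    deBranges h (Vop h a (Vop h a^* F)) -> Vop h a (Vop h a^* F) = F.
  move=> Ea Ea' BF BV.
  have off z : Uext (rext h) z -> z != a -> z != a^* -> Vop h a (Vop h a^* F) z = F z.
    move=> Ez za za'; rewrite VopE // dd_off //.
    have nd : a != a^* by rewrite -subr_eq0.
    rewrite !VopE // !dd_off // conjCK; have n1 : z - a != 0 by rewrite subr_eq0.
    have n2 : z - a^* != 0 by rewrite subr_eq0.
    have n3 : a^* - a != 0 by rewrite -opprB oppr_eq0.
    by field; rewrite n1 n2 na.
  apply/funext => z; have [Ez|nEz] := pselect (Uext (rext h) z); last first.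
    by rewrite -(dB_supp BV) patchE memNset // -[in RHS](dB_supp BF) patchE memNset.
  apply: eq_at_punctured; [exact: (dB_der sh nz BV Ez)|exact: (dB_der sh nz BF Ez)|].
  have n1 : \forall t \near z^', t != a.
    have [->|za] := eqVneq z a; first exact: dnear_neq.
    apply: dnearW; have z0 : z - a != 0 by rewrite subr_eq0.
    have := near_neq0 (derivable_cont (@derB R (fun t => t) (fun=> a) z (@der_id R z) (@der_cst R a z))) z0.
    by apply: filterS => t; rewrite subr_eq0.
  have n2 : \forall t \near z^', t != a^*.
    have [->|za] := eqVneq z a^*; first exact: dnear_neq.
    apply: dnearW; have z0 : z - a^* != 0 by rewrite subr_eq0.
    have := near_neq0 (derivable_cont (@derB R (fun t => t) (fun=> a^*) z (@der_id R z) (@der_cst R a^* z))) z0.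
    by apply: filterS => t; rewrite subr_eq0.
  move: n1 n2 (dnearW (open_near (@oE R h) Ez)); apply: filterS3 => t t1 t2 Et; exact: off.
have [_ e1 e1' e2 e2'] := Oa; have [x1 x2 _] := cp; have [y1 y2 _] := ct.
rewrite [RHS]surjective_pairing /Tpair /=; congr pair; exact: aux.
Qed.

Lemma b1T a p q : Om a -> common p -> common q ->
  iprod B1 (Tpair a p).1 (Tpair a q).1 = iprod B1 p.1 q.1 - toC (2 * imC a) * (p.1 a * (q.1 a)^*).
Proof.
move=> Oa [x1 _ _] [y1 _ _]; have [_ e1 e1' _ _] := Oa; rewrite /Tpair /=.
rewrite (V_ip s1 nz1 e1 e1' (Om_neq Oa) x1 y1) subCJ toCM toC2.
have i2 := sqrCi C.
have -> : 'i * (2 * 'i * toC (imC a)) = 'i ^+ 2 * (2 * toC (imC a)) by ring.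
by rewrite i2 mulN1r !mulNr mulrA.
Qed.

Lemma b2T a p q : Om a -> common p -> common q ->
  iprod B2 (Tpair a p).2 (Tpair a q).2 = iprod B2 p.2 q.2 - toC (2 * imC a) * (p.1 a * (q.1 a)^*).
Proof.
move=> Oa [_ x2 ex] [_ y2 ey]; have [_ _ _ e2 e2'] := Oa; rewrite /Tpair /= ex // ey //.
rewrite (V_ip s2 nz2 e2 e2' (Om_neq Oa) x2 y2) subCJ toCM toC2.
have i2 := sqrCi C.
have -> : 'i * (2 * 'i * toC (imC a)) = 'i ^+ 2 * (2 * toC (imC a)) by ring.
by rewrite i2 mulN1r !mulNr mulrA.
Qed.

(* A kernel dominated by both de Branges kernels that is itself of de Branges type:
   the reproducing kernel of the intersection for an invariant form dominating both norms. *)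
Theorem common_kernel a w0 p0 : upper a -> Om a -> common p0 -> Om w0 -> p0.1 w0 != 0 ->
  exists (Q : C -> C) (l : R), [/\ 1 <= l, analytic_on upper Q,
    forall z, upper z -> Om z -> l * cmod (Q z) ^+ 2 <= 1 /\
       cmod (h1 z) ^+ 2 <= l * cmod (Q z) ^+ 2 /\ cmod (h2 z) ^+ 2 <= l * cmod (Q z) ^+ 2
    & l * cmod (Q a) ^+ 2 < 1].
Proof.
move=> ua Oa c0 Ow0 pw0; have Oa' := Om_conj Oa.
have k0 : 0 < 2 * imC a by rewrite mulr_gt0.
have [b [hY bT b1Y b2Y]] := invariant_form_ex pre1 pre2 common_hilbert (fun p => @common_T a p Oa)
  (fun c p q => @Tpair_lin a c p q Oa) k0 (fun p q => @b1T a p q Oa) (fun p q => @b2T a p q Oa).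
pose Y := InnerSpace common b; have pY : pre_hilbert Y := hilbert_pre hY.
have evb w p : Om w -> common p -> cmod (p.1 w) ^+ 2 <= nsq Y p * reC (K1 w w) /\
    cmod (p.1 w) ^+ 2 <= nsq Y p * reC (K2 w w).
  move=> Ow cp; have [x1 x2 ex] := cp; have [_ e1 _ e2 _] := Ow; split.
    apply: le_trans (dB_eval s1 nz1 e1 x1) _; apply: ler_wpM2r; first exact: (K_diag_ge0 s1 nz1 e1).
    exact: b1Y.
  rewrite ex //; apply: le_trans (dB_eval s2 nz2 e2 x2) _.
  by apply: ler_wpM2r; [exact: (K_diag_ge0 s2 nz2 e2)|exact: b2Y].
have kex w : exists q : V, Om w -> common q /\ forall p, common p -> p.1 w = b p q.
  have [Ow|nOw] := pselect (Om w); last by exists 0.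
  have [|p cp|q cq hq] := @riesz R V Y hY (fun p => p.1 w) (Num.sqrt (reC (K1 w w))).
  - by move=> c p q _ _; exact: lin_app.
  - have [_ e1 _ _ _] := Ow; have g := K_diag_ge0 s1 nz1 e1.
    rewrite -(ler_pXn2r (ltn0Sn 1)) ?nnegrE ?cmod_ge0 ?mulr_ge0 ?sqrtr_ge0 ?hnorm_ge0 //.
    rewrite exprMn (sqr_sqrtr g) (hnorm_sq pY cp) mulrC; exact: (evb w p Ow cp).1.
  by exists q.
have [ke hke] := choice kex.
pose K z w := (ke w).1 z.
have Kip z w : Om z -> Om w -> K z w = b (ke w) (ke z).
  by move=> Oz Ow; exact: ((hke z Oz).2 _ (hke w Ow).1).
have Kc z w : Om z -> Om w -> (K z w)^* = K w z.
  by move=> Oz Ow; rewrite !Kip //; exact/esym/(ipC pY (hke w Ow).1 (hke z Oz).1).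
have Kd z : Om z -> K z z = toC (reC (K z z)) /\ 0 <= reC (K z z).
  move=> Oz; have cz := (hke z Oz).1.
  have g : 0 <= K z z by rewrite Kip //; exact: (ip_ge0 pY cz).
  by split; [exact: ge0_toC|rewrite -toC_ge0 -ge0_toC].
have Kdom z : Om z -> reC (K z z) <= reC (K1 z z) /\ reC (K z z) <= reC (K2 z z).
  move=> Oz; have cz := (hke z Oz).1; have [Kz Kz0] := Kd z Oz; have [ev1 ev2] := evb z _ Oz cz.
  have [_ e1 _ e2 _] := Oz; have g1 := K_diag_ge0 s1 nz1 e1; have g2 := K_diag_ge0 s2 nz2 e2.
  have nY : nsq Y (ke z) = reC (K z z) by rewrite Kip.
  rewrite -/(K z z) Kz cmod_toC real_normK ?num_real // nY in ev1.
  rewrite -/(K z z) Kz cmod_toC real_normK ?num_real // nY in ev2.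
  have [r0|r0] := eqVneq (reC (K z z)) 0; first by rewrite r0.
  have rp : 0 < reC (K z z) by rewrite lt_def r0.
  by rewrite expr2 ler_pM2l // in ev1; rewrite expr2 ler_pM2l // in ev2.
(* The invariance identity applied to [ke u] and [Tpair] at conj a of [ke w], whose image under
   [Tpair a] is [ke w]. All inner products become kernel values, and the result expresses K(w,u)
   through the kernel at [a] and conj a. *)
have rel w u : Om w -> Om u -> (w - u^*) * K w u =
    (w - a) * K w a^* - (u^* - a) * K a u - 'i * (w - a) * (u^* - a) * K a u * K w a^*.
  move=> Ow Ou; have [wa|wa] := eqVneq w a; first by rewrite wa; ring.
  have [ua'|ua'] := eqVneq u a^*; first by rewrite ua' conjCK; ring.
  have n1 : w - a != 0 by rewrite subr_eq0.
  have n2 : u^* - a != 0 by rewrite subr_eq0; apply: contra ua' => /eqP <-; rewrite conjCK.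
  have n2' : u - a^* != 0 by rewrite subr_eq0.
  have cu := (hke u Ou).1; have cw := (hke w Ow).1.
  have cTu := common_T Oa cu; have ct := common_T Oa' cw.
  have [_ f1 _ _ _] := Ow; have [_ f2 _ _ _] := Ou; have [_ fa fa' _ _] := Oa.
  have e1 : (Tpair a (ke u)).1 w = ((w - a^*) * K w u - (a - a^*) * K a u) / (w - a).
    by rewrite /Tpair /= VopE // dd_off // -/(K w u) -/(K a u); field.
  have e2 : (Tpair a^* (ke w)).1 u = ((u - a) * K u w - (a^* - a) * K a^* w) / (u - a^*).
    by rewrite /Tpair /= VopE // dd_off // conjCK -/(K u w) -/(K a^* w); field.
  have e3 : (Tpair a^* (ke w)).1 a = K a^* w.
    have nd : a != a^* by rewrite -subr_eq0; exact: Om_neq.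
    have n3 : a - a^* != 0 by exact: Om_neq.
    by rewrite /Tpair /= VopE // dd_off // conjCK -/(K a w) -/(K a^* w); field.
  have := (hke w Ow).2 _ cTu; rewrite -(Tpair_inv Oa cw) (bT _ _ cu ct).
  have -> : b (ke u) (Tpair a^* (ke w)) = ((Tpair a^* (ke w)).1 u)^*.
    by rewrite ((hke u Ou).2 _ ct); exact: (ipC pY ct cu).
  rewrite e1 e2 e3 -/(K a u) !cjE Kc // Kc // => e.
  have ii : toC (2 * imC a) = - 'i * (a - a^*).
    by rewrite toCM toC2; exact: imC_expr.
  rewrite ii in e.
  have n3 : a - a^* != 0 by exact: Om_neq.
  have e4 : ((w - a^*) * K w u - (a - a^*) * K a u) * (u^* - a) =
     ((u^* - a^*) * K w u - (a - a^*) * K w a^*) * (w - a)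
      - (- 'i * (a - a^*) * (K a u * K w a^*)) * (w - a) * (u^* - a).
    move/(congr1 (fun x => x * (w - a) * (u^* - a))): e => e.
    transitivity (((w - a^*) * K w u - (a - a^*) * K a u) / (w - a) * (w - a) * (u^* - a)); first by field.
    by rewrite e; field.
  apply: (mulfI n3); apply/eqP; rewrite -subr_eq0; apply/eqP.
  transitivity (((u^* - a^*) * K w u - (a - a^*) * K w a^*) * (w - a)
      - (- 'i * (a - a^*) * (K a u * K w a^*)) * (w - a) * (u^* - a) -
     ((w - a^*) * K w u - (a - a^*) * K a u) * (u^* - a)); first by ring.
  by rewrite -e4 subrr.
(* By [rel] the function 1 + i (z - conj w) K(z,w) factors as P(z) conj(Q(w)). Since Q(conj a) = 1
   and K is Hermitian, P = l Q with l = P(conj a) real. The square root of [l] times [Q] is thus the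
   function c of the kernel K = (1 - c(z) conj(c(w)))/(-i (z - conj w)). *)
pose Q z : C := 1 + 'i * (z - a^*) * K z a.
pose P z : C := 1 + 'i * (z - a) * K z a^*.
have PQ z w : Om z -> Om w -> 1 + 'i * (z - w^*) * K z w = P z * (Q w)^*.
  move=> Oz Ow; have -> : 1 + 'i * (z - w^*) * K z w = 1 + 'i * ((z - w^*) * K z w) by ring.
  by rewrite rel // /Q /P !cjE Kc //; ring.
have Qa' : Q a^* = 1 by rewrite /Q subrr mulr0 mul0r addr0.
have [Kaa Kaa0] := Kd a^* Oa'.
pose l : R := 1 + 2 * imC a * reC (K a^* a^*).
have Pl : P a^* = toC l.
  rewrite /P Kaa /l toCD toC1 !toCM toC2 -[in RHS]mulrA; congr (_ + _).
  have -> : 2 * (toC (imC a) * toC (reC (K a^* a^*))) = (2 * toC (imC a)) * toC (reC (K a^* a^*)) by ring.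
  by rewrite imC_expr; ring.
have PE z : Om z -> P z = toC l * Q z.
  move=> Oz; have e := PQ _ _ Oz Oa'; rewrite Qa' conjC1 mulr1 in e.
  have := congr1 (fun x => x^*) (PQ _ _ Oa' Oz); rewrite Pl !cjE Kc // => e2.
  by rewrite -e2 -e conjCK; ring.
have key z : Om z -> upper z -> l * cmod (Q z) ^+ 2 = 1 - 2 * imC z * reC (K z z).
  move=> Oz uz; have := PQ z z Oz Oz; rewrite PE // -[_ * (Q z)^*]mulrA cmod_conj (Kd z Oz).1 => e.
  have : toC (l * cmod (Q z) ^+ 2) = toC (1 - 2 * imC z * reC (K z z)).
    rewrite toCM -e toCB toC1 !toCM toC2; congr (_ + _).
    by rewrite imC_expr; ring.
  by move/(congr1 (@reC R)); rewrite !reC_toC.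
have l1 : 1 <= l by rewrite lerDl mulr_ge0 // ltW.
exists Q, l; split=> //.
- apply: (analytic_derI (@open_upper R)) => z uz.
  have [x1 _ _] := (hke a Oa).1.
  apply: (@derD R (fun=> 1) (fun z => 'i * (z - a^*) * K z a)); first exact: der_cst.
  apply: (@derM R (fun z => 'i * (z - a^*)) (fun z => K z a)); last exact: (dB_der s1 nz1 x1 (E_up s1 uz)).
  apply: (@derM R (fun=> 'i) (fun z => z - a^*)); first exact: der_cst.
  by apply: (@derB R (fun z => z) (fun=> a^*)); [exact: der_id|exact: der_cst].
- move=> z uz Oz; rewrite key //; have [_ Kz0] := Kd z Oz; have [d1 d2] := Kdom z Oz.
  have iz : 0 < 2 * imC z by rewrite mulr_gt0.
  have hrel (h : C -> C) (sh : schur h) (nz : exists2 z, upper z & h z != 0) :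
      cmod (h z) ^+ 2 = 1 - 2 * imC z * reC (skernel (rext h) z z).
    have Ez : Uext (rext h) z by exact: E_up.
    have := skern_rel sh nz Ez Ez; rewrite M_up // cmod_conj => e.
    have Kr : skernel (rext h) z z = toC (reC (skernel (rext h) z z)).
      apply: ge0_toC; rewrite -(dB_ker_ip sh nz Ez Ez).
      exact: (ip_ge0 (hilbert_pre (dB_hilbert sh nz)) (dB_ker sh nz Ez)).
    have : toC (cmod (h z) ^+ 2) = toC (1 - 2 * imC z * reC (skernel (rext h) z z)).
      rewrite toCB toC1 [toC (2 * _ * _)]toCM [toC (2 * _)]toCM toC2 imC_expr -Kr.
      rewrite -[- 'i * _ * _]mulrA e; have i2 := sqrCi C.
      transitivity (1 + 'i ^+ 2 * (1 - toC (cmod (h z) ^+ 2))); last by ring.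
      by rewrite i2; ring.
    by move/(congr1 (@reC R)); rewrite !reC_toC.
  split; first by rewrite gerBl mulr_ge0 // ltW.
  by rewrite (hrel h1 s1 nz1) (hrel h2 s2 nz2); split; rewrite lerD2l lerN2 ler_pM2l.
- rewrite key // gtrBl mulr_gt0 // lt_def (Kd a Oa).2 andbT.
  (* If K(a,a) = 0, every common element vanishes at [a]. But V at [w0] maps [p0], which vanishes at
     [a] and not at [w0], to a common element that does not vanish at [a]. *)
  apply/eqP => K0.
  have van p : common p -> p.1 a = 0.
    move=> cp; have [ev1 _] := evb a p Oa cp.
    have nY : nsq Y (ke a) = 0 by rewrite /nsq /= -Kip.
    have ka0 : ke a = 0 by exact: (hilbert_eq0 hY (hke a Oa).1 nY).
    by rewrite ((hke a Oa).2 p cp) ka0; exact: (ip0r pY cp).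
  have wa : w0 != a by apply: contra pw0 => /eqP ->; rewrite van.
  have n0 : a - w0 != 0 by rewrite subr_eq0 eq_sym.
  have := van _ (common_T Ow0 c0); rewrite /Tpair /=; have [_ fa _ _ _] := Oa.
  have nd : a != w0 by rewrite eq_sym.
  rewrite VopE // dd_off // van // add0r sub0r => /eqP.
  by rewrite !mulf_eq0 oppr_eq0 invr_eq0 (negPf (Om_neq Ow0)) (negPf pw0) (negPf n0).
Qed.

End CommonElements.

(** * The extremal pair *)

Section Extremal.
Variable R : realType.
Local Notation C := (Cplx R).
Implicit Types (f g h c : C -> C) (z w : C).

(** The quotient h/c is bounded by 1 off isolated points, so its singularities are removable. Taking
    [k] as the limit over punctured neighbourhoods at every point glues the local extensions. *)
Lemma div_schur h c : schur h -> analytic_on upper c ->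
  (forall z, upper z -> \forall w \near z^', h w != 0 /\ cmod (h w) <= cmod (c w)) ->
  exists2 k, schur k & forall z, upper z -> k z * c z = h z.
Proof.
move=> sh can hc; pose f w := h w / c w; pose k z : C := lim (f w @[w --> z^']).
have dc z : upper z -> derivable c z 1 by exact: analytic_derE can.
have loc z : upper z -> exists e : R, 0 < e /\ exists2 g, (forall w, cmod (w - z) < e -> derivable g w 1) &
    (forall w, cmod (w - z) < e -> k w = g w) /\ (forall w, w != z -> cmod (w - z) < e ->
      [/\ g w = f w, c w != 0 & cmod (f w) <= 1]).
  move=> uz; have /dnbhsCP[e1 e10 he1] := hc z uz.
  have /nearCP[e2 e20 he2] := open_near (@open_upper R) uz.
  pose e := Num.min e1 e2; have e0 : 0 < e by rewrite lt_min e10.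
  have he w : w != z -> cmod (w - z) < e -> [/\ h w != 0, c w != 0, cmod (h w) <= cmod (c w) & upper w].
    move=> wz; rewrite lt_min => /andP[w1 w2]; have [h0 hle] := he1 w wz w1.
    split=> //; last exact: he2.
    by apply: contraNneq h0 => cw; move: hle; rewrite cw cmod0 -cmod_eq0 eq_le cmod_ge0 andbT.
  have f1 w : w != z -> cmod (w - z) < e -> cmod (f w) <= 1.
    by move=> wz we; have [_ c0 hle _] := he w wz we; rewrite /f cmodf ler_pdivrMr ?mul1r ?cmod_gt0.
  have fd w : w != z -> cmod (w - z) < e -> derivable f w 1.
    move=> wz we; have [_ c0 _ uw] := he w wz we.
    by apply: (@derDiv R h c); [exact: c0|exact: schur_der|exact: dc].
  have [g [gd gf]] := removable e0 fd f1.
  exists e; split=> //; exists g => //; split=> w; last first.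
    by move=> wz we; have [_ c0 _ _] := he w wz we; split; [exact: gf|exact: c0|exact: f1].
  move=> we; have PF : ProperFilter w^' by exact: dnbhs_proper.
  apply: limC_eq; apply: (@cvgC_near_eq R C w^' _ _ g).
    have n1 : \forall t \near w^', cmod (t - z) < e.
      apply: dnearW; apply/nearCP; exists (e - cmod (w - z)); first by rewrite subr_gt0.
      by move=> t tw; have := cmodBB t w z; lra.
    have n2 : \forall t \near w^', t != z.
      have [->|wz] := eqVneq w z; first exact: dnear_neq.
      apply/dnbhsCP; exists (cmod (w - z)); first by rewrite cmod_gt0 subr_eq0.
      by move=> t _; apply: contraTneq => ->; rewrite cmodBC ltxx.
    by move: n1 n2; apply: filterS2 => t te tz; rewrite gf.
  have cg := derivable_cont (gd w we).
  by apply: cvg_trans cg; apply: cvg_app; exact: cvg_within.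
have k_der z : upper z -> derivable k z 1.
  move=> /loc[e [e0 [g gd [kg _]]]].
  have dz : derivable g z 1 by apply: gd; rewrite subrr cmod0.
  by apply: (derivable_near_eq _ dz).1; apply/nearCP; exists e => // w /kg.
exists k; first split.
- exact: (analytic_derI (@open_upper R)).
- move=> z uz; have [e [e0 [g gd [kg gf]]]] := loc z uz.
  have zz : cmod (z - z) < e by rewrite subrr cmod0.
  have PF : ProperFilter z^' by exact: dnbhs_proper.
  have cg : g t @[t --> z^'] --> g z.
    by apply: cvg_trans (derivable_cont (gd z zz)); apply: cvg_app; exact: cvg_within.
  rewrite kg //; apply: cvg_cmod_le cg _; apply/dnbhsCP; exists e => // t tz te.
  by have [-> _] := gf t tz te.
- move=> z uz; have [e [e0 [g gd [kg gf]]]] := loc z uz.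
  apply: (@cont_eq_dnear R (fun z => k z * c z) h).
  + by apply: derivable_cont; apply: (@derM R k c); [exact: k_der|exact: dc].
  + by apply: derivable_cont; exact: schur_der.
  + by apply/dnbhsCP; exists e => // t tz te; have [gt c0 _] := gf t tz te; rewrite kg // gt /f divfK.
Qed.

(** Montel's theorem along an ultrafilter. *)
Lemma schur_limit (U : set_system nat) (UU : UltraFilter U) (h : nat -> C -> C) : (forall n, schur (h n)) ->
  exists2 k, schur k & forall z, upper z -> h n z @[n --> U] --> k z.
Proof.
move=> sh; have UF : ProperFilter U by exact: ultra_proper.
have lim z : exists l : C, upper z -> h n z @[n --> U] --> l.
  have [uz|nz] := pselect (upper z); last by exists 0.
  by have [|l hl] := @ultra_cvgC R nat U UU (fun n => h n z) 1; [move=> n; exact: (sh n).2|exists l].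
have [k hk] := choice lim; exists k => //; split.
  apply: (@ultra_analytic R nat U UU upper h k (@open_upper R)) => // [n|z uz]; first exact: (sh n).1.
  by exists 1, 1; split=> // n w uw _; exact: (sh n).2.
move=> z uz; apply: cvg_cmod_le (hk z uz) _; apply: nearW => n; exact: (sh n).2.
Qed.

Variables (f1 f2 : C -> C) (z0 : C).
Hypotheses (sf1 : schur f1) (sf2 : schur f2) (uz0 : upper z0) (f10 : f1 z0 != 0) (f20 : f2 z0 != 0).

(** The relation h1/h2 = f1/f2 is multiplied out so that it survives pointwise limits. The zero pair
    is allowed; maximality at [z0] excludes it, since [f1], [f2] is itself admissible. *)
Definition admissible h1 h2 := [/\ schur h1, schur h2 & forall z, upper z -> h1 z * f2 z = h2 z * f1 z].

Lemma maximal_pair : exists h1 h2, admissible h1 h2 /\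
  forall k1 k2, admissible k1 k2 -> cmod (k2 z0) <= cmod (h2 z0).
Proof.
pose S := [set r : R | exists h1 h2, admissible h1 h2 /\ r = cmod (h2 z0)].
have S0 : S !=set0.
  by exists (cmod (f2 z0)), f1, f2; split=> //; split=> // z _; rewrite mulrC.
have Sub : has_ubound S by exists 1 => _ [h1 [h2 [[_ s2 _] ->]]]; exact: s2.2.
have ex n : exists hh : (C -> C) * (C -> C), admissible hh.1 hh.2 /\ sup S - n.+1%:R^-1 < cmod (hh.2 z0).
  have i0 : 0 < n.+1%:R^-1 :> R by rewrite invr_gt0.
  by have [_ [h1 [h2 [ad ->]]] hl] := sup_adherent i0 (conj S0 Sub); exists (h1, h2).
have [hh hhP] := choice ex.
have [U [UU hU]] := infty_ultra; have UF : ProperFilter U by exact: ultra_proper.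
have a1 n : schur (hh n).1 by have [[]] := hhP n.
have a2 n : schur (hh n).2 by have [[]] := hhP n.
have [k1 sk1 lk1] := schur_limit UU a1; have [k2 sk2 lk2] := schur_limit UU a2.
exists k1, k2; split.
  split=> // z uz; have c1 : (hh n).1 z * f2 z @[n --> U] --> k1 z * f2 z.
    by apply: cvgCM (lk1 z uz) _; exact: cvgCcst.
  apply: cvgC_unique c1 _.
  have c2 : (hh n).2 z * f1 z @[n --> U] --> k2 z * f1 z.
    by apply: cvgCM (lk2 z uz) _; exact: cvgCcst.
  by apply: cvgC_near_eq c2; apply: nearW => n; have [[_ _ +] _] := hhP n; apply.
move=> g1 g2 ad; have gS : cmod (g2 z0) <= sup S by apply: ub_le_sup => //; exists g1, g2.
apply: le_trans gS _; apply/ler_addgt0Pl => e e0; have e2 : 0 < e / 2 by rewrite divr_gt0.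
have /cvgCP/(_ _ e2) n1 := lk2 z0 uz0.
have [N hN] := inv_null e2.
have n2 : \forall n \near U, n.+1%:R^-1 < e / 2 by apply: hU; exists N => // n; exact: hN.
have [n [/= l1 l2]] := filter_ex (filterI n1 n2).
have := (hhP n).2; have := lerB_cmod ((hh n).2 z0) (k2 z0).
by move: l2; move: (n.+1%:R^-1) => q; lra.
Qed.

Theorem extremal_pair : exists h1 h2, [/\ admissible h1 h2, h1 z0 != 0, h2 z0 != 0 &
  trivial_mero_inter (deBranges h1) (deBranges h2)].
Proof.
have [h1 [h2 [[s1 s2 rel] hmax]]] := maximal_pair.
have h20 : h2 z0 != 0.
  rewrite -cmod_gt0; apply: lt_le_trans (hmax f1 f2 _); first by rewrite cmod_gt0.
  by split=> // z _; rewrite mulrC.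
have h10 : h1 z0 != 0.
  by apply/eqP => h10; have := rel z0 uz0; rewrite h10 mul0r => /esym/eqP; rewrite mulf_eq0 (negPf h20) (negPf f10).
have nz1 : exists2 z, upper z & h1 z != 0 by exists z0.
have nz2 : exists2 z, upper z & h2 z != 0 by exists z0.
exists h1, h2; split=> // g1 g2 B1 B2 g12.
have cp : common h1 h2 (g1, g2).
  split=> // z [nz e1 _ e2 _] /=.
  by apply: eq_at_punctured (g12 z nz); [exact: (dB_der s1 nz1 B1 e1)|exact: (dB_der s2 nz2 B2 e2)].
have [[w0 Ow0 gw0]|no] := pselect (exists2 w, common_dom h1 h2 w & g1 w != 0); last first.
  move=> z nz; have := dnear_Om s1 s2 nz1 nz2 nz; apply: filterS => w Ow.
  by apply/eqP/negPn/negP => gw; apply: no; exists w.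
exfalso; have Oz0 := upper_Om s1 s2 nz1 nz2 uz0 h10 h20.
have [Q [l [l1 Qan Qb Qz]]] := common_kernel s1 s2 nz1 nz2 uz0 Oz0 cp Ow0 gw0.
have l0 : 0 <= l by exact: le_trans ler01 l1.
pose c z := toC (Num.sqrt l) * Q z.
have csq z : cmod (c z) ^+ 2 = l * cmod (Q z) ^+ 2.
  by rewrite /c cmodM exprMn cmod_toC real_normK ?num_real // (sqr_sqrtr l0).
have can : analytic_on upper c.
  apply: (analytic_derI (@open_upper R)) => z uz; apply: (@derM R (fun=> toC (Num.sqrt l)) Q); first exact: der_cst.
  exact: analytic_derE Qan uz.
have le2 (x y : C) : cmod x ^+ 2 <= cmod y ^+ 2 -> cmod x <= cmod y.
  by rewrite ler_pXn2r ?nnegrE ?cmod_ge0.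
have near_c h : schur h -> (exists2 z, upper z & h z != 0) ->
    (forall z, upper z -> common_dom h1 h2 z -> cmod (h z) <= cmod (c z)) ->
    forall z, upper z -> \forall w \near z^', h w != 0 /\ cmod (h w) <= cmod (c w).
  move=> sh nz hc z uz.
  have n1 := dnear_Om s1 s2 nz1 nz2 (upper_nonreal uz).
  have n2 := schur_isolated sh uz nz; have n3 := dnearW (open_near (@open_upper R) uz).
  by move: n1 n2 n3; apply: filterS3 => w Ow hw uw; split=> //; exact: hc.
have b1 z : upper z -> common_dom h1 h2 z -> cmod (h1 z) <= cmod (c z).
  by move=> uz Oz; apply: le2; rewrite csq; exact: (Qb z uz Oz).2.1.
have b2 z : upper z -> common_dom h1 h2 z -> cmod (h2 z) <= cmod (c z).
  by move=> uz Oz; apply: le2; rewrite csq; exact: (Qb z uz Oz).2.2.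
have nc1 := near_c h1 s1 nz1 b1.
have [k1 sk1 kc1] := div_schur s1 can nc1.
have [k2 sk2 kc2] := div_schur s2 can (near_c h2 s2 nz2 b2).
have ad : admissible k1 k2.
  split=> // z uz; apply: (@cont_eq_dnear R (fun z => k1 z * f2 z) (fun z => k2 z * f1 z)).
  - by apply: derivable_cont; apply: (@derM R k1 f2); exact: schur_der.
  - by apply: derivable_cont; apply: (@derM R k2 f1); exact: schur_der.
  - move: (nc1 z uz) (dnearW (open_near (@open_upper R) uz)); apply: filterS2 => w [hw hcw] uw.
    have cw : c w != 0.
      by apply: contraNneq hw => cw; move: hcw; rewrite cw cmod0 -cmod_eq0 eq_le cmod_ge0 andbT.
    apply: (mulIf cw); rewrite -mulrA [f2 w * _]mulrC mulrA kc1 // rel //.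
    by rewrite -mulrA [f1 w * _]mulrC mulrA kc2.
have := hmax _ _ ad; rewrite -(kc2 z0 uz0) cmodM leNgt => /negP; apply.
have k20 : 0 < cmod (k2 z0).
  by rewrite cmod_gt0; apply: contraNneq h20 => k0; rewrite -(kc2 z0 uz0) k0 mul0r.
rewrite gtr_pMr // -(ltr_pXn2r (ltn0Sn 1)) ?nnegrE ?cmod_ge0 // expr1n csq.
exact: Qz.
Qed.

End Extremal.

(** * Functions of bounded type *)

Section Nevanlinna.
Variable R : realType.
Local Notation C := (Cplx R).
Implicit Types (f g h v : C -> C) (z w : C).

Lemma cmodDef z : complex.Re `|z| = cmod z.
Proof. Transparent cmod. by []. Opaque cmod. Qed.

Lemma analytic_mero (D : set C) f : analytic_on D f -> meromorphic_on D f.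
Proof. by move=> fD z Dz; left; exact: fD. Qed.

Lemma pole_inv f z : {for z, continuous f} -> f z = 0 -> (\forall w \near z^', f w != 0) ->
  complex.Re `|(f w)^-1| @[w --> z^'] --> +oo.
Proof.
move=> /continuous_eps cf fz fn; apply/cvgryPge => A.
have a0 : 0 < (`|A| + 1)^-1 by rewrite invr_gt0 ltr_wpDl.
have [r r0 hr] := cf _ a0.
have n1 : \forall w \near z^', cmod (w - z) < r by apply: dnearW; apply/nearCP; exists r.
move: n1 fn; apply: filterS2 => w /hr; rewrite fz subr0 => fw f0; rewrite cmodDef cmodV.
apply: (@le_trans _ _ (`|A| + 1)); first by have := ler_norm A; lra.
rewrite -[leLHS]invrK lef_pV2 ?posrE ?cmod_gt0 //; exact: ltW.
Qed.

Lemma Hinf_cst (D : set C) : open D -> Hinf D (fun=> 1 : C).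
Proof.
move=> oD; split; first by apply: (analytic_derI oD) => z _; exact: der_cst.
by exists 1 => z _; rewrite cmodDef cmod1.
Qed.

Section SchurS0.
Variable h : C -> C.
Hypotheses (sh : schur h) (hnz : exists2 z, upper z & h z != 0).
Local Notation H := (rext h).

Lemma rext_upper_an : analytic_on upper H.
Proof. by move=> z uz; exact: rext_an_up. Qed.

Lemma rext_mero_lower z : lower z -> analytic_at H z \/ pole_at H z.
Proof.
move=> lz; have uz := lowerJ lz; have [hz|hz] := eqVneq (h z^*) 0; last by left; exact: rext_an_low.
right; have n1 := dnear_conj (schur_isolated sh uz hnz).
have n2 := dnearW (open_near (@open_lower R) lz); split.
  by move: n1 n2; apply: filterS2 => w hw lw; exact: rext_an_low.
have c := derivable_cont (derivable_conj (schur_der sh uz)).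
have fz : (h z^*)^* = 0 by rewrite hz conjC0.
have fn : \forall w \near z^', (h w^*)^* != 0 by move: n1; apply: filterS => w; rewrite conjC_eq0.
have P := pole_inv c fz fn; apply: cvg_trans P; apply: near_eq_cvg.
by move: n2; apply: filterS => w lw; rewrite rext_low.
Qed.

Theorem rext_S0 : S0 H.
Proof.
have bound z : upper z -> complex.Re `|H z| <= 1.
  by move=> uz; rewrite cmodDef rext_up //; exact: sh.2.
have [z1 uz1 hz1] := hnz.
have Hup : Hinf upper H by split; [exact: rext_upper_an|exists 1].
have shJ : analytic_on lower (SR h).
  by move=> z lz; apply: analytic_conj; apply: sh.1; exact: lowerJ.
split.
- split.
  + move=> z /nonreal_cases[uz|lz]; [left; exact: rext_upper_an|exact: rext_mero_lower].
  + split; first exact: analytic_mero rext_upper_an.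
    exists H, (fun=> 1); split; first exact: Hup.
    * exact: Hinf_cst (@open_upper R).
    * by exists z1 => //; exact: oner_neq0.
    * by move=> z uz; apply: nearW => w; rewrite divr1.
  + split; first by move=> z lz; exact: rext_mero_lower.
    exists (fun=> 1), (SR h); split.
    * exact: Hinf_cst (@open_lower R).
    * split; first exact: shJ.
      exists 1 => z lz; rewrite cmodDef /SR cmodJ; apply: sh.2; exact: lowerJ.
    * by exists z1^*; [exact: upperJ|rewrite /SR conjCK conjC_eq0].
    * move=> z lz; apply: dnearW; have := open_near (@open_lower R) lz.
      by apply: filterS => w lw; rewrite rext_low // /SR div1r.
- exact: Hup.
- by exists z1 => //; rewrite rext_up.
- rewrite /Hinf_norm; apply: ge_sup; first by exists (complex.Re `|H z1|), z1.
  by move=> _ [z uz <-]; exact: bound.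
- split.
    move=> /(_ z1 uz1) H0; have n1 := schur_isolated sh uz1 hnz.
    have n2 := dnearW (open_near (@open_upper R) uz1).
    have PF : ProperFilter z1^' by exact: dnbhs_proper.
    have [w [/= hw [hw0 uw]]] := filter_ex (filterI H0 (filterI n1 n2)).
    by move: hw0; rewrite -rext_up // hw eqxx.
  move=> z lz; apply: dnearW; have := open_near (@open_lower R) lz.
  by apply: filterS => w lw; rewrite rext_low // /SR rext_up //; exact: lowerJ.
Qed.

End SchurS0.

Lemma schur_scale_down f (c : R) : 0 < c -> analytic_on upper f ->
  (forall z, upper z -> cmod (f z) <= c) -> schur (fun z => (toC c)^-1 * f z).
Proof.
move=> c0 fa fb; split.
  apply: (analytic_derI (@open_upper R)) => z uz; apply: (@derM R (fun=> (toC c)^-1) f); first exact: der_cst.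
  exact: analytic_derE fa uz.
move=> z uz; rewrite cmodM cmodV cmod_toC gtr0_norm // mulrC ler_pdivrMr // mul1r; exact: fb.
Qed.

Theorem Nevanlinna_factor v : Nevanlinna v -> reflection_symmetric v -> exists h1 h2,
  [/\ schur h1 /\ (exists2 z, upper z & h1 z != 0), schur h2 /\ (exists2 z, upper z & h2 z != 0),
      eq_mero nonreal v (fun z => rext h1 z / rext h2 z)
    & trivial_mero_inter (deBranges h1) (deBranges h2)].
Proof.
move=> [_ [_ [f1 [f2 [[a1 [M1 b1]] [a2 [M2 b2]] [z2 uz2 f2z2] vf]]]] _] [vnz vsym].
have b1' z : upper z -> cmod (f1 z) <= M1 by rewrite -cmodDef; exact: b1.
have b2' z : upper z -> cmod (f2 z) <= M2 by rewrite -cmodDef; exact: b2.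
have M10 : 0 <= M1 by exact: le_trans (cmod_ge0 _) (b1' _ uz2).
have M20 : 0 <= M2 by exact: le_trans (cmod_ge0 _) (b2' _ uz2).
(* Both functions are divided by the same constant, which leaves their quotient unchanged; the
   summand 1 keeps it positive. *)
pose c := M1 + M2 + 1; have c0 : 0 < c by rewrite /c; lra.
have cn : (toC c)^-1 != 0 by rewrite invr_eq0 toC_eq0 gt_eqF.
pose F1 z := (toC c)^-1 * f1 z; pose F2 z := (toC c)^-1 * f2 z.
have s1 : schur F1 by apply: schur_scale_down => // z /b1'; rewrite /c; lra.
have s2 : schur F2 by apply: schur_scale_down => // z /b2'; rewrite /c; lra.
have nzF2 : exists2 z, upper z & F2 z != 0 by exists z2; rewrite ?mulf_neq0.
have nzF1 : exists2 z, upper z & F1 z != 0.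
  have [//|no] := pselect (exists2 z, upper z & F1 z != 0); exfalso; apply: vnz => z uz.
  move: (vf z uz) (dnearW (open_near (@open_upper R) uz)); apply: filterS2 => w -> uw.
  have -> : f1 w = 0; last by rewrite mul0r.
  apply/eqP/negPn/negP => fw; apply: no; exists w => //; exact: mulf_neq0.
have [z0 uz0 [F10 F20]] : exists2 z, upper z & F1 z != 0 /\ F2 z != 0.
  have PF : ProperFilter z2^' by exact: dnbhs_proper.
  have n1 := schur_isolated s1 uz2 nzF1; have n2 := schur_isolated s2 uz2 nzF2.
  have n3 := dnearW (open_near (@open_upper R) uz2).
  by have [z [/= hz1 [hz2 uz]]] := filter_ex (filterI n1 (filterI n2 n3)); exists z.
have [h1 [h2 [[sh1 sh2 rel] h10 h20 tr]]] := extremal_pair s1 s2 uz0 F10 F20.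
have nz1 : exists2 z, upper z & h1 z != 0 by exists z0.
have nz2 : exists2 z, upper z & h2 z != 0 by exists z0.
exists h1, h2; split=> //.
have up z : upper z -> \forall w \near z^', v w = h1 w / h2 w.
  move=> uz; have n1 := schur_isolated s2 uz nzF2; have n2 := schur_isolated sh2 uz nz2.
  have n3 := dnearW (open_near (@open_upper R) uz); have n4 := vf z uz.
  have n5 : \forall w \near z^', F2 w != 0 /\ h2 w != 0 by move: n1 n2; apply: filterS2.
  move: n5 n3 n4; apply: filterS3 => w [F2w h2w] uw ->.
  have f2w : f2 w != 0 by move: F2w; rewrite mulf_eq0 negb_or => /andP[].
  apply: (mulIf h2w); rewrite divfK // mulrAC; apply: (mulIf f2w); rewrite divfK //.
  by apply: (mulfI cn); have := rel w uw; rewrite /F1 /F2 => e; transitivity (h2 w * ((toC c)^-1 * f1 w)); [ring|rewrite -e; ring].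
move=> z /nonreal_cases[uz|lz].
  move: (up z uz) (dnearW (open_near (@open_upper R) uz)); apply: filterS2 => w -> uw.
  by rewrite !rext_up.
move: (vsym z lz) (dnear_conj (up _ (lowerJ lz))) (dnearW (open_near (@open_lower R) lz)).
apply: filterS3 => w -> vw lw; rewrite /SR vw !rext_low // cjM cjV invfM //.
Qed.

End Nevanlinna.

(** Transports a Hilbert space structure along a linear isometry onto [Y]; it makes the two summands
    of the quotient space Hilbert spaces. *)
Lemma hilbert_image (R : realType) (V W : lmodType (Cplx R)) (X : inner_space V) (Y : inner_space W)
    (phi : V -> W) : is_hilbert X ->
  (forall y, Y y <-> exists2 x, X x & y = phi x) ->
  (forall a x y, X x -> X y -> phi (a *: x + y) = a *: phi x + phi y) ->
  (forall x y, X x -> X y -> iprod Y (phi x) (phi y) = iprod X x y) -> is_hilbert Y.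
Proof.
move=> hX cY lin ip; have pX := hilbert_pre hX; have [_ pos cmpl] := hX.
have phiY x : X x -> Y (phi x) by move=> Xx; apply/cY; exists x.
have phi0 : phi 0 = 0.
  have := lin (-1) 0 0 (pre0 pX) (pre0 pX); rewrite scaler0 addr0 => {1}->.
  by rewrite scaleN1r addNr.
have phiB x y : X x -> X y -> phi (x - y) = phi x - phi y.
  by move=> Xx Xy; rewrite addrC -scaleN1r lin // scaleN1r addrC.
have hn x : X x -> hnorm Y (phi x) = hnorm X x by move=> Xx; rewrite !hnormE /nsq ip.
split.
- split.
  + by apply/cY; exists 0; [exact: pre0 pX|rewrite phi0].
  + move=> a _ _ /cY[x Xx ->] /cY[y Xy ->]; apply/cY; exists (a *: x + y); first exact: preL.
    by rewrite lin.
  + move=> a _ _ _ /cY[x Xx ->] /cY[y Xy ->] /cY[z Xz ->]; rewrite -lin // !ip //; first exact: ipL.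
    exact: preL.
  + by move=> _ _ /cY[x Xx ->] /cY[y Xy ->]; rewrite !ip //; exact: ipC.
- move=> _ /cY[x Xx ->] px; rewrite ip //; apply: pos => //.
  by apply: contraNneq px => ->; rewrite phi0.
- move=> u Yu cu; have ex n : exists x, X x /\ u n = phi x by have /cY[x Xx e] := Yu n; exists x.
  have [x hx] := choice ex; have Xx n := (hx n).1.
  have [|l Xl xl] := cmpl x Xx.
    move=> e /cu[N hN]; exists N => m n mN nN; have := hN m n mN nN.
    by rewrite !(hx _).2 -phiB // hn //; exact: preB.
  exists (phi l); first exact: phiY.
  apply: cvg_trans xl; apply: near_eq_cvg; apply: nearW => n.
  by rewrite (hx n).2 -phiB // hn //; exact: preB.
Qed.

(** * The Krein space *)

Section QuotientSpace.
Variable R : realType.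
Local Notation C := (Cplx R).
Implicit Types (F G : C -> C) (z w u a : C).
Variables h1 h2 v : C -> C.
Hypotheses (s1 : schur h1) (s2 : schur h2).
Hypotheses (nz1 : exists2 z, upper z & h1 z != 0) (nz2 : exists2 z, upper z & h2 z != 0).
Local Notation H1 := (rext h1).
Local Notation H2 := (rext h2).
Local Notation E1 := (Uext H1).
Local Notation E2 := (Uext H2).
Local Notation K1 := (skernel H1).
Local Notation K2 := (skernel H2).
Local Notation M1 := (mero_ext H1).
Local Notation M2 := (mero_ext H2).
Local Notation B1 := (deBranges h1).
Local Notation B2 := (deBranges h2).
Local Notation U := (U0 H1 H2).
Local Notation quot := (quot_fun H1 H2).
Let hB1 : is_hilbert B1 := dB_hilbert s1 nz1.
Let hB2 : is_hilbert B2 := dB_hilbert s2 nz2.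
Let pB1 : pre_hilbert B1 := hilbert_pre hB1.
Let pB2 : pre_hilbert B2 := hilbert_pre hB2.
Hypothesis mv : meromorphic_on nonreal v.
Hypothesis vq : eq_mero nonreal v (fun z => H1 z / H2 z).
Hypothesis tr : trivial_mero_inter B1 B2.

Lemma U_neq0 z : U z -> M1 z != 0 /\ M2 z != 0.
Proof. by case=> _ _; rewrite mulf_eq0 negb_or => /andP[]. Qed.

Lemma M1_der z : U z -> derivable M1 z 1.
Proof. by case=> e1 _ _; exact: (analytic_derE (@M_an R h1) e1). Qed.
Lemma M2_der z : U z -> derivable M2 z 1.
Proof. by case=> _ e2 _; exact: (analytic_derE (@M_an R h2) e2). Qed.

Lemma near_U z : U z -> \forall w \near z, U w.
Proof.
move=> Uz; have [e1 e2 _] := Uz; have [m1 m2] := U_neq0 Uz.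
have n1 := open_near (@oE R h1) e1; have n2 := open_near (@oE R h2) e2.
have n3 := near_neq0 (derivable_cont (M1_der Uz)) m1.
have n4 := near_neq0 (derivable_cont (M2_der Uz)) m2.
by near=> w; split; [near: w; exact: n1|near: w; exact: n2|rewrite mulf_neq0 //; near: w].
Unshelve. all: by end_near. Qed.

Lemma open_U : open U.
Proof. by apply/openCP => z /near_U/nearCP[e e0 he]; exists e. Qed.

Lemma dnear_U z : nonreal z -> \forall w \near z^', U w.
Proof.
move=> nz; have := dnear_Om s1 s2 nz1 nz2 nz; apply: filterS => w [_ e1 e1' e2 e2'].
by split=> //; rewrite mulf_neq0 // M_neq0.
Qed.

Lemma quotE g1 g2 z : U z -> quot g1 g2 z = (g1 z + g2 z) / M2 z.
Proof. by move=> Uz; rewrite /quot_fun patchE mem_set. Qed.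

Lemma quot_out g1 g2 z : ~ U z -> quot g1 g2 z = 0.
Proof. by move=> Uz; rewrite /quot_fun patchE memNset. Qed.

Lemma quot_supp g1 g2 : quot g1 g2 \_ U = quot g1 g2.
Proof. by apply/funext => z; rewrite /quot_fun !patchE; case: (z \in U). Qed.

Lemma quot_lin a g1 g2 g1' g2' :
  quot (a *: g1 + g1') (a *: g2 + g2') = a *: quot g1 g2 + quot g1' g2'.
Proof.
apply/funext => z; rewrite lin_app; have [Uz|nU] := pselect (U z); last by rewrite !quot_out // mulr0 addr0.
by rewrite !quotE // !lin_app mulrA -mulrDl; congr (_ / _); ring.
Qed.

Lemma quot0 : quot 0 0 = 0.
Proof.
have := quot_lin (-1) 0 0 0 0; rewrite scaler0 addr0 => {1}->.
by rewrite scaleN1r addNr.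
Qed.

Lemma dB_eq0 (h : C -> C) (sh : schur h) (nz : exists2 z, upper z & h z != 0) F :
  deBranges h F -> eq_mero nonreal F (fun=> 0) -> F = 0.
Proof.
move=> BF F0; apply/funext => z.
have [Ez|nEz] := pselect (Uext (rext h) z); last by rewrite -(dB_supp BF) patchE memNset.
have nr w : Uext (rext h) w -> nonreal w -> F w = 0.
  move=> Ew nw; apply: (@eq_at_punctured R F (fun=> 0) w); last exact: F0.
    exact: (dB_der sh nz BF Ew).
  exact: der_cst.
apply: (@cvgC_unique R nat \oo _ (fun n => F (z + shift R n))).
  by apply: cvg_cont (@shiftD R z); apply: derivable_cont; exact: (dB_der sh nz BF Ez).
apply: (@cvgC_near_eq R nat \oo _ _ (fun=> 0)); last exact: cvgCcst.
have n1 := @shift_nonreal R z; have n2 := cvg_near (@shiftD R z) (near_E Ez).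
by move: n1 n2; apply: filterS2 => n n1 n2; exact: nr.
Qed.

Lemma quot_eq0 g1 g2 : B1 g1 -> B2 g2 -> quot g1 g2 = 0 -> g1 = 0 /\ g2 = 0.
Proof.
move=> x1 x2 q0; have x2' := preN pB2 x2.
have gg z : U z -> g1 z = - g2 z.
  move=> Uz; have [_ m2] := U_neq0 Uz; have := congr1 (fun f => f z) q0; rewrite quotE // => /eqP.
  by rewrite mulf_eq0 invr_eq0 (negPf m2) orbF addr_eq0 => /eqP.
have e1 : eq_mero nonreal g1 (fun=> 0).
  by apply: (tr x1 x2') => z /dnear_U; apply: filterS => w /gg.
split; first exact: (dB_eq0 s1 nz1 x1).
apply: (dB_eq0 s2 nz2 x2) => z nz; move: (e1 z nz) (dnear_U nz); apply: filterS2 => w g0 Uw.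
by apply: oppr_inj; rewrite -(gg w Uw) g0 oppr0.
Qed.

Lemma quot_inj g1 g2 g1' g2' : B1 g1 -> B2 g2 -> B1 g1' -> B2 g2' ->
  quot g1 g2 = quot g1' g2' -> g1 = g1' /\ g2 = g2'.
Proof.
move=> x1 x2 y1 y2 e.
have [e1 e2] : -1 *: g1' + g1 = 0 /\ -1 *: g2' + g2 = 0.
  apply: quot_eq0; [exact: (preL pB1)|exact: (preL pB2)|].
  by rewrite quot_lin -e scaleN1r addNr.
rewrite !scaleN1r ![- _ + _]addrC in e1 e2.
by split; apply/eqP; rewrite -subr_eq0; apply/eqP.
Qed.

Let rep (f : C -> C) : (C -> C) * (C -> C) :=
  if pselect (exists g : (C -> C) * (C -> C), [/\ B1 g.1, B2 g.2 & f = quot g.1 g.2])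
    is left ex then sval (cid ex) else (0, 0).

Lemma rep_quot g1 g2 : B1 g1 -> B2 g2 -> rep (quot g1 g2) = (g1, g2).
Proof.
move=> x1 x2; rewrite /rep; case: pselect => [ex|[]]; last by exists (g1, g2).
have [y1 y2 e] := svalP (cid ex); have [i1 i2] := quot_inj x1 x2 y1 y2 e.
by rewrite [LHS]surjective_pairing -i1 -i2.
Qed.

(** The inner product uses the representation selected by [rep], which is the only one by
    [quot_inj]; the default (0, 0) concerns functions outside the space. *)
Definition quot_space : fspace R :=
  InnerSpace [set quot g1 g2 | g1 in carrier B1 & g2 in carrier B2]
    (fun f f' => iprod B1 (rep f).1 (rep f').1 - iprod B2 (rep f).2 (rep f').2).
Local Notation Y := quot_space.

Lemma quot_in g1 g2 : B1 g1 -> B2 g2 -> Y (quot g1 g2).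
Proof. by move=> x1 x2; exists g1 => //; exists g2. Qed.

Lemma quot_ip g1 g2 g1' g2' : B1 g1 -> B2 g2 -> B1 g1' -> B2 g2' ->
  iprod Y (quot g1 g2) (quot g1' g2') = iprod B1 g1 g1' - iprod B2 g2 g2'.
Proof. by move=> x1 x2 y1 y2; rewrite /= !rep_quot. Qed.

Lemma quot_spaceP : is_quot_space H1 H2 B1 B2 Y.
Proof. by split=> // *; exact: quot_ip. Qed.

Lemma quot_inner : is_inner Y.
Proof.
split.
- by rewrite -quot0; apply: quot_in; [exact: (pre0 pB1)|exact: (pre0 pB2)].
- move=> a _ _ [g1 x1 [g2 x2 <-]] [g1' y1 [g2' y2 <-]]; rewrite -quot_lin.
  by apply: quot_in; [exact: (preL pB1)|exact: (preL pB2)].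
- move=> a _ _ _ [g1 x1 [g2 x2 <-]] [g1' y1 [g2' y2 <-]] [f1 z1 [f2 z2 <-]].
  have t1 := preL pB1 a x1 y1; have t2 := preL pB2 a x2 y2.
  rewrite -quot_lin (quot_ip t1 t2 z1 z2) (quot_ip x1 x2 z1 z2) (quot_ip y1 y2 z1 z2).
  rewrite (ipL pB1 a x1 y1 z1) (ipL pB2 a x2 y2 z2); ring.
- move=> _ _ [g1 x1 [g2 x2 <-]] [g1' y1 [g2' y2 <-]].
  rewrite (quot_ip x1 x2 y1 y2) (quot_ip y1 y2 x1 x2) cjB.
  by rewrite -(ipC pB1 x1 y1) -(ipC pB2 x2 y2).
Qed.

Definition Kplus : set (C -> C) := [set quot g 0 | g in carrier B1].
Definition Kminus : set (C -> C) := [set quot 0 g | g in carrier B2].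

Let z1 : B1 0 := pre0 pB1.
Let z2 : B2 0 := pre0 pB2.

Lemma quot_split g1 g2 : quot g1 g2 = quot g1 0 + quot 0 g2.
Proof.
have := quot_lin 1 g1 0 0 g2; rewrite !scale1r addr0 add0r => ->.
by [].
Qed.

Lemma quot_decomposition : fundamental_decomposition Y Kplus Kminus.
Proof.
split.
- apply: (@hilbert_image _ _ _ B1 _ (fun g => quot g 0) hB1).
  + by move=> y; split=> [[g Bg <-]|[g Bg ->]]; exists g.
  + by move=> a g g' _ _; rewrite -quot_lin scaler0 addr0.
  + by move=> g g' x y; rewrite [LHS](quot_ip x z2 y z2) (ip0l pB2 z2) subr0.
- apply: (@hilbert_image _ _ _ B2 _ (fun g => quot 0 g) hB2).
  + by move=> y; split=> [[g Bg <-]|[g Bg ->]]; exists g.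
  + by move=> a g g' _ _; rewrite -quot_lin scaler0 addr0.
  + move=> g g' x y; rewrite -[LHS]/(- iprod Y (quot 0 g) (quot 0 g')) (quot_ip z1 x z1 y).
    by rewrite (ip0l pB1 z1) sub0r opprK.
- move=> _ _ [g x <-] [g' y <-]; rewrite (quot_ip x z2 z1 y) (ip0r pB1 x) (ip0l pB2 y).
  by rewrite subrr.
- apply/seteqP; split=> [f [[g x <-] [g' y e]]|f ->].
    by have [<- _] := quot_inj z1 y x z2 e; rewrite quot0.
  by split; exists 0 => //; rewrite quot0.
- apply/seteqP; split=> [_ [g1 x1 [g2 x2 <-]]|_ [_ [g1 x1 <-] [_ [g2 x2 <-] <-]]].
    by exists (quot g1 0); [exists g1|exists (quot 0 g2); [exists g2|rewrite -quot_split]].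
  by rewrite -quot_split; exact: quot_in.
Qed.

Lemma quot_der g1 g2 z : B1 g1 -> B2 g2 -> U z -> derivable (quot g1 g2) z 1.
Proof.
move=> x1 x2 Uz; have [e1 e2 _] := Uz; have [_ m2] := U_neq0 Uz.
have d : derivable (fun z => (g1 z + g2 z) / M2 z) z 1.
  apply: (@derDiv R (fun z => g1 z + g2 z) M2); [exact: m2| |exact: M2_der].
  by apply: derD; [exact: (dB_der s1 nz1 x1 e1)|exact: (dB_der s2 nz2 x2 e2)].
apply: (derivable_near_eq _ d).1.
by have := near_U Uz; apply: filterS => w Uw; rewrite quotE.
Qed.

Lemma ratio_der z : U z -> derivable (fun z => M1 z / M2 z) z 1.
Proof.
by move=> Uz; apply: (@derDiv R M1 M2); [exact: (U_neq0 Uz).2|exact: M1_der|exact: M2_der].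
Qed.

Lemma v_dnear z : nonreal z -> \forall w \near z^', v w = M1 w / M2 w.
Proof.
move=> nz; have n1 := dnearW (open_near (@open_nonreal R) nz).
by move: (vq nz) n1; apply: filterS2 => w -> nw; rewrite !mero_ext_nonreal.
Qed.

(** The factorization of [v] holds only up to isolated points. At a point of [U] the quotient is
    continuous, hence locally bounded, so [v] has no pole there, and two continuous functions that
    agree on a punctured neighbourhood have the same value. *)
Lemma v_nonreal z : nonreal z -> U z -> v z = M1 z / M2 z.
Proof.
move=> nz Uz; have cr := derivable_cont (ratio_der Uz).
have [va|[_ vp]] := mv nz.
  exact: (cont_eq_dnear (analytic_cont va) cr (v_dnear nz)).
exfalso; have [r r0 hr] := (continuous_eps _ _).1 cr 1 ltr01.
have n1 : \forall w \near z^', cmod (w - z) < r by apply: dnearW; apply/nearCP; exists r.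
have n2 : \forall w \near z^', cmod (M1 z / M2 z) + 1 <= complex.Re `|v w|.
  by have /cvgryPge := vp; apply.
have PF : ProperFilter z^' by exact: dnbhs_proper.
have [w [/= l1 [l2 l3]]] := filter_ex (filterI n1 (filterI n2 (v_dnear nz))).
move: l2; rewrite cmodDef l3; have := hr w l1; have := lerB_cmod (M1 w / M2 w) (M1 z / M2 z).
by move: (cmod _) (cmod _) (cmod _) => a b d; lra.
Qed.

Lemma mero_ext_v z : U z -> mero_ext v z = M1 z / M2 z.
Proof.
move=> Uz; have [rz|nz] := eqVneq (imC z) 0; last by rewrite mero_ext_nonreal // v_nonreal.
have -> : mero_ext v z = lim (v w @[w --> within (@nonreal R) (nbhs z)]) by rewrite /mero_ext rz eqxx.
apply: (@lim_nonreal R v (fun z => M1 z / M2 z)); first exact: derivable_cont (ratio_der Uz).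
by have := near_U Uz; apply: filterS => w Uw nw; exact: v_nonreal.
Qed.

Lemma skernel_v z w : U z -> U w ->
  skernel v z w = (K1 z w - K2 z w) / (M2 z * (M2 w)^*).
Proof.
move=> Uz Uw; have [e1 e2 _] := Uz; have [f1 f2 _] := Uw; have [m1 m2] := U_neq0 Uw.
have mj : (M2 w)^* != 0 by rewrite conjC_eq0.
have off t : U t -> t != w^* -> kernel_quot v w t = (K1 t w - K2 t w) / (M2 t * (M2 w)^*).
  move=> Ut tw; have [_ mt] := U_neq0 Ut; have n0 : t - w^* != 0 by rewrite subr_eq0.
  rewrite (skern_off h1 tw) (skern_off h2 tw) /pk /kernel_quot !mero_ext_v // cjM cjV.
  have i0 : 'i != 0 :> C by exact: i_neq0.
  by field; rewrite mj mt n0 i0.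
rewrite {1}/skernel; case: eqVneq => [zw|zw]; last exact: off.
have PF : ProperFilter (w^*)^' by exact: dnbhs_proper.
rewrite zw; apply: limC_eq; rewrite zw in e1 e2 Uz.
apply: (@cvgC_near_eq R C (w^*)^' _ _ (fun t => (K1 t w - K2 t w) / (M2 t * (M2 w)^*))).
  move: (dnearW (near_U Uz)) (dnear_neq w^*); apply: filterS2 => t Ut tw; exact: off.
have d : derivable (fun t => (K1 t w - K2 t w) / (M2 t * (M2 w)^*)) w^* 1.
  have k1 := analytic_derE (ker_an s1 nz1 f1) e1; have k2 := analytic_derE (ker_an s2 nz2 f2) e2.
  apply: (@derDiv R (fun t => K1 t w - K2 t w) (fun t => M2 t * (M2 w)^*)).
  - by rewrite mulf_neq0 //; exact: (U_neq0 Uz).2.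
  - exact: derB k1 k2.
  - by apply: (@derM R M2 (fun=> (M2 w)^*)); [exact: M2_der|exact: der_cst].
by apply: cvg_trans (derivable_cont d); apply: cvg_app; exact: cvg_within.
Qed.

Lemma quot_ker w : U w -> (skernel v)^~ w \_ U =
  quot (((M2 w)^*)^-1 *: (K1^~ w \_ E1)) ((- ((M2 w)^*)^-1) *: (K2^~ w \_ E2)).
Proof.
move=> Uw; have [_ m2] := U_neq0 Uw; have mj : (M2 w)^* != 0 by rewrite conjC_eq0.
apply/funext => z; rewrite patchE; have [Uz|nU] := pselect (U z); last by rewrite quot_out // memNset.
have [e1 e2 _] := Uz; have [_ mz] := U_neq0 Uz.
rewrite mem_set // quotE // skernel_v //.
rewrite -[X in _ = (X + _) / _]/(((M2 w)^*)^-1 * (K1^~ w \_ E1) z).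
rewrite -[X in _ = (_ + X) / _]/((- ((M2 w)^*)^-1) * (K2^~ w \_ E2) z) !dB_kerE //.
by field; rewrite mj mz.
Qed.

Theorem quot_rkks : is_rkks U (skernel v) Y.
Proof.
split; first by split; [exact: quot_inner|exists Kplus, Kminus; exact: quot_decomposition].
have kerB w : U w -> B1 (((M2 w)^*)^-1 *: (K1^~ w \_ E1)) /\ B2 ((- ((M2 w)^*)^-1) *: (K2^~ w \_ E2)).
  by case=> e1 e2 _; split; [exact: (preZ pB1 _ (dB_ker s1 nz1 e1))|exact: (preZ pB2 _ (dB_ker s2 nz2 e2))].
split.
- exact: open_U.
- move=> _ [g1 x1 [g2 x2 <-]]; split; last exact: quot_supp.
  by apply: (analytic_derI open_U) => z Uz; exact: quot_der.
- by move=> w Uw; have [k1 k2] := kerB w Uw; rewrite quot_ker //; exact: quot_in.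
- move=> w _ Uw [g1 x1 [g2 x2 <-]]; have [k1 k2] := kerB w Uw; have [e1 e2 _] := Uw.
  rewrite quot_ker // (quot_ip x1 x2 k1 k2) quotE //.
  rewrite (ipZr pB1 _ (dB_ker s1 nz1 e1) x1) (ipZr pB2 _ (dB_ker s2 nz2 e2) x2).
  rewrite -(dB_rep s1 nz1 e1 x1) -(dB_rep s2 nz2 e2 x2) !cjE.
  by rewrite mulNr opprK -mulrDr mulrC.
Qed.

(** The product rule leaves (g1 + g2)(w) times the difference quotient of 1/h2 at w. Since h2 is
    nonzero at [w], conj w lies in its domain, and [skern_rel] identifies (1 - h2(z)/h2(w))/(z - w)
    with -i K2(z, conj w), an element of B(h2). *)
Lemma D_quot w g1 g2 : U w -> B1 g1 -> B2 g2 ->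
  Dw U w (quot g1 g2) =
  quot (Dw E1 w g1) ((- ('i * (g1 w + g2 w))) *: (K2^~ w^* \_ E2) + Dw E2 w g2) /\
  B1 (Dw E1 w g1) /\ B2 ((- ('i * (g1 w + g2 w))) *: (K2^~ w^* \_ E2) + Dw E2 w g2).
Proof.
move=> Uw x1 x2; have [e1 e2 _] := Uw; have [m1 m2] := U_neq0 Uw.
have [A1 hA1] := dB_D_bounded s1 nz1 e1 m1; have [A2 hA2] := dB_D_bounded s2 nz2 e2 m2.
have e2' := E_conj s2 nz2 e2 m2.
have D1 := (hA1 _ x1).1; have D2 := (hA2 _ x2).1.
have G2 := preL pB2 (- ('i * (g1 w + g2 w))) (dB_ker s2 nz2 e2') D2.
split; last by split.
have off z : U z -> z != w -> dd (quot g1 g2) w z =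
    quot (Dw E1 w g1) ((- ('i * (g1 w + g2 w))) *: (K2^~ w^* \_ E2) + Dw E2 w g2) z.
  move=> Uz zw; have [f1 f2 _] := Uz; have [_ mz] := U_neq0 Uz.
  have n0 : z - w != 0 by rewrite subr_eq0.
  rewrite dd_off // !quotE // lin_app dB_kerE // /Dw !patchE !mem_set // (negPf zw).
  have r := skern_rel s2 nz2 f2 e2'; rewrite conjCK MJE // in r.
  have i2 := sqrCi C.
  have Kz : K2 z w^* = 'i * (1 - M2 z / M2 w) / (z - w) by rewrite -r mulrAC mulfV // mul1r.
  rewrite Kz; apply: (mulIf mz); rewrite divfK //; apply: (mulIf n0).
  transitivity ((g1 z + g2 z) - (g1 w + g2 w) * M2 z / M2 w); first by field; rewrite mz m2 n0.
  transitivity (g1 z - g1 w + (- 'i ^+ 2 * (g1 w + g2 w) * (1 - M2 z / M2 w)) + (g2 z - g2 w)).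
    by rewrite i2 opprK mul1r; field.
  by field; rewrite n0 m2.
apply/funext => z; have [Uz|nU] := pselect (U z); last by rewrite quot_out // /Dw patchE memNset.
rewrite /Dw patchE mem_set // -[LHS]/(dd (quot g1 g2) w z).
have [->|zw] := eqVneq z w; last exact: off.
apply: (@cont_eq_dnear R (dd (quot g1 g2) w) (quot (Dw E1 w g1)
   ((- ('i * (g1 w + g2 w))) *: (K2^~ w^* \_ E2) + Dw E2 w g2))).
- by apply: dd_continuous; exact: quot_der.
- by apply: derivable_cont; exact: quot_der.
- by move: (dnearW (near_U Uw)) (dnear_neq w); apply: filterS2 => t; exact: off.
Qed.

Theorem quot_D_bounded w : U w -> bounded_op Y (Dw U w).
Proof.
move=> Uw; split.
  by move=> _ [g1 x1 [g2 x2 <-]]; have [-> [y1 y2]] := D_quot Uw x1 x2; exact: quot_in.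
exists Kplus, Kminus; split; first exact: quot_decomposition.
have [e1 e2 _] := Uw; have [m1 m2] := U_neq0 Uw; have e2' := E_conj s2 nz2 e2 m2.
have [A1 hA1] := dB_D_bounded s1 nz1 e1 m1; have [A2 hA2] := dB_D_bounded s2 nz2 e2 m2.
have k1 := dB_ker s1 nz1 e1; have k2 := dB_ker s2 nz2 e2; have k2' := dB_ker s2 nz2 e2'.
pose q1 := hnorm B1 (K1^~ w \_ E1); pose q2 := hnorm B2 (K2^~ w \_ E2); pose q := hnorm B2 (K2^~ w^* \_ E2).
(* Absolute values, because the constants of [dB_D_bounded] come without a sign. The last summand
   bounds the kernel term: |g1(w)| and |g2(w)| are at most q1 and q2 times the norm, and q is the
   norm of the kernel function at conj w. *)
exists (`|A1| + `|A2| + (q1 + q2) * q).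
move=> _ _ _ _ [g1 x1 <-] [g2 x2 <-] [y1 Y1 <-] [y2 Y2 <-].
rewrite -!quot_split; have [-> [D1 D2]] := D_quot Uw x1 x2 => e.
have [<- <-] := quot_inj D1 D2 Y1 Y2 e.
have fn f1 f2 : B1 f1 -> B2 f2 -> fnorm Y (quot f1 0) (quot 0 f2) = Num.sqrt (nsq B1 f1 + nsq B2 f2).
  move=> b1 b2; rewrite /fnorm (quot_ip b1 z2 b1 z2) (quot_ip z1 b2 z1 b2).
  by rewrite (ip0l pB1 z1) (ip0l pB2 z2) subr0 sub0r reCN opprK.
rewrite !fn //; set S := Num.sqrt (nsq B1 g1 + nsq B2 g2).
have n1 : hnorm B1 g1 <= S.
  by rewrite hnormE; apply: ler_wsqrtr; rewrite lerDl; exact: (nsq_ge0 pB2 x2).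
have n2 : hnorm B2 g2 <= S.
  by rewrite hnormE; apply: ler_wsqrtr; rewrite lerDr; exact: (nsq_ge0 pB1 x1).
have S0 : 0 <= S by exact: sqrtr_ge0.
apply: le_trans (sqrt_add (nsq_ge0 pB1 D1) (nsq_ge0 pB2 D2)) _; rewrite -!hnormE.
have l1 : hnorm B1 (Dw E1 w g1) <= `|A1| * S.
  apply: le_trans (hA1 _ x1).2 _; apply: (@le_trans _ _ (`|A1| * hnorm B1 g1)).
    by apply: ler_wpM2r; [exact: hnorm_ge0|exact: ler_norm].
  by apply: ler_wpM2l.
have l2 : hnorm B2 (Dw E2 w g2) <= `|A2| * S.
  apply: le_trans (hA2 _ x2).2 _; apply: (@le_trans _ _ (`|A2| * hnorm B2 g2)).
    by apply: ler_wpM2r; [exact: hnorm_ge0|exact: ler_norm].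
  by apply: ler_wpM2l.
have c1 : cmod (g1 w) <= S * q1.
  rewrite (dB_rep s1 nz1 e1 x1); apply: le_trans (CS pB1 x1 k1) _.
  by apply: ler_wpM2r; [exact: hnorm_ge0|].
have c2 : cmod (g2 w) <= S * q2.
  rewrite (dB_rep s2 nz2 e2 x2); apply: le_trans (CS pB2 x2 k2) _.
  by apply: ler_wpM2r; [exact: hnorm_ge0|].
have l3 : hnorm B2 ((- ('i * (g1 w + g2 w))) *: (K2^~ w^* \_ E2)) <= (q1 + q2) * q * S.
  rewrite (hnormZ pB2 _ k2') cmodN cmodM cmodi mul1r -/q.
  have -> : (q1 + q2) * q * S = (S * q1 + S * q2) * q by ring.
  apply: ler_wpM2r; first exact: hnorm_ge0.
  by apply: le_trans (cmodD _ _) _; exact: lerD.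
have l4 := hnormD pB2 (preZ pB2 (- ('i * (g1 w + g2 w))) k2') (hA2 _ x2).1.
have -> : (`|A1| + `|A2| + (q1 + q2) * q) * S = `|A1| * S + ((q1 + q2) * q * S + `|A2| * S) by ring.
apply: lerD l1 _; apply: le_trans l4 _; exact: lerD.
Qed.

End QuotientSpace.

Theorem theorem3p8 (R : realType) (v : Cplx R -> Cplx R)
    (hv : Nevanlinna v) (hsym : reflection_symmetric v) :
  exists h1 h2 : Cplx R -> Cplx R,
    [/\ S0 h1, S0 h2,
        eq_mero nonreal v (fun z => h1 z / h2 z)
      & exists B1 B2 Bv : fspace R,
        [/\ is_deBranges h1 B1 /\ is_deBranges h2 B2,
            trivial_mero_inter B1 B2,
            is_quot_space h1 h2 B1 B2 Bv,
            is_rkks (U0 h1 h2) (skernel v) Bv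
          & forall w : Cplx R, U0 h1 h2 w -> bounded_op Bv (Dw (U0 h1 h2) w)]].
Proof.
have [h1 [h2 [[s1 nz1] [s2 nz2] vq tr]]] := Nevanlinna_factor hv hsym.
exists (rext h1), (rext h2); split; [exact: rext_S0|exact: rext_S0|exact: vq|].
exists (deBranges h1), (deBranges h2), (quot_space h1 h2); split.
- by split; exact: dB_deBranges.
- exact: tr.
- exact: (quot_spaceP s1 s2 nz1 nz2 tr).
- by case: hv => mv _ _; exact: (quot_rkks s1 s2 nz1 nz2 mv vq tr).
- by move=> w; exact: (quot_D_bounded s1 s2 nz1 nz2 tr).
Qed.
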